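(* Fix $\alpha>0$ and let $\varphi$ be a Dirichlet polynomial in $\mathcal{G}$ with unrestricted range. (i) If $d=\dim(\varphi)\geq2$ and $\deg(\varphi)\in\{1,2\}$, then $\mathcal{C}_\varphi f=f\circ\varphi$ maps $\mathcal{D}_\alpha$ boundedly into $\mathcal{D}_{(2^\alpha-1)/d}$; in particular it maps $\mathcal{D}_\alpha$ boundedly into $\mathcal{D}_\beta$ for some $\beta<2^\alpha-1$. (ii) If $\dim(\varphi)=1$, then $\mathcal{C}_\varphi:\mathcal{D}_\alpha\to\mathcal{D}_\beta$ is not bounded for any $\beta<2^\alpha-1$. (iii) For every integer $d\ge1$ and every integer $K\geq3$ there is a Dirichlet polynomial $\varphi\in\mathcal{G}$ with unrestricted range, $\dim(\varphi)=d$ and $\deg(\varphi)=K$, such that $\mathcal{C}_\varphi$ is not bounded from $\mathcal{D}_\alpha$ to $\mathcal{D}_\beta$ for any $\beta<2^\alpha-1$.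
   Context: $\mathbb{C}_\theta=\{s:\operatorname{Re}s>\theta\}$. For $\alpha\in\mathbb{R}$, $\mathcal{D}_\alpha$ is the Hilbert space of Dirichlet series $f(s)=\sum a_nn^{-s}$ with $\|f\|_{\mathcal{D}_\alpha}^2=\sum|a_n|^2/[d(n)]^\alpha<\infty$ ($d(n)$ = number of divisors). The Gordon–Hedenmalm class $\mathcal{G}$ consists of $\varphi:\mathbb{C}_{1/2}\to\mathbb{C}_{1/2}$, $\varphi(s)=c_0s+\sum_{n\ge1}c_nn^{-s}$, with $c_0\in\{0,1,\dots\}$, $\varphi_0=\sum c_nn^{-s}$ converging uniformly in each $\mathbb{C}_\varepsilon$, and: if $c_0=0$ then $\varphi_0(\mathbb{C}_0)\subset\mathbb{C}_{1/2}$; if $c_0\ge1$ then $\varphi_0\equiv0$ or $\varphi_0(\mathbb{C}_0)\subset\mathbb{C}_0$. A Dirichlet polynomial $\varphi(s)=\sum_{n=1}^Nc_nn^{-s}$ has Bohr lift $\Phi(z)=\sum c_nz^{\kappa(n)}$, where $n=\prod_jp_j^{\kappa_j}$ ($p_j$ the $j$-th prime) and $z^{\kappa(n)}=\prod_jz_j^{\kappa_j}$; $\dim(\varphi)$ is the number of variables on which $\Phi$ depends and $\deg(\varphi)$ is the total degree of the polynomial $\Phi$. $\varphi$ has unrestricted range if $\varphi(\mathbb{C}_0)$ is not contained in $\mathbb{C}_{1/2+\delta}$ for any $\delta>0$. *)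

(* Defs.v *)
From mathcomp Require Import ssreflect ssrfun ssrbool eqtype ssrnat seq div prime bigop.
From Stdlib Require Import Reals.
From Coquelicot Require Import Coquelicot.

Open Scope R_scope.

Definition Cnz (z : C) : bool := if Req_EM_T (fst z) 0 then
                                   (if Req_EM_T (snd z) 0 then false else true)
                                 else true.

(* n^{-s} = exp(-s log n) for a positive integer n and s in C. *)
Definition npow (n : nat) (s : C) : C :=
  (Rpower (INR n) (- Re s) * cos (Im s * ln (INR n)),
   - (Rpower (INR n) (- Re s) * sin (Im s * ln (INR n)))).

Definition ndiv (n : nat) : nat := size (divisors n).

(* ---- The spaces D_beta: coefficient sequences a : nat -> C, where a n is the
   coefficient of n^{-s} (a 0 is irrelevant). ---- *)
Definition Dterm (beta : R) (a : nat -> C) (k : nat) : R :=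
  (Cmod (a k.+1)) ^ 2 / Rpower (INR (ndiv k.+1)) beta.

Definition inD (beta : R) (a : nat -> C) : Prop := ex_series (Dterm beta a).

Definition normD (beta : R) (a : nat -> C) : R := sqrt (Series (Dterm beta a)).

Definition DS_at (a : nat -> C) (s : C) (v : C) : Prop :=
  is_series (fun k => Cmult (a k.+1) (npow k.+1 s)) v.

Definition dpoly (N : nat) (c : nat -> C) (s : C) : C :=
  sum_n_m (fun n => Cmult (c n) (npow n s)) 1%nat N.

(* Membership in the Gordon-Hedenmalm class G (here c_0 = 0, phi = phi_0;
   uniform convergence is automatic for a Dirichlet polynomial):
   phi_0(C_0) is contained in C_{1/2}. *)
Definition inG (N : nat) (c : nat -> C) : Prop :=
  forall s : C, 0 < Re s -> 1/2 < Re (dpoly N c s).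

Definition unrestricted (N : nat) (c : nat -> C) : Prop :=
  forall delta : R, 0 < delta ->
    exists s : C, 0 < Re s /\ Re (dpoly N c s) <= 1/2 + delta.

(* dim(phi): the number of variables z_j on which the Bohr lift
   Phi(z) = sum_n c_n z^{kappa(n)} depends, i.e. the number of primes p
   dividing some n in 1..N with c_n <> 0 (distinct n give distinct monomials). *)
Definition dimD (N : nat) (c : nat -> C) : nat :=
  count (fun p => prime p && has (fun n => Cnz (c n) && (p %| n)) (seq.iota 1%nat N))
        (seq.iota 0%nat N.+1).

(* total degree of the monomial z^{kappa(n)}: Omega(n) = sum_p v_p(n) *)
Definition bigOmega (n : nat) : nat := (\sum_(p <- primes n) logn p n)%nat.

Definition degD (N : nat) (c : nat -> C) : nat :=
  (\max_(1 <= n < N.+1 | Cnz (c n)) bigOmega n)%nat.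

Definition CompBounded (N : nat) (c : nat -> C) (alpha beta : R) : Prop :=
  exists M : R, forall a : nat -> C, inD alpha a ->
    exists b : nat -> C, inD beta b /\ normD beta b <= M * normD alpha a /\
      forall s : C, 1/2 < Re s ->
        exists v : C, DS_at b s v /\ DS_at a (dpoly N c s) v.

(* Main.v *)
Require Import Defs.
From HB Require Import structures.
From mathcomp Require Import ssreflect ssrfun ssrbool eqtype ssrnat seq div prime bigop fintype finfun binomial.
From mathcomp Require Import zify.
From Stdlib Require Import Reals Lra Factorial.
From Coquelicot Require Import Coquelicot.
Open Scope R_scope.

(** Write [A] for [2 ^ alpha], so that [sum_(n <= x) d(n)^alpha / n] has the order of [(log x)^A], and
    [Phi] for the Bohr lift of the symbol.

    Lower bounds. Evaluate the image of [a_n = d(n)^alpha conj(n^(-Phi(z)))] at a point [z] of the polydisc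
    all of whose coordinates but one, [zeta], vanish.  If [Re Phi(z) <= 1/2 + O(eps)] with
    [eps = 1 - |zeta|], the value [F], which is also the squared norm of [a], has order at least
    [eps^(-A)], whereas this point evaluation has squared norm [O(eps^(-1-beta))] on [D_beta]; hence
    [beta >= A - 1].  In dimension one the unrestricted range provides such points.  In any dimension and
    degree at least 3 they exist for [3/2 - z_2 + eta (1 - z_2)^2 sum_u z^u].

    Upper bound. The norm of [D_beta] is controlled by a weighted sum, over radii [exp(-2^(-j_i))] in each
    variable, of quadratic means over the torus, which are replaced by means over a fine grid.  The bound
    [Re Phi >= 1/2] passes from the vertical flow to the polydisc by a Fejer kernel.  When the degree is
    at most 2, a Harnack inequality then gives [Re Phi - 1/2 >= delta (1 - |z_i|)] for each [i], and the
    speed of [Phi] in a suitable variable is bounded below wherever [Re Phi - 1/2] is small; so the points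
    where [Re Phi - 1/2] is of order [e] and [Im Phi] lies in a window of length [e] have proportion [O(e)].
    A large sieve inequality, proved by Schur's test with the weight [d(n)^alpha (log n)^(1-A) / n],
    bounds the contribution of such a level.  The level [e = 2^(-l)] occurs only when all [j_i] are at
    least [l - O(1)], which produces a factor [2^(-l d beta)], and the sum over the levels converges to
    the norm of [D_alpha] precisely when [d beta = A - 1]. *)

(** No integral or measure enters: means over the torus are means over M-th roots of unity, means
    along vertical lines are sums over arithmetic progressions, and area means are weighted sums of
    squared Taylor terms. Everything is therefore done for Dirichlet polynomials cut at [X] and
    exponential series cut at order [K], with final constants independent of both; the cut-offs are
    removed at the end.

    The obstacle to any exponent below A - 1 is contact with the critical line: where Re Phi - 1/2
    is of order e, the values must not linger in a window of length e. In degree at most two, Phi -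
    1/2 is a + b z + q z^2 in each variable; positivity on the disc controls b and q, and Re a is
    bounded away from 0 uniformly in the other variables. In degree three (1 - z_2)^2 can multiply a
    new variable, which then disappears to first order at the contact.

    The number A has an arithmetic origin: since d(p) = 2, the Euler factors of the series of
    d(n)^alpha begin with 1 + 2^alpha p^(-s), as for the power A of zeta. *)

Notation iota := seq.iota.
Notation "m ^ n" := (expn m n) : nat_scope.

HB.instance Definition _ := Monoid.isComLaw.Build R 0 Rplus (fun x y z => esym (Rplus_assoc x y z)) Rplus_comm Rplus_0_l.
HB.instance Definition _ := Monoid.isComLaw.Build R 1 Rmult (fun x y z => esym (Rmult_assoc x y z)) Rmult_comm Rmult_1_l.
HB.instance Definition _ := Monoid.isMulLaw.Build R 0 Rmult Rmult_0_l Rmult_0_r.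
HB.instance Definition _ := Monoid.isAddLaw.Build R Rmult Rplus Rmult_plus_distr_r Rmult_plus_distr_l.
HB.instance Definition _ := Monoid.isComLaw.Build C (RtoC 0) Cplus Cplus_assoc Cplus_comm Cplus_0_l.
HB.instance Definition _ := Monoid.isComLaw.Build C (RtoC 1) Cmult Cmult_assoc Cmult_comm Cmult_1_l.
HB.instance Definition _ := Monoid.isMulLaw.Build C (RtoC 0) Cmult Cmult_0_l Cmult_0_r.
HB.instance Definition _ := Monoid.isAddLaw.Build C Cmult Cplus Cmult_plus_distr_r Cmult_plus_distr_l.

Notation "\rsum_ ( i <- r | P ) F" := (\big[Rplus/0%R]_(i <- r | P%B) F%R)
  (at level 34, F at level 35, i, r at level 50, format "\rsum_ ( i  <-  r  |  P )  F").
Notation "\rsum_ ( i <- r ) F" := (\big[Rplus/0%R]_(i <- r) F%R)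
  (at level 34, F at level 35, i, r at level 50, format "\rsum_ ( i  <-  r )  F").
Notation "\rsum_ ( m <= i < n | P ) F" := (\big[Rplus/0%R]_(m%nat <= i < n%nat | P%B) F%R)
  (at level 34, F at level 35, i, m, n at level 50, format "\rsum_ ( m  <=  i  <  n  |  P )  F").
Notation "\rsum_ ( m <= i < n ) F" := (\big[Rplus/0%R]_(m%nat <= i < n%nat) F%R)
  (at level 34, F at level 35, i, m, n at level 50, format "\rsum_ ( m  <=  i  <  n )  F").
Notation "\rsum_ ( i : t ) F" := (\big[Rplus/0%R]_(i : t) F%R)
  (at level 34, F at level 35, i at level 50, format "\rsum_ ( i  :  t )  F").
Notation "\rsum_ ( i | P ) F" := (\big[Rplus/0%R]_(i | P%B) F%R)
  (at level 34, F at level 35, i at level 50, format "\rsum_ ( i  |  P )  F").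
Notation "\csum_ ( i <- r | P ) F" := (\big[Cplus/RtoC 0%R]_(i <- r | P%B) F%C)
  (at level 34, F at level 35, i, r at level 50, format "\csum_ ( i  <-  r  |  P )  F").
Notation "\csum_ ( i <- r ) F" := (\big[Cplus/RtoC 0%R]_(i <- r) F%C)
  (at level 34, F at level 35, i, r at level 50, format "\csum_ ( i  <-  r )  F").
Notation "\csum_ ( m <= i < n | P ) F" := (\big[Cplus/RtoC 0%R]_(m%nat <= i < n%nat | P%B) F%C)
  (at level 34, F at level 35, i, m, n at level 50, format "\csum_ ( m  <=  i  <  n  |  P )  F").
Notation "\csum_ ( m <= i < n ) F" := (\big[Cplus/RtoC 0%R]_(m%nat <= i < n%nat) F%C)
  (at level 34, F at level 35, i, m, n at level 50, format "\csum_ ( m  <=  i  <  n )  F").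
Notation "\csum_ ( i : t ) F" := (\big[Cplus/RtoC 0%R]_(i : t) F%C)
  (at level 34, F at level 35, i at level 50, format "\csum_ ( i  :  t )  F").
Notation "\rprod_ ( i <- r | P ) F" := (\big[Rmult/1%R]_(i <- r | P%B) F%R)
  (at level 34, F at level 35, i, r at level 50, format "\rprod_ ( i  <-  r  |  P )  F").
Notation "\rprod_ ( i <- r ) F" := (\big[Rmult/1%R]_(i <- r) F%R)
  (at level 34, F at level 35, i, r at level 50, format "\rprod_ ( i  <-  r )  F").
Notation "\cprod_ ( i <- r | P ) F" := (\big[Cmult/RtoC 1%R]_(i <- r | P%B) F%C)
  (at level 34, F at level 35, i, r at level 50, format "\cprod_ ( i  <-  r  |  P )  F").
Notation "\cprod_ ( i <- r ) F" := (\big[Cmult/RtoC 1%R]_(i <- r) F%C)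
  (at level 34, F at level 35, i, r at level 50, format "\cprod_ ( i  <-  r )  F").

(** * Finite sums and products of real and complex numbers *)

Lemma rsum_ge0 (I : Type) (s : seq I) (P : pred I) (F : I -> R) :
  (forall i, P i -> 0 <= F i) -> 0 <= \rsum_(i <- s | P i) F i.
Proof. by move=> h; elim/big_ind: _ => //; [lra | move=> x y; lra]. Qed.

Lemma rprod_ge0 (I : Type) (s : seq I) (P : pred I) (F : I -> R) :
  (forall i, P i -> 0 <= F i) -> 0 <= \rprod_(i <- s | P i) F i.
Proof. by move=> h; elim/big_ind: _ => //; [lra | move=> x y; apply: Rmult_le_pos]. Qed.

Lemma rsum_le (I : Type) (s : seq I) (P : pred I) (F G : I -> R) :
  (forall i, P i -> F i <= G i) -> \rsum_(i <- s | P i) F i <= \rsum_(i <- s | P i) G i.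
Proof. by move=> h; elim/big_ind2: _ => //; [lra | move=> x y z t; lra]. Qed.

Lemma rsum_le_in (I : eqType) (s : seq I) (P : pred I) (F G : I -> R) :
  (forall i, i \in s -> P i -> F i <= G i) -> \rsum_(i <- s | P i) F i <= \rsum_(i <- s | P i) G i.
Proof.
move=> h; rewrite big_seq_cond [X in _ <= X]big_seq_cond.
by apply: rsum_le => i /andP[]; apply: h.
Qed.

Lemma rsum_le_nat (m n : nat) (F G : nat -> R) :
  (forall i, (m <= i < n)%nat -> F i <= G i) -> \rsum_(m <= i < n) F i <= \rsum_(m <= i < n) G i.
Proof. by move=> h; apply: rsum_le_in => i; rewrite mem_index_iota => hi _; apply: h. Qed.

Lemma rprod_le (I : Type) (s : seq I) (P : pred I) (F G : I -> R) :
  (forall i, P i -> 0 <= F i <= G i) -> \rprod_(i <- s | P i) F i <= \rprod_(i <- s | P i) G i.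
Proof.
move=> h; suff: 0 <= \rprod_(i <- s | P i) F i <= \rprod_(i <- s | P i) G i by lra.
elim/big_ind2: _ => //; first lra.
by move=> x y z t [? ?] [? ?]; split; [apply: Rmult_le_pos | apply: Rmult_le_compat].
Qed.

Lemma rsum_cond_le (I : Type) (s : seq I) (P Q : pred I) (F : I -> R) :
  (forall i, P i -> Q i) -> (forall i, Q i -> 0 <= F i) ->
  \rsum_(i <- s | P i) F i <= \rsum_(i <- s | Q i) F i.
Proof.
move=> PQ F0; rewrite big_mkcond [X in _ <= X]big_mkcond /=; apply: rsum_le => i _.
case: (boolP (P i)) => hp; first by rewrite (PQ _ hp); lra.
by case: ifP => hq; [apply: F0 | lra].
Qed.

Lemma rsum_sub (I : eqType) (s t : seq I) (F : I -> R) :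
  uniq s -> {subset s <= t} -> (forall i, i \in t -> 0 <= F i) ->
  \rsum_(i <- s) F i <= \rsum_(i <- t) F i.
Proof.
elim: s t => [|x s IH] t /=; first by move=> _ _ h; rewrite big_nil big_seq; apply: rsum_ge0.
case/andP=> xs us st F0; have xt : x \in t by apply: st; rewrite inE eqxx.
rewrite big_cons (big_rem x xt) /=; apply: Rplus_le_compat_l; apply: IH => //; last first.
  by move=> i /mem_rem; apply: F0.
move=> y ys; have yt : y \in t by apply: st; rewrite inE ys orbT.
have := yt; rewrite (perm_mem (perm_to_rem xt)) inE.
by case/orP=> // /eqP yx; move: xs; rewrite -yx ys.
Qed.

Lemma rsum_scal (I : Type) (a : R) (s : seq I) (P : pred I) (F : I -> R) :
  a * \rsum_(i <- s | P i) F i = \rsum_(i <- s | P i) (a * F i).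
Proof. by rewrite big_distrr. Qed.

Lemma rsum_scalr (I : Type) (a : R) (s : seq I) (P : pred I) (F : I -> R) :
  (\rsum_(i <- s | P i) F i) * a = \rsum_(i <- s | P i) (F i * a).
Proof. by rewrite big_distrl. Qed.

Lemma csum_scal (I : Type) (a : C) (s : seq I) (P : pred I) (F : I -> C) :
  (a * \csum_(i <- s | P i) F i)%C = \csum_(i <- s | P i) (a * F i).
Proof. by rewrite big_distrr. Qed.

Lemma csum_scalr (I : Type) (a : C) (s : seq I) (P : pred I) (F : I -> C) :
  ((\csum_(i <- s | P i) F i) * a)%C = \csum_(i <- s | P i) (F i * a).
Proof. by rewrite big_distrl. Qed.

Lemma Cmod_csum (I : Type) (s : seq I) (P : pred I) (F : I -> C) :
  Cmod (\csum_(i <- s | P i) F i) <= \rsum_(i <- s | P i) Cmod (F i).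
Proof.
elim/big_ind2: _ => //; first by rewrite Cmod_0; lra.
  move=> x1 x2 y1 y2 h1 h2; apply: Rle_trans (Cmod_triangle _ _) _; exact: Rplus_le_compat.
by move=> i _; apply: Rle_refl.
Qed.

Lemma Re_csum (I : Type) (s : seq I) (P : pred I) (F : I -> C) :
  Re (\csum_(i <- s | P i) F i) = \rsum_(i <- s | P i) Re (F i).
Proof. by elim/big_ind2: _ => // x1 x2 y1 y2 <- <-. Qed.

Lemma Cconj_csum (I : Type) (s : seq I) (P : pred I) (F : I -> C) :
  Cconj (\csum_(i <- s | P i) F i) = \csum_(i <- s | P i) Cconj (F i).
Proof.
elim/big_ind2: _ => //; first by rewrite /Cconj /RtoC /= Ropp_0.
by move=> x1 x2 y1 y2 <- <-; rewrite Cplus_conj.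
Qed.

Lemma RtoC_rsum (I : Type) (s : seq I) (P : pred I) (F : I -> R) :
  RtoC (\rsum_(i <- s | P i) F i) = \csum_(i <- s | P i) RtoC (F i).
Proof. by elim/big_ind2: _ => // x1 x2 y1 y2 <- <-; rewrite RtoC_plus. Qed.

Lemma rsum_const_nat (m n : nat) (a : R) : \rsum_(m <= i < n) a = INR (n - m) * a.
Proof.
rewrite big_const_nat; elim: (n - m)%nat => [|k IH]; first by rewrite /= Rmult_0_l.
by rewrite iterS IH S_INR; lra.
Qed.

Lemma rsum_const (I : Type) (s : seq I) (a : R) : \rsum_(i <- s) a = INR (size s) * a.
Proof.
elim: s => [|x s IH]; first by rewrite big_nil /= Rmult_0_l.
have -> : size (x :: s) = (size s).+1 by []. by rewrite big_cons IH S_INR; lra.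
Qed.

Lemma rsum_cauchy (I : Type) (s : seq I) (P : pred I) (F G : I -> R) :
  (\rsum_(i <- s | P i) (F i * G i)) ^ 2 <=
  (\rsum_(i <- s | P i) F i ^ 2) * \rsum_(i <- s | P i) G i ^ 2.
Proof.
set A := \rsum_(i <- s | P i) F i ^ 2; set B := \rsum_(i <- s | P i) G i ^ 2.
set D := \rsum_(i <- s | P i) (F i * G i).
have A0 : 0 <= A by apply: rsum_ge0 => i _; nra.
have B0 : 0 <= B by apply: rsum_ge0 => i _; nra.
have key x y : 0 <= x ^ 2 * A + 2 * x * y * D + y ^ 2 * B.
  rewrite /A /B /D !rsum_scal -!big_split /=; apply: rsum_ge0 => i _.
  have := pow2_ge_0 (x * F i + y * G i); nra.
case: (Req_dec B 0) => [Bz|Bn].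
  case: (Req_dec D 0) => [->|Dn]; first by nra.
  (* With [B = 0] the form is A + 2 y D, which this y makes equal to - A - 2 < 0; hence [D]
     vanishes. *)
  have := key 1 (- (A + 1) / D); rewrite Bz.
  have -> : 2 * 1 * (- (A + 1) / D) * D = - 2 * (A + 1) by field.
  nra.
have := key B (- D).
have -> : B ^ 2 * A + 2 * B * - D * D + (- D) ^ 2 * B = B * (A * B - D ^ 2) by ring.
move=> h; have Bp : 0 < B by lra.
have : 0 <= A * B - D ^ 2 by apply: (Rmult_le_reg_l B) => //; lra.
lra.
Qed.

Lemma sum_n_rsum (a : nat -> R) n : sum_n a n = \rsum_(0 <= i < n.+1) a i.
Proof.
elim: n => [|n IH]; first by rewrite sum_O big_nat1.
by rewrite sum_Sn IH [RHS]big_nat_recr.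
Qed.

Lemma sum_n_csum (a : nat -> C) n : sum_n a n = \csum_(0 <= i < n.+1) a i.
Proof.
elim: n => [|n IH]; first by rewrite sum_O big_nat1.
by rewrite sum_Sn IH [RHS]big_nat_recr.
Qed.

Lemma sum_n_rsum1 (a : nat -> R) n : sum_n (fun k => a k.+1) n = \rsum_(1 <= i < n.+2) a i.
Proof. by rewrite sum_n_rsum big_add1. Qed.

Lemma ex_series_bounded (a : nat -> R) (B : R) :
  (forall n, 0 <= a n) -> (forall n, sum_n a n <= B) -> ex_series a.
Proof.
move=> a0 aB; have : ex_finite_lim_seq (sum_n a).
  apply: (ex_finite_lim_seq_incr _ B) => // n.
  by rewrite sum_Sn; have := a0 n.+1; rewrite /plus /=; lra.
case=> l hl; exists l; exact: hl.
Qed.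

Lemma sum_n_le_Series (a : nat -> R) n :
  (forall n, 0 <= a n) -> ex_series a -> sum_n a n <= Series a.
Proof.
move=> a0 [l hl]; rewrite (is_series_unique _ _ hl).
apply: (is_lim_seq_incr_compare (sum_n a) l hl) => k.
by rewrite sum_Sn; have := a0 k.+1; rewrite /plus /=; lra.
Qed.

Lemma Series_le_bound (a : nat -> R) (B : R) :
  (forall n, sum_n a n <= B) -> ex_series a -> Series a <= B.
Proof.
move=> aB [l hl]; rewrite (is_series_unique _ _ hl).
have := is_lim_seq_le (sum_n a) (fun _ => B) l B aB hl (is_lim_seq_const B).
by [].
Qed.

(** * Mean values of powers of the divisor function *)

Lemma rsum_ge_term (I : eqType) (s : seq I) (F : I -> R) (i : I) :
  i \in s -> (forall j, j \in s -> 0 <= F j) -> F i <= \rsum_(j <- s) F j.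
Proof.
move=> hi F0; rewrite (big_rem i hi) /=.
suff: 0 <= \rsum_(j <- rem i s) F j by lra.
by rewrite big_seq; apply: rsum_ge0 => j /mem_rem; apply: F0.
Qed.

(** The tool for arithmetic reindexing: integers are mapped injectively to pairs, quotients or
    exponents, and the terms outside the image are dropped by nonnegativity. *)
Lemma rsum_inj_le (I J : eqType) (s : seq I) (t : seq J) (h : I -> J) (F : I -> R) (G : J -> R) :
  uniq s -> {in s &, injective h} -> (forall n, n \in s -> h n \in t /\ F n <= G (h n)) ->
  (forall j, j \in t -> 0 <= G j) -> \rsum_(n <- s) F n <= \rsum_(j <- t) G j.
Proof.
move=> us hinj hF G0; apply: Rle_trans (_ : \rsum_(j <- map h s) G j <= _).
  by rewrite big_map; apply: rsum_le_in => i /hF [].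
apply: rsum_sub => //; first by rewrite map_inj_in_uniq.
by move=> j /mapP [n ns ->]; case: (hF n ns).
Qed.

Definition smooth (y n : nat) := all (fun q => (q <= y)%nat) (primes n).

Lemma smoothP (y n : nat) :
  (0 < n)%nat -> reflect (forall q, prime q -> (q %| n)%nat -> (q <= y)%nat) (smooth y n).
Proof.
move=> n0; apply: (iffP allP) => h q; first by move=> pq dq; apply: h; rewrite mem_primes pq n0.
by rewrite mem_primes => /and3P [pq _ dq]; apply: h.
Qed.

Lemma iotaS_last (y : nat) : iota 0%nat y.+2 = rcons (iota 0%nat y.+1) y.+1.
Proof. by rewrite -addn1 iotaD cats1. Qed.

Section EulerUpper.
Variables (f : nat -> R) (x : nat).
Hypothesis f0 : forall n, 0 <= f n.
Hypothesis f1 : f 1%nat <= 1.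
Hypothesis fM : forall p k m, prime p -> ~~ (p %| m)%nat -> (0 < m)%nat ->
  f (p ^ k * m)%nat <= f (p ^ k)%nat * f m.

(** Induction on [y]. When p = y + 1 is prime, n is sent to its exponent at p and its p-free part;
    this is injective into exponents at most [x] times y-smooth integers, and expanding the product
    only adds nonnegative terms. *)
Lemma euler_upper_smooth (y : nat) :
  \rsum_(1 <= n < x.+1 | smooth y n) f n <=
  \rprod_(p <- iota 0%nat y.+1 | prime p) \rsum_(0 <= k < x.+1) f (p ^ k)%nat.
Proof.
elim: y => [|y IH].
  rewrite big_cons big_nil /= -big_filter.
  apply: Rle_trans (_ : \rsum_(n <- [:: 1%nat]) f n <= _); last by rewrite big_seq1.
  apply: rsum_sub => [||i _]; [exact: filter_uniq (iota_uniq _ _) | | exact: f0].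
  move=> n; rewrite mem_filter mem_index_iota => /andP [/smoothP h /andP [n0 _]].
  rewrite inE; case: (ltngtP n 1%nat) => [|n1|//]; first by rewrite ltnS leqNgt n0.
  by have := h n0 _ (pdiv_prime n1) (pdiv_dvd n); rewrite leqNgt (prime_gt0 (pdiv_prime n1)).
rewrite iotaS_last -cats1 big_cat big_cons big_nil /=.
case: ifP => py; last first.
  rewrite Rmult_1_r; apply: Rle_trans IH; rewrite big_nat_cond [X in _ <= X]big_nat_cond.
  apply: rsum_cond_le => [n /andP [/andP [n0 ->] /smoothP h]|n _]; last exact: f0.
  rewrite n0 /=; apply/smoothP => // q pq dq; have := h n0 q pq dq.
  by rewrite leq_eqVlt => /orP [/eqP qy|]; [rewrite qy py in pq | ].
rewrite Rmult_1_r; set p := y.+1.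
set t := [seq (k, m) | k <- iota 0%nat x.+1, m <- [seq m <- iota 1%nat x | smooth y m]].
have -> : \rsum_(1 <= n < x.+1 | smooth p n) f n = \rsum_(n <- [seq n <- iota 1%nat x | smooth p n]) f n.
  by rewrite big_filter /index_iota subn1.
apply: Rle_trans (_ : \rsum_(j <- t) (f (p ^ j.1)%nat * f j.2) <= _); last first.
  rewrite big_allpairs /=.
  have -> : \rsum_(i1 <- iota 0%nat x.+1) \rsum_(i2 <- [seq m <- iota 1%nat x | smooth y m]) (f (p ^ i1)%nat * f i2)
    = (\rsum_(1 <= n < x.+1 | smooth y n) f n) * \rsum_(0 <= k < x.+1) f (p ^ k)%nat.
    rewrite Rmult_comm rsum_scalr /index_iota subn0; apply: eq_bigr => k _.
    by rewrite -rsum_scal big_filter subn1.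
  apply: Rmult_le_compat_r IH; apply: rsum_ge0 => k _; exact: f0.
apply: (rsum_inj_le _ _ _ _ (fun n => (logn p n, n %/ p ^ logn p n)%nat)).
- exact: filter_uniq (iota_uniq _ _).
- move=> n m _ _ [e1 e2]; have en := divnK (pfactor_dvdnn p n); have em := divnK (pfactor_dvdnn p m).
  by apply: etrans (esym en) _; rewrite e2 e1.
- move=> n; rewrite mem_filter mem_iota => /andP [/smoothP h /andP [n0 nx]].
  have en := divnK (pfactor_dvdnn p n); set m := (n %/ _)%nat in en *.
  have m0 : (0 < m)%nat by rewrite /m divn_gt0 ?expn_gt0 //; apply: dvdn_leq => //; exact: pfactor_dvdnn.
  have mn : (m <= n)%nat by apply: leq_div.
  have pm : ~~ (p %| m)%nat.
    apply/negP => pm; have : (p ^ (logn p n).+1 %| n)%nat by rewrite -[X in (_ %| X)%nat]en expnS dvdn_mul.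
    by rewrite pfactor_dvdn // ltnn.
  split; last by rewrite -{1}en mulnC; apply: fM.
  apply/allpairsP; exists (logn p n, m); split => //.
    rewrite [(_, _).1]/= mem_iota add0n ltnS; apply: leq_trans (_ : n <= x)%nat; last by rewrite add1n ltnS in nx.
    apply: ltnW; apply: leq_trans (ltn_expl _ (prime_gt1 py)) _; apply: dvdn_leq => //; exact: pfactor_dvdnn.
  rewrite [(_, _).2]/= mem_filter mem_iota m0 (leq_ltn_trans mn nx) !andbT; apply/smoothP => // q pq dq.
  have : (q <= p)%nat by apply: (h n0 q pq); rewrite -en dvdn_mulr.
  by rewrite leq_eqVlt => /orP [/eqP qp|//]; rewrite -qp dq in pm.
- by move=> j _; apply: Rmult_le_pos.
Qed.

Lemma euler_upper :
  \rsum_(1 <= n < x.+1) f n <=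
  \rprod_(p <- iota 0%nat x.+1 | prime p) \rsum_(0 <= k < x.+1) f (p ^ k)%nat.
Proof.
apply: Rle_trans (euler_upper_smooth x).
rewrite big_nat [X in _ <= X]big_nat_cond; apply: rsum_cond_le => [n /andP [n0 nx]|n _]; last exact: f0.
rewrite n0 nx /=; apply/smoothP => // q pq dq.
by apply: leq_trans (dvdn_leq n0 dq) _.
Qed.
End EulerUpper.

(** Expanding the product lists the squarefree integers composed of the primes up to [P]: at each
    new prime the list is extended by its multiples. A list without repetition is enough, as it is
    later compared with an initial segment of the integers. *)
Lemma sqfree_prod (F g : nat -> R) (P : nat) :
  F 1%nat = 1 -> (forall p m, prime p -> ~~ (p %| m)%nat -> (0 < m)%nat -> F (p * m)%nat = g p * F m) ->
  exists s : seq nat, [/\ uniq s, forall m, m \in s -> (0 < m)%nat /\ smooth P m &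
    \rsum_(m <- s) F m = \rprod_(p <- iota 0%nat P.+1 | prime p) (1 + g p)].
Proof.
move=> F1 FM; elim: P => [|P [s [us hs es]]].
  exists [:: 1%nat]; split => //; last by rewrite big_seq1 big_cons big_nil /= F1.
  by move=> m; rewrite inE => /eqP ->.
rewrite iotaS_last -cats1 big_cat big_cons big_nil /=; case: ifP => pP; last first.
  exists s; split => //; last by rewrite es Rmult_1_r.
  move=> m /hs [m0 /smoothP h]; split => //; apply/smoothP => // q pq dq; apply: leqW; exact: h.
have pm m : m \in s -> ~~ (P.+1 %| m)%nat.
  by move=> /hs [m0 /smoothP h]; apply/negP => d; have := h m0 _ pP d; rewrite ltnn.
exists (s ++ map (muln P.+1) s); split.
- rewrite cat_uniq us /= map_inj_uniq ?us ?andbT; last first.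
    by move=> a b /eqP; rewrite eqn_pmul2l // => /eqP.
  apply/hasPn => _ /mapP [m ms ->]; apply/negP => /pm.
  by rewrite dvdn_mulr.
- move=> m; rewrite mem_cat => /orP [/hs [m0 /smoothP h]|/mapP [k ks ->]].
    by split => //; apply/smoothP => // q pq dq; apply: leqW; exact: h.
  have [k0 /smoothP h] := hs k ks; split; first by rewrite muln_gt0.
  apply/smoothP; first by rewrite muln_gt0.
  move=> q pq; rewrite Euclid_dvdM // => /orP [d|d]; first exact: dvdn_leq.
  by apply: leqW; apply: h.
- rewrite big_cat big_map /= Rmult_1_r -es.
  have -> : \rsum_(j <- s) F (P.+1 * j)%nat = g P.+1 * \rsum_(j <- s) F j.
    rewrite rsum_scal big_seq [RHS]big_seq; apply: eq_bigr => j js; apply: FM => //; first exact: pm.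
    by case: (hs j js).
  ring.
Qed.

Lemma sqfree_prod_le (F g : nat -> R) (P : nat) :
  F 1%nat = 1 -> (forall p m, prime p -> ~~ (p %| m)%nat -> (0 < m)%nat -> F (p * m)%nat = g p * F m) ->
  (forall n, 0 <= F n) ->
  exists X : nat, \rprod_(p <- iota 0%nat P.+1 | prime p) (1 + g p) <= \rsum_(1 <= n < X.+1) F n.
Proof.
move=> F1 FM F0; have [s [us hs <-]] := sqfree_prod F g P F1 FM.
exists (\max_(m <- s) m)%nat; apply: rsum_sub => // m ms.
rewrite mem_index_iota ltnS; have [-> _] := hs m ms.
by rewrite (big_rem m ms) /= leq_maxl.
Qed.

Lemma exp_le (x y : R) : x <= y -> exp x <= exp y.
Proof. by case=> [h|->]; [apply: Rlt_le; apply: exp_increasing | apply: Rle_refl]. Qed.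

Lemma Rpower_pos (x s : R) : 0 < Rpower x s.
Proof. exact: exp_pos. Qed.

Lemma INRS_pos (n : nat) : 0 < INR n.+1.
Proof. by apply: lt_0_INR; apply/ltP. Qed.

Lemma INR_pos (n : nat) : (0 < n)%nat -> 0 < INR n.
Proof. by case: n => // n _; apply: INRS_pos. Qed.

Lemma INR_ge1 (n : nat) : (0 < n)%nat -> 1 <= INR n.
Proof. by move=> n0; have := le_INR 1 n (elimT leP n0). Qed.

Lemma INR_leq (m n : nat) : (m <= n)%nat -> INR m <= INR n.
Proof. by move/leP/le_INR. Qed.

Lemma ln_ge0 (x : R) : 1 <= x -> 0 <= ln x.
Proof. by move=> h; rewrite -ln_1; apply: ln_le; lra. Qed.

Lemma ln_INR_ge0 (n : nat) : 0 <= ln (INR n).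
Proof.
case: n => [|n]; last by apply: ln_ge0; apply: INR_ge1.
rewrite /ln /=; case: Rlt_dec => [h|_]; [exfalso; lra | exact: Rle_refl].
Qed.

Lemma Rpower_1l (s : R) : Rpower 1 s = 1.
Proof. by rewrite /Rpower ln_1 Rmult_0_r exp_0. Qed.

Lemma Rpower_INR_mul (m n : nat) (s : R) : (0 < m)%nat -> (0 < n)%nat ->
  Rpower (INR (m * n)) s = Rpower (INR m) s * Rpower (INR n) s.
Proof. by move=> m0 n0; rewrite mult_INR Rpower_mult_distr //; apply: INR_pos. Qed.

Lemma Rpower_INR_exp (m k : nat) (s : R) : (0 < m)%nat ->
  Rpower (INR (m ^ k)%nat) s = Rpower (INR m) s ^ k.
Proof.
move=> m0; elim: k => [|k IH]; first by rewrite expn0 Rpower_1l.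
by rewrite expnS Rpower_INR_mul ?expn_gt0 ?m0 // IH.
Qed.

Lemma rprod_exp (I : Type) (s : seq I) (P : pred I) (F : I -> R) :
  \rprod_(i <- s | P i) exp (F i) = exp (\rsum_(i <- s | P i) F i).
Proof.
elim/big_ind2: _ => //; first by rewrite exp_0.
by move=> x1 x2 y1 y2 -> ->; rewrite exp_plus.
Qed.

Section ZetaSteps.
Variables (d : R) (n : nat).
Hypothesis d0 : 0 < d.
Let x := ln (INR n.+1).
Let y := ln (INR n.+2).

Let n0 : 0 < INR n.+1 := INRS_pos n.
Let n1 : 0 < INR n.+2 := INRS_pos n.+1.

Let step_ge : / INR n.+2 <= y - x.
Proof.
have h : INR n.+1 / INR n.+2 <= exp (- / INR n.+2).
  have := exp_ineq1_le (- / INR n.+2); rewrite [in INR n.+1 / _](_ : INR n.+1 = INR n.+2 - 1).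
    by move=> h; apply: Rle_trans h; right; field; lra.
  by rewrite (S_INR n.+1); ring.
have := ln_le _ _ (Rdiv_lt_0_compat _ _ n0 n1) h.
rewrite ln_exp ln_div // -/x -/y; lra.
Qed.

Let step_le : y - x <= / INR n.+1.
Proof.
have h : INR n.+2 / INR n.+1 <= exp (/ INR n.+1).
  have := exp_ineq1_le (/ INR n.+1) => h; apply: Rle_trans h; right.
  by rewrite (S_INR n.+1); field; lra.
have := ln_le _ _ (Rdiv_lt_0_compat _ _ n1 n0) h.
rewrite ln_exp ln_div // -/x -/y; lra.
Qed.

(** Discrete integral test: the increment of ln lies between 1 / (n+2) and 1 / (n+1), and convexity
    of exp turns this into a comparison of n^(-(1+d)) with telescoping differences of n^(-d) / d. *)
Lemma zeta_step_upper :
  d * Rpower (INR n.+2) (- (1 + d)) <= Rpower (INR n.+1) (- d) - Rpower (INR n.+2) (- d).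
Proof.
have -> : Rpower (INR n.+2) (- (1 + d)) = Rpower (INR n.+2) (- d) * / INR n.+2.
  by rewrite -{3}(Rpower_1 (INR n.+2)) // -Rpower_Ropp -Rpower_plus; congr Rpower; ring.
have -> : Rpower (INR n.+1) (- d) = Rpower (INR n.+2) (- d) * exp (d * (y - x)).
  by rewrite /Rpower -exp_plus -/x -/y; congr exp; ring.
have := Rpower_pos (INR n.+2) (- d); set u := Rpower _ _ => u0.
have := exp_ineq1_le (d * (y - x)) => h.
have : d * / INR n.+2 <= d * (y - x) by apply: Rmult_le_compat_l; [lra|].
nra.
Qed.

Lemma zeta_step_lower :
  Rpower (INR n.+1) (- d) - Rpower (INR n.+2) (- d) <= d * Rpower (INR n.+1) (- (1 + d)).
Proof.
have -> : Rpower (INR n.+1) (- (1 + d)) = Rpower (INR n.+1) (- d) * / INR n.+1.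
  by rewrite -{3}(Rpower_1 (INR n.+1)) // -Rpower_Ropp -Rpower_plus; congr Rpower; ring.
have -> : Rpower (INR n.+2) (- d) = Rpower (INR n.+1) (- d) * exp (- (d * (y - x))).
  by rewrite /Rpower -exp_plus -/x -/y; congr exp; ring.
have := Rpower_pos (INR n.+1) (- d); set u := Rpower _ _ => u0.
have := exp_ineq1_le (- (d * (y - x))) => h.
have : d * (y - x) <= d * / INR n.+1 by apply: Rmult_le_compat_l; [lra|].
nra.
Qed.
End ZetaSteps.

Lemma zeta_upper (d : R) (X : nat) : 0 < d ->
  \rsum_(1 <= n < X.+1) Rpower (INR n) (- (1 + d)) <= 1 + 1 / d.
Proof.
move=> d0; have d1 : 0 < 1 / d by apply: Rdiv_lt_0_compat; lra.
case: X => [|X]; first by rewrite big_geq //; lra.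
suff h : \rsum_(1 <= n < X.+2) Rpower (INR n) (- (1 + d)) <= 1 + (1 - Rpower (INR X.+1) (- d)) / d.
  apply: Rle_trans h _; apply: Rplus_le_compat_l; apply: Rmult_le_compat_r.
    by apply: Rlt_le; apply: Rinv_0_lt_compat.
  by have := Rpower_pos (INR X.+1) (- d); lra.
elim: X => [|X IH]; first by rewrite big_nat1 /= !Rpower_1l; right; field; lra.
rewrite big_nat_recr //.
apply: Rle_trans (Rplus_le_compat_r _ _ _ IH) _.
have := zeta_step_upper d X d0 => h.
have : Rpower (INR X.+2) (- (1 + d)) <= (Rpower (INR X.+1) (- d) - Rpower (INR X.+2) (- d)) / d.
  apply: (Rmult_le_reg_l d) => //; apply: Rle_trans h _; right; field; lra.
rewrite /Rdiv; lra.
Qed.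

Lemma zeta_lower (d : R) : 0 < d ->
  exists P : nat, 1 / (2 * d) <= \rsum_(1 <= n < P.+1) Rpower (INR n) (- (1 + d)).
Proof.
(* Beyond 2^(1/d) the remaining term (P+1)^(-d) is at most 1/2, so half of the full telescoped value
   1 / d is reached. *)
move=> d0; have [P hP] := INR_unbounded (Rpower 2 (1 / d)); exists P.
suff h : (1 - Rpower (INR P.+1) (- d)) / d <= \rsum_(1 <= n < P.+1) Rpower (INR n) (- (1 + d)).
  apply: Rle_trans h.
  have e : Rpower 2 (1 / d) <= INR P.+1 by rewrite S_INR; lra.
  have : Rpower (INR P.+1) (- d) <= / 2.
    rewrite Rpower_Ropp; apply: Rinv_le_contravar; first lra.
    apply: Rle_trans (Rle_Rpower_l (Rpower 2 (1 / d)) (INR P.+1) d _ _).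
    - rewrite Rpower_mult (_ : 1 / d * d = 1); last by field; lra.
      by rewrite Rpower_1; lra.
    - lra.
    - by split => //; apply: Rpower_pos.
  move=> h; rewrite (_ : 1 / (2 * d) = (1 - / 2) / d); last by field; lra.
  apply: Rmult_le_compat_r; last lra.
  by apply: Rlt_le; apply: Rinv_0_lt_compat.
elim: P {hP} => [|P IH]; first by rewrite big_geq // Rpower_1l; right; field; lra.
rewrite big_nat_recr //; apply: Rle_trans (Rplus_le_compat_r _ _ _ IH).
have := zeta_step_lower d P d0 => h.
have : (Rpower (INR P.+1) (- d) - Rpower (INR P.+2) (- d)) / d <= Rpower (INR P.+1) (- (1 + d)).
  apply: (Rmult_le_reg_l d) => //; apply: Rle_trans h; right; field; lra.
rewrite /Rdiv; lra.
Qed.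

(** The exponent b ln x - x is largest at x = b, which gives the constant. *)
Lemma Rpower_le_exp (b x : R) : 0 < b -> 0 < x -> Rpower x b <= exp (b * ln b - b) * exp x.
Proof.
move=> b0 x0; rewrite /Rpower -exp_plus; apply: exp_le.
have h : x / b <= exp (x / b - 1) by have := exp_ineq1_le (x / b - 1); lra.
have xb : 0 < x / b by apply: Rdiv_lt_0_compat.
have := ln_le _ _ xb h; rewrite ln_exp ln_div //.
move=> h1; have : b * (ln x - ln b) <= b * (x / b - 1) by apply: Rmult_le_compat_l; lra.
rewrite (_ : b * (x / b - 1) = x - b); last by field; lra.
lra.
Qed.

Lemma geom_sum_le (q : R) (n : nat) : 0 <= q < 1 -> \rsum_(0 <= k < n) q ^ k <= / (1 - q).
Proof.
move=> [q0 q1]; suff -> : \rsum_(0 <= k < n) q ^ k = (1 - q ^ n) / (1 - q).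
  have := pow_le q n q0 => h; rewrite -[X in _ <= X]Rmult_1_l; apply: Rmult_le_compat_r; last lra.
  by apply: Rlt_le; apply: Rinv_0_lt_compat; lra.
elim: n => [|n IH]; first by rewrite big_geq //=; field; lra.
by rewrite big_nat_recr //= IH; field; lra.
Qed.

Lemma exp_pow (x : R) (k : nat) : exp x ^ k = exp (INR k * x).
Proof.
elim: k => [|k IH]; first by rewrite /= Rmult_0_l exp_0.
by rewrite S_INR /= IH -exp_plus; congr exp; ring.
Qed.

Lemma one_minus_exp (t : R) : 0 <= t <= 1 -> t / 2 <= 1 - exp (- t).
Proof.
move=> [t0 t1]; have h := exp_ineq1_le t.
have -> : exp (- t) = / exp t by rewrite exp_Ropp.
have : / exp t <= / (1 + t) by apply: Rinv_le_contravar; lra.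
have : t / 2 <= 1 - / (1 + t).
  rewrite (_ : 1 - / (1 + t) = t / (1 + t)); last by field; lra.
  by apply: Rmult_le_compat_l => //; apply: Rinv_le_contravar; lra.
lra.
Qed.

Lemma exp_geom_sum_le (e : R) (n : nat) : 0 < e <= 1 ->
  \rsum_(0 <= k < n) exp (- (e * INR k)) <= 2 / e.
Proof.
move=> [e0 e1]; have h := one_minus_exp e ltac:(lra).
have -> : \rsum_(0 <= k < n) exp (- (e * INR k)) = \rsum_(0 <= k < n) exp (- e) ^ k.
  by apply: eq_bigr => k _; rewrite exp_pow; congr exp; ring.
apply: Rle_trans (geom_sum_le _ _ _) _; first by split; [have := exp_pos (- e) |]; lra.
rewrite (_ : 2 / e = / (e / 2)); last by field; lra.
by apply: Rinv_le_contravar; lra.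
Qed.

(** Half of the exponential decay absorbs (k+1)^b at the cost of e^(-b); the other half sums to
    O(1/e). With e of order 1 - |zeta| this is the squared norm of a point evaluation in one
    variable. *)
Lemma poly_geom_sum_le (b : R) : 0 < b -> exists2 C0, 0 < C0 & forall e n, 0 < e <= 1 ->
  \rsum_(0 <= k < n) (Rpower (INR k.+1) b * exp (- (e * INR k))) <= C0 * Rpower e (- (1 + b)).
Proof.
move=> b0; set C1 := exp (b * ln b - b); have C1p : 0 < C1 by apply: exp_pos.
have P2 := Rpower_pos 2 b; have ep := exp_pos 1.
exists (C1 * Rpower 2 b * exp 1 * 4); first by repeat apply: Rmult_lt_0_compat; lra.
move=> e n [e0 e1].
have key k : Rpower (INR k.+1) b * exp (- (e * INR k)) <=
   (C1 * Rpower 2 b * Rpower e (- b) * exp 1) * exp (- (e / 2 * INR k)).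
  have k0 := INRS_pos k; have kk : INR k.+1 = INR k + 1 by rewrite S_INR.
  have h := Rpower_le_exp b (e / 2 * INR k.+1) b0 ltac:(apply: Rmult_lt_0_compat; lra).
  rewrite -Rpower_mult_distr // in h; last lra.
  have e2 : Rpower (e / 2) b * (Rpower 2 b * Rpower e (- b)) = 1.
    rewrite -Rmult_assoc Rpower_mult_distr; [|lra|lra].
    rewrite (_ : e / 2 * 2 = e); last by field.
    by rewrite -Rpower_plus (_ : b + - b = 0); [rewrite Rpower_O | ring].
  have pe := Rpower_pos e (- b); set u := Rpower 2 b * Rpower e (- b) in e2.
  have u0 : 0 < u by apply: Rmult_lt_0_compat.
  have h2 : Rpower (INR k.+1) b <= C1 * u * exp (e / 2 * INR k.+1).
    rewrite -(Rmult_1_l (Rpower _ _)) -e2.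
    have := Rmult_le_compat_l u _ _ (Rlt_le _ _ u0) h; rewrite -/C1; lra.
  apply: Rle_trans (Rmult_le_compat_r _ _ _ (Rlt_le _ _ (exp_pos _)) h2) _.
  rewrite Rmult_assoc -exp_plus (_ : C1 * Rpower 2 b * Rpower e (- b) = C1 * u); last by rewrite /u; ring.
  rewrite [X in _ <= X]Rmult_assoc -exp_plus; apply: Rmult_le_compat_l; first by apply: Rlt_le; apply: Rmult_lt_0_compat.
  by apply: exp_le; rewrite kk; nra.
apply: Rle_trans (rsum_le _ _ _ _ _ (fun k _ => key k)) _.
rewrite -rsum_scal; have pe := Rpower_pos e (- b).
apply: Rle_trans (Rmult_le_compat_l _ _ _ _ (exp_geom_sum_le (e / 2) n ltac:(lra))) _.
  by apply: Rlt_le; repeat apply: Rmult_lt_0_compat.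
right; rewrite (_ : - (1 + b) = - b + - 1); last ring.
rewrite Rpower_plus (Rpower_Ropp e 1) Rpower_1 //; field; lra.
Qed.

(** * The divisor function and its Dirichlet series *)

Lemma ndiv_gt0 (n : nat) : (0 < n)%nat -> (0 < ndiv n)%nat.
Proof. by move=> n0; rewrite /ndiv; case: (divisors n) (divisors_id n0). Qed.

Lemma ndiv1 : ndiv 1 = 1%nat.
Proof. by []. Qed.

(** A divisor d of m n is gcd(d, m) times a divisor of n; different pairs may have the same
    product. *)
Lemma ndiv_mul_le (m n : nat) : (0 < m)%nat -> (0 < n)%nat -> (ndiv (m * n) <= ndiv m * ndiv n)%nat.
Proof.
move=> m0 n0; rewrite /ndiv -(size_allpairs muln); apply: uniq_leq_size; first exact: divisors_uniq.
move=> d; rewrite -dvdn_divisors ?muln_gt0 ?m0 // => dmn; apply/allpairsP.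
have d0 : (0 < d)%nat by apply: dvdn_gt0 dmn; rewrite muln_gt0 m0.
have g0 : (0 < gcdn d m)%nat by rewrite gcdn_gt0 d0.
exists (gcdn d m, d %/ gcdn d m)%nat; split.
- by rewrite -dvdn_divisors //= dvdn_gcdr.
- rewrite -dvdn_divisors //=.
  rewrite -(@Gauss_dvdr _ (m %/ gcdn d m)%nat); last first.
    rewrite /coprime -(eqn_pmul2r g0) mul1n muln_gcdl !divnK ?dvdn_gcdl ?dvdn_gcdr //.
  rewrite -(@dvdn_pmul2r (gcdn d m)) // divnK ?dvdn_gcdl // mulnAC divnK ?dvdn_gcdr //.
- by rewrite /= mulnC divnK // dvdn_gcdl.
Qed.

Lemma ndiv_coprime (m n : nat) : (0 < m)%nat -> (0 < n)%nat -> coprime m n ->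
  ndiv (m * n) = (ndiv m * ndiv n)%nat.
Proof.
move=> m0 n0 cop; apply/eqP; rewrite eqn_leq ndiv_mul_le //= /ndiv -(size_allpairs muln).
apply: uniq_leq_size; last first.
  move=> _ /allpairsP [[a b] [ha hb ->]]; rewrite -!dvdn_divisors ?muln_gt0 ?m0 //= in ha hb *.
  exact: dvdn_mul.
apply: allpairs_uniq; [exact: divisors_uniq | exact: divisors_uniq |].
move=> _ _ /allpairsP [[a b] [ha hb ->]] /allpairsP [[a' b'] [ha' hb' ->]] /= e.
rewrite -!dvdn_divisors //= in ha hb ha' hb'.
have cab' : coprime a b' by apply: coprime_dvdl ha _; apply: coprime_dvdr hb' _.
have ca'b : coprime a' b by apply: coprime_dvdl ha' _; apply: coprime_dvdr hb _.
have a0 := dvdn_gt0 m0 ha.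
have ea : a = a'.
  apply/eqP; rewrite eqn_dvd; apply/andP; split.
    by rewrite -(Gauss_dvdl _ cab') -e dvdn_mulr.
  by rewrite -(Gauss_dvdl _ ca'b) e dvdn_mulr.
by move: e; rewrite -ea => /eqP; rewrite eqn_pmul2l // => /eqP ->.
Qed.

Lemma divisors_pexp (p k : nat) : prime p -> perm_eq (divisors (p ^ k)) [seq (p ^ i)%nat | i <- iota 0%nat k.+1].
Proof.
move=> pp; apply: uniq_perm; first exact: divisors_uniq.
  by rewrite map_inj_uniq ?iota_uniq //; apply: expnI; apply: prime_gt1.
move=> d; rewrite -dvdn_divisors ?expn_gt0 ?prime_gt0 //; apply/idP/mapP.
  by move/(dvdn_pfactor _ _ pp) => [i ik ->]; exists i => //; rewrite mem_iota.
by move=> [i]; rewrite mem_iota => ik ->; apply: dvdn_exp2l.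
Qed.

Lemma ndiv_pexp (p k : nat) : prime p -> ndiv (p ^ k) = k.+1.
Proof. by move=> pp; rewrite /ndiv (perm_size (divisors_pexp p k pp)) size_map size_iota. Qed.

Definition dpow (a : R) (n : nat) : R := Rpower (INR (ndiv n)) a.

Lemma dpow_pos (a : R) (n : nat) : 0 < dpow a n.
Proof. exact: Rpower_pos. Qed.

Lemma dpow_ge1 (a : R) (n : nat) : 0 <= a -> (0 < n)%nat -> 1 <= dpow a n.
Proof.
move=> a0 n0; rewrite -(Rpower_O (INR (ndiv n))); last by apply: INR_pos; apply: ndiv_gt0.
by apply: Rle_Rpower => //; apply: INR_ge1; apply: ndiv_gt0.
Qed.

Lemma dpow0 (n : nat) : (0 < n)%nat -> dpow 0 n = 1.
Proof. by move=> n0; rewrite /dpow Rpower_O //; apply: INR_pos; apply: ndiv_gt0. Qed.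

Lemma dpow1 (a : R) : dpow a 1 = 1.
Proof. by rewrite /dpow ndiv1 Rpower_1l. Qed.

Lemma dpow_pexp (a : R) (p k : nat) : prime p -> dpow a (p ^ k)%nat = Rpower (INR k.+1) a.
Proof. by move=> pp; rewrite /dpow ndiv_pexp. Qed.

Lemma dpow_coprime (a : R) (m n : nat) : (0 < m)%nat -> (0 < n)%nat -> coprime m n ->
  dpow a (m * n)%nat = dpow a m * dpow a n.
Proof.
by move=> m0 n0 c; rewrite /dpow ndiv_coprime // Rpower_INR_mul //; apply: ndiv_gt0.
Qed.

Lemma dpow_pexp_mul_le (a : R) (p k m : nat) : 0 <= a -> prime p -> (0 < m)%nat ->
  dpow a (p ^ k * m)%nat <= Rpower (INR k.+1) a * dpow a m.
Proof.
move=> a0 pp m0; rewrite -(dpow_pexp a p k pp) /dpow -Rpower_INR_mul; try exact: ndiv_gt0.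
  apply: Rle_Rpower_l => //; split; last by apply: INR_leq; apply: ndiv_mul_le; rewrite ?expn_gt0 ?(prime_gt0 pp).
  by apply: INR_pos; apply: ndiv_gt0; rewrite muln_gt0 expn_gt0 prime_gt0.
by apply: ndiv_gt0; rewrite expn_gt0 prime_gt0.
Qed.

(** Allows passing from Euler products to exponentials and back: for y of order p^(-(1+d)) the error
    y^2 is O(p^(-2)), whose sum over primes is bounded uniformly in d. *)
Lemma exp_over_le (y : R) : 0 <= y -> exp y <= (1 + y) * exp (y ^ 2).
Proof.
move=> y0; have h : exp (y / (1 + y)) <= 1 + y.
  have := exp_ineq1_le (- (y / (1 + y))); rewrite (_ : 1 + - (y / (1 + y)) = / (1 + y)); last by field; lra.
  rewrite exp_Ropp => h; have := Rinv_le_contravar _ _ (Rinv_0_lt_compat (1 + y) ltac:(lra)) h.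
  by rewrite !Rinv_inv.
have -> : exp y = exp (y / (1 + y)) * exp (y - y / (1 + y)) by rewrite -exp_plus; congr exp; ring.
apply: Rmult_le_compat => //; try (by apply: Rlt_le; apply: exp_pos).
apply: exp_le; rewrite (_ : y - y / (1 + y) = y ^ 2 / (1 + y)); last by field; lra.
rewrite -[X in _ <= X]Rmult_1_r; apply: Rmult_le_compat_l; first nra.
rewrite -Rinv_1; apply: Rinv_le_contravar; lra.
Qed.

(** A yardstick: a partial sum of the prime zeta function at 1 + d. The zeta sum is compared with
    its exponential and the divisor series with the exponential of 2^a times it, so the order 1/d of
    the former gives the order (1/d)^(2^a) of the latter. *)
Definition psum (d : R) (X : nat) : R := \rsum_(p <- iota 0%nat X.+1 | prime p) Rpower (INR p) (- (1 + d)).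

Lemma prime_sum_le (F : nat -> R) (X : nat) : (forall n, 0 <= F n) ->
  \rsum_(p <- iota 0%nat X.+1 | prime p) F p <= \rsum_(1 <= n < X.+1) F n.
Proof.
move=> F0; rewrite -big_filter; apply: rsum_sub => //; first exact: filter_uniq (iota_uniq _ _).
by move=> p; rewrite mem_filter mem_index_iota mem_iota => /andP [/prime_gt0 -> /andP [_]].
Qed.

Lemma prime_sq_sum_le (X : nat) : \rsum_(p <- iota 0%nat X.+1 | prime p) Rpower (INR p) (- 2) <= 2.
Proof.
apply: Rle_trans (prime_sum_le _ _ _) _; first by move=> n; apply: Rlt_le; apply: Rpower_pos.
have := zeta_upper 1 X ltac:(lra).
by rewrite (_ : - (1 + 1) = - 2); [lra | ring].
Qed.

Lemma Rpower_neg_le (n : nat) (s t : R) : (0 < n)%nat -> s <= t -> Rpower (INR n) s <= Rpower (INR n) t.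
Proof. by move=> n0 st; apply: Rle_Rpower => //; apply: INR_ge1. Qed.

Lemma psum_upper (d : R) (X : nat) : 0 < d -> exp (psum d X) <= (1 + 1 / d) * exp 2.
Proof.
move=> d0; rewrite -rprod_exp.
apply: Rle_trans (_ : \rprod_(p <- iota 0%nat X.+1 | prime p)
   ((1 + Rpower (INR p) (- (1 + d))) * exp (Rpower (INR p) (- 2))) <= _).
  apply: rprod_le => p pp; split; first by apply: Rlt_le; apply: exp_pos.
  have x0 := Rpower_pos (INR p) (- (1 + d)); set x := Rpower _ _ in x0 *.
  apply: Rle_trans (exp_over_le x ltac:(lra)) _; apply: Rmult_le_compat_l; first lra.
  apply: exp_le; rewrite /x -Rpower_pow; last exact: Rpower_pos.
  by rewrite Rpower_mult; apply: Rpower_neg_le; [exact: prime_gt0 | rewrite /=; lra].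
rewrite big_split /= rprod_exp; apply: Rmult_le_compat.
- by apply: rprod_ge0 => p _; have := Rpower_pos (INR p) (- (1 + d)); lra.
- by apply: Rlt_le; apply: exp_pos.
- have [Y hY] := sqfree_prod_le (fun n => Rpower (INR n) (- (1 + d))) (fun n => Rpower (INR n) (- (1 + d))) X
    (Rpower_1l _) (fun p m pp _ m0 => Rpower_INR_mul p m _ (prime_gt0 pp) m0)
    (fun n => Rlt_le _ _ (Rpower_pos _ _)).
  by apply: Rle_trans hY _; apply: zeta_upper.
- by apply: exp_le; apply: prime_sq_sum_le.
Qed.

Lemma div_sum_pow2 (a : R) : 0 <= a -> exists2 S, 0 < S & forall n,
  \rsum_(0 <= k < n) (Rpower (INR k.+1) a * (/ 2) ^ k) <= S.
Proof.
move=> a0; have [S S0 hS] := poly_geom_sum_le (a + 1) ltac:(lra).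
have l2 : 0 < ln 2 <= 1.
  split; first by rewrite -ln_1; apply: ln_increasing; lra.
  by have := exp_ineq1_le 1 => h; have := ln_le 2 (exp 1) ltac:(lra) ltac:(lra); rewrite ln_exp.
exists (S * Rpower (ln 2) (- (1 + (a + 1)))); first by apply: Rmult_lt_0_compat => //; apply: Rpower_pos.
move=> n; apply: Rle_trans (hS _ n l2); apply: rsum_le => k _.
have -> : (/ 2) ^ k = exp (- (ln 2 * INR k)).
  rewrite (_ : / 2 = exp (- ln 2)); last by rewrite exp_Ropp exp_ln; lra.
  by rewrite exp_pow; congr exp; ring.
apply: Rmult_le_compat_r; first by apply: Rlt_le; apply: exp_pos.
by apply: Rpower_neg_le => //; lra.
Qed.

(** p^(-s k) is at most p^(-2) p^(-(k-2)) and p >= 2; the factor 4 turns 2^(-(k-2)) into 2^(-k). The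
    second disjunct sets apart the terms k = 0 and k = 1, which are treated separately. *)
Lemma inv_pow_prime (p k : nat) (s : R) : prime p -> 1 <= s ->
  Rpower (INR p) (- s) ^ k <= 4 * Rpower (INR p) (- 2) * (/ 2) ^ k \/ (k < 2)%nat.
Proof.
move=> pp s1; case: (ltnP k 2) => k2; [by right | left].
have p2 : 2 <= INR p by have := INR_leq _ _ (prime_gt1 pp); rewrite /=; lra.
have p0 : 0 < INR p by lra.
have h1 : Rpower (INR p) (- s) <= / INR p.
  rewrite -{2}(Rpower_1 (INR p)) // -Rpower_Ropp.
  by apply: Rpower_neg_le; [exact: prime_gt0 | lra].
have h2 : / INR p <= / 2 by apply: Rinv_le_contravar; lra.
have i0 : 0 < / INR p by apply: Rinv_0_lt_compat.
apply: Rle_trans (pow_incr _ _ k (conj (Rlt_le _ _ (Rpower_pos _ _)) h1)) _.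
rewrite (_ : - 2 = - (INR 2)); last by rewrite /=; ring.
rewrite Rpower_Ropp Rpower_pow // -pow_inv.
rewrite -(subnKC k2) !pow_add.
have h3 := pow_incr (/ INR p) (/ 2) (k - 2) ltac:(lra).
have h4 := pow_lt (/ INR p) 2 i0.
have := Rmult_le_compat_l _ _ _ (Rlt_le _ _ h4) h3; rewrite [(/ 2) ^ 2]/=; lra.
Qed.

(** Since d(p) = 2, the term k = 1 of the local factor is 2^a p^(-(1+d)): this is the source of the
    exponent 2^a. The terms k >= 2 together are at most 4 S p^(-2), which sums to the constant. *)
Lemma euler_factor_le (a : R) : 0 <= a -> exists C0, forall d X, 0 < d ->
  \rsum_(1 <= n < X.+1) (dpow a n * Rpower (INR n) (- (1 + d))) <= exp (Rpower 2 a * psum d X + C0).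
Proof.
move=> a0; have [S S0 hS] := div_sum_pow2 a a0; exists (4 * S * 2) => d X d0.
set f := fun n => dpow a n * Rpower (INR n) (- (1 + d)).
have f0 n : 0 <= f n by apply: Rmult_le_pos; apply: Rlt_le; apply: Rpower_pos.
apply: Rle_trans (euler_upper f X f0 _ _) _.
- by rewrite /f dpow1 Rpower_1l; lra.
- move=> p k m pp pm m0; have q0 : (0 < p ^ k)%nat by rewrite expn_gt0 prime_gt0.
  rewrite /f Rpower_INR_mul // dpow_coprime //; first by right; ring.
  by apply: coprimeXl; rewrite prime_coprime.
apply: Rle_trans (_ : \rprod_(p <- iota 0%nat X.+1 | prime p)
   exp (Rpower 2 a * Rpower (INR p) (- (1 + d)) + 4 * S * Rpower (INR p) (- 2)) <= _); last first.
  rewrite rprod_exp; apply: exp_le; rewrite big_split /= -!rsum_scal; apply: Rplus_le_compat_l.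
  by apply: Rmult_le_compat_l; [lra | exact: prime_sq_sum_le].
apply: rprod_le => p pp; split; first by apply: rsum_ge0.
apply: Rle_trans (exp_ineq1_le _).
have p2 := Rpower_pos (INR p) (- 2).
have e k : f (p ^ k)%nat = Rpower (INR k.+1) a * Rpower (INR p) (- (1 + d)) ^ k.
  by rewrite /f dpow_pexp // Rpower_INR_exp // prime_gt0.
(* Two terms more than required, so that k = 0 and k = 1 can be split off whatever [X] is. *)
apply: Rle_trans (_ : \rsum_(0 <= k < X.+3) f (p ^ k)%nat <= _).
  rewrite [X in _ <= X]big_nat_recr // [X in _ <= X + _]big_nat_recr //=.
  have := f0 (p ^ X.+1)%nat; have := f0 (p ^ X.+2)%nat; lra.
have e2 : INR 2 = 2 by rewrite /=; ring.
rewrite big_nat_recl // big_nat_recl // !e Rpower_1l e2 pow_O pow_1 !Rmult_1_r.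
rewrite -Rplus_assoc -[X in _ <= X]Rplus_assoc; apply: Rplus_le_compat; first lra.
apply: Rle_trans (_ : 4 * Rpower (INR p) (- 2) * \rsum_(0 <= k < X.+3) (Rpower (INR k.+1) a * (/ 2) ^ k) <= _).
  rewrite [in X in _ <= X]big_nat_recl // [in X in _ <= X]big_nat_recl //.
  set u := 4 * Rpower (INR p) (- 2); have u0 : 0 < u by rewrite /u; lra.
  rewrite !Rmult_plus_distr_l -[X in X <= _]Rplus_0_l -[X in _ <= X]Rplus_assoc; apply: Rplus_le_compat.
    have t k : 0 <= u * (Rpower (INR k.+1) a * (/ 2) ^ k).
      apply: Rmult_le_pos; first lra.
      by apply: Rmult_le_pos; [apply: Rlt_le; apply: Rpower_pos | apply: pow_le; lra].
    exact: (Rplus_le_le_0_compat _ _ (t 0%nat) (t 1%nat)).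
  rewrite rsum_scal; apply: rsum_le => k _; rewrite e.
  have [h|//] := inv_pow_prime p k.+2 (1 + d) pp ltac:(lra).
  have := Rmult_le_compat_l _ _ _ (Rlt_le _ _ (Rpower_pos (INR k.+3) a)) h; rewrite /u; lra.
rewrite (_ : 4 * S * _ = 4 * Rpower (INR p) (- 2) * S); last ring.
by apply: Rmult_le_compat_l; [lra | exact: hS].
Qed.

Lemma div_series_upper (a : R) : 0 <= a -> exists2 C0, 0 < C0 & forall d X, 0 < d ->
  \rsum_(1 <= n < X.+1) (dpow a n * Rpower (INR n) (- (1 + d))) <= C0 * Rpower (1 + 1 / d) (Rpower 2 a).
Proof.
move=> a0; have [C0 hC] := euler_factor_le a a0; set A := Rpower 2 a in hC *.
have A0 : 0 < A by apply: Rpower_pos.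
exists (exp (A * 2 + C0)); first exact: exp_pos.
move=> d X d0; apply: Rle_trans (hC d X d0) _.
have d1 : 0 < 1 + 1 / d by have := Rdiv_lt_0_compat 1 d ltac:(lra) d0; lra.
have := psum_upper d X d0; rewrite -(exp_ln (1 + 1 / d)) // -exp_plus => h.
have h2 : psum d X <= ln (1 + 1 / d) + 2.
  by have := ln_le _ _ (exp_pos _) h; rewrite !ln_exp.
rewrite exp_ln // /Rpower -exp_plus; apply: exp_le; rewrite -/A; nra.
Qed.

(** Squarefree integers already give the right order, since 1 + A x >= exp(A x - (A x)^2) for each
    factor. The lower bound for [psum] comes from [euler_factor_le] at a = 0, where the divisor
    series is the zeta sum and 2^0 = 1. *)
Lemma div_series_lower (a : R) : 0 <= a -> exists2 c0, 0 < c0 & forall d, 0 < d ->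
  exists X : nat, c0 * Rpower (/ d) (Rpower 2 a) <=
    \rsum_(1 <= n < X.+1) (dpow a n * Rpower (INR n) (- (1 + d))).
Proof.
move=> a0; have [C1 hC] := euler_factor_le 0 (Rle_refl _); set A := Rpower 2 a.
have A0 : 0 < A by apply: Rpower_pos.
exists (exp (A * (- C1 - ln 2) - A ^ 2 * 2)); first exact: exp_pos.
move=> d d0; have [P hP] := zeta_lower d d0.
have h1 : 1 / (2 * d) <= exp (psum d P + C1).
  apply: Rle_trans hP _; have := hC d P d0; rewrite Rpower_O ?Rmult_1_l; last lra.
  apply: Rle_trans; right; rewrite big_nat [RHS]big_nat; apply: eq_bigr => n /andP [n0 _].
  by rewrite dpow0 // Rmult_1_l.
have h2 : - ln 2 + ln (/ d) <= psum d P + C1.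
  have i0 : 0 < / d by apply: Rinv_0_lt_compat.
  have := ln_le _ _ (Rdiv_lt_0_compat 1 (2 * d) ltac:(lra) ltac:(lra)) h1.
  rewrite ln_exp (_ : 1 / (2 * d) = / 2 * / d); last by field; lra.
  rewrite ln_mult; [|lra|exact: i0]; rewrite ln_Rinv; lra.
have [|||X hX] := sqfree_prod_le (fun n => dpow a n * Rpower (INR n) (- (1 + d)))
  (fun p => A * Rpower (INR p) (- (1 + d))) P.
- by rewrite dpow1 Rpower_1l; ring.
- move=> p m pp pm m0; have p0 := prime_gt0 pp.
  rewrite Rpower_INR_mul // dpow_coprime // ?prime_coprime //.
  rewrite -{1}(expn1 p) dpow_pexp // (_ : INR 2 = 2); last by rewrite /=; ring.
  by rewrite -/A; ring.
- by move=> n; apply: Rmult_le_pos; apply: Rlt_le; apply: Rpower_pos.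
exists X; apply: Rle_trans (_ : \rprod_(p <- iota 0%nat P.+1 | prime p) (1 + A * Rpower (INR p) (- (1 + d))) <= _); last exact: hX.
apply: Rle_trans (_ : \rprod_(p <- iota 0%nat P.+1 | prime p)
    exp (A * Rpower (INR p) (- (1 + d)) - A ^ 2 * Rpower (INR p) (- 2)) <= _); last first.
    apply: rprod_le => p pp; split; first by apply: Rlt_le; apply: exp_pos.
    have x0 := Rpower_pos (INR p) (- (1 + d)); set x := Rpower _ _ in x0 *.
    have Ax : 0 <= A * x by apply: Rmult_le_pos; lra.
    have h := exp_over_le (A * x) Ax.
    have hx : x ^ 2 <= Rpower (INR p) (- 2).
      rewrite /x -Rpower_pow; last exact: Rpower_pos.
      by rewrite Rpower_mult; apply: Rpower_neg_le; [exact: prime_gt0 | rewrite /=; lra].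
    have hq : (A * x) ^ 2 <= A ^ 2 * Rpower (INR p) (- 2).
      by rewrite Rpow_mult_distr; apply: Rmult_le_compat_l hx; apply: pow2_ge_0.
    rewrite /Rminus exp_plus exp_Ropp; apply: (Rmult_le_reg_r (exp (A ^ 2 * Rpower (INR p) (- 2)))); first exact: exp_pos.
    rewrite Rmult_assoc Rinv_l; last by have := exp_pos (A ^ 2 * Rpower (INR p) (- 2)); lra.
    rewrite Rmult_1_r; apply: Rle_trans h _; apply: Rmult_le_compat_l; [lra | exact: exp_le].
  rewrite rprod_exp; rewrite /Rpower -exp_plus -/(Rpower 2 a) -/A; apply: exp_le.
  rewrite /Rminus big_split /=.
  have -> : \rsum_(i <- iota 0%nat P.+1 | prime i) - (A ^ 2 * Rpower (INR i) (- 2)) =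
     - A ^ 2 * \rsum_(i <- iota 0%nat P.+1 | prime i) Rpower (INR i) (- 2).
    by rewrite rsum_scal; apply: eq_bigr => i _; ring.
  rewrite -rsum_scal -/(psum d P).
  have := prime_sq_sum_le P; have := pow2_ge_0 A; nra.
Qed.

Arguments seq.iota : simpl never.

(** * Chebyshev estimates and the summatory function of d(n)^a *)

Lemma bin_le_pow2 (n k : nat) : ('C(n, k) <= 2 ^ n)%nat.
Proof.
elim: n k => [|n IH] [|k] //; first by rewrite bin0 expn_gt0.
by rewrite binS expnS mul2n -addnn leq_add.
Qed.

Lemma prime_dvd_fact_le (p n : nat) : prime p -> (p %| n`!)%nat -> (p <= n)%nat.
Proof.
move=> pp; elim: n => [|n IH]; first by rewrite dvdn1 => /eqP p1; rewrite p1 in pp.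
by rewrite factS Euclid_dvdM // => /orP [/dvdn_leq -> // | /IH /leqW].
Qed.

Lemma ln_sum_primes_le (s : seq nat) (N : nat) : (0 < N)%nat -> uniq s ->
  (forall p, p \in s -> prime p /\ (p %| N)%nat) -> \rsum_(p <- s) ln (INR p) <= ln (INR N).
Proof.
elim: s N => [|p s IH] N N0 /=; first by rewrite big_nil => _ _; apply: ln_INR_ge0.
case/andP=> ps us hs; have [pp /dvdnP [m em]] : prime p /\ (p %| N)%nat by apply: hs; rewrite inE eqxx.
have p0 := prime_gt0 pp; have m0 : (0 < m)%nat by move: N0; rewrite em muln_gt0 => /andP [].
rewrite big_cons em mult_INR ln_mult; [|exact: INR_pos|exact: INR_pos].
rewrite Rplus_comm; apply: Rplus_le_compat_r; apply: IH => // q qs.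
have [pq dq] : prime q /\ (q %| N)%nat by apply: hs; rewrite inE qs orbT.
split => //; move: dq; rewrite em Euclid_dvdM // => /orP [//|].
by rewrite dvdn_prime2 // => /eqP qp; rewrite -qp qs in ps.
Qed.

Definition theta (n : nat) : R := \rsum_(p <- iota 0%nat n.+1 | prime p) ln (INR p).

Lemma theta_mono (m n : nat) : (m <= n)%nat -> theta m <= theta n.
Proof.
move=> mn; rewrite /theta -(subnKC mn) -addSn iotaD big_cat /=.
have := @rsum_ge0 _ (iota (0 + m.+1)%nat (n - m)) prime (fun p => ln (INR p)) (fun p _ => ln_INR_ge0 p).
lra.
Qed.

(** The primes in (m, 2m] divide the central binomial coefficient, which is at most 4^m. *)
Lemma theta_double (m : nat) : theta (2 * m) <= theta m + 2 * INR m * ln 2.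
Proof.
rewrite /theta mul2n -addnn -addSn iotaD big_cat /=; apply: Rplus_le_compat_l.
have c0 : (0 < 'C(m + m, m))%nat by rewrite bin_gt0 leq_addr.
apply: Rle_trans (_ : ln (INR 'C(m + m, m)) <= _).
  rewrite -big_filter; apply: ln_sum_primes_le => //; first exact: filter_uniq (iota_uniq _ _).
  move=> p; rewrite mem_filter mem_iota add0n => /andP [pp /andP [mp pm]]; split => //.
  have : (p %| (m + m)`!)%nat by apply: dvdn_fact; rewrite prime_gt0 //= -ltnS -addSn.
  have := @bin_fact (m + m) m (leq_addr _ _); rewrite addnK => <-.
  rewrite !Euclid_dvdM // => /orP [//|/orP []] /(prime_dvd_fact_le _ _ pp);
    by rewrite leqNgt mp.
apply: Rle_trans (_ : ln (INR (2 ^ (m + m))%nat) <= _).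
  by apply: ln_le; [exact: INR_pos | apply: INR_leq; exact: bin_le_pow2].
have -> : INR (2 ^ (m + m))%nat = 2 ^ (m + m).
  by elim: (m + m)%nat => [//|k IH]; rewrite expnS mult_INR IH.
rewrite ln_pow; last lra.
by right; rewrite plus_INR; ring.
Qed.

Lemma ln2_pos : 0 < ln 2.
Proof. by rewrite -ln_1; apply: ln_increasing; lra. Qed.

(** Halving with rounding up loses 2 [uphalf n] <= n + 1; the constant 4 is large enough to absorb
    this once n >= 3. *)
Lemma chebyshev_upper (n : nat) : theta n <= 4 * ln 2 * INR n.
Proof.
have l2 := ln2_pos; elim/ltn_ind: n => n IH; case: (ltnP n 3) => n3.
  have e2 : INR 2 = 2 by rewrite /=; lra.
  by case: n n3 {IH} => [|[|[|//]]] _; rewrite /theta !big_cons big_nil ?e2 /=; lra.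
have un : (uphalf n < n)%nat by rewrite uphalf_half; move: (odd_double_half n); lia.
apply: Rle_trans (theta_mono n (2 * uphalf n) _) _.
  by lia.
apply: Rle_trans (theta_double _) _.
have h := IH _ un.
have : (2 * uphalf n <= n + 1)%nat.
  by lia.
move/INR_leq; rewrite mult_INR plus_INR [INR 2]/= [INR 1]/= => h2.
have := INR_leq _ _ n3; rewrite [INR 3]/= => h3.
nra.
Qed.

Lemma INR_expn (m k : nat) : INR (m ^ k)%nat = INR m ^ k.
Proof. by elim: k => [//|k IH]; rewrite expnS mult_INR IH. Qed.

Lemma ln_le_2sqrt (x : R) : 0 < x -> ln x <= 2 * Rpower x (1 / 2).
Proof.
move=> x0; have h : ln (Rpower x (1 / 2)) <= Rpower x (1 / 2).
  rewrite -{2}(ln_exp (Rpower x (1 / 2))); apply: ln_le; first exact: Rpower_pos.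
  by have := exp_ineq1_le (Rpower x (1 / 2)); lra.
move: h; rewrite {1}/Rpower ln_exp; lra.
Qed.

(** Chebyshev's psi function with the prime power p^k weighted by d(p^k)^a. *)
Definition psiw (a : R) (y : nat) : R :=
  \rsum_(p <- iota 0%nat y.+1 | prime p) \rsum_(1 <= k < y.+1 | (p ^ k <= y)%nat) (Rpower (INR k.+1) a * ln (INR p)).

(** The primes give [theta]. For k >= 2, Rankin's device replaces the condition p^k <= y by the
    factor y p^(-k), and the bound of p^(-2) ln p by 2 p^(-3/2) keeps the sum over primes finite. *)
Lemma psiw_upper (a : R) : 0 <= a -> exists2 C0, 0 < C0 & forall y, psiw a y <= C0 * INR y.
Proof.
move=> a0; have [S S0 hS] := div_sum_pow2 a a0; have A0 := Rpower_pos 2 a; have l2 := ln2_pos.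
exists (Rpower 2 a * (4 * ln 2) + 4 * S * 2 * 3); first nra.
move=> y.
have y0 : 0 <= INR y by apply: pos_INR.
apply: Rle_trans (_ : \rsum_(p <- iota 0%nat y.+1 | prime p)
  (Rpower 2 a * ln (INR p) + INR y * (4 * S * 2) * Rpower (INR p) (- (1 + 1 / 2))) <= _); last first.
  rewrite big_split /= -!rsum_scal -/(theta y).
  have := chebyshev_upper y.
  have h : \rsum_(p <- iota 0%nat y.+1 | prime p) Rpower (INR p) (- (1 + 1 / 2)) <= 3.
    apply: Rle_trans (prime_sum_le _ _ _) _; first by move=> n; apply: Rlt_le; apply: Rpower_pos.
    by have := zeta_upper (1 / 2) y ltac:(lra); rewrite (_ : 1 + 1 / (1 / 2) = 3) //; field.
  move=> h2; have := Rmult_le_compat_l _ _ _ (Rlt_le _ _ A0) h2.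
  have := Rmult_le_compat_l (INR y * (4 * S * 2)) _ _ ltac:(nra) h; lra.
rewrite /psiw big_seq_cond [X in _ <= X]big_seq_cond; apply: rsum_le => p /andP [].
rewrite mem_iota add0n ltnS => /andP [_ py] pp.
have p0 := prime_gt0 pp; have p2 := prime_gt1 pp; have y1 : (1 <= y)%nat by apply: leq_trans py.
have lp := ln_INR_ge0 p; have Ip := INR_pos p p0.
rewrite big_ltn_cond // expn1 py; apply: Rplus_le_compat.
  by rewrite (_ : INR 2 = 2); [lra | rewrite /=; lra].
apply: Rle_trans (_ : \rsum_(0 <= k < y.+1) (INR y * ln (INR p) * (4 * Rpower (INR p) (- 2)) * (Rpower (INR k.+1) a * (/ 2) ^ k)) <= _).
  apply: Rle_trans (_ : \rsum_(2 <= k < y.+1) (INR y * ln (INR p) * (4 * Rpower (INR p) (- 2)) * (Rpower (INR k.+1) a * (/ 2) ^ k)) <= _); last first.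
    rewrite [X in _ <= X](big_cat_nat (n := 2)) //=.
    set w := INR y * _ * _; have w0 : 0 <= w.
      by apply: Rmult_le_pos; [nra | have := Rpower_pos (INR p) (- 2); lra].
    rewrite -[X in X <= _]Rplus_0_l; apply: Rplus_le_compat_r; apply: rsum_ge0 => k _.
    apply: Rmult_le_pos => //; apply: Rmult_le_pos; first by apply: Rlt_le; apply: Rpower_pos.
    by apply: pow_le; lra.
  rewrite big_mkcond big_nat [X in _ <= X]big_nat; apply: rsum_le => k /andP [k2 _].
  have rk := Rpower_pos (INR k.+1) a; have r2 := Rpower_pos (INR p) (- 2); have hk := pow_lt (/ 2) k ltac:(lra).
  case: ifP => hy; last first.
    by apply: Rmult_le_pos; [apply: Rmult_le_pos; nra | nra].
  have [h|] := inv_pow_prime p k 1 pp (Rle_refl _); last by rewrite ltnNge k2.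
  have pk : 0 < INR p ^ k by apply: pow_lt.
  rewrite Rpower_Ropp Rpower_1 // pow_inv in h.
  have hyk : INR p ^ k <= INR y by rewrite -INR_expn; apply: INR_leq.
  have h1 : 1 <= INR y * / INR p ^ k.
    by apply: (Rmult_le_reg_r (INR p ^ k)) => //; rewrite Rmult_assoc Rinv_l; lra.
  have h2 : 1 <= INR y * (4 * Rpower (INR p) (- 2) * (/ 2) ^ k).
    by apply: Rle_trans h1 _; apply: Rmult_le_compat_l.
  have := Rmult_le_compat_l (Rpower (INR k.+1) a * ln (INR p)) _ _ ltac:(nra) h2; lra.
rewrite -rsum_scal.
have h3 : ln (INR p) * Rpower (INR p) (- 2) <= 2 * Rpower (INR p) (- (1 + 1 / 2)).
  rewrite (_ : - (1 + 1 / 2) = 1 / 2 + - 2); last field.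
  rewrite Rpower_plus -Rmult_assoc; apply: Rmult_le_compat_r; last exact: ln_le_2sqrt.
  by apply: Rlt_le; apply: Rpower_pos.
have r2 := Rpower_pos (INR p) (- 2).
have h4 := Rmult_le_compat_l (INR y * (ln (INR p) * Rpower (INR p) (- 2)) * 4) _ _ ltac:(apply: Rmult_le_pos; [apply: Rmult_le_pos; nra | lra]) (hS y.+1).
have := Rmult_le_compat_l (INR y * 4 * S) _ _ ltac:(apply: Rmult_le_pos; nra) h3; lra.
Qed.

Lemma ln_prod (I : Type) (s : seq I) (P : pred I) (F : I -> nat) :
  (forall i, P i -> (0 < F i)%nat) ->
  ln (INR (\prod_(i <- s | P i) F i)%nat) = \rsum_(i <- s | P i) ln (INR (F i)).
Proof.
move=> h; suff : ln (INR (\prod_(i <- s | P i) F i)%nat) = \rsum_(i <- s | P i) ln (INR (F i)) /\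
  (0 < \prod_(i <- s | P i) F i)%nat by case.
elim/big_rec2: _ => [|i y1 y2 Pi [<- y0]]; first by rewrite ln_1.
by rewrite muln_gt0 h // y0 mult_INR ln_mult //; apply: INR_pos => //; apply: h.
Qed.

Lemma ln_le_sum_prime_powers (n x : nat) : (0 < n)%nat -> (n <= x)%nat ->
  ln (INR n) <= \rsum_(p <- iota 0%nat x.+1 | prime p) \rsum_(1 <= k < x.+1 | (p ^ k %| n)%nat) ln (INR p).
Proof.
move=> n0 nx; rewrite -{1}(partnT n0) (widen_partn _ nx).
rewrite (bigID prime) /= [X in (_ * X)%nat]big1 ?muln1; last first.
  by move=> p np; rewrite lognE (negbTE np).
rewrite ln_prod; last by move=> p pp; rewrite expn_gt0 prime_gt0.
rewrite /index_iota subn0; apply: rsum_le => p pp.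
rewrite INR_expn ln_pow; last by apply: INR_pos; apply: prime_gt0.
rewrite logn_count_dvd //.
have -> : INR (\sum_(1 <= k < n) (p ^ k %| n))%nat = \rsum_(1 <= k < n) INR (p ^ k %| n)%nat.
  by elim/big_ind2: _ => // a b c d <- <-; rewrite plus_INR.
rewrite rsum_scalr (big_cat_nat (n := n) (p := x.+1)) //=; last exact: leqW.
rewrite -[X in X <= _]Rplus_0_r; apply: Rplus_le_compat; last by apply: rsum_ge0 => k _; apply: ln_INR_ge0.
rewrite [X in _ <= X]big_mkcond; apply: rsum_le => k _.
by case: ifP => _ /=; lra.
Qed.

Lemma psiw_mono_nat (a : R) (x y : nat) : 
  (y <= x)%nat -> \rsum_(p <- iota 0%nat x.+1 | prime p)
    \rsum_(1 <= k < x.+1 | (p ^ k <= y)%nat) (Rpower (INR k.+1) a * ln (INR p)) <= psiw a y.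
Proof.
move=> yx; rewrite /psiw.
have t0 p k : 0 <= Rpower (INR k.+1) a * ln (INR p).
  by apply: Rmult_le_pos; [apply: Rlt_le; apply: Rpower_pos | exact: ln_INR_ge0].
rewrite -{1}(subnKC yx) -addSn iotaD big_cat /= [X in _ + X <= _]big1_seq ?Rplus_0_r; last first.
  move=> p; rewrite mem_iota add0n => /andP [pp /andP [yp _]]; rewrite big_nat_cond big1 //.
  move=> k /andP [/andP [k1 _] h]; move: h; rewrite leqNgt.
  by rewrite (leq_trans yp) // -{1}(expn1 p) leq_exp2l // prime_gt1.
apply: rsum_le => p pp; rewrite (big_cat_nat (n := y.+1)) //= [X in _ + X <= _]big1_seq; first by lra.
move=> k; rewrite mem_index_iota => /andP [h /andP [yk _]]; move: h; rewrite leqNgt.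
by rewrite (leq_trans yk) // ltnW // ltn_expl // prime_gt1.
Qed.

(** ln n is decomposed over the prime powers p^k dividing n. Taking p^k out of d(n)^a costs at most
    (k+1)^a, also when p still divides n / p^k; for fixed m = n / p^k what remains is [psiw] at x /
    m. *)
Lemma div_log_sum (a : R) : 0 <= a -> exists2 C0, 0 < C0 & forall x,
  \rsum_(1 <= n < x.+1) (dpow a n * ln (INR n)) <= C0 * INR x * \rsum_(1 <= m < x.+1) (dpow a m / INR m).
Proof.
move=> a0; have [C0 C00 hC] := psiw_upper a a0; exists C0 => // x.
have dp n := dpow_pos a n.
have rk k : 0 < Rpower (INR k.+1) a by apply: Rpower_pos.
apply: Rle_trans (_ : \rsum_(1 <= n < x.+1) \rsum_(p <- iota 0%nat x.+1 | prime p)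
   \rsum_(1 <= k < x.+1 | (p ^ k %| n)%nat) (dpow a n * ln (INR p)) <= _).
  rewrite big_nat [X in _ <= X]big_nat; apply: rsum_le => n /andP [n0 nx].
  have := ln_le_sum_prime_powers n x n0 nx => h.
  apply: Rle_trans (Rmult_le_compat_l _ _ _ (Rlt_le _ _ (dp n)) h) _; right.
  by rewrite rsum_scal; apply: eq_bigr => p _; rewrite rsum_scal.
apply: Rle_trans (_ : \rsum_(1 <= m < x.+1) (dpow a m * psiw a (x %/ m)) <= _); last first.
  rewrite rsum_scal; apply: rsum_le_nat => m /andP [m0 mx].
  have h := hC (x %/ m)%nat; have Im := INR_pos _ m0.
  have h2 : INR (x %/ m)%nat <= INR x / INR m.
    apply: (Rmult_le_reg_r (INR m)) => //; rewrite -mult_INR /Rdiv Rmult_assoc Rinv_l ?Rmult_1_r; last lra.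
    by apply: INR_leq; apply: leq_divM.
  have := Rmult_le_compat_l _ _ _ (Rlt_le _ _ C00) h2 => h3.
  apply: Rle_trans (Rmult_le_compat_l _ _ _ (Rlt_le _ _ (dp m)) (Rle_trans _ _ _ h h3)) _.
  by right; rewrite /Rdiv; ring.
apply: Rle_trans (_ : \rsum_(1 <= m < x.+1) \rsum_(p <- iota 0%nat x.+1 | prime p)
   \rsum_(1 <= k < x.+1 | (p ^ k <= x %/ m)%nat) (dpow a m * (Rpower (INR k.+1) a * ln (INR p))) <= _); last first.
  apply: rsum_le_nat => m /andP [m0 mx].
  apply: Rle_trans (Rmult_le_compat_l _ _ _ (Rlt_le _ _ (dp m)) (psiw_mono_nat a x _ (leq_div x m))).
  by right; rewrite rsum_scal; apply: eq_bigr => p _; rewrite rsum_scal.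
rewrite exchange_big [X in _ <= X]exchange_big /=; apply: rsum_le => p pp.
rewrite (exchange_big_dep predT) //= [X in _ <= X](exchange_big_dep predT) //=; apply: rsum_le_nat => k /andP [k1 _].
rewrite -/(INR k.+1).
have q0 : (0 < p ^ k)%nat by rewrite expn_gt0 prime_gt0.
rewrite -big_filter -[X in _ <= X]big_filter.
apply: (rsum_inj_le _ _ _ _ (fun n => n %/ p ^ k)%nat).
- exact: filter_uniq (iota_uniq _ _).
- move=> n m; rewrite !mem_filter => /andP [dn _] /andP [dm _] e.
  by rewrite -(divnK dn) -(divnK dm) e.
- move=> n; rewrite !mem_filter !mem_index_iota => /andP [dn /andP [n0 nx]].
  have m0 : (0 < n %/ p ^ k)%nat by rewrite divn_gt0 // dvdn_leq.
  split.
    rewrite ltnS in nx; rewrite m0 ltnS (leq_trans (leq_div _ _) nx) /= andbT.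
    by rewrite leq_divRL // mulnC divnK.
  rewrite -Rmult_assoc; apply: Rmult_le_compat_r; first exact: ln_INR_ge0.
  have h := dpow_pexp_mul_le a p k (n %/ p ^ k) a0 pp m0.
  by rewrite (_ : (p ^ k * (n %/ p ^ k) = n)%nat) in h; [lra | rewrite mulnC divnK].
- move=> m _; apply: Rmult_le_pos; first exact: Rlt_le.
  by apply: Rmult_le_pos; [apply: Rlt_le | exact: ln_INR_ge0].
Qed.

(** One logarithm is gained: ln x times the sum [T] is at most a constant times x [W], and the
    logarithmic mean [W] is O((1 + ln x)^A) by comparison with the Dirichlet series at 1 + 1 / ln x,
    since n^(1 / ln x) <= exp 1 for n <= x. *)
Lemma div_sum_upper (a : R) : 0 < a -> exists2 C0, 0 < C0 & forall x, (0 < x)%nat ->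
  \rsum_(1 <= n < x.+1) dpow a n <= C0 * INR x * Rpower (1 + ln (INR x)) (Rpower 2 a - 1).
Proof.
move=> a0; have [C1 C10 h1] := div_log_sum a (Rlt_le _ _ a0).
have [C2 C20 h2] := div_series_upper a (Rlt_le _ _ a0).
set A := Rpower 2 a in h2 *; have e1 := exp_pos 1; have l2 := ln2_pos.
set C3 := (C1 + 1) * (C2 * exp 1) * (1 + / ln 2).
have i2 : 0 < / ln 2 by apply: Rinv_0_lt_compat.
have C30 : 0 < C3 by repeat apply: Rmult_lt_0_compat; lra.
exists (C3 + 1); first lra.
move=> x x0; have Ix := INR_ge1 _ x0; have lx := ln_INR_ge0 x.
case: (leqP x 1) => [x1|x2].
  have -> : x = 1%nat by apply/eqP; rewrite eqn_leq x1.
  by rewrite big_nat1 dpow1 /= ln_1 Rplus_0_r Rpower_1l; lra.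
have lx2 : ln 2 <= ln (INR x).
  by apply: ln_le; [lra | have := INR_leq _ _ x2; rewrite /=; lra].
set L := ln (INR x) in lx lx2 *; set T := \rsum_(1 <= n < x.+1) dpow a n.
set W := \rsum_(1 <= m < x.+1) (dpow a m / INR m).
have hW : W <= exp 1 * (C2 * Rpower (1 + L) A).
  have := h2 (/ L) x ltac:(apply: Rinv_0_lt_compat; lra).
  rewrite (_ : 1 + 1 / / L = 1 + L); last by field; lra.
  move=> h; apply: Rle_trans (Rmult_le_compat_l _ _ _ (Rlt_le _ _ e1) h).
  rewrite rsum_scal; apply: rsum_le_nat => n /andP [n0 nx].
  have In := INR_pos _ n0; have dn := dpow_pos a n.
  rewrite -Rmult_assoc (Rmult_comm (exp 1)) Rmult_assoc; apply: Rmult_le_compat_l; first lra.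
  rewrite -{1}(exp_ln (INR n)) // -exp_Ropp /Rpower -exp_plus; apply: exp_le.
  have hl : ln (INR n) <= L by apply: ln_le => //; apply: INR_leq; rewrite -ltnS.
  have : / L * ln (INR n) <= 1.
    by apply: (Rmult_le_reg_l L); [lra | rewrite -Rmult_assoc Rinv_r; lra].
  lra.
have hT : L * T <= (C1 + 1) * INR x * W.
  have e : L * T = \rsum_(1 <= n < x.+1) (dpow a n * ln (INR n)) + \rsum_(1 <= n < x.+1) (dpow a n * (L - ln (INR n))).
    by rewrite -big_split rsum_scal /=; apply: eq_bigr => n _; ring.
  (* L - ln n = ln (x / n) is at most x / n. *)
  have h3 : \rsum_(1 <= n < x.+1) (dpow a n * (L - ln (INR n))) <= INR x * W.
    rewrite rsum_scal; apply: rsum_le_nat => n /andP [n0 nx].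
    have In := INR_pos _ n0; have dn := dpow_pos a n.
    rewrite /Rdiv (Rmult_comm (dpow a n) (/ _)) -Rmult_assoc Rmult_comm; apply: Rmult_le_compat_r; first lra.
    rewrite /L -ln_div //; last lra.
    rewrite -[X in _ <= X](ln_exp (INR x * / INR n)); apply: ln_le; first by apply: Rdiv_lt_0_compat; lra.
    by have := exp_ineq1_le (INR x * / INR n); rewrite /Rdiv; lra.
  by have := h1 x; rewrite -/W; lra.
have hR : Rpower (1 + L) A = (1 + L) * Rpower (1 + L) (A - 1).
  rewrite -{2}(Rpower_1 (1 + L)); last lra.
  by rewrite -Rpower_plus; congr Rpower; ring.
have hL : 1 + L <= (1 + / ln 2) * L.
  have : 1 <= / ln 2 * L by rewrite -(Rinv_l (ln 2)); [apply: Rmult_le_compat_l; lra | lra].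
  lra.
have r0 := Rpower_pos (1 + L) (A - 1); set r := Rpower _ _ in r0 hR *.
apply: (Rmult_le_reg_l L); first lra.
apply: Rle_trans hT _.
have s1 : (C1 + 1) * INR x * W <= (C1 + 1) * INR x * (exp 1 * (C2 * Rpower (1 + L) A)).
  by apply: Rmult_le_compat_l => //; apply: Rmult_le_pos; lra.
apply: Rle_trans s1 _; rewrite hR.
have s2 := Rmult_le_compat_l ((C1 + 1) * INR x * (exp 1 * C2) * r) _ _ ltac:(repeat apply: Rmult_le_pos; lra) hL.
have s3 : 0 <= L * (INR x * r) by repeat apply: Rmult_le_pos; lra.
rewrite /C3; lra.
Qed.

(** On a dyadic block 1 / m is comparable to 2^(-i), so only the power A - 1 of the logarithm
    remains; the weight of Schur's test is made to cancel it. *)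
Lemma div_window (a : R) : 0 < a -> exists2 C0, 0 < C0 & forall i,
  \rsum_((2 ^ i)%nat <= m < (2 ^ i.+1)%nat) (dpow a m / INR m) <= C0 * Rpower (INR i.+1) (Rpower 2 a - 1).
Proof.
move=> a0; have [C0 C00 hC] := div_sum_upper a a0; set A := Rpower 2 a in hC *.
have A1 : 0 <= A - 1.
  by have := Rle_Rpower 2 0 a ltac:(lra) ltac:(lra); rewrite Rpower_O -/A; lra.
exists (C0 * 2 * Rpower 2 (A - 1)).
  by apply: Rmult_lt_0_compat; [lra | exact: Rpower_pos].
move=> i; have q0 : (0 < 2 ^ i)%nat by rewrite expn_gt0.
have Iq := INR_pos _ q0; have pi := Rinv_0_lt_compat _ Iq.
have ex : INR (2 ^ i.+1)%nat = 2 * INR (2 ^ i)%nat by rewrite expnS mult_INR /=; ring.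
apply: Rle_trans (_ : / INR (2 ^ i)%nat * \rsum_(1 <= m < (2 ^ i.+1).+1) dpow a m <= _).
  rewrite [X in _ * X](big_cat_nat (n := (2 ^ i)%nat)) //=; last by rewrite ltnW // ltnS leq_exp2l.
  rewrite [X in _ * (_ + X)](big_cat_nat (n := (2 ^ i.+1)%nat)) //=; last by rewrite leq_exp2l.
  apply: Rle_trans (_ : / INR (2 ^ i)%nat * \rsum_((2 ^ i)%nat <= m < (2 ^ i.+1)%nat) dpow a m <= _).
    rewrite rsum_scal; apply: rsum_le_nat => m /andP [hm _]; rewrite /Rdiv Rmult_comm.
    apply: Rmult_le_compat_r; first exact: Rlt_le (dpow_pos a m).
    by apply: Rinv_le_contravar => //; apply: INR_leq.
  apply: Rmult_le_compat_l; first lra.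
  have t s : 0 <= \rsum_(m <- s) dpow a m by apply: rsum_ge0 => m _; apply: Rlt_le; apply: dpow_pos.
  have := t (index_iota 1 (2 ^ i)); have := t (index_iota (2 ^ i.+1) (2 ^ i.+1).+1).
  lra.
have := hC (2 ^ i.+1)%nat ltac:(by rewrite expn_gt0) => h.
apply: Rle_trans (Rmult_le_compat_l _ _ _ (Rlt_le _ _ pi) h) _.
rewrite ex; set u := INR (2 ^ i)%nat in Iq pi *.
rewrite -!Rmult_assoc (_ : / u * C0 * 2 * u = C0 * 2); last by field; lra.
rewrite (Rmult_assoc (C0 * 2)); apply: Rmult_le_compat_l; first lra.
rewrite Rpower_mult_distr; [|lra|exact: INRS_pos].
apply: Rle_Rpower_l => //.
have -> : ln (2 * u) = INR i.+1 * ln 2.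
  by rewrite /u -ex INR_expn ln_pow //=; lra.
have l2 := ln2_pos; have l21 : ln 2 <= 1.
  by have := exp_ineq1_le 1 => h3; have := ln_le 2 (exp 1) ltac:(lra) ltac:(lra); rewrite ln_exp.
have := INR_ge1 i.+1 isT => h4; split; nra.
Qed.

(** * The complex exponential and its Taylor polynomials *)

Definition Cexp (w : C) : C := (exp (Re w) * cos (Im w), exp (Re w) * sin (Im w)).

Lemma Cexp_plus (u v : C) : Cexp (u + v) = (Cexp u * Cexp v)%C.
Proof.
case: u v => u1 u2 [v1 v2]; rewrite /Cexp /Cmult /= exp_plus cos_plus sin_plus.
by congr pair; ring.
Qed.

Lemma Cexp_0 : Cexp 0 = 1.
Proof. by rewrite /Cexp /= exp_0 cos_0 sin_0 /RtoC; congr pair; ring. Qed.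

Lemma Cmod_Cexp (w : C) : Cmod (Cexp w) = exp (Re w).
Proof.
rewrite /Cexp /Cmod /=.
have -> : forall e c s, e * c * (e * c * 1) + e * s * (e * s * 1) = e * e * (Rsqr s + Rsqr c).
  by move=> e c s; rewrite /Rsqr; ring.
by rewrite sin2_cos2 Rmult_1_r sqrt_square //; apply: Rlt_le; apply: exp_pos.
Qed.

Lemma npow_Cexp (n : nat) (s : C) : npow n s = Cexp (- (ln (INR n) * s))%C.
Proof.
case: s => a b; rewrite /npow /Cexp /Rpower /=.
rewrite (_ : - (ln (INR n) * a - 0 * b) = - a * ln (INR n)); last ring.
rewrite (_ : - (ln (INR n) * b + 0 * a) = - (b * ln (INR n))); last ring.
by rewrite cos_neg sin_neg; congr pair; ring.
Qed.

Lemma npow_mul (m n : nat) (s : C) : (0 < m)%nat -> (0 < n)%nat ->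
  npow (m * n) s = (npow m s * npow n s)%C.
Proof.
move=> m0 n0; rewrite !npow_Cexp -Cexp_plus; congr Cexp.
rewrite mult_INR ln_mult; [|exact: INR_pos|exact: INR_pos].
by rewrite RtoC_plus; ring.
Qed.

Lemma npow1 (s : C) : npow 1 s = 1.
Proof. by rewrite npow_Cexp /= ln_1 Cmult_0_l Copp_0 Cexp_0. Qed.

Lemma Cmod_npow (n : nat) (s : C) : Cmod (npow n s) = Rpower (INR n) (- Re s).
Proof. by rewrite npow_Cexp Cmod_Cexp /Rpower; congr exp; case: s => a b /=; ring. Qed.

Lemma Cmod_Re_Im (w : C) : Cmod w <= Rabs (Re w) + Rabs (Im w).
Proof.
have -> : w = (RtoC (Re w) + Ci * RtoC (Im w))%C by case: w => a b; rewrite /Cplus /Cmult /=; congr pair; ring.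
apply: Rle_trans (Cmod_triangle _ _) _; rewrite Cmod_mult Cmod_Ci !Cmod_R /= Rmult_1_l.
rewrite (_ : Re w + (0 * Im w - 1 * 0) = Re w); last ring.
by rewrite (_ : 0 + (0 * 0 + 1 * Im w) = Im w); [lra | ring].
Qed.

Lemma im_le_Cmod (w : C) : Rabs (Im w) <= Cmod w.
Proof. by have := Rmax_Cmod w; have := Rmax_r (Rabs (fst w)) (Rabs (snd w)); rewrite /Im; lra. Qed.

Definition Texp (K : nat) (w : C) : C := \csum_(0 <= k < K) (RtoC (/ INR (fact k)) * w ^ k).

Lemma is_derive_Texp (K : nat) (w : C) (t : R) :
  is_derive (fun t : R => Re (Texp K.+1 (RtoC t * w))) t (Re (w * Texp K (t * w))) /\
  is_derive (fun t : R => Im (Texp K.+1 (RtoC t * w))) t (Im (w * Texp K (t * w))).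
Proof.
have e k (x : R) : (RtoC (/ INR (fact k)) * (x * w) ^ k)%C = (RtoC (x ^ k) * (RtoC (/ INR (fact k)) * w ^ k))%C.
  by rewrite Cpow_mult_l -RtoC_pow; ring.
elim: K => [|K [IH1 IH2]].
  rewrite /Texp big_geq // Cmult_0_r; split.
    apply: (is_derive_ext (fun _ : R => Re (RtoC (/ INR (fact 0)) * 1)%C)); last exact: is_derive_const.
    by move=> x; rewrite big_nat1.
  apply: (is_derive_ext (fun _ : R => Im (RtoC (/ INR (fact 0)) * 1)%C)); last exact: is_derive_const.
  by move=> x; rewrite big_nat1.
set u := (RtoC (/ INR (fact K.+1)) * w ^ K.+1)%C.
have es x : Texp K.+2 (RtoC x * w) = (Texp K.+1 (RtoC x * w) + RtoC (x ^ K.+1) * u)%C.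
  by rewrite {1}/Texp big_nat_recr // -/(Texp K.+1 _) e.
have ed : (w * Texp K.+1 (t * w))%C = (w * Texp K (t * w) + RtoC (INR K.+1 * t ^ K) * u)%C.
  rewrite {1}/Texp big_nat_recr // -/(Texp K _) e Cmult_plus_distr_l; congr Cplus.
  rewrite /u fact_simpl mult_INR Rinv_mult !RtoC_mult.
  have h : (RtoC (INR K.+1) * RtoC (/ INR K.+1) = 1)%C.
    by rewrite -RtoC_mult Rinv_r //; have := INRS_pos K; lra.
  rewrite -[LHS]Cmult_1_l -h; change (w ^ K.+1)%C with (w * w ^ K)%C; ring.
have dp : is_derive (fun x : R => x ^ K.+1) t (INR K.+1 * t ^ K).
  by auto_derive => //; rewrite /=; ring.
have rr (a : R) (v : C) : Re (RtoC a * v) = a * Re v by case: v => v1 v2 /=; ring.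
have ii (a : R) (v : C) : Im (RtoC a * v) = a * Im v by case: v => v1 v2 /=; ring.
split.
- apply: (is_derive_ext (fun x : R => plus (Re (Texp K.+1 (RtoC x * w))) (x ^ K.+1 * Re u))).
    by move=> x; rewrite es -(rr (x ^ K.+1) u).
  rewrite ed (_ : Re (_ + _)%C = plus (Re (w * Texp K (t * w))%C) (INR K.+1 * t ^ K * Re u)); last by rewrite -(rr (INR K.+1 * t ^ K) u).
  apply: is_derive_plus => //.
  by apply: is_derive_ext (is_derive_scal_l _ t _ (Re u) dp) => x.
- apply: (is_derive_ext (fun x : R => plus (Im (Texp K.+1 (RtoC x * w))) (x ^ K.+1 * Im u))).
    by move=> x; rewrite es -(ii (x ^ K.+1) u).
  rewrite ed (_ : Im (_ + _)%C = plus (Im (w * Texp K (t * w))%C) (INR K.+1 * t ^ K * Im u)); last by rewrite -(ii (INR K.+1 * t ^ K) u).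
  apply: is_derive_plus => //.
  by apply: is_derive_ext (is_derive_scal_l _ t _ (Im u) dp) => x.
Qed.

Lemma is_derive_Cexp (w : C) (t : R) :
  is_derive (fun t : R => Re (Cexp (RtoC t * w))) t (Re (w * Cexp (t * w))) /\
  is_derive (fun t : R => Im (Cexp (RtoC t * w))) t (Im (w * Cexp (t * w))).
Proof.
case: w => a b; rewrite /Cexp /=.
rewrite (_ : t * a - 0 * b = t * a); last ring.
rewrite (_ : t * b + 0 * a = t * b); last ring.
split.
- apply: (is_derive_ext (fun x => exp (x * a) * cos (x * b))).
    by move=> x; congr (exp _ * cos _); ring.
  by auto_derive => //; ring.
- apply: (is_derive_ext (fun x => exp (x * a) * sin (x * b))).
    by move=> x; congr (exp _ * sin _); ring.
  by auto_derive => //; ring.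
Qed.

Lemma le_of_derive_le (f g f' g' : R -> R) (t : R) : 0 <= t ->
  (forall x, 0 <= x <= t -> is_derive f x (f' x)) -> (forall x, 0 <= x <= t -> is_derive g x (g' x)) ->
  (forall x, 0 <= x <= t -> f' x <= g' x) -> f 0 = 0 -> g 0 = 0 -> f t <= g t.
Proof.
move=> t0 df dg fg f0 g0.
have mm : Rmin 0 t = 0 by apply: Rmin_left.
have mM : Rmax 0 t = t by apply: Rmax_right.
have dh x : 0 <= x <= t -> is_derive (fun x : R => minus (g x) (f x)) x (minus (g' x) (f' x)).
  by move=> hx; apply: is_derive_minus; [exact: dg | exact: df].
have [] := MVT_gen (fun x : R => minus (g x) (f x)) 0 t (fun x => minus (g' x) (f' x)).
- by rewrite mm mM => x hx; apply: dh; lra.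
- rewrite mm mM => x hx; apply: derivable_continuous_pt; exists (minus (g' x) (f' x)).
  by apply/is_derive_Reals; apply: dh.
move=> c [hc]; rewrite mm mM in hc; rewrite f0 g0 /minus /plus /opp /=.
have := fg c hc; nra.
Qed.

(** Along t w the remainder of order K+1 has derivative w times the remainder of order K, so the
    estimate is integrated step by step. Real and imaginary parts are compared separately, as the
    mean value theorem is real; recombining them doubles [Cmod w] at each order. *)
Lemma Cexp_Texp_parts (w : C) (K : nat) (t : R) : 0 <= t <= 1 ->
  Rabs (Re (Cexp (t * w) - Texp K (t * w))) <= (2 * Cmod w * t) ^ K / INR (fact K) * exp (Cmod w) /\
  Rabs (Im (Cexp (t * w) - Texp K (t * w))) <= (2 * Cmod w * t) ^ K / INR (fact K) * exp (Cmod w).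
Proof.
have W0 := Cmod_ge_0 w; have E0 := exp_pos (Cmod w).
elim: K t => [|K IH] t [t0 t1].
  rewrite /Texp big_geq // /Cminus Copp_0 Cplus_0_r pow_O [INR (fact 0)]/= /Rdiv Rinv_1 !Rmult_1_l.
  have h : Cmod (Cexp (t * w)) <= exp (Cmod w).
    rewrite Cmod_Cexp; apply: exp_le.
    have := re_le_Cmod (RtoC t * w)%C; rewrite Cmod_mult Cmod_R (Rabs_pos_eq t) //.
    by have := Rle_abs (Re (RtoC t * w)%C); nra.
  by split; [have := re_le_Cmod (Cexp (t * w)) | have := im_le_Cmod (Cexp (t * w))]; lra.
set ff := INR (fact K.+1).
have F0 : 0 < ff by apply: INR_fact_lt_0.
pose g (x : R) := (2 * Cmod w * x) ^ K.+1 / ff * exp (Cmod w).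
pose g' (x : R) := Cmod w * (2 * ((2 * Cmod w * x) ^ K / INR (fact K) * exp (Cmod w))).
have dg x : is_derive g x (g' x).
  have F1 := INR_fact_lt_0 K.
  rewrite /g /g'; auto_derive => //; rewrite /ff fact_simpl mult_INR; change (Nat.pred K.+1) with K.
  rewrite -/(INR K.+1); have := INRS_pos K => h; field; lra.
have g0 : g 0 = 0 by rewrite /g /= !Rmult_0_r !Rmult_0_l /Rdiv !Rmult_0_l.
have T0 : Texp K.+1 (RtoC 0 * w) = 1.
  rewrite /Texp big_nat_recl // big1 => [|i _]; last by rewrite Cmult_0_l Cpow_S Cmult_0_l Cmult_0_r.
  by rewrite /= Rinv_1 Cmult_1_l Cplus_0_r.
have R0 : (Cexp (RtoC 0 * w) - Texp K.+1 (RtoC 0 * w) = 0)%C.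
  by rewrite T0 Cmult_0_l Cexp_0 /Cminus Cplus_opp_r.
have bd x : 0 <= x <= t -> Cmod (w * (Cexp (x * w) - Texp K (x * w))) <= g' x.
  move=> hx; rewrite Cmod_mult /g'; apply: Rmult_le_compat_l => //.
  have [h1 h2] := IH x ltac:(lra); have := Cmod_Re_Im (Cexp (x * w) - Texp K (x * w)); lra.
have dr x : is_derive (fun x : R => Re (Cexp (RtoC x * w) - Texp K.+1 (RtoC x * w))) x (Re (w * (Cexp (RtoC x * w) - Texp K (RtoC x * w)))).
  have [h1 _] := is_derive_Cexp w x; have [h2 _] := is_derive_Texp K w x.
  apply: (is_derive_ext (fun x : R => minus (Re (Cexp (RtoC x * w))) (Re (Texp K.+1 (RtoC x * w))))) => //.
  have -> : Re (w * (Cexp (x * w) - Texp K (x * w))) = minus (Re (w * Cexp (x * w))%C) (Re (w * Texp K (x * w))%C).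
    by rewrite /minus /plus /opp /=; ring.
  exact: is_derive_minus.
have di x : is_derive (fun x : R => Im (Cexp (RtoC x * w) - Texp K.+1 (RtoC x * w))) x (Im (w * (Cexp (RtoC x * w) - Texp K (RtoC x * w)))).
  have [_ h1] := is_derive_Cexp w x; have [_ h2] := is_derive_Texp K w x.
  apply: (is_derive_ext (fun x : R => minus (Im (Cexp (RtoC x * w))) (Im (Texp K.+1 (RtoC x * w))))) => //.
  have -> : Im (w * (Cexp (x * w) - Texp K (x * w))) = minus (Im (w * Cexp (x * w))%C) (Im (w * Texp K (x * w))%C).
    by rewrite /minus /plus /opp /=; ring.
  exact: is_derive_minus.
have core (f f' : R -> R) : (forall x, is_derive f x (f' x)) -> f 0 = 0 ->
    (forall x, 0 <= x <= t -> Rabs (f' x) <= g' x) -> Rabs (f t) <= g t.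
  move=> df f0 hf; apply: Rabs_le; split; last first.
    apply: (le_of_derive_le f g f' g') => // x hx.
    by have := hf x hx; have := Rle_abs (f' x); lra.
  have : - f t <= g t; last lra.
  apply: (le_of_derive_le (fun x => opp (f x)) g (fun x => opp (f' x)) g') => //.
  - by move=> x _; apply: is_derive_opp.
  - by move=> x hx; have := hf x hx; have := Rle_abs (- f' x); rewrite Rabs_Ropp /opp /=; lra.
  - by rewrite f0 /opp /= Ropp_0.
split.
- apply: (core (fun x : R => Re (Cexp (RtoC x * w) - Texp K.+1 (RtoC x * w))) _ dr); first by rewrite R0.
  by move=> x hx; apply: Rle_trans (re_le_Cmod _) (bd x hx).
- apply: (core (fun x : R => Im (Cexp (RtoC x * w) - Texp K.+1 (RtoC x * w))) _ di); first by rewrite R0.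
  by move=> x hx; apply: Rle_trans (im_le_Cmod _) (bd x hx).
Qed.

Lemma Cexp_Texp (w : C) (K : nat) :
  Cmod (Cexp w - Texp K w) <= 2 * ((2 * Cmod w) ^ K / INR (fact K) * exp (Cmod w)).
Proof.
have [] := Cexp_Texp_parts w K 1 ltac:(lra); rewrite Cmult_1_l Rmult_1_r => h1 h2.
have := Cmod_Re_Im (Cexp w - Texp K w); lra.
Qed.

Lemma pow_fact_small (x e : R) : 0 < e -> exists K0, forall K, (K0 <= K)%nat -> Rabs (x ^ K / INR (fact K)) < e.
Proof.
move=> e0; have [K0 h] := cv_speed_pow_fact x e e0; exists K0 => K hK.
by have := h K (elimT leP hK); rewrite /R_dist Rminus_0_r.
Qed.

Lemma Texp_uniform (B e : R) : 0 < e -> exists K0, forall K w, (K0 <= K)%nat -> Cmod w <= B ->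
  Cmod (Cexp w - Texp K w) <= e.
Proof.
move=> e0; have eB := exp_pos B.
have [K0 h] := pow_fact_small (2 * B) (e / (2 * exp B)) ltac:(apply: Rdiv_lt_0_compat; lra).
exists K0 => K w hK wB; apply: Rle_trans (Cexp_Texp w K) _.
have W0 := Cmod_ge_0 w; have F0 := INR_fact_lt_0 K.
have h1 : (2 * Cmod w) ^ K / INR (fact K) <= e / (2 * exp B).
  apply: Rle_trans (_ : (2 * B) ^ K / INR (fact K) <= _).
    apply: Rmult_le_compat_r; first by apply: Rlt_le; apply: Rinv_0_lt_compat.
    by apply: pow_incr; lra.
  by have := h K hK; have := Rle_abs ((2 * B) ^ K / INR (fact K)); lra.
have h2 : exp (Cmod w) <= exp B by apply: exp_le.
have h0 : 0 <= (2 * Cmod w) ^ K / INR (fact K).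
  by apply: Rmult_le_pos; [apply: pow_le; lra | apply: Rlt_le; apply: Rinv_0_lt_compat].
have := Rmult_le_compat _ _ _ _ h0 (Rlt_le _ _ (exp_pos (Cmod w))) h1 h2.
rewrite (_ : e / (2 * exp B) * exp B = e / 2); last by field; lra.
lra.
Qed.

(** * Characters and powers of Dirichlet polynomials *)

Definition cmult (chi : nat -> C) : Prop :=
  chi 1%nat = 1 /\ forall m n, (0 < m)%nat -> (0 < n)%nat -> chi (m * n)%nat = (chi m * chi n)%C.

Lemma nat_prime_ind (P : nat -> Prop) : P 1%nat ->
  (forall p m, prime p -> (0 < m)%nat -> P m -> P (p * m)%nat) -> forall n, (0 < n)%nat -> P n.
Proof.
move=> P1 PM n; elim/ltn_ind: n => n IH n0; case: (leqP n 1) => n1.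
  by have -> : n = 1%nat by apply/eqP; rewrite eqn_leq n1.
have pp := pdiv_prime n1; have pd := pdiv_dvd n.
have m0 : (0 < n %/ pdiv n)%nat by rewrite divn_gt0 ?prime_gt0 // dvdn_leq.
have -> : n = (pdiv n * (n %/ pdiv n))%nat by rewrite mulnC divnK.
by apply: PM => //; apply: IH => //; rewrite ltn_Pdiv // prime_gt1.
Qed.

(** The monomial z^kappa(n), with variables indexed by the primes themselves rather than by their
    rank. *)
Definition zchar (z : nat -> C) (n : nat) : C := \cprod_(p <- primes n) (z p ^ logn p n).

Lemma zchar_wide (z : nat -> C) (n B : nat) : (0 < n)%nat -> (n < B)%nat ->
  zchar z n = \cprod_(p <- iota 0%nat B | prime p) (z p ^ logn p n).
Proof.
move=> n0 nB; rewrite -big_filter /zchar.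
rewrite [RHS](bigID (fun p => p \in primes n)) /= [X in (_ * X)%C]big1_seq ?Cmult_1_r; last first.
  by move=> p /andP [np _]; rewrite -logn_gt0 lt0n negbK in np; rewrite (eqP np).
rewrite -[in RHS]big_filter; apply: perm_big; apply: uniq_perm.
- exact: primes_uniq.
- by apply: filter_uniq; apply: filter_uniq; apply: iota_uniq.
move=> p; rewrite !mem_filter mem_iota add0n /= mem_primes n0 /=.
case: (boolP (prime p)) => pp //=; case: (boolP (p %| n)%nat) => //= d.
by rewrite (leq_ltn_trans (dvdn_leq n0 d) nB).
Qed.

Lemma Cpow_D (x : C) (m n : nat) : (x ^ (m + n) = x ^ m * x ^ n)%C.
Proof. exact: Cpow_add_r. Qed.

Lemma zchar1 (z : nat -> C) : zchar z 1 = 1.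
Proof. by rewrite /zchar big_nil. Qed.

Lemma zchar_mul (z : nat -> C) (m n : nat) : (0 < m)%nat -> (0 < n)%nat ->
  zchar z (m * n) = (zchar z m * zchar z n)%C.
Proof.
move=> m0 n0; have mn0 : (0 < m * n)%nat by rewrite muln_gt0 m0.
rewrite (zchar_wide z _ (m * n).+1) // (zchar_wide z m (m * n).+1) ?ltnS ?leq_pmulr //.
rewrite (zchar_wide z n (m * n).+1) ?ltnS ?leq_pmull // -big_split /=.
by apply: eq_bigr => p pp; rewrite lognM // Cpow_D.
Qed.

Lemma zchar_cmult (z : nat -> C) : cmult (zchar z).
Proof. by split; [exact: zchar1 | exact: zchar_mul]. Qed.

Lemma npow_cmult (s : C) : cmult (fun n => npow n s).
Proof. by split; [exact: npow1 | move=> m n m0 n0; exact: npow_mul]. Qed.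

Lemma zchar_prime (z : nat -> C) (p : nat) : prime p -> zchar z p = z p.
Proof. by move=> pp; rewrite /zchar primes_prime // big_seq1 logn_prime // eqxx Cpow_1_r. Qed.

Lemma cmult_eq (u v : nat -> C) : cmult u -> cmult v -> (forall p, prime p -> u p = v p) ->
  forall n, (0 < n)%nat -> u n = v n.
Proof.
move=> [u1 uM] [v1 vM] h; apply: nat_prime_ind; first by rewrite u1 v1.
by move=> p m pp m0 IH; have p0 := prime_gt0 pp; rewrite uM // vM // IH h.
Qed.

Lemma cmult_exp (u : nat -> C) (m k : nat) : cmult u -> (0 < m)%nat -> u (m ^ k)%nat = (u m ^ k)%C.
Proof.
move=> [u1 uM] m0; elim: k => [|k IH]; first by rewrite expn0 u1.
by rewrite expnS uM ?expn_gt0 ?m0 // IH Cpow_S.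
Qed.

Lemma zchar_mod_le (z : nat -> C) (n : nat) : (forall p, prime p -> Cmod (z p) <= 1) ->
  (0 < n)%nat -> Cmod (zchar z n) <= 1.
Proof.
move=> h; move: n; apply: nat_prime_ind; first by rewrite zchar1 Cmod_1; lra.
move=> p m pp m0 IH; have p0 := prime_gt0 pp; rewrite zchar_mul // zchar_prime // Cmod_mult.
have := h p pp; have := Cmod_ge_0 (z p); have := Cmod_ge_0 (zchar z m); nra.
Qed.

(* The Bohr lift [sum c_n z^kappa(n)], for an arbitrary completely multiplicative [chi]
   in place of the monomials. *)
Definition Phi (N : nat) (c : nat -> C) (chi : nat -> C) : C := \csum_(1 <= n < N.+1) (c n * chi n).

Lemma dpoly_Phi (N : nat) (c : nat -> C) (s : C) : dpoly N c s = Phi N c (fun n => npow n s).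
Proof.
rewrite /dpoly /Phi; case: N => [|N]; first by rewrite sum_n_m_zero // big_geq.
elim: N => [|N IH]; first by rewrite sum_n_n big_nat1.
by rewrite sum_n_Sm; [rewrite IH [RHS]big_nat_recr | apply/leP].
Qed.

Lemma Phi_eq (N : nat) (c chi psi : nat -> C) :
  (forall n, (0 < n)%nat -> (n <= N)%nat -> chi n = psi n) -> Phi N c chi = Phi N c psi.
Proof.
by move=> h; rewrite /Phi big_nat [RHS]big_nat; apply: eq_bigr => n /andP [n0 nN]; rewrite h.
Qed.

Definition l1norm (N : nat) (c : nat -> C) : R := \rsum_(1 <= n < N.+1) Cmod (c n).

Lemma l1norm_ge0 (N : nat) (c : nat -> C) : 0 <= l1norm N c.
Proof. by apply: rsum_ge0 => n _; apply: Cmod_ge_0. Qed.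

Lemma Phi_mod_le (N : nat) (c chi : nat -> C) :
  (forall n, (0 < n)%nat -> Cmod (chi n) <= 1) -> Cmod (Phi N c chi) <= l1norm N c.
Proof.
move=> h; apply: Rle_trans (Cmod_csum _ _ _ _) _; apply: rsum_le_nat => n /andP [n0 _].
by rewrite Cmod_mult; have := Cmod_ge_0 (c n); have := h n n0; nra.
Qed.

Lemma big_dvd_reindex (T : Type) (idx : T) (op : Monoid.com_law idx) (n B : nat) (G : nat -> T) :
  (0 < n)%nat ->
  \big[op/idx]_(1 <= m < B | (n %| m)%nat) G (m %/ n)%nat = \big[op/idx]_(1 <= m < B | (n * m < B)%nat) G m.
Proof.
move=> n0; rewrite -big_filter -[RHS]big_filter.
transitivity (\big[op/idx]_(j <- [seq (m %/ n)%nat | m <- [seq m <- index_iota 1 B | (n %| m)%nat]]) G j).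
  by rewrite big_map.
apply: perm_big; apply: uniq_perm.
- rewrite map_inj_in_uniq; first exact: filter_uniq (iota_uniq _ _).
  move=> a b; rewrite !mem_filter => /andP [da _] /andP [db _] e.
  by rewrite -(divnK da) -(divnK db) e.
- exact: filter_uniq (iota_uniq _ _).
move=> j; apply/mapP/idP.
  move=> [m]; rewrite mem_filter mem_index_iota => /andP [dm /andP [m0 mB]] ->.
  rewrite mem_filter mem_index_iota mulnC divnK // mB divn_gt0 // dvdn_leq //=.
  exact: leq_ltn_trans (leq_div _ _) mB.
rewrite mem_filter mem_index_iota => /andP [h /andP [j0 jB]].
exists (n * j)%nat; last by rewrite mulKn.
by rewrite mem_filter mem_index_iota dvdn_mulr //= h muln_gt0 n0 j0.
Qed.

(* Coefficients of the [k]-th power of the Dirichlet polynomial [sum_(n <= N) c n n^-s]. *)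
Fixpoint Cpw (N : nat) (c : nat -> C) (k m : nat) : C :=
  match k with
  | 0 => if m == 1%nat then RtoC 1 else RtoC 0
  | k'.+1 => \csum_(1 <= n < N.+1 | (n %| m)%nat) (c n * Cpw N c k' (m %/ n)%nat)
  end.

Lemma Cpw_support (N : nat) (c : nat -> C) (k m : nat) :
  (0 < m)%nat -> (N ^ k < m)%nat -> Cpw N c k m = 0.
Proof.
elim: k m => [|k IH] m m0 /= hm; first by rewrite expn0 in hm; rewrite gtn_eqF.
rewrite big_nat_cond big1 // => n /andP [/andP [n0 nN] d]; rewrite IH ?Cmult_0_r //.
  by rewrite divn_gt0 // dvdn_leq.
rewrite ltn_divRL //; apply: leq_ltn_trans hm.
by rewrite expnS mulnC leq_mul2r -ltnS nN orbT.
Qed.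

Lemma Cpw_eval (N : nat) (c chi : nat -> C) (k B : nat) : cmult chi -> (N ^ k < B)%nat ->
  \csum_(1 <= m < B) (Cpw N c k m * chi m) = (Phi N c chi ^ k)%C.
Proof.
move=> hc; have [c1 cM] := hc; elim: k B => [|k IH] B hB.
  rewrite expn0 in hB; rewrite (big_ltn hB) /= c1 big_nat big1.
    by rewrite Cmult_1_l Cplus_0_r.
  by move=> m /andP [m1 _]; rewrite gtn_eqF // Cmult_0_l.
rewrite /= ; transitivity (\csum_(1 <= n < N.+1) \csum_(1 <= m < B | (n %| m)%nat)
    (c n * Cpw N c k (m %/ n)%nat * (chi n * chi (m %/ n)%nat))).
  rewrite (exchange_big_dep predT) //=; rewrite big_nat [RHS]big_nat; apply: eq_bigr => m /andP [m0 mB].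
  rewrite csum_scalr; rewrite big_nat_cond [RHS]big_nat_cond; apply: eq_bigr => n /andP [/andP [n0 _] d].
  have q0 : (0 < m %/ n)%nat by rewrite divn_gt0 // dvdn_leq.
  have e : chi m = (chi n * chi (m %/ n)%nat)%C by rewrite -(cM n (m %/ n)%nat n0 q0) mulnC divnK.
  by rewrite e.
rewrite /Phi csum_scalr big_nat [RHS]big_nat; apply: eq_bigr => n /andP [n0 nN].
rewrite (big_dvd_reindex _ _ _ n B (fun j => (c n * Cpw N c k j * (chi n * chi j))%C)) //.
have nNB : (n * N ^ k < B)%nat.
  by apply: leq_ltn_trans hB; rewrite expnS leq_mul2r -ltnS nN orbT.
have h1 : (N ^ k < B)%nat by apply: leq_ltn_trans nNB; rewrite leq_pmull.
rewrite -(IH B h1) csum_scal big_mkcond /= big_nat [RHS]big_nat; apply: eq_bigr => m /andP [m0 mB].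
case: ifP => hm; first by ring.
rewrite Cpw_support //; first by ring.
rewrite -(ltn_pmul2l n0); apply: leq_trans nNB _; by rewrite leqNgt hm.
Qed.

Lemma Cpw_l1 (N : nat) (c : nat -> C) (k B : nat) :
  \rsum_(1 <= m < B) Cmod (Cpw N c k m) <= l1norm N c ^ k.
Proof.
elim: k B => [|k IH] B /=.
  case: (ltnP 1 B) => hB; last by rewrite big_geq //; lra.
  rewrite big_ltn // /= Cmod_1 big_nat big1; first by lra.
  by move=> m /andP [m1 _]; rewrite gtn_eqF // Cmod_0.
apply: Rle_trans (_ : \rsum_(1 <= m < B) \rsum_(1 <= n < N.+1 | (n %| m)%nat)
   (Cmod (c n) * Cmod (Cpw N c k (m %/ n)%nat)) <= _).
  apply: rsum_le_nat => m _; apply: Rle_trans (Cmod_csum _ _ _ _) _.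
  by apply: rsum_le => n _; rewrite Cmod_mult; lra.
rewrite (exchange_big_dep predT) //= /l1norm rsum_scalr; apply: rsum_le_nat => n /andP [n0 _].
rewrite (big_dvd_reindex _ _ _ n B (fun j => Cmod (c n) * Cmod (Cpw N c k j))) // -rsum_scal.
apply: Rmult_le_compat_l; first exact: Cmod_ge_0.
apply: Rle_trans (IH B); apply: rsum_cond_le => // m _; exact: Cmod_ge_0.
Qed.

(* Coefficients of the Dirichlet polynomial obtained from [sum_(n <= X) a n n^(-phi)] by truncating
   the exponential series. *)
Definition bT (N : nat) (c a : nat -> C) (X K m : nat) : C :=
  \csum_(1 <= n < X.+1) (a n *
    \csum_(0 <= k < K) (RtoC (/ INR (fact k)) * (- RtoC (ln (INR n))) ^ k * Cpw N c k m)).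

Lemma bT_eval (N : nat) (c a chi : nat -> C) (X K B : nat) : cmult chi ->
  (forall k, (k < K)%nat -> (N ^ k < B)%nat) ->
  \csum_(1 <= m < B) (bT N c a X K m * chi m) =
  \csum_(1 <= n < X.+1) (a n * Texp K (- RtoC (ln (INR n)) * Phi N c chi)).
Proof.
move=> hc hB; rewrite /bT.
transitivity (\csum_(1 <= m < B) \csum_(1 <= n < X.+1) (a n *
    \csum_(0 <= k < K) (RtoC (/ INR (fact k)) * (- RtoC (ln (INR n))) ^ k * Cpw N c k m * chi m))).
  apply: eq_bigr => m _; rewrite csum_scalr; apply: eq_bigr => n _.
  by rewrite -Cmult_assoc csum_scalr.
rewrite exchange_big /=; apply: eq_bigr => n _; rewrite -csum_scal; congr Cmult.
rewrite exchange_big /= /Texp big_nat [RHS]big_nat; apply: eq_bigr => k /andP [_ kK].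
rewrite Cpow_mult_l -(Cpw_eval N c chi k B hc (hB k kK)) Cmult_assoc csum_scal.
by apply: eq_bigr => m _; ring.
Qed.

Lemma bT_diff_l1 (N : nat) (c a : nat -> C) (X K K' B : nat) : (K <= K')%nat ->
  \rsum_(1 <= m < B) Cmod (bT N c a X K' m - bT N c a X K m) <=
  \rsum_(1 <= n < X.+1) (Cmod (a n) * \rsum_(K <= k < K') ((ln (INR n) * l1norm N c) ^ k / INR (fact k))).
Proof.
move=> KK.
apply: Rle_trans (_ : \rsum_(1 <= m < B) \rsum_(1 <= n < X.+1) (Cmod (a n) *
   \rsum_(K <= k < K') (/ INR (fact k) * ln (INR n) ^ k * Cmod (Cpw N c k m))) <= _).
  apply: rsum_le_nat => m _.
  have -> : (bT N c a X K' m - bT N c a X K m)%C = \csum_(1 <= n < X.+1) (a n *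
    \csum_(K <= k < K') (RtoC (/ INR (fact k)) * (- RtoC (ln (INR n))) ^ k * Cpw N c k m)).
    rewrite /bT; set u := \csum_(1 <= n < X.+1) _; set v := \csum_(1 <= n < X.+1) _.
    set w := (RHS); suff -> : u = (v + w)%C by ring.
    rewrite /u /v /w -big_split /=; apply: eq_bigr => n _.
    by rewrite (big_cat_nat (n := K)) //= Cmult_plus_distr_l.
  apply: Rle_trans (Cmod_csum _ _ _ _) _; apply: rsum_le => n _.
  rewrite Cmod_mult; apply: Rmult_le_compat_l; first exact: Cmod_ge_0.
  apply: Rle_trans (Cmod_csum _ _ _ _) _; apply: rsum_le => k _.
  rewrite !Cmod_mult Cmod_pow Cmod_opp !Cmod_R !Rabs_pos_eq; first lra.
    exact: ln_INR_ge0.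
  by apply: Rlt_le; apply: Rinv_0_lt_compat; apply: INR_fact_lt_0.
rewrite exchange_big /=; apply: rsum_le => n _; rewrite -rsum_scal.
apply: Rmult_le_compat_l; first exact: Cmod_ge_0.
rewrite exchange_big /=; apply: rsum_le => k _; rewrite -rsum_scal Rpow_mult_distr.
have F0 := Rinv_0_lt_compat _ (INR_fact_lt_0 k).
have l0 := pow_le _ k (ln_INR_ge0 n); have := Cpw_l1 N c k B.
move=> h; have := Rmult_le_compat_l (/ INR (fact k) * ln (INR n) ^ k) _ _ ltac:(nra) h.
rewrite /Rdiv; lra.
Qed.

Lemma exp_tail (x e : R) : 0 < e -> exists K0, forall K K', (K0 <= K)%nat -> (K <= K')%nat ->
  \rsum_(K <= k < K') (x ^ k / INR (fact k)) <= e.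
Proof.
move=> e0; have [K0 hK] := Texp_uniform (Rabs x) (e / 2) ltac:(lra); exists K0 => K K' h1 h2.
have e1 : \rsum_(K <= k < K') (x ^ k / INR (fact k)) = Re (Texp K' x - Texp K x).
  have rT L : Texp L x = RtoC (\rsum_(0 <= k < L) (x ^ k / INR (fact k))).
    rewrite RtoC_rsum /Texp; apply: eq_bigr => k _.
    by rewrite /Rdiv RtoC_mult RtoC_pow Cmult_comm.
  by rewrite !rT (big_cat_nat (m := 0) (n := K) (p := K')) //=; ring.
rewrite e1; have w : Cmod x <= Rabs x by rewrite Cmod_R; lra.
have := hK K x h1 w; have := hK K' x (leq_trans h1 h2) w.
have -> : (Texp K' x - Texp K x = (Cexp x - Texp K x) - (Cexp x - Texp K' x))%C by ring.
set u := (Cexp x - Texp K x)%C; set v := (Cexp x - Texp K' x)%C.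
have := re_le_Cmod (u - v)%C; have := Rle_abs (Re (u - v)%C); have := Cmod_triangle u (- v)%C.
rewrite Cmod_opp -/(Cminus u v); lra.
Qed.

(** Cauchy in l^1, uniformly in [B], because the k-th power of the symbol has l^1 norm at most
    [l1norm N c ^ k]. The limit can thus be evaluated at every completely multiplicative [chi]
    bounded by 1, not only on vertical lines. *)
Lemma bT_cauchy (N : nat) (c a : nat -> C) (X : nat) (e : R) : 0 < e ->
  exists K0, forall K K' B, (K0 <= K)%nat -> (K <= K')%nat ->
  \rsum_(1 <= m < B) Cmod (bT N c a X K' m - bT N c a X K m) <= e.
Proof.
move=> e0.
have [K0 hK] : exists K0, forall K K', (K0 <= K)%nat -> (K <= K')%nat ->
  \rsum_(1 <= n < X.+1) (Cmod (a n) * \rsum_(K <= k < K') ((ln (INR n) * l1norm N c) ^ k / INR (fact k))) <= e.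
  elim: X e e0 => [|X IH] e e0; first by exists 0%nat => K K' _ _; rewrite big_geq //; lra.
  have [K1 h1] := IH (e / 2) ltac:(lra).
  have A0 := Cmod_ge_0 (a X.+1).
  have [K2 h2] := exp_tail (ln (INR X.+1) * l1norm N c) (e / 2 / (Cmod (a X.+1) + 1))
     ltac:(apply: Rdiv_lt_0_compat; lra).
  exists (maxn K1 K2) => K K'; rewrite geq_max => /andP [g1 g2] g; rewrite big_nat_recr //.
  have t1 := h1 K K' g1 g; have t2 := h2 K K' g2 g.
  have t3 := Rmult_le_compat_l _ _ _ A0 t2.
  have t4 : Cmod (a X.+1) * (e / 2 / (Cmod (a X.+1) + 1)) <= e / 2.
    rewrite (_ : Cmod (a X.+1) * (e / 2 / (Cmod (a X.+1) + 1)) = e / 2 * (Cmod (a X.+1) / (Cmod (a X.+1) + 1)));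
      last by field; lra.
    rewrite -[X in _ <= X]Rmult_1_r; apply: Rmult_le_compat_l; first lra.
    by apply/Rle_div_l; lra.
  by apply: Rle_trans (Rplus_le_compat _ _ _ _ t1 (Rle_trans _ _ _ t3 t4)) _; lra.
by exists K0 => K K' B h1 h2; apply: Rle_trans (bT_diff_l1 N c a X K K' B h2) (hK K K' h1 h2).
Qed.

(** * Convergence and uniqueness of Dirichlet series *)

Definition Cconv (u : nat -> C) (l : C) : Prop :=
  forall e : R, 0 < e -> exists K0 : nat, forall K, (K0 <= K)%nat -> Cmod (u K - l) <= e.

Definition Csum_to (g : nat -> C) (v : C) : Prop := Cconv (fun B => \csum_(1 <= m < B) g m) v.

Lemma Cconv_unique (u : nat -> C) (l l' : C) : Cconv u l -> Cconv u l' -> l = l'.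
Proof.
move=> h h'; have z : Cmod (l - l') = 0.
  apply: Rle_antisym; last exact: Cmod_ge_0.
  apply: le_epsilon => e e0; rewrite Rplus_0_l.
  have [K1 k1] := h (e / 2) ltac:(lra); have [K2 k2] := h' (e / 2) ltac:(lra).
  have := k1 _ (leq_maxl K1 K2); have := k2 _ (leq_maxr K1 K2); set w := u _.
  have -> : (l - l' = (w - l') + - (w - l))%C by ring.
  by have := Cmod_triangle (w - l') (- (w - l)); rewrite Cmod_opp; lra.
have := Cmod_eq_0 _ z => e; have -> : l = (l - l' + l')%C by ring.
by rewrite e; ring.
Qed.

Lemma Cconv_sub (u v : nat -> C) (l l' : C) : Cconv u l -> Cconv v l' ->
  Cconv (fun n => u n - v n)%C (l - l').
Proof.
move=> h h' e e0; have [K1 k1] := h (e / 2) ltac:(lra); have [K2 k2] := h' (e / 2) ltac:(lra).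
exists (maxn K1 K2) => K; rewrite geq_max => /andP [g1 g2].
have -> : (u K - v K - (l - l') = (u K - l) + - (v K - l'))%C by ring.
by have := Cmod_triangle (u K - l) (- (v K - l')); rewrite Cmod_opp; have := k1 K g1; have := k2 K g2; lra.
Qed.

Lemma Cconv_mod_le (u : nat -> C) (l : C) (M : R) : Cconv u l ->
  (exists K1, forall K, (K1 <= K)%nat -> Cmod (u K) <= M) -> Cmod l <= M.
Proof.
move=> h [K1 hM]; apply: le_epsilon => e e0; have [K0 hK] := h e e0.
have := hM _ (leq_maxl K1 K0); have := hK _ (leq_maxr K1 K0); set w := u _ => h1 h2.
have -> : (l = w + - (w - l))%C by ring.
by have := Cmod_triangle w (- (w - l)); rewrite Cmod_opp; lra.
Qed.

(** A total function; it carries information only for Cauchy sequences, through [Climit_cauchy]. *)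
Definition Climit (u : nat -> C) : C :=
  (real (Lim_seq (fun n => Re (u n))), real (Lim_seq (fun n => Im (u n)))).

Lemma Climit_cauchy (u : nat -> C) :
  (forall e, 0 < e -> exists K0 : nat, forall K K', (K0 <= K)%nat -> (K <= K')%nat -> Cmod (u K' - u K) <= e) ->
  Cconv u (Climit u).
Proof.
move=> hu.
have hr (f : C -> R) : (forall w, Rabs (f w) <= Cmod w) -> (forall v w, f (v - w)%C = f v - f w) ->
  forall e, 0 < e -> exists K0 : nat, forall K, (K0 <= K)%nat -> Rabs (f (u K) - real (Lim_seq (fun n => f (u n)))) <= e.
  move=> f1 f2 e e0.
  have ex : ex_finite_lim_seq (fun n => f (u n)).
    apply/ex_lim_seq_cauchy_corr => d; have [K0 hK] := hu (d / 2) ltac:(have := cond_pos d; lra).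
    exists K0 => n m /leP hn /leP hm; rewrite -f2; apply: Rle_lt_trans (f1 _) _.
    have d0 := cond_pos d; case: (leqP n m) => nm; last by have := hK m n hm (ltnW nm); lra.
    by have := hK n m hn nm; rewrite -Cmod_opp (_ : - (u m - u n) = u n - u m)%C; [lra | ring].
  have := Lim_seq_correct' _ ex => /is_lim_seq_spec /(_ (mkposreal e e0)) [K0 hK].
  by exists K0 => K /leP hk; apply: Rlt_le; apply: hK.
move=> e e0.
have [K1 h1] := hr Re re_le_Cmod (fun v w => erefl) (e / 2) ltac:(lra).
have [K2 h2] := hr Im im_le_Cmod (fun v w => erefl) (e / 2) ltac:(lra).
exists (maxn K1 K2) => K; rewrite geq_max => /andP [g1 g2].
have := Cmod_Re_Im (u K - Climit u); have := h1 K g1; have := h2 K g2; rewrite /Climit /=.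
rewrite /Rminus /Im /Re; lra.
Qed.

Lemma is_series_Csum (a : nat -> C) (v : C) :
  @is_series C_AbsRing C_NormedModule a v <-> Cconv (fun B => \csum_(0 <= m < B) a m) v.
Proof.
split=> h.
- move=> e e0; have /filterlim_locally_ball_norm /(_ (mkposreal e e0)) [K0 hK] := h.
  exists K0.+1 => -[//|K]; rewrite ltnS => /leP hk; have := hK K hk.
  rewrite /ball_norm sum_n_csum => h1; apply: Rlt_le; exact: h1.
- apply/filterlim_locally_ball_norm => d; have d0 := cond_pos d.
  have [K0 hK] := h (d / 2) ltac:(lra); exists K0 => K /leP hk.
  rewrite /ball_norm sum_n_csum; apply: Rle_lt_trans (hK K.+1 (leqW hk)) _; lra.
Qed.

Lemma DS_at_Csum (a : nat -> C) (s v : C) : DS_at a s v <-> Csum_to (fun m => a m * npow m s)%C v.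
Proof.
rewrite /DS_at is_series_Csum /Csum_to /Cconv; split=> h e e0; have [K0 hK] := h e e0.
- exists K0.+1 => -[//|K]; rewrite ltnS => hk; rewrite big_add1 /=; exact: hK.
- exists K0 => K hk; have := hK K.+1 (leqW hk); by rewrite big_add1.
Qed.

Lemma Csum_finite (g : nat -> C) (X : nat) : (forall m, (X < m)%nat -> g m = 0) ->
  Csum_to g (\csum_(1 <= m < X.+1) g m).
Proof.
move=> h e e0; exists X.+1 => B hB; rewrite (big_cat_nat (n := X.+1) (p := B)) //=.
rewrite [X in (_ + X)%C]big_nat [X in (_ + X)%C]big1 => [|m /andP [hm _]]; last exact: h.
by rewrite (_ : _ - _ = RtoC 0)%C ?Cmod_0; [lra | ring].
Qed.

Lemma normD_partial (beta : R) (a : nat -> C) (B : nat) : inD beta a ->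
  \rsum_(1 <= m < B) (Cmod (a m) ^ 2 / dpow beta m) <= normD beta a ^ 2.
Proof.
move=> h; have t0 n : 0 <= Dterm beta a n.
  apply: Rmult_le_pos; first exact: pow2_ge_0.
  by apply: Rlt_le; apply: Rinv_0_lt_compat; apply: Rpower_pos.
have S0 : 0 <= Series (Dterm beta a).
  by apply: Rle_trans (sum_n_le_Series _ 0 t0 h); rewrite sum_O.
rewrite /normD -Rsqr_pow2 Rsqr_sqrt //.
case: B => [|[|B]]; try by rewrite big_geq.
apply: Rle_trans (sum_n_le_Series _ B t0 h).
by right; rewrite -sum_n_rsum1.
Qed.

Lemma inD_bound (beta : R) (a : nat -> C) (M : R) :
  (forall B, \rsum_(1 <= m < B) (Cmod (a m) ^ 2 / dpow beta m) <= M) -> inD beta a /\ normD beta a <= sqrt M.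
Proof.
move=> h; have t0 n : 0 <= Dterm beta a n.
  apply: Rmult_le_pos; first exact: pow2_ge_0.
  by apply: Rlt_le; apply: Rinv_0_lt_compat; apply: Rpower_pos.
have hB n : sum_n (Dterm beta a) n <= M.
  by apply: Rle_trans (h n.+2); right; rewrite -sum_n_rsum1.
have ex : inD beta a by apply: ex_series_bounded t0 hB.
split => //; apply: sqrt_le_1_alt; exact: Series_le_bound.
Qed.

Lemma normD_ge0 (beta : R) (a : nat -> C) : 0 <= normD beta a.
Proof. exact: sqrt_pos. Qed.

Lemma rsum_cauchy_weight (w : nat -> R) (g chi : nat -> C) (s : seq nat) : (forall m, 0 < w m) ->
  (\rsum_(m <- s) (Cmod (g m) * Cmod (chi m))) ^ 2 <=
  (\rsum_(m <- s) (Cmod (g m) ^ 2 / w m)) * \rsum_(m <- s) (w m * Cmod (chi m) ^ 2).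
Proof.
move=> w0.
have := rsum_cauchy _ s xpredT (fun m => Cmod (g m) / sqrt (w m)) (fun m => sqrt (w m) * Cmod (chi m)).
have e1 m : (Cmod (g m) / sqrt (w m)) * (sqrt (w m) * Cmod (chi m)) = Cmod (g m) * Cmod (chi m).
  by have := sqrt_lt_R0 _ (w0 m) => h; field; lra.
have e2 m : (Cmod (g m) / sqrt (w m)) ^ 2 = Cmod (g m) ^ 2 / w m.
  have h := sqrt_lt_R0 _ (w0 m); rewrite -{2}(sqrt_sqrt (w m)); last exact: Rlt_le.
  by field; lra.
have e3 m : (sqrt (w m) * Cmod (chi m)) ^ 2 = w m * Cmod (chi m) ^ 2.
  by rewrite -{2}(sqrt_sqrt (w m)); [ring | exact: Rlt_le].
by rewrite (eq_bigr _ (fun m _ => e1 m)) (eq_bigr _ (fun m _ => e2 m)) (eq_bigr _ (fun m _ => e3 m)).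
Qed.

(** Strong induction: once the smaller coefficients vanish, evaluation at s = 2 + k bounds |g m|
    m^(-(2+k)) by S (m+1)^(-k), and k tends to infinity. *)
Lemma Csum_unique (g : nat -> C) (S : R) :
  (forall B, \rsum_(1 <= m < B) (Cmod (g m) * Rpower (INR m) (- 2)) <= S) ->
  (forall s : R, 2 <= s -> Csum_to (fun m => g m * npow m (RtoC s))%C 0) ->
  forall m, (0 < m)%nat -> g m = 0.
Proof.
move=> hS h0 m; elim/ltn_ind: m => m IH m0.
apply: Cmod_eq_0; apply: Rle_antisym; last exact: Cmod_ge_0.
have Im := INR_pos m m0; have Im1 := INRS_pos m.
have eM s n : Cmod (g n * npow n (RtoC s)) = Cmod (g n) * Rpower (INR n) (- s).
  by rewrite Cmod_mult Cmod_npow.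
have S0 : 0 <= S by have := hS 0%nat; rewrite big_geq.
have key (k : R) : 0 <= k -> Cmod (g m) * Rpower (INR m) (- (2 + k)) <= S * Rpower (INR m.+1) (- k).
  move=> k0; rewrite -eM.
  have hc : Cconv (fun _ => g m * npow m (RtoC (2 + k)))%C (g m * npow m (RtoC (2 + k))).
    by move=> e e0; exists 0%nat => K _; rewrite (_ : _ - _ = RtoC 0)%C ?Cmod_0; [lra | ring].
  have := Cconv_sub _ _ _ _ hc (h0 (2 + k) ltac:(lra)).
  rewrite /Cminus Copp_0 Cplus_0_r => hd; apply: (Cconv_mod_le _ _ _ hd); exists m.+1 => B hB.
  rewrite (big_cat_nat (n := m.+1) (p := B)) //= big_nat_recr //=.
  rewrite [X in (X + _ + _)%C]big_nat [X in (X + _ + _)%C]big1 => [|j /andP [j0 jm]]; last first.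
    by rewrite IH // Cmult_0_l.
  set u := (g m * _)%C; set v := \csum_(m.+1 <= i < B) _.
  rewrite (_ : u + - _ = - v)%C; last by ring.
  rewrite Cmod_opp; apply: Rle_trans (Cmod_csum _ _ _ _) _.
  apply: Rle_trans (_ : (\rsum_(m.+1 <= i < B) (Cmod (g i) * Rpower (INR i) (- 2))) * Rpower (INR m.+1) (- k) <= _).
    rewrite rsum_scalr; apply: rsum_le_nat => i /andP [im _]; rewrite eM Rmult_assoc.
    apply: Rmult_le_compat_l; first exact: Cmod_ge_0.
    have i0 : (0 < i)%nat by apply: leq_trans im.
    rewrite (_ : - (2 + k) = - 2 + - k); last ring.
    rewrite Rpower_plus; apply: Rmult_le_compat_l; first by apply: Rlt_le; apply: Rpower_pos.
    rewrite !Rpower_Ropp; apply: Rinv_le_contravar; first exact: Rpower_pos.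
    by apply: Rle_Rpower_l => //; split => //; apply: INR_leq.
  apply: Rmult_le_compat_r; first by apply: Rlt_le; apply: Rpower_pos.
  apply: Rle_trans (hS B); rewrite [X in _ <= X](big_cat_nat (n := m.+1)) //=.
  rewrite -[X in X <= _]Rplus_0_l; apply: Rplus_le_compat_r; apply: rsum_ge0 => i _.
  by apply: Rmult_le_pos; [exact: Cmod_ge_0 | apply: Rlt_le; apply: Rpower_pos].
apply: le_epsilon => e e0; rewrite Rplus_0_l.
set r := INR m / INR m.+1.
have r1 : 0 < r < 1.
  split; first exact: Rdiv_lt_0_compat.
  by apply/Rlt_div_l => //; rewrite S_INR; lra.
have P2 := Rpower_pos (INR m) 2.
have [n hn] := pow_lt_1_zero r ltac:(rewrite Rabs_pos_eq; lra) (e / (S * Rpower (INR m) 2 + 1))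
  ltac:(apply: Rdiv_lt_0_compat; [lra | nra]).
have h1 := key (INR n) (pos_INR n); have h2 := hn n (le_n n).
have rn : 0 < r ^ n by apply: pow_lt; lra.
rewrite Rabs_pos_eq in h2; last lra.
have e1 : Cmod (g m) <= S * Rpower (INR m) 2 * r ^ n.
  have Pk := Rpower_pos (INR m) (2 + INR n).
  have := Rmult_le_compat_r _ _ _ (Rlt_le _ _ Pk) h1.
  rewrite Rmult_assoc -Rpower_plus (_ : - (2 + INR n) + (2 + INR n) = 0); last ring.
  rewrite Rpower_O // Rmult_1_r => h3; apply: Rle_trans h3 _; right.
  rewrite Rpower_plus Rpower_Ropp !Rpower_pow // /r /Rdiv Rpow_mult_distr pow_inv; ring.
apply: Rle_trans e1 _; have SP : 0 <= S * Rpower (INR m) 2 by apply: Rmult_le_pos; lra.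
apply: Rle_trans (Rmult_le_compat_l _ _ _ SP (Rlt_le _ _ h2)) _.
set q := S * Rpower (INR m) 2 in SP *.
rewrite (_ : q * (e / (q + 1)) = e * (q / (q + 1))); last by field; lra.
rewrite -[X in _ <= X]Rmult_1_r; apply: Rmult_le_compat_l; first lra.
by apply/Rle_div_l; lra.
Qed.

(** Coefficients of the image under the composition operator of the series [a] cut at [X]. *)
Definition bX (N : nat) (c a : nat -> C) (X m : nat) : C := Climit (fun K => bT N c a X K m).

Definition expPhi (N : nat) (c a : nat -> C) (X : nat) (chi : nat -> C) : C :=
  \csum_(1 <= n < X.+1) (a n * Cexp (- RtoC (ln (INR n)) * Phi N c chi)).

Lemma rsum_Cconv_small (u : nat -> nat -> C) (l : nat -> C) (B : nat) :
  (forall m, (0 < m)%nat -> Cconv (u m) (l m)) -> forall e, 0 < e ->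
  exists K0, forall K, (K0 <= K)%nat -> \rsum_(1 <= m < B) Cmod (l m - u m K) <= e.
Proof.
move=> h; elim: B => [|B IH] e e0; first by exists 0%nat => K _; rewrite big_geq //; lra.
case: B IH => [|B] IH; first by exists 0%nat => K _; rewrite big_geq //; lra.
have [K1 h1] := IH (e / 2) ltac:(lra); have [K2 h2] := h B.+1 isT (e / 2) ltac:(lra).
exists (maxn K1 K2) => K; rewrite geq_max => /andP [g1 g2]; rewrite big_nat_recr //.
have t2 : Cmod (l B.+1 - u B.+1 K) <= e / 2.
  by have := h2 K g2; rewrite -Cmod_opp (_ : - (_ - _) = l B.+1 - u B.+1 K)%C //; ring.
by apply: Rle_trans (Rplus_le_compat _ _ _ _ (h1 K g1) t2) _; lra.
Qed.

Lemma rsum_Cmod_triangle (u v w : nat -> C) (s : seq nat) :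
  \rsum_(m <- s) Cmod (u m - w m) <= \rsum_(m <- s) Cmod (u m - v m) + \rsum_(m <- s) Cmod (v m - w m).
Proof.
rewrite -big_split /=; apply: rsum_le => m _.
by have := Cmod_triangle (u m - v m) (v m - w m); rewrite (_ : _ + _ = u m - w m)%C //; ring.
Qed.

Lemma bX_tail (N : nat) (c a : nat -> C) (X : nat) (e : R) : 0 < e ->
  exists K0, forall K B, (K0 <= K)%nat -> \rsum_(1 <= m < B) Cmod (bX N c a X m - bT N c a X K m) <= e.
Proof.
move=> e0; have [K0 hK] := bT_cauchy N c a X (e / 2) ltac:(lra); exists K0 => K B g.
have hc m : (0 < m)%nat -> Cconv (fun K => bT N c a X K m) (bX N c a X m).
  move=> m0; apply: Climit_cauchy => d d0; have [K1 h1] := bT_cauchy N c a X d d0.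
  exists K1 => k k' gk gk'; apply: Rle_trans (h1 k k' m.+1 gk gk').
  apply: (rsum_ge_term _ (index_iota 1 m.+1) (fun m => Cmod (bT N c a X k' m - bT N c a X k m))).
    by rewrite mem_index_iota m0 leqnn.
  by move=> j _; apply: Cmod_ge_0.
have [K1 h1] := rsum_Cconv_small (fun m K => bT N c a X K m) (bX N c a X) B hc (e / 2) ltac:(lra).
apply: Rle_trans (rsum_Cmod_triangle _ (fun m => bT N c a X (maxn K K1) m) _ _) _.
have := hK K (maxn K K1) B g (leq_maxl _ _); have := h1 _ (leq_maxr K K1); lra.
Qed.

Lemma bT_near_expPhi (N : nat) (c a : nat -> C) (X : nat) (e : R) : 0 < e ->
  exists K0, forall K chi, (K0 <= K)%nat -> (forall n, (0 < n)%nat -> Cmod (chi n) <= 1) ->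
  Cmod (expPhi N c a X chi - \csum_(1 <= n < X.+1) (a n * Texp K (- RtoC (ln (INR n)) * Phi N c chi))) <= e.
Proof.
elim: X e => [|X IH] e e0.
  by exists 0%nat => K chi _ _; rewrite /expPhi !big_geq // (_ : _ - _ = RtoC 0)%C ?Cmod_0; [lra | ring].
have [K1 h1] := IH (e / 2) ltac:(lra); have A0 := Cmod_ge_0 (a X.+1).
have [K2 h2] := Texp_uniform (ln (INR X.+1) * l1norm N c) (e / 2 / (Cmod (a X.+1) + 1)) ltac:(apply: Rdiv_lt_0_compat; lra).
exists (maxn K1 K2) => K chi; rewrite geq_max => /andP [g1 g2] hc.
rewrite /expPhi big_nat_recr // [X in (_ - X)%C]big_nat_recr // -/(expPhi N c a X chi).
set w := (- RtoC (ln (INR X.+1)) * Phi N c chi)%C.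
have t1 := h1 K chi g1 hc; set u := \csum_(1 <= n < X.+1) _ in t1 *.
have t2 : Cmod (Cexp w - Texp K w) <= e / 2 / (Cmod (a X.+1) + 1).
  apply: h2 => //; rewrite /w Cmod_mult Cmod_opp Cmod_R Rabs_pos_eq; last exact: ln_INR_ge0.
  by apply: Rmult_le_compat_l; [exact: ln_INR_ge0 | exact: Phi_mod_le].
have -> : (Cplus (expPhi N c a X chi) (a X.+1 * Cexp w) - Cplus u (a X.+1 * Texp K w) =
  (expPhi N c a X chi - u) + a X.+1 * (Cexp w - Texp K w))%C by ring.
apply: Rle_trans (Cmod_triangle _ _) _; rewrite Cmod_mult.
have t3 := Rmult_le_compat_l _ _ _ A0 t2.
have t4 : Cmod (a X.+1) * (e / 2 / (Cmod (a X.+1) + 1)) <= e / 2.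
  rewrite (_ : Cmod (a X.+1) * (e / 2 / (Cmod (a X.+1) + 1)) = e / 2 * (Cmod (a X.+1) / (Cmod (a X.+1) + 1)));
    last by field; lra.
  rewrite -[X in _ <= X]Rmult_1_r; apply: Rmult_le_compat_l; first lra.
  by apply/Rle_div_l; lra.
lra.
Qed.

Lemma expn_bound (N K : nat) : exists B0, forall k, (k < K)%nat -> (N ^ k < B0)%nat.
Proof.
exists (\max_(k < K) N ^ k).+1%nat => k kK; rewrite ltnS.
exact: (leq_bigmax (Ordinal kK) (F := fun k : 'I_K => (N ^ k)%nat)).
Qed.

Lemma bX_eval (N : nat) (c a chi : nat -> C) (X : nat) : cmult chi ->
  (forall n, (0 < n)%nat -> Cmod (chi n) <= 1) ->
  Csum_to (fun m => bX N c a X m * chi m)%C (expPhi N c a X chi).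
Proof.
move=> hc h1 e e0; have [K1 k1] := bX_tail N c a X (e / 2) ltac:(lra).
have [K2 k2] := bT_near_expPhi N c a X (e / 2) ltac:(lra).
set K := maxn K1 K2; have [B0 hB0] := expn_bound N K.
exists B0 => B hB.
have e1 := bT_eval N c a chi X K B hc (fun k kK => leq_trans (hB0 k kK) hB).
have t2 := k2 K chi (leq_maxr _ _) h1; rewrite -e1 in t2.
have t1 : Cmod (\csum_(1 <= m < B) (bX N c a X m * chi m) - \csum_(1 <= m < B) (bT N c a X K m * chi m)) <= e / 2.
  apply: Rle_trans (k1 K B (leq_maxl _ _)).
  have -> : (\csum_(1 <= m < B) (bX N c a X m * chi m) - \csum_(1 <= m < B) (bT N c a X K m * chi m))%C =
    \csum_(1 <= m < B) ((bX N c a X m - bT N c a X K m) * chi m).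
    set w := (RHS); set v := \csum_(1 <= m < B) (bT N c a X K m * chi m).
    suff -> : \csum_(1 <= m < B) (bX N c a X m * chi m) = (v + w)%C by ring.
    by rewrite /v /w -big_split /=; apply: eq_bigr => m _; ring.
  apply: Rle_trans (Cmod_csum _ _ _ _) _; apply: rsum_le_nat => m /andP [m0 _].
  rewrite Cmod_mult; have := h1 m m0; have := Cmod_ge_0 (bX N c a X m - bT N c a X K m).
  by have := Cmod_ge_0 (chi m); nra.
set u := \csum_(1 <= m < B) (bX _ _ _ _ _ * _) in t1 *; set v := \csum_(1 <= m < B) _ in t1 t2.
have -> : (u - expPhi N c a X chi = (u - v) + - (expPhi N c a X chi - v))%C by ring.
by apply: Rle_trans (Cmod_triangle _ _) _; rewrite Cmod_opp; lra.
Qed.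

Lemma dpow_weight_sum (beta : R) : 0 <= beta -> exists S, forall B,
  \rsum_(1 <= m < B) (dpow beta m * Rpower (INR m) (- 2)) <= S.
Proof.
move=> b0; have [C0 C00 hC] := div_series_upper beta b0; exists (C0 * Rpower 2 (Rpower 2 beta)) => -[|B'].
  by rewrite big_geq //; apply: Rmult_le_pos; [lra | apply: Rlt_le; apply: Rpower_pos].
have := hC 1 B' ltac:(lra); rewrite (_ : 1 + 1 / 1 = 2); last by field.
by rewrite (_ : - (1 + 1) = - 2); last by ring.
Qed.

Lemma expPhi_npow (N : nat) (c a : nat -> C) (X : nat) (s : C) :
  expPhi N c a X (fun n => npow n s) = \csum_(1 <= n < X.+1) (a n * npow n (dpoly N c s)).
Proof.
apply: eq_bigr => n _; rewrite npow_Cexp dpoly_Phi; congr (_ * Cexp _)%C; ring.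
Qed.

Lemma Cmod_npow_le1 (s : C) (n : nat) : 0 <= Re s -> (0 < n)%nat -> Cmod (npow n s) <= 1.
Proof.
move=> s0 n0; rewrite Cmod_npow -(Rpower_O (INR n)); last exact: INR_pos.
by apply: Rpower_neg_le => //; lra.
Qed.

(** [CompBounded] describes [b] only by values on Re s > 1/2. Uniqueness identifies it with [bX],
    which is absolutely summable and can be evaluated at points of the polydisc. *)
Lemma comp_coeff_unique (N : nat) (c a b : nat -> C) (X : nat) (beta : R) : 0 < beta ->
  (forall n, (X < n)%nat -> a n = 0) -> inD beta b ->
  (forall s : C, 1 / 2 < Re s -> exists v, DS_at b s v /\ DS_at a (dpoly N c s) v) ->
  forall m, (0 < m)%nat -> b m = bX N c a X m.
Proof.
move=> b0 ha hb hv.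
have val s : 1 / 2 < Re s -> Csum_to (fun m => b m * npow m s)%C (expPhi N c a X (fun n => npow n s)).
  move=> hs; have [v [/DS_at_Csum h1 /DS_at_Csum h2]] := hv s hs.
  rewrite (_ : expPhi _ _ _ _ _ = v) //; rewrite expPhi_npow.
  apply: (Cconv_unique _ _ _ _ h2); apply: (Csum_finite (fun m => a m * npow m (dpoly N c s))%C) => m hm.
  by rewrite ha // Cmult_0_l.
have [S1 hS1] := dpow_weight_sum beta (Rlt_le _ _ b0).
have [K1 k1] := bX_tail N c a X 1 ltac:(lra).
have bfin : exists S, forall B, \rsum_(1 <= m < B) Cmod (bX N c a X m) <= S.
  have [B0 hB0] := expn_bound N K1.
  exists (1 + \rsum_(1 <= n < X.+1) (Cmod (a n) * \rsum_(0 <= k < K1) ((ln (INR n) * l1norm N c) ^ k / INR (fact k)))) => B.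
  apply: Rle_trans (Rplus_le_compat _ _ _ _ (k1 K1 B (leqnn _)) (bT_diff_l1 N c a X 0 K1 B (leq0n _))).
  have bT0 m : bT N c a X 0 m = 0.
    by rewrite /bT big1 // => n _; rewrite big_geq // Cmult_0_r.
  rewrite -big_split /=; apply: rsum_le => m _; rewrite bT0.
  have t := Cmod_triangle (bX N c a X m - bT N c a X K1 m) (bT N c a X K1 m - 0).
  by rewrite (_ : bX N c a X m - bT N c a X K1 m + (bT N c a X K1 m - 0) = bX N c a X m)%C in t; [| ring].
have [S2 hS2] := bfin.
set g := fun m => (b m - bX N c a X m)%C.
suff g0 : forall m, (0 < m)%nat -> g m = 0.
  by move=> m m0; have := g0 m m0; rewrite /g => e; transitivity (b m - bX N c a X m + bX N c a X m)%C; [ring | rewrite e; ring].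
apply: (Csum_unique g (normD beta b ^ 2 + S1 + S2)); last first.
  move=> s s2; have hs : 1 / 2 < Re (RtoC s) by rewrite /=; lra.
  have hX := bX_eval N c a _ X (npow_cmult s) (fun n n0 => Cmod_npow_le1 (RtoC s) n ltac:(rewrite /=; lra) n0).
  have := Cconv_sub _ _ _ _ (val (RtoC s) hs) hX; rewrite (_ : _ - _ = RtoC 0)%C; last by ring.
  move=> h e e0; have [K hK] := h e e0; exists K => B hB; have := hK B hB.
  congr (Cmod (_ - _) <= _)%C; set u := \csum_(1 <= m < B) (bX N c a X m * _).
  suff -> : \csum_(1 <= m < B) (b m * npow m s) = (u + \csum_(1 <= m < B) (g m * npow m s))%C by ring.
  by rewrite /u -big_split /=; apply: eq_bigr => m _; rewrite /g; ring.
move=> B.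
apply: Rle_trans (_ : \rsum_(1 <= m < B) (Cmod (b m) ^ 2 / dpow beta m + dpow beta m * Rpower (INR m) (- 2) + Cmod (bX N c a X m)) <= _).
  apply: rsum_le_nat => m /andP [m0 _].
  have P2 := Rpower_pos (INR m) (- 2); have D := dpow_pos beta m.
  have P1 : Rpower (INR m) (- 2) <= 1.
    by rewrite -(Rpower_O (INR m)); [apply: Rpower_neg_le => //; lra | exact: INR_pos].
  have t := Cmod_triangle (b m) (- bX N c a X m); rewrite Cmod_opp -/(Cminus _ _) -/(g m) in t.
  have B0 := Cmod_ge_0 (b m); have X0 := Cmod_ge_0 (bX N c a X m).
  have h1 : Cmod (b m) * Rpower (INR m) (- 2) <= Cmod (b m) ^ 2 / dpow beta m + dpow beta m * Rpower (INR m) (- 2).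
    have D' := Rinv_0_lt_compat _ D.
    have h2 : Cmod (b m) <= Cmod (b m) ^ 2 / dpow beta m + dpow beta m.
      apply: (Rmult_le_reg_r (dpow beta m)) => //.
      rewrite Rmult_plus_distr_r /Rdiv Rmult_assoc Rinv_l; last lra.
      by have := pow2_ge_0 (Cmod (b m) - dpow beta m); nra.
    have h3 : 0 <= Cmod (b m) ^ 2 / dpow beta m by apply: Rmult_le_pos; [exact: pow2_ge_0 | lra].
    have := Rmult_le_compat_r _ _ _ (Rlt_le _ _ P2) h2; nra.
  have := Cmod_ge_0 (g m); nra.
rewrite !big_split /=; have := normD_partial beta b B hb; have := hS1 B; have := hS2 B.
move=> h1 h2 h3; exact: (Rplus_le_compat _ _ _ _ (Rplus_le_compat _ _ _ _ h3 h2) h1).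
Qed.

(** [G] bounds the squared norm of evaluation at [z] on D_beta: Cauchy-Schwarz with the weight
    d(m)^beta estimates the series of the image at [z], whose value is the finite sum [expPhi]. *)
Lemma comp_point_bound (N : nat) (c : nat -> C) (alpha beta : R) : 0 < beta -> CompBounded N c alpha beta ->
  exists M, forall (a : nat -> C) (X : nat) (z : nat -> C) (G : R), (forall n, (X < n)%nat -> a n = 0) ->
  (forall p, prime p -> Cmod (z p) <= 1) ->
  (forall B, \rsum_(1 <= m < B) (dpow beta m * Cmod (zchar z m) ^ 2) <= G) ->
  Cmod (expPhi N c a X (zchar z)) ^ 2 <= M ^ 2 * (\rsum_(1 <= n < X.+1) (Cmod (a n) ^ 2 / dpow alpha n)) * G.
Proof.
move=> b0 [M hM]; exists M => a X z G ha hz hG.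
set A := \rsum_(1 <= n < X.+1) _.
have hA B : \rsum_(1 <= m < B) (Cmod (a m) ^ 2 / dpow alpha m) <= A.
  have t0 m : 0 <= Cmod (a m) ^ 2 / dpow alpha m.
    apply: Rmult_le_pos; first exact: pow2_ge_0.
    by apply: Rlt_le; apply: Rinv_0_lt_compat; apply: Rpower_pos.
  case: (leqP B X.+1) => hB.
    rewrite /A; case: B hB => [|B] hB; first by rewrite big_geq //; apply: rsum_ge0.
    rewrite [X in _ <= X](big_cat_nat (n := B.+1)) //=.
    by rewrite -[X in X <= _]Rplus_0_r; apply: Rplus_le_compat_l; apply: rsum_ge0 => i _; exact: t0.
  have e : \rsum_(X.+1 <= m < B) (Cmod (a m) ^ 2 / dpow alpha m) = 0.
    rewrite big_nat big1 // => i /andP [hi _].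
    by rewrite ha // Cmod_0 /= Rmult_0_l /Rdiv Rmult_0_l.
  rewrite (big_cat_nat (n := X.+1)) //; last exact: ltnW.
  by rewrite -/A e; apply: Req_le; exact: Rplus_0_r.
have [ia na] := inD_bound alpha a A hA.
have A0 : 0 <= A by have := hA 0%nat; rewrite big_geq.
have [b [ib [nb hv]]] := hM a ia.
have hb := comp_coeff_unique N c a b X beta b0 ha ib hv.
have G0 : 0 <= G by have := hG 0%nat; rewrite big_geq.
have nn : normD beta b ^ 2 <= M ^ 2 * A.
  have n1 := normD_ge0 beta b; have n2 := normD_ge0 alpha a.
  have s2 : sqrt A ^ 2 = A by rewrite -Rsqr_pow2 Rsqr_sqrt.
  have na2 : normD alpha a ^ 2 <= A by rewrite -s2; apply: pow_incr.
  apply: Rle_trans (_ : (M * normD alpha a) ^ 2 <= _); first by apply: pow_incr.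
  by rewrite Rpow_mult_distr; apply: Rmult_le_compat_l => //; apply: pow2_ge_0.
have hX := bX_eval N c a _ X (zchar_cmult z) (fun n n0 => zchar_mod_le z n hz n0).
have key : Cmod (expPhi N c a X (zchar z)) <= sqrt (M ^ 2 * A * G).
  apply: (Cconv_mod_le _ _ _ hX); exists 0%nat => B _.
  apply: Rle_trans (Cmod_csum _ _ _ _) _.
  rewrite -(sqrt_pow2 (\rsum_(1 <= i < B) _)); last by apply: rsum_ge0 => i _; apply: Cmod_ge_0.
  apply: sqrt_le_1_alt.
  have -> : \rsum_(1 <= i < B) Cmod (bX N c a X i * zchar z i) = \rsum_(1 <= i < B) (Cmod (b i) * Cmod (zchar z i)).
    by rewrite big_nat [RHS]big_nat; apply: eq_bigr => i /andP [i0 _]; rewrite Cmod_mult hb.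
  apply: Rle_trans (rsum_cauchy_weight (dpow beta) _ _ _ (dpow_pos beta)) _.
  apply: Rmult_le_compat.
  - apply: rsum_ge0 => i _; apply: Rmult_le_pos; first exact: pow2_ge_0.
    by apply: Rlt_le; apply: Rinv_0_lt_compat; apply: Rpower_pos.
  - by apply: rsum_ge0 => i _; apply: Rmult_le_pos; [apply: Rlt_le; apply: Rpower_pos | exact: pow2_ge_0].
  - exact: Rle_trans (normD_partial beta b B ib) nn.
  - exact: hG.
have := pow_incr _ _ 2 (conj (Cmod_ge_0 _) key).
rewrite -(Rsqr_pow2 (sqrt _)) Rsqr_sqrt //; apply: Rmult_le_pos => //; apply: Rmult_le_pos => //; exact: pow2_ge_0.
Qed.

(** * Lower bounds: one variable *)

Lemma CompBounded_mono (N : nat) (c : nat -> C) (alpha beta beta' : R) : beta <= beta' ->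
  CompBounded N c alpha beta -> CompBounded N c alpha beta'.
Proof.
move=> bb [M hM]; exists M => a ia; have [b [ib [nb hv]]] := hM a ia; exists b.
have t0 x n : 0 <= Dterm x b n.
  apply: Rmult_le_pos; first exact: pow2_ge_0.
  by apply: Rlt_le; apply: Rinv_0_lt_compat; apply: Rpower_pos.
have le n : 0 <= Dterm beta' b n <= Dterm beta b n.
  split; first exact: t0.
  apply: Rmult_le_compat_l; first exact: pow2_ge_0.
  apply: Rinv_le_contravar; first exact: Rpower_pos.
  by apply: Rle_Rpower => //; apply: INR_ge1; apply: ndiv_gt0.
split.
  by apply: (ex_series_le (Dterm beta' b) (Dterm beta b)) ib => n; rewrite /norm /= /abs /= Rabs_pos_eq; case: (le n).
split => //; apply: Rle_trans nb; apply: sqrt_le_1_alt; exact: Series_le.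
Qed.

Definition point_at (p : nat) (zeta : C) (q : nat) : C := if q == p then zeta else RtoC 0.

Lemma zchar_point_at (p : nat) (zeta : C) (m : nat) : prime p -> (0 < m)%nat ->
  m = (p ^ logn p m)%nat \/ zchar (point_at p zeta) m = 0.
Proof.
move=> pp m0; have em := divnK (pfactor_dvdnn p m); set l := logn p m in em *.
set k := (m %/ p ^ l)%nat in em; have p0 := prime_gt0 pp.
have k0 : (0 < k)%nat by move: m0; rewrite -em muln_gt0 => /andP [].
have pl0 : (0 < p ^ l)%nat by rewrite expn_gt0 p0.
case: (ltngtP k 1) => [|k1|k1]; [by rewrite ltnS leqNgt k0 | right | by left; rewrite -{1}em k1 mul1n].
have [q qp qd] : exists2 q, prime q & (q %| k)%nat by exists (pdiv k); [exact: pdiv_prime | exact: pdiv_dvd].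
have eq := divnK qd; have q0 := prime_gt0 qp.
have qk0 : (0 < k %/ q)%nat by rewrite divn_gt0 // dvdn_leq.
have nqp : q != p.
  apply/eqP => e; have : (p ^ l.+1 %| m)%nat by rewrite -em expnS dvdn_mul // -e.
  by rewrite pfactor_dvdn // ltnn.
rewrite -em -eq zchar_mul ?muln_gt0 ?qk0 ?q0 // zchar_mul // (zchar_prime _ q qp).
by rewrite /point_at (negbTE nqp) Cmult_0_r Cmult_0_l.
Qed.

Lemma point_at_mod (p : nat) (zeta : C) (q : nat) : Cmod zeta <= 1 -> Cmod (point_at p zeta q) <= 1.
Proof. by rewrite /point_at; case: ifP => // _ _; rewrite Cmod_0; lra. Qed.

(** Only powers of [p] survive at such a point, and d(p^k) = k + 1; the kernel is thus a
    one-variable sum, with exponent 1 + beta whatever the dimension of the symbol. *)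
Lemma point_at_kernel (p : nat) (beta : R) : prime p -> 0 < beta -> exists2 C0, 0 < C0 &
  forall e zeta, 0 < e <= 1 / 2 -> Cmod zeta <= 1 - e -> forall B,
  \rsum_(1 <= m < B) (dpow beta m * Cmod (zchar (point_at p zeta) m) ^ 2) <= C0 * Rpower (2 * e) (- (1 + beta)).
Proof.
move=> pp b0; have [C0 C00 hC] := poly_geom_sum_le beta b0; exists C0 => // e zeta he hz B.
apply: Rle_trans (hC (2 * e) B ltac:(lra)).
have Z0 := Cmod_ge_0 zeta; have p0 := prime_gt0 pp.
rewrite (bigID (fun m => m == (p ^ logn p m)%nat)) /= [X in _ + X <= _]big1_seq ?Rplus_0_r; last first.
  move=> m; rewrite mem_index_iota => /andP [h /andP [m0 _]].
  have [e1|->] := zchar_point_at p zeta m pp m0; first by rewrite -e1 eqxx in h.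
  by rewrite Cmod_0; ring.
rewrite -big_filter; apply: (rsum_inj_le _ _ _ _ (logn p)).
- exact: filter_uniq (iota_uniq _ _).
- by move=> m n; rewrite !mem_filter => /andP [/eqP em _] /andP [/eqP en _] eq; rewrite em en eq.
- move=> m; rewrite mem_filter !mem_index_iota => /andP [/eqP em /andP [m0 mB]].
  set k := logn p m in em *; split.
    rewrite /=; apply: leq_ltn_trans mB; rewrite em; apply: ltnW; apply: ltn_expl; exact: prime_gt1.
  rewrite em dpow_pexp // (cmult_exp _ _ _ (zchar_cmult _)) // zchar_prime // /point_at eqxx.
  apply: Rmult_le_compat_l; first by apply: Rlt_le; apply: Rpower_pos.
  rewrite Cmod_pow; have -> : forall y k, y ^ k * (y ^ k * 1) = (y ^ 2) ^ k.
    by move=> y j; rewrite -pow_mult Nat.mul_comm pow_mult.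
  have -> : exp (- (2 * e * INR k)) = (exp (- e) ^ 2) ^ k.
    by rewrite !exp_pow; congr exp; rewrite [INR 2]/=; ring.
  apply: pow_incr; split; first exact: pow2_ge_0.
  apply: pow_incr; split => //; apply: Rle_trans hz _; have := exp_ineq1_le (- e); lra.
- by move=> k _; apply: Rmult_le_pos; apply: Rlt_le; [exact: Rpower_pos | exact: exp_pos].
Qed.

Lemma comp_unbounded (N : nat) (c : nat -> C) (alpha beta C1 e0 : R) (p : nat) :
  0 < alpha -> beta < Rpower 2 alpha - 1 -> prime p -> 0 < e0 -> 0 < C1 ->
  (forall e, 0 < e <= e0 -> exists zeta, Cmod zeta <= 1 - e /\
     Re (Phi N c (zchar (point_at p zeta))) <= 1 / 2 + C1 * e) ->
  ~ CompBounded N c alpha beta.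
Proof.
move=> a0 hb pp e00 C10 hz hB; set A := Rpower 2 alpha in hb *.
have A1 : 1 < A by have := Rpower_lt 2 0 alpha ltac:(lra) a0; rewrite Rpower_O -/A; lra.
(* Raising the target exponent preserves boundedness, and the kernel estimate asks for a positive
   one. *)
have [b' [b1 b2 b3]] : exists b', [/\ beta <= b', 0 < b' & b' < A - 1].
  exists ((Rmax beta 0 + (A - 1)) / 2); have := Rmax_l beta 0; have := Rmax_r beta 0.
  by have := Rmax_lub_lt beta 0 (A - 1) hb ltac:(lra) => ? ? ?; split; lra.
have {hB} hB := CompBounded_mono N c alpha beta b' b1 hB.
have [M hM] := comp_point_bound N c alpha b' b2 hB.
have [C0 C00 hC] := point_at_kernel p b' pp b2.
have [c0 c00 hc] := div_series_lower alpha (Rlt_le _ _ a0); rewrite -/A in hc.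
set g := A - 1 - b'; have g0 : 0 < g by rewrite /g; lra.
have M2 := pow2_ge_0 M; have PC1 := Rpower_pos C1 A.
set Q := M ^ 2 * C0 * Rpower C1 A / c0.
have Q0 : 0 <= Q.
  apply: Rmult_le_pos; last by apply: Rlt_le; apply: Rinv_0_lt_compat.
  by repeat apply: Rmult_le_pos => //; lra.
(* For e = 1 / (2T) the three entries give e <= [e0], e <= 1/2 and T^g >= [Q] + 1; the last
   contradicts T^g <= [Q], to which the norm estimate reduces. *)
set T := Rmax (1 / (2 * e0)) (Rmax 1 (Rpower (Q + 1) (/ g))).
have T1 : 1 <= T by apply: Rle_trans (Rmax_r _ _); apply: Rmax_l.
have T2 : 1 / (2 * e0) <= T by apply: Rmax_l.
have T3 : Rpower (Q + 1) (/ g) <= T by apply: Rle_trans (Rmax_r _ _); apply: Rmax_r.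
have T4 : Q + 1 <= Rpower T g.
  have e : Rpower (Rpower (Q + 1) (/ g)) g = Q + 1.
    by rewrite Rpower_mult Rinv_l ?Rpower_1; lra.
  by rewrite -{1}e; apply: Rle_Rpower_l; [lra | split => //; apply: Rpower_pos].
set e := / (2 * T).
have e1 : 0 < e by apply: Rinv_0_lt_compat; lra.
have e2 : e <= e0.
  rewrite -(Rinv_inv e0) /e; apply: Rinv_le_contravar; first exact: Rinv_0_lt_compat.
  have -> : / e0 = 2 * (1 / (2 * e0)) by field; lra.
  by apply: Rmult_le_compat_l; lra.
have e3 : e <= 1 / 2.
  by rewrite /e (_ : 1 / 2 = / 2); [apply: Rinv_le_contravar; lra | field].
have eT : 2 * e = / T by rewrite /e; field; lra.
have [zeta [z1 z2]] := hz e (conj e1 e2).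
set chi := zchar (point_at p zeta) in z2.
have d0 : 0 < 2 * (C1 * e) by have := Rmult_lt_0_compat _ _ C10 e1; lra.
(* Since |n^(-Phi)|^2 is at least n^(-(1 + 2 C1 e)), the sum [F] dominates the divisor series at 1 +
   2 C1 e. *)
have [X hX] := hc (2 * (C1 * e)) d0.
pose w n := Cexp (- RtoC (ln (INR n)) * Phi N c chi).
pose a n := if (n <= X)%nat then (RtoC (dpow alpha n) * Cconj (w n))%C else RtoC 0.
set F := \rsum_(1 <= n < X.+1) (dpow alpha n * Cmod (w n) ^ 2).
have hF : expPhi N c a X chi = RtoC F.
  rewrite /expPhi /F RtoC_rsum big_nat [RHS]big_nat; apply: eq_bigr => n /andP [_ nX].
  rewrite /a -ltnS nX -/(w n) RtoC_mult -Cmult_assoc; congr Cmult.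
  by rewrite Cmod2_conj Cmult_comm.
have hA : \rsum_(1 <= n < X.+1) (Cmod (a n) ^ 2 / dpow alpha n) = F.
  rewrite /F big_nat [RHS]big_nat; apply: eq_bigr => n /andP [_ nX].
  have D := dpow_pos alpha n.
  rewrite /a -ltnS nX Cmod_mult Cmod_conj Cmod_R Rabs_pos_eq; last lra.
  by field; lra.
have zm1 q : prime q -> Cmod (point_at p zeta q) <= 1 by move=> _; apply: point_at_mod; lra.
have := hM a X (point_at p zeta) _ _ zm1 (hC e zeta (conj e1 e3) z1); rewrite -/chi hF hA => h1.
have {h1} h1 : F ^ 2 <= M ^ 2 * F * (C0 * Rpower (2 * e) (- (1 + b'))).
  have F0 : 0 <= F by apply: rsum_ge0 => n _; apply: Rmult_le_pos; [apply: Rlt_le; apply: Rpower_pos | exact: pow2_ge_0].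
  have := h1 _; rewrite Cmod_R Rabs_pos_eq //; apply.
  by move=> n hn; rewrite /a leqNgt hn.
have hFl : c0 * Rpower (/ (2 * (C1 * e))) A <= F.
  apply: Rle_trans hX _; apply: rsum_le_nat => n /andP [n0 _].
  apply: Rmult_le_compat_l; first by apply: Rlt_le; apply: Rpower_pos.
  rewrite /w Cmod_Cexp exp_pow /Rpower; apply: exp_le.
  have l0 := ln_INR_ge0 n; have -> : Re (- RtoC (ln (INR n)) * Phi N c chi) = - ln (INR n) * Re (Phi N c chi).
    by case: (Phi N c chi) => x y /=; ring.
  by rewrite [INR 2]/=; nra.
have F0 : 0 < F.
  by apply: Rlt_le_trans hFl; apply: Rmult_lt_0_compat => //; apply: Rpower_pos.
have {h1} h1 : F <= M ^ 2 * (C0 * Rpower (2 * e) (- (1 + b'))).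
  by apply: (Rmult_le_reg_l F) => //; lra.
have r1 : Rpower (2 * e) (- (1 + b')) = Rpower T (1 + b').
  by rewrite eT /Rpower ln_Rinv; [congr exp; ring | lra].
have r2 : Rpower (/ (2 * (C1 * e))) A * Rpower C1 A = Rpower T A.
  rewrite Rpower_mult_distr //; last exact: Rinv_0_lt_compat.
  by congr Rpower; rewrite (_ : 2 * (C1 * e) = C1 * (2 * e)); [rewrite eT; field; lra | ring].
have r3 : Rpower T A = Rpower T g * Rpower T (1 + b').
  by rewrite -Rpower_plus; congr Rpower; rewrite /g; ring.
rewrite r1 in h1; have PT := Rpower_pos T (1 + b'); set t := Rpower T (1 + b') in h1 r3 PT.
have h2 : c0 * Rpower T A <= M ^ 2 * (C0 * t) * Rpower C1 A.
  rewrite -r2 -Rmult_assoc; apply: Rmult_le_compat_r; first lra.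
  exact: Rle_trans hFl h1.
have h3 : c0 * (Q + 1) * t <= c0 * Q * t.
  apply: Rle_trans (_ : c0 * Rpower T A <= _).
    rewrite r3 -Rmult_assoc; apply: Rmult_le_compat_r; first lra.
    by apply: Rmult_le_compat_l; lra.
  by apply: Rle_trans h2 _; right; rewrite /Q; field; lra.
have := Rmult_lt_0_compat _ _ c00 PT; lra.
Qed.

Lemma pow_contract (e : R) (k : nat) : 0 <= e <= 1 -> 1 - INR k * e <= (1 - e) ^ k <= 1.
Proof.
move=> he; elim: k => [|k [IH1 IH2]]; first by rewrite /=; lra.
by rewrite S_INR /=; have := pos_INR k; have := pow_le (1 - e) k ltac:(lra) => h1 h2; split; nra.
Qed.

Lemma Cnz_false (z : C) : Cnz z = false -> z = 0.
Proof.
case: z => x y; rewrite /Cnz /=; case: Req_EM_T => [hx|//]; case: Req_EM_T => [hy|//] _.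
by rewrite hx hy.
Qed.

Lemma Cnz_true (z : C) : z <> 0 -> Cnz z.
Proof. by move=> h; case e: (Cnz z) => //; case: h; apply: Cnz_false. Qed.

Lemma Cnz_neq0 (z : C) : Cnz z -> z <> 0.
Proof. by move=> h e; move: h; rewrite e /Cnz /=; case: Req_EM_T => // _; case: Req_EM_T. Qed.

Definition cprimes (N : nat) (c : nat -> C) : seq nat :=
  [seq p <- iota 0%nat N.+1 | prime p && has (fun n => Cnz (c n) && (p %| n)%nat) (iota 1%nat N)].

Lemma dimD_size (N : nat) (c : nat -> C) : dimD N c = size (cprimes N c).
Proof. by rewrite size_filter. Qed.

Lemma mem_cprimes (N : nat) (c : nat -> C) (q n : nat) : prime q -> (0 < n)%nat -> (n <= N)%nat ->
  c n <> 0 -> (q %| n)%nat -> q \in cprimes N c.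
Proof.
move=> pq n0 nN cn d; rewrite mem_filter pq mem_iota /= add0n ltnS (leq_trans (dvdn_leq n0 d) nN) andbT.
by apply/hasP; exists n; [rewrite mem_iota n0 add1n ltnS | rewrite d Cnz_true].
Qed.

Lemma cprimesP (N : nat) (c : nat -> C) (q : nat) : q \in cprimes N c ->
  prime q /\ exists n, [/\ (0 < n)%nat, (n <= N)%nat, c n <> 0 & (q %| n)%nat].
Proof.
rewrite mem_filter => /andP [/andP [pq /hasP [n nI /andP [/Cnz_neq0 cn d]]] _].
by move: nI; rewrite mem_iota add1n ltnS => /andP [n0 nN]; split => //; exists n.
Qed.

(** With a single prime the symbol is a polynomial in p^(-s), so the unrestricted range itself
    supplies points of the disc. Contracting p^(-s) by 1 - e gives modulus at most 1 - e and moves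
    the value by at most [C2] e. *)
Lemma dim_one_unbounded (N : nat) (c : nat -> C) (alpha beta : R) : 0 < alpha ->
  unrestricted N c -> dimD N c = 1%nat -> beta < Rpower 2 alpha - 1 -> ~ CompBounded N c alpha beta.
Proof.
move=> a0 ur; rewrite dimD_size; case ec: (cprimes N c) => [//|p [|//]] _ hb.
have [pp _] : prime p /\ _ := cprimesP N c p ltac:(by rewrite ec inE eqxx).
set C2 := \rsum_(1 <= n < N.+1) (Cmod (c n) * INR n).
have C20 : 0 <= C2 by apply: rsum_ge0 => n _; apply: Rmult_le_pos; [exact: Cmod_ge_0 | exact: pos_INR].
apply: (comp_unbounded N c alpha beta (1 + C2) 1 p a0 hb pp) => //; try lra.
move=> e [e0 e1]; have [s [s0 hs]] := ur e e0.
have Z0 : Cmod (npow p s) <= 1 by apply: Cmod_npow_le1; [lra | exact: prime_gt0].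
exists (RtoC (1 - e) * npow p s)%C; split.
  rewrite Cmod_mult Cmod_R Rabs_pos_eq; last lra.
  by have := Cmod_ge_0 (npow p s); nra.
set chi := zchar _; rewrite dpoly_Phi in hs; set psi := fun n => npow n s in hs.
have key : Cmod (Phi N c chi - Phi N c psi) <= C2 * e.
  have -> : (Phi N c chi - Phi N c psi)%C = \csum_(1 <= n < N.+1) (c n * (chi n - psi n)).
    set w := (RHS); suff -> : Phi N c chi = (Phi N c psi + w)%C by ring.
    by rewrite /Phi /w -big_split /=; apply: eq_bigr => n _; ring.
  apply: Rle_trans (Cmod_csum _ _ _ _) _; rewrite /C2 rsum_scalr.
  apply: rsum_le_nat => n /andP [n0 nN]; rewrite Cmod_mult Rmult_assoc.
  have [->|cn] := Ceq_dec (c n) 0; first by rewrite Cmod_0 !Rmult_0_l; lra.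
  apply: Rmult_le_compat_l; first exact: Cmod_ge_0.
  have en : n = (p ^ logn p n)%nat.
    have [//|hz] := zchar_point_at p 1 n pp n0.
    have : zchar (point_at p 1) n = 1; last by rewrite hz => /(f_equal Re) /=; lra.
    rewrite /zchar big_seq big1 // => q; rewrite mem_primes => /and3P [pq _ dq].
    have : q \in cprimes N c by apply: (mem_cprimes N c q n).
    by rewrite ec inE => /eqP ->; rewrite /point_at eqxx Cpow_1_l.
  set k := logn p n in en.
  have -> : chi n = (RtoC ((1 - e) ^ k) * psi n)%C.
    rewrite en (cmult_exp chi) ?prime_gt0 //; last exact: zchar_cmult.
    rewrite (cmult_exp psi) ?prime_gt0 //; last exact: npow_cmult.
    by rewrite /chi zchar_prime // /point_at eqxx Cpow_mult_l RtoC_pow.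
  have -> : (RtoC ((1 - e) ^ k) * psi n - psi n = RtoC ((1 - e) ^ k - 1) * psi n)%C by rewrite RtoC_minus; ring.
  rewrite Cmod_mult Cmod_R.
  have [h1 h2] := pow_contract e k ltac:(lra).
  rewrite -Rabs_Ropp Rabs_pos_eq; last lra.
  have p1 : Cmod (psi n) <= 1 by apply: Cmod_npow_le1 => //; lra.
  have kn : INR k <= INR n by apply: INR_leq; rewrite [X in (_ <= X)%nat]en; apply: ltnW; apply: ltn_expl; apply: prime_gt1.
  have h3 : INR k * e <= INR n * e by apply: Rmult_le_compat_r; lra.
  by have := Cmod_ge_0 (psi n); nra.
have := re_le_Cmod (Phi N c chi - Phi N c psi); have := Rle_abs (Re (Phi N c chi - Phi N c psi)).
have -> : Re (Phi N c chi - Phi N c psi) = Re (Phi N c chi) - Re (Phi N c psi) by [].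
lra.
Qed.

(** * Lower bounds: a tangential example *)

Lemma bigOmega_wide (n B : nat) : (0 < n)%nat -> (n < B)%nat ->
  bigOmega n = (\sum_(p <- iota 0%nat B | prime p) logn p n)%nat.
Proof.
move=> n0 nB; rewrite -big_filter /bigOmega.
rewrite [RHS](bigID (fun p => p \in primes n)) /= [X in (_ + X)%nat]big1_seq ?addn0; last first.
  by move=> p /andP [np _]; rewrite -logn_gt0 lt0n negbK in np; rewrite (eqP np).
rewrite -[in RHS]big_filter; apply: perm_big; apply: uniq_perm.
- exact: primes_uniq.
- by apply: filter_uniq; apply: filter_uniq; apply: iota_uniq.
move=> p; rewrite !mem_filter mem_iota add0n /= mem_primes n0 /=.
case: (boolP (prime p)) => pp //=; case: (boolP (p %| n)%nat) => //= d.
by rewrite (leq_ltn_trans (dvdn_leq n0 d) nB).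
Qed.

Lemma bigOmega_mul (m n : nat) : (0 < m)%nat -> (0 < n)%nat ->
  bigOmega (m * n) = (bigOmega m + bigOmega n)%nat.
Proof.
move=> m0 n0; have mn0 : (0 < m * n)%nat by rewrite muln_gt0 m0.
rewrite (bigOmega_wide _ (m * n).+1) // (bigOmega_wide m (m * n).+1) ?ltnS ?leq_pmulr //.
rewrite (bigOmega_wide n (m * n).+1) ?ltnS ?leq_pmull // -big_split /=.
by apply: eq_bigr => p pp; rewrite lognM.
Qed.

Lemma bigOmega_prime (p : nat) : prime p -> bigOmega p = 1%nat.
Proof. by move=> pp; rewrite /bigOmega primes_prime // big_seq1 logn_prime // eqxx. Qed.

Lemma bigOmega_exp (p k : nat) : prime p -> bigOmega (p ^ k) = k.
Proof.
move=> pp; have p0 := prime_gt0 pp; elim: k => [|k IH]; first by rewrite expn0 /bigOmega big_nil.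
by rewrite expnS bigOmega_mul ?expn_gt0 ?p0 // IH bigOmega_prime.
Qed.

Definition dl (k n : nat) : C := if n == k then RtoC 1 else RtoC 0.

(* [3/2 - z_2 + eta (1 - z_2)^2 sum_(u in U) z^kappa(u)], which is tangent to the critical line at
   [z_2 = 1] whatever the other variables are. *)
Definition cex (eta : R) (U : seq nat) (n : nat) : C :=
  (RtoC (3 / 2) * dl 1 n - dl 2 n + RtoC eta * \csum_(u <- U) (dl u n - 2 * dl (2 * u) n + dl (4 * u) n))%C.

(** A crude bound for the support, which consists of 1, 2 and the u, 2 u, 4 u. *)
Definition Ncex (U : seq nat) : nat := (2 + \sum_(u <- U) 4 * u)%nat.

Lemma csum_dl (k N : nat) (chi : nat -> C) : (0 < k)%nat -> (k <= N)%nat ->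
  \csum_(1 <= n < N.+1) (dl k n * chi n) = chi k.
Proof.
move=> k0 kN; have kI : k \in index_iota 1 N.+1 by rewrite mem_index_iota k0 ltnS.
rewrite (big_rem k kI) /= /dl eqxx big1_seq; first by rewrite Cmult_1_l Cplus_0_r.
move=> n /andP [_]; rewrite mem_rem_uniq ?iota_uniq // inE => /andP [nk _].
by rewrite (negbTE nk) Cmult_0_l.
Qed.

Lemma Ncex_ge (U : seq nat) (u : nat) : u \in U -> (4 * u <= Ncex U)%nat.
Proof. by move=> uU; rewrite /Ncex (big_rem u uU) /= addnCA leq_addr. Qed.

Section Example.
Variables (eta : R) (U : seq nat).
Hypothesis U0 : forall u, u \in U -> (0 < u)%nat.
Let c := cex eta U.
Let N := Ncex U.

Lemma Phi_cex (chi : nat -> C) : cmult chi ->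
  Phi N c chi = (RtoC (1 / 2) + (1 - chi 2%nat) + RtoC eta * ((1 - chi 2%nat) * (1 - chi 2%nat)) * \csum_(u <- U) chi u)%C.
Proof.
move=> hc; have [c1 cM] := hc.
have e2 k : (k <= 2)%nat -> (k <= N)%nat by move=> h; apply: leq_trans h _; rewrite /N /Ncex leq_addr.
have -> : Phi N c chi = (RtoC (3 / 2) * \csum_(1 <= n < N.+1) (dl 1 n * chi n) + - \csum_(1 <= n < N.+1) (dl 2 n * chi n)
  + RtoC eta * \csum_(u <- U) (\csum_(1 <= n < N.+1) (dl u n * chi n) + - 2 * \csum_(1 <= n < N.+1) (dl (2 * u) n * chi n)
    + \csum_(1 <= n < N.+1) (dl (4 * u) n * chi n)))%C.
  have -> : (- \csum_(1 <= n < N.+1) (dl 2 n * chi n))%C = \csum_(1 <= n < N.+1) (- 1 * (dl 2 n * chi n)).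
    by rewrite -csum_scal; ring.
  have -> : \csum_(u <- U) (\csum_(1 <= n < N.+1) (dl u n * chi n) + - 2 * \csum_(1 <= n < N.+1) (dl (2 * u) n * chi n)
      + \csum_(1 <= n < N.+1) (dl (4 * u) n * chi n)) =
    \csum_(1 <= n < N.+1) \csum_(u <- U) (dl u n * chi n + - 2 * (dl (2 * u) n * chi n) + dl (4 * u) n * chi n).
    rewrite [RHS]exchange_big /=; apply: eq_bigr => u _.
    by rewrite csum_scal -!big_split.
  rewrite !csum_scal -!big_split /=; apply: eq_bigr => n _; rewrite /c /cex.
  have -> : \csum_(u <- U) (dl u n * chi n + - 2 * (dl (2 * u) n * chi n) + dl (4 * u) n * chi n) =
    (\csum_(u <- U) (dl u n - 2 * dl (2 * u) n + dl (4 * u) n) * chi n)%C.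
    by rewrite csum_scalr; apply: eq_bigr => u _; ring.
  ring.
rewrite !csum_dl //; try exact: e2.
have -> : \csum_(u <- U) (\csum_(1 <= n < N.+1) (dl u n * chi n) + - 2 * \csum_(1 <= n < N.+1) (dl (2 * u) n * chi n)
    + \csum_(1 <= n < N.+1) (dl (4 * u) n * chi n)) = \csum_(u <- U) ((1 - chi 2%nat) * (1 - chi 2%nat) * chi u).
  rewrite big_seq [RHS]big_seq; apply: eq_bigr => u uU; have u0 := U0 u uU; have uN := Ncex_ge U u uU.
  rewrite !csum_dl ?muln_gt0 ?u0 //; try by rewrite /N; lia.
  rewrite (cM 2%nat u) // (_ : 4 * u = 2 * (2 * u))%nat; last by lia.
  by rewrite !cM ?muln_gt0 ?u0 //; ring.
rewrite -csum_scal c1 (_ : RtoC (3 / 2) = RtoC (1 / 2) + 1)%C; first ring.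
by rewrite -RtoC_plus; congr RtoC; field.
Qed.

Hypothesis eta0 : 0 < eta.
Hypothesis eta1 : eta * INR (size U) <= 1 / 4.

Lemma cex_sum_mod (chi : nat -> C) : (forall n, (0 < n)%nat -> Cmod (chi n) <= 1) ->
  Cmod (\csum_(u <- U) chi u) <= INR (size U).
Proof.
move=> h; apply: Rle_trans (Cmod_csum _ _ _ _) _.
rewrite -(Rmult_1_r (INR _)) -rsum_const; apply: rsum_le_in => u uU _; exact: h (U0 u uU).
Qed.

(** For |x| <= 1, |1 - x|^2 <= 2 (1 - Re x); with [eta1] the perturbation is therefore at most half
    of 1 - Re z_2. *)
Lemma cex_Re_bounds (chi : nat -> C) : cmult chi -> (forall n, (0 < n)%nat -> Cmod (chi n) <= 1) ->
  1 / 2 + (1 - Re (chi 2%nat)) / 2 <= Re (Phi N c chi) <= 1 / 2 + 2 * (1 - Re (chi 2%nat)).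
Proof.
move=> hc h1; rewrite Phi_cex //; set x := chi 2%nat; set S := \csum_(u <- U) chi u.
have x1 : Cmod x <= 1 by apply: h1.
have S1 : Cmod S <= INR (size U) by apply: cex_sum_mod.
have q : Cmod (1 - x) * Cmod (1 - x) <= 2 * (1 - Re x).
  have x2 : Cmod x ^ 2 <= 1 by have := Cmod_ge_0 x; nra.
  rewrite Cmod2_alt in x2; have := Cmod2_alt (1 - x)%C.
  rewrite (_ : Re (1 - x) = 1 - Re x); last by [].
  rewrite (_ : Im (1 - x) = - Im x); last by rewrite /= /Im; ring.
  nra.
set w := (RtoC eta * ((1 - x) * (1 - x)) * S)%C.
have hw : Cmod w <= (1 - Re x) / 2.
  rewrite /w !Cmod_mult Cmod_R Rabs_pos_eq; last lra.
  have m0 := Cmod_ge_0 (1 - x); have s0 := Cmod_ge_0 S.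
  have xr : 0 <= 1 - Re x by have := re_le_Cmod x; have := Rle_abs (Re x); lra.
  have p0 := pos_INR (size U).
  apply: Rle_trans (_ : eta * (2 * (1 - Re x)) * INR (size U) <= _); last nra.
  apply: Rmult_le_compat => //; first by apply: Rmult_le_pos; nra.
  by apply: Rmult_le_compat_l; lra.
have := re_le_Cmod w; have := Rle_abs (Re w); have := Rle_abs (- Re w); rewrite Rabs_Ropp.
have -> : Re (RtoC (1 / 2) + (1 - x) + w)%C = 1 / 2 + (1 - Re x) + Re w by [].
lra.
Qed.

Lemma cex_inG : inG N c.
Proof.
move=> s s0; rewrite dpoly_Phi.
have [h _] := cex_Re_bounds _ (npow_cmult s) (fun n n0 => Cmod_npow_le1 s n (Rlt_le _ _ s0) n0).
have : Re (npow 2 s) < 1; last lra.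
apply: Rle_lt_trans (Rle_abs _) _; apply: Rle_lt_trans (re_le_Cmod _) _; rewrite Cmod_npow.
have e2 : 1 < INR 2 by rewrite /=; lra.
by rewrite -(Rpower_O (INR 2)); [apply: Rpower_lt => //; lra | lra].
Qed.

Lemma cex_unrestricted : unrestricted N c.
Proof.
move=> d d0; exists (RtoC (d / 2)); have s0 : 0 < Re (RtoC (d / 2)) by rewrite /=; lra.
split => //; rewrite dpoly_Phi.
have [_ h] := cex_Re_bounds _ (npow_cmult (RtoC (d / 2))) (fun n n0 => Cmod_npow_le1 _ n (Rlt_le _ _ s0) n0).
apply: Rle_trans h _; suff : 1 - d / 2 <= Re (npow 2 (RtoC (d / 2))) by lra.
have e2 : INR 2 = 2 by rewrite /=; lra.
rewrite /npow /= Rmult_0_l cos_0 Rmult_1_r -/(INR 2) e2 /Rpower.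
apply: Rle_trans (exp_ineq1_le _).
have l21 : ln 2 <= 1.
  by have := exp_ineq1_le 1 => h; have := ln_le 2 (exp 1) ltac:(lra) ltac:(lra); rewrite ln_exp.
have := ln2_pos; nra.
Qed.

Lemma cex_unbounded (alpha beta : R) : 0 < alpha -> beta < Rpower 2 alpha - 1 -> ~ CompBounded N c alpha beta.
Proof.
move=> a0 hb; apply: (comp_unbounded N c alpha beta 2 1 2 a0 hb isT ltac:(lra) ltac:(lra)) => e [e0 e1].
exists (RtoC (1 - e)).
have z1 : Cmod (RtoC (1 - e)) <= 1 - e by rewrite Cmod_R Rabs_pos_eq; lra.
split => //.
have hp q : prime q -> Cmod (point_at 2 (RtoC (1 - e)) q) <= 1 by move=> _; apply: point_at_mod; lra.
have [_ h] := cex_Re_bounds _ (zchar_cmult _) (fun n n0 => zchar_mod_le _ n hp n0).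
by apply: Rle_trans h _; rewrite zchar_prime // /point_at eqxx /=; lra.
Qed.

Hypothesis Uu : uniq U.
Hypothesis U4 : forall u v, u \in U -> v \in U -> (4 * u)%nat != v /\ (4 * u)%nat != (2 * v)%nat.

(** By [U4] the index 4 u arises only from the last term of [u] itself, so its coefficient is [eta]:
    nothing cancels it. *)
Lemma cex_neq0 (u : nat) : u \in U -> c (4 * u)%nat <> 0.
Proof.
move=> uU; have u0 := U0 u uU.
have -> : c (4 * u)%nat = RtoC eta; last by move=> h; have := f_equal Re h => /=; lra.
rewrite /c /cex /dl !gtn_eqF; try lia.
rewrite (big_rem u uU) /= big1_seq.
  have [h1 h2] := U4 u u uU uU; rewrite (negbTE h1) (negbTE h2) eqxx; ring.
move=> v /andP [_]; rewrite mem_rem_uniq // inE => /andP [vu vU].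
have [h1 h2] := U4 u v uU vU; rewrite (negbTE h1) (negbTE h2).
have -> : (4 * u == 4 * v)%nat = false by apply/eqP => h; move/eqP: vu; apply; lia.
ring.
Qed.

Lemma cex_support (n : nat) : c n <> 0 ->
  [\/ n = 1%nat, n = 2%nat | exists2 u, u \in U & [\/ n = u, n = (2 * u)%nat | n = (4 * u)%nat]].
Proof.
move=> cn; case: (eqVneq n 1%nat) => [|n1]; first by constructor 1.
case: (eqVneq n 2%nat) => [|n2]; first by constructor 2.
constructor 3; case: (boolP (has (fun u => [|| n == u, n == (2 * u)%nat | n == (4 * u)%nat]) U)) => [/hasP [u uU h]|/hasPn h].
  exists u => //; case/or3P: h => /eqP h; [by constructor 1 | by constructor 2 | by constructor 3].
case: cn; rewrite /c /cex /dl (negbTE n1) (negbTE n2) big1_seq; first by ring.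
move=> u /andP [_ uU]; have := h u uU; rewrite !negb_or => /and3P [/negbTE -> /negbTE -> /negbTE ->]; ring.
Qed.

Lemma cex_dim (P : seq nat) : U != [::] -> uniq P ->
  (forall q, (q \in P) <-> (prime q /\ (q = 2%nat \/ exists2 u, u \in U & (q %| u)%nat))) ->
  dimD N c = size P.
Proof.
move=> Un Pu hP; rewrite dimD_size; apply: perm_size; apply: uniq_perm => //.
  exact: filter_uniq (iota_uniq _ _).
have mem4 u q : u \in U -> prime q -> (q %| 4 * u)%nat -> q \in cprimes N c.
  move=> uU pq d; have u0 := U0 u uU; apply: (mem_cprimes N c q (4 * u)%nat) => //.
  - by rewrite muln_gt0 u0.
  - exact: Ncex_ge.
  - exact: cex_neq0.
move=> q; apply/idP/idP.
- move=> /cprimesP [pq [n [n0 nN cn d]]]; apply/hP; split => //.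
  have q2 k : (q %| 2 ^ k)%nat -> q = 2%nat by rewrite Euclid_dvdX // => /andP []; rewrite dvdn_prime2 // => /eqP.
  case: (cex_support n cn) => [en|en|[u uU hu]].
  + by move: d; rewrite en dvdn1 => /eqP q1; rewrite q1 in pq.
  + by left; apply: (q2 1%nat); rewrite expn1 -en.
  + have : (q %| 2 ^ 2 * u)%nat.
      case: hu => en; move: d; rewrite en => d; first exact: dvdn_mull.
        by apply: dvdn_trans d _; apply: dvdn_mul.
      exact: d.
    rewrite Euclid_dvdM // => /orP [/q2|h]; [by left | by right; exists u].
- move=> /hP [pq hq]; case: hq => [->|[u uU d]].
    case: (U) Un mem4 => [//|u s] _ mem4; apply: (mem4 u) => //; first by rewrite inE eqxx.
    by apply: dvdn_mulr.
  by apply: (mem4 u) => //; apply: dvdn_mull.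
Qed.

Lemma cex_deg (K : nat) : (forall u, u \in U -> (bigOmega u + 2 <= K)%nat) -> (1 <= K)%nat ->
  (exists2 u, u \in U & (bigOmega u + 2)%nat = K) -> degD N c = K.
Proof.
move=> h1 K1 [u uU eK]; have u0 := U0 u uU.
have o2 : bigOmega 2 = 1%nat by apply: bigOmega_prime.
have o4 v : v \in U -> bigOmega (4 * v) = (bigOmega v + 2)%nat.
  by move=> vU; have v0 := U0 v vU; rewrite (_ : 4 = 2 ^ 2)%nat // bigOmega_mul // bigOmega_exp // addnC.
apply/eqP; rewrite eqn_leq /degD; apply/andP; split.
  apply/bigmax_leqP_seq => n _ /Cnz_neq0 /cex_support [->|->|[v vU]].
  - by rewrite /bigOmega big_nil.
  - by rewrite o2.
  have v0 := U0 v vU; have hv := h1 v vU; case=> ->.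
  - by lia.
  - by rewrite bigOmega_mul // o2; lia.
  - by rewrite o4.
rewrite -eK -(o4 u uU).
have i4 : (4 * u)%nat \in index_iota 1 N.+1.
  by rewrite mem_index_iota ltnS muln_gt0 u0 /=; exact: Ncex_ge.
by apply: (leq_bigmax_seq (4 * u)%nat) => //; apply: Cnz_true; apply: cex_neq0.
Qed.
End Example.

Lemma exists_odd_primes (m : nat) : exists s : seq nat,
  [/\ size s = m, uniq s & forall q, q \in s -> prime q /\ (2 < q)%nat].
Proof.
elim: m => [|m [s [es us hs]]]; first by exists [::].
have [p hp pp] := prime_above (maxn 2 (\max_(q <- s) q)).
exists (p :: s); split; first by rewrite /= es.
  rewrite /= us andbT; apply/negP => ps; move: hp; rewrite gtn_max => /andP [_].
  by rewrite ltnNge (leq_bigmax_seq p).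
move=> q; rewrite inE => /orP [/eqP ->|/hs //]; split => //.
by move: hp; rewrite gtn_max => /andP [].
Qed.

(** The set [U] carries both parameters. For d = 1 it is {2^(K-2)}; otherwise it consists of q^(K-2)
    for one odd prime q, which gives degree K, and of d - 2 further odd primes, whose terms have
    degree at most 3 <= K. As K >= 3, q really occurs, and oddness excludes the coincidences
    forbidden by [U4]. *)
Lemma exists_unbounded (d K : nat) : (1 <= d)%nat -> (3 <= K)%nat ->
  exists (N : nat) (c : nat -> C),
    [/\ inG N c, unrestricted N c, dimD N c = d, degD N c = K &
      forall alpha beta : R, 0 < alpha -> beta < Rpower 2 alpha - 1 -> ~ CompBounded N c alpha beta].
Proof.
move=> d1 K3.
suff [U [P [Un U0 Uu U4 [Pu eP hP [hd1 hd2]]]]] : exists U P : seq nat,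
  [/\ U != [::], forall u, u \in U -> (0 < u)%nat, uniq U,
   forall u v, u \in U -> v \in U -> (4 * u)%nat != v /\ (4 * u)%nat != (2 * v)%nat &
   [/\ uniq P, size P = d,
   forall q, (q \in P) <-> (prime q /\ (q = 2%nat \/ exists2 u, u \in U & (q %| u)%nat)) &
   (forall u, u \in U -> (bigOmega u + 2 <= K)%nat) /\ (exists2 u, u \in U & (bigOmega u + 2)%nat = K)]].
  have sU : 0 <= INR (size U) := pos_INR _.
  set eta := / (4 * (INR (size U) + 1)).
  have e0 : 0 < eta by apply: Rinv_0_lt_compat; lra.
  have e1 : eta * INR (size U) <= 1 / 4.
    rewrite /eta (_ : / (4 * (INR (size U) + 1)) * INR (size U) = INR (size U) / (4 * (INR (size U) + 1))); last by field; lra.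
    by apply/Rle_div_l; lra.
  exists (Ncex U), (cex eta U); split.
  - exact: cex_inG.
  - exact: cex_unrestricted.
  - by rewrite (cex_dim eta U U0 e0 Uu U4 P Un Pu hP).
  - by apply: cex_deg => //; apply: leq_trans K3.
  - exact: cex_unbounded.
case: d d1 => [//|[|d]] _.
  exists [:: 2 ^ (K - 2)]%nat, [:: 2%nat]; split => //.
  - by move=> u; rewrite inE => /eqP ->; rewrite expn_gt0.
  - have p0 : (0 < 2 ^ (K - 2))%nat by rewrite expn_gt0.
    by move=> u v; rewrite !inE => /eqP -> /eqP ->; split; apply/eqP; lia.
  split => //.
  - move=> q; rewrite inE; split; first by move/eqP ->; split => //; left.
    move=> [pq [->//|[u]]]; rewrite inE => /eqP ->; rewrite Euclid_dvdX // => /andP [].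
    by rewrite dvdn_prime2 // => /eqP ->.
  split; first by move=> u; rewrite inE => /eqP ->; rewrite bigOmega_exp //; lia.
  by exists (2 ^ (K - 2))%nat; rewrite ?inE // bigOmega_exp //; lia.
have [[|q0 s] [es us hs]] := exists_odd_primes d.+1; first by [].
have [pq0 q02] := hs q0 ltac:(by rewrite inE eqxx).
have hs' q : q \in s -> prime q /\ (2 < q)%nat by move=> qs; apply: hs; rewrite inE qs orbT.
have q00 := prime_gt0 pq0.
set u0 := (q0 ^ (K - 2))%nat.
have odd_big q : prime q -> (2 < q)%nat -> odd q.
  by move=> pq q2; case: (even_prime pq) => [e|//]; rewrite e in q2.
have oU u : u \in u0 :: s -> odd u.
  rewrite inE => /orP [/eqP ->|/hs' [pq q2]]; last exact: odd_big.
  by rewrite /u0 oddX odd_big // orbT.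
have u0s : u0 \notin s.
  apply/negP => h; have [pu _] := hs' _ h.
  have : (q0 %| u0)%nat by rewrite /u0 dvdn_exp //; lia.
  rewrite dvdn_prime2 // => /eqP e; move: us; rewrite /= {1}e h.
  by [].
exists (u0 :: s), [:: 2%nat, q0 & s]; split => //.
- by move=> u /oU; case: u.
- by rewrite /= u0s /=; move: us => /= /andP [].
- move=> u v /oU ou /oU ov; split; apply/eqP => e.
    by move: ov; rewrite -e oddM.
  by have : (2 * u)%nat = v by [lia]; move=> e2; move: ov; rewrite -e2 oddM.
split.
- rewrite cons_uniq us andbT; apply/negP => h; have [_] := hs _ h; by rewrite ltnn.
- by rewrite /= in es *; rewrite es.
- move=> q; split.
    rewrite inE => /orP [/eqP ->|]; first by split => //; left.
    rewrite inE => /orP [/eqP ->|qs].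
      by split => //; right; exists u0; rewrite ?inE ?eqxx // /u0 dvdn_exp //; lia.
    have [pq _] := hs' q qs; split => //; right; exists q => //.
    by rewrite inE qs orbT.
  move=> [pq [->|[u]]]; first by rewrite inE eqxx.
  rewrite inE => /orP [/eqP ->|us'].
    by rewrite /u0 Euclid_dvdX // => /andP []; rewrite dvdn_prime2 // => /eqP -> _; rewrite !inE eqxx orbT.
  by have [pu _] := hs' u us'; rewrite dvdn_prime2 // => /eqP ->; rewrite !inE us' !orbT.
split.
  move=> u; rewrite inE => /orP [/eqP ->|/hs' [pu _]]; first by rewrite bigOmega_exp //; lia.
  by rewrite bigOmega_prime //; lia.
by exists u0; [rewrite inE eqxx | rewrite bigOmega_exp //; lia].
Qed.

(** * Transference to the polydisc *)

Lemma Cgeom_sum (q : C) (Q : nat) : ((1 - q) * \csum_(0 <= j < Q) (q ^ j) = 1 - q ^ Q)%C.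
Proof.
elim: Q => [|Q IH]; first by rewrite big_geq //=; ring.
by rewrite big_nat_recr // Cmult_plus_distr_l IH Cpow_S; ring.
Qed.

Lemma Cgeom_sum_le (q : C) (Q : nat) : Cmod q = 1 -> q <> 1 ->
  Cmod (\csum_(0 <= j < Q) (q ^ j)) <= 2 / Cmod (1 - q).
Proof.
move=> q1 qn; have h : 0 < Cmod (1 - q).
  by apply/Cmod_gt_0 => e; apply: qn; transitivity (1 - (1 - q))%C; [ring | rewrite e; ring].
apply/Rle_div_r => //; rewrite Rmult_comm -Cmod_mult Cgeom_sum.
apply: Rle_trans (Cmod_triangle _ _) _; rewrite Cmod_1 Cmod_opp Cmod_pow q1 pow1; lra.
Qed.

Lemma Cexp_pow (w : C) (k : nat) : (Cexp w ^ k)%C = Cexp (RtoC (INR k) * w).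
Proof.
elim: k => [|k IH]; first by rewrite Cmult_0_l Cexp_0.
by rewrite Cpow_S IH -Cexp_plus S_INR RtoC_plus; congr Cexp; ring.
Qed.

Lemma Cexp_conj (w : C) : Cconj (Cexp w) = Cexp (Cconj w).
Proof. by case: w => x y; rewrite /Cconj /Cexp /= cos_neg sin_neg; congr pair; ring. Qed.

Lemma Cexp_i_neq1 (x : R) : 0 < Rabs x -> Rabs x <= 1 -> Cexp (Ci * RtoC x) <> 1.
Proof.
move=> x0 x1 h; have hs : sin x = 0.
  have := f_equal Im h; rewrite /Cexp /= !Rmult_0_l !Rmult_1_l Rminus_0_l Rplus_0_l Ropp_0 exp_0 Rmult_1_l => ->.
  by [].
have PI2 := PI2_3_2.
case: (Rcase_abs x) => xs.
- have := sin_gt_0 (- x); rewrite sin_neg hs; rewrite Rabs_left // in x0 x1; have := PI2; rewrite /PI2.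
  move=> ? hh; have := hh ltac:(lra) ltac:(lra); lra.
- have := sin_gt_0 x; rewrite hs; rewrite Rabs_right // in x0 x1; have := PI2; rewrite /PI2.
  move=> ? hh; have := hh ltac:(lra) ltac:(lra); lra.
Qed.

Lemma npow_ratio (a b : nat) (t : R) :
  (npow a (Ci * RtoC t) * Cconj (npow b (Ci * RtoC t)))%C = Cexp (Ci * RtoC (- (t * (ln (INR a) - ln (INR b))))).
Proof.
rewrite !npow_Cexp Cexp_conj -Cexp_plus; congr Cexp.
by rewrite /Ci /Cconj /Cmult /Copp /Cplus /RtoC /=; congr pair; ring.
Qed.

Lemma exists_small_step (I : Type) (s : seq I) (x : I -> R) :
  exists2 t, 0 < t & List.Forall (fun i => t * Rabs (x i) <= 1) s.
Proof.
elim: s => [|i s [t t0 ht]]; first by exists 1; [lra | constructor].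
exists (Rmin t (/ (Rabs (x i) + 1))).
  by apply: Rmin_glb_lt => //; apply: Rinv_0_lt_compat; have := Rabs_pos (x i); lra.
have X0 := Rabs_pos (x i); constructor.
  apply: Rle_trans (Rmult_le_compat_r _ _ _ X0 (Rmin_r _ _)) _.
  by rewrite Rmult_comm; apply/Rle_div_l; lra.
apply: List.Forall_impl ht => j hj; apply: Rle_trans hj.
by apply: Rmult_le_compat_r; [exact: Rabs_pos | exact: Rmin_l].
Qed.

(** Bohr's mean value along an arithmetic progression. The step is so small that the ratio attached
    to two distinct frequencies is never 1, so each off-diagonal term is a geometric sum bounded
    independently of [Q]. *)
Lemma mean_bound (I : Type) (s : seq I) (u : I -> C) (a b : I -> nat) (t : R) :
  (forall i, (0 < a i)%nat /\ (0 < b i)%nat) -> 0 < t ->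
  List.Forall (fun i => t * Rabs (ln (INR (a i)) - ln (INR (b i))) <= 1) s ->
  exists C0, forall Q, Cmod (\csum_(0 <= j < Q) (\csum_(i <- s) (u i *
      (npow (a i) (Ci * RtoC (INR j * t)) * Cconj (npow (b i) (Ci * RtoC (INR j * t))))))
     - RtoC (INR Q) * \csum_(i <- s | a i == b i) u i) <= C0.
Proof.
move=> h0 t0; elim: s => [|i s IH] hs.
  exists 0 => Q; rewrite big_nil; under eq_bigr do rewrite big_nil.
  by rewrite big1 // (_ : _ - _ = RtoC 0)%C ?Cmod_0; [lra | ring].
have hs1 := List.Forall_inv hs; have [C1 hC] := IH (List.Forall_inv_tail hs) => {IH}.
pose e Q := \csum_(0 <= j < Q) (npow (a i) (Ci * RtoC (INR j * t)) * Cconj (npow (b i) (Ci * RtoC (INR j * t)))).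
have [C2 hC2] : exists C2, forall Q, Cmod (e Q - (if a i == b i then RtoC (INR Q) else RtoC 0)) <= C2.
  pose q := Cexp (Ci * RtoC (- (t * (ln (INR (a i)) - ln (INR (b i)))))).
  have eq Q : e Q = \csum_(0 <= j < Q) (q ^ j).
    apply: eq_bigr => j _; rewrite npow_ratio /q Cexp_pow; congr Cexp.
    by rewrite !RtoC_opp !RtoC_mult; ring.
  case: eqP => hab.
    exists 0 => Q; rewrite eq /q hab Rminus_diag Rmult_0_r Ropp_0 Cmult_0_r Cexp_0.
    have -> : \csum_(0 <= j < Q) (RtoC 1 ^ j) = RtoC (INR Q).
      elim: Q => [|Q IH]; first by rewrite big_geq.
      by rewrite big_nat_recr // IH Cpow_1_l S_INR RtoC_plus.
    by rewrite (_ : _ - _ = RtoC 0)%C ?Cmod_0; [lra | ring].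
  exists (2 / Cmod (1 - q)) => Q; rewrite eq (_ : _ - 0 = \csum_(0 <= j < Q) (q ^ j))%C; last by ring.
  apply: Cgeom_sum_le; first by rewrite /q Cmod_Cexp /= !Rmult_0_l Rmult_1_l Rminus_0_l Ropp_0 exp_0.
  have [a0 b0] := h0 i.
  have nz : ln (INR (a i)) - ln (INR (b i)) <> 0.
    move=> h; apply: hab; apply: INR_eq; apply: ln_inv; [exact: INR_pos | exact: INR_pos | lra].
  have := Rabs_pos_lt _ nz => p.
  apply: Cexp_i_neq1; rewrite Rabs_Ropp Rabs_mult (Rabs_pos_eq t); try lra.
  by apply: Rmult_lt_0_compat.
exists (C1 + Cmod (u i) * C2) => Q.
have -> : (\csum_(0 <= j < Q) (\csum_(k <- i :: s) (u k *
      (npow (a k) (Ci * RtoC (INR j * t)) * Cconj (npow (b k) (Ci * RtoC (INR j * t))))))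
     - RtoC (INR Q) * \csum_(k <- i :: s | a k == b k) u k)%C =
   ((\csum_(0 <= j < Q) (\csum_(k <- s) (u k *
      (npow (a k) (Ci * RtoC (INR j * t)) * Cconj (npow (b k) (Ci * RtoC (INR j * t))))))
     - RtoC (INR Q) * \csum_(k <- s | a k == b k) u k)
    + u i * (e Q - (if a i == b i then RtoC (INR Q) else RtoC 0)))%C.
  have -> : \csum_(0 <= j < Q) (\csum_(k <- i :: s) (u k *
      (npow (a k) (Ci * RtoC (INR j * t)) * Cconj (npow (b k) (Ci * RtoC (INR j * t)))))) =
     (u i * e Q + \csum_(0 <= j < Q) (\csum_(k <- s) (u k *
      (npow (a k) (Ci * RtoC (INR j * t)) * Cconj (npow (b k) (Ci * RtoC (INR j * t)))))))%C.
    by rewrite /e csum_scal -big_split /=; apply: eq_bigr => j _; rewrite big_cons.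
  by rewrite big_cons; case: ifP => _; ring.
apply: Rle_trans (Cmod_triangle _ _) _; rewrite Cmod_mult; apply: Rplus_le_compat; first exact: hC.
by apply: Rmult_le_compat_l; [exact: Cmod_ge_0 | exact: hC2].
Qed.

Lemma mean_positive (I : Type) (s : seq I) (u : I -> C) (a b : I -> nat) :
  (forall i, (0 < a i)%nat /\ (0 < b i)%nat) ->
  (forall t : R, 0 <= Re (\csum_(i <- s) (u i * (npow (a i) (Ci * RtoC t) * Cconj (npow (b i) (Ci * RtoC t)))))) ->
  0 <= Re (\csum_(i <- s | a i == b i) u i).
Proof.
move=> h0 hp; have [t t0 ht] := exists_small_step _ s (fun i => ln (INR (a i)) - ln (INR (b i))).
have [C0 hC] := mean_bound _ s u a b t h0 t0 ht.
set m := \csum_(i <- s | a i == b i) u i in hC *.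
case: (Rle_lt_dec 0 (Re m)) => // hm; exfalso.
have key Q : INR Q * (- Re m) <= C0.
  have := hC Q; set w := \csum_(0 <= j < Q) _ => hw.
  have w0 : 0 <= Re w by rewrite /w Re_csum; apply: rsum_ge0 => j _; apply: hp.
  have := re_le_Cmod (w - RtoC (INR Q) * m); have := Rle_abs (Re (w - RtoC (INR Q) * m)).
  have rr (x y : C) (r : R) : Re (x - RtoC r * y) = Re x - r * Re y by case: x y => ? ? [? ?] /=; ring.
  rewrite rr.
  lra.
have [Q hQ] := INR_unbounded (C0 / - Re m).
have := key Q; have : C0 < INR Q * - Re m by apply/Rlt_div_l; lra.
lra.
Qed.

Lemma bigOmega_le (n : nat) : (0 < n)%nat -> (bigOmega n <= n)%nat.
Proof.
move: n; apply: nat_prime_ind; first by rewrite /bigOmega big_nil.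
move=> p m pp m0 IH; rewrite bigOmega_mul ?(prime_gt0 pp) // bigOmega_prime // add1n.
apply: leq_ltn_trans IH _; have := prime_gt1 pp; nia.
Qed.

Lemma logn_le_bigOmega (p n : nat) : prime p -> (0 < n)%nat -> (logn p n <= bigOmega n)%nat.
Proof.
move=> pp n0; case: (boolP (p \in primes n)) => hp; first by rewrite /bigOmega (big_rem p hp) /= leq_addr.
by move: hp; rewrite -logn_gt0 lt0n negbK => /eqP ->.
Qed.

Lemma ndiv_ratio (m p L : nat) : prime p -> (0 < m)%nat -> (0 < L)%nat -> (L <= logn p m)%nat ->
  (p %| m)%nat /\ INR L / INR L.+1 * INR (ndiv m) <= INR (ndiv (m %/ p)).
Proof.
move=> pp m0 L0 hL; have p0 := prime_gt0 pp.
have [k pk em] := pfactor_coprime pp m0; move: em hL; case: (logn p m) => [|v] em hL.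
  by move: hL; rewrite leqNgt L0.
have k0 : (0 < k)%nat by move: m0; rewrite em muln_gt0 => /andP [].
have mp : (m %/ p = k * p ^ v)%nat by rewrite em expnS mulnCA mulKn.
split; first by rewrite em expnS mulnCA dvdn_mulr.
rewrite mp em !ndiv_coprime ?expn_gt0 ?p0 // ?(coprimeXr _ _) 1?coprime_sym ?coprimeXl // !ndiv_pexp //.
rewrite !mult_INR; have kk := pos_INR (ndiv k).
have L1 := INRS_pos L; have v1 := INRS_pos v; have Lv := INR_leq _ _ hL.
apply: (Rmult_le_reg_r (INR L.+1)) => //.
rewrite (_ : INR L / INR L.+1 * (INR (ndiv k) * INR v.+2) * INR L.+1 = INR (ndiv k) * (INR L * INR v.+2)); last by field; lra.
rewrite Rmult_assoc; apply: Rmult_le_compat_l => //; rewrite (S_INR v.+1) (S_INR L); nra.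
Qed.

(** The divisors of [R0] are nearly stable under multiplication by [n] when the primes of [n] occur
    in [R0] to high powers: removing one prime factor costs at most the ratio L / (L+1). *)
Lemma ndiv_ratio_iter (R0 L k : nat) (P : seq nat) : (0 < R0)%nat -> (0 < L)%nat ->
  (forall p, p \in P -> (L + k <= logn p R0)%nat) ->
  forall n, (0 < n)%nat -> (forall p, prime p -> (p %| n)%nat -> p \in P) -> (bigOmega n <= k)%nat ->
  (n %| R0)%nat /\ (INR L / INR L.+1) ^ bigOmega n * INR (ndiv R0) <= INR (ndiv (R0 %/ n)).
Proof.
move=> R00 L0 hP; apply: nat_prime_ind.
  by move=> _ _; split; [exact: dvd1n | rewrite /bigOmega big_nil divn1 /=; lra].
move=> p m pp m0 IH hpm ho; have p0 := prime_gt0 pp.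
have eo : bigOmega (p * m) = (bigOmega m).+1 by rewrite bigOmega_mul // bigOmega_prime.
rewrite eo in ho *.
have [dm hm] := IH (fun q pq dq => hpm q pq (dvdn_mull _ dq)) (ltnW ho).
have pP : p \in P by apply: hpm => //; apply: dvdn_mulr.
have q0 : (0 < R0 %/ m)%nat by rewrite divn_gt0 // dvdn_leq.
have hl : (L <= logn p (R0 %/ m))%nat.
  rewrite logn_div //; have := hP p pP; have := logn_le_bigOmega p m pp m0; lia.
have [dp hr] := ndiv_ratio (R0 %/ m) p L pp q0 L0 hl.
split; first by rewrite -(divnK dm) dvdn_mul.
rewrite mulnC divnMA; apply: Rle_trans hr.
have r0 : 0 <= INR L / INR L.+1.
  by apply: Rmult_le_pos; [exact: pos_INR | apply: Rlt_le; apply: Rinv_0_lt_compat; exact: INRS_pos].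
by rewrite /= Rmult_assoc; apply: Rmult_le_compat_l.
Qed.

Lemma csum_count (I : Type) (s : seq I) (a : pred I) (y : C) :
  \csum_(m <- s) (if a m then y else RtoC 0) = (y * RtoC (INR (count a s)))%C.
Proof.
elim: s => [|m s IH]; first by rewrite big_nil /= Cmult_0_r.
rewrite big_cons IH; change (count a (m :: s)) with (a m + count a s)%nat.
rewrite plus_INR RtoC_plus; case: (a m) => /=; ring.
Qed.

Section Transfer.
Variables (N : nat) (c : nat -> C) (P : seq nat).
Hypothesis Pp : forall p, p \in P -> prime p.
Hypothesis cP : forall n, (0 < n)%nat -> (n <= N)%nat -> c n <> 0 ->
  forall p, prime p -> (p %| n)%nat -> p \in P.
Hypothesis N1 : (1 <= N)%nat.
Hypothesis line : forall t : R, 1 / 2 <= Re (Phi N c (fun n => npow n (Ci * RtoC t))).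

Variable z : nat -> C.
Hypothesis z1 : forall p, prime p -> Cmod (z p) = 1.

Let c' n := (c n - (if n == 1%nat then RtoC (1 / 2) else RtoC 0))%C.

Let Phi' (chi : nat -> C) : chi 1%nat = 1 -> (\csum_(1 <= n < N.+1) (c' n * chi n) = Phi N c chi - RtoC (1 / 2))%C.
Proof.
move=> h; have -> : \csum_(1 <= n < N.+1) (c' n * chi n) =
  (Phi N c chi + \csum_(1 <= n < N.+1) (RtoC (- (1 / 2)) * (dl 1 n * chi n)))%C.
  rewrite /Phi -big_split /=; apply: eq_bigr => n _; rewrite /c' /dl.
  by case: ifP => _; rewrite ?RtoC_opp; ring.
by rewrite -csum_scal csum_dl // h RtoC_opp; ring.
Qed.

Let zu n : (0 < n)%nat -> (Cconj (zchar z n) * zchar z n = 1)%C.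
Proof.
move: n; apply: nat_prime_ind; first by rewrite zchar1 /Cconj /RtoC /Cmult /=; congr pair; ring.
move=> p m pp m0 IH; rewrite zchar_mul ?(prime_gt0 pp) // zchar_prime // Cmult_conj.
rewrite (_ : Cconj (z p) * _ * _ = (z p * Cconj (z p)) * (Cconj (zchar z m) * zchar z m))%C; last by ring.
rewrite IH Cmult_1_r; have := Cmod2_conj (z p); rewrite z1 // pow1 => <-.
by [].
Qed.

(** The values on the line are weighted by |S(t)|^2, where S(t) is the sum of conj(z^kappa(m))
    m^(-it) over the divisors m of [R0], and averaged. Nonnegativity survives, while the frequency n
    acquires z^kappa(n) times the number of m such that m and m n divide [R0]. This stands in for
    Kronecker's approximation theorem. *)
Lemma fejer_positive (R0 : nat) : (0 < R0)%nat ->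
  0 <= Re (\csum_(1 <= n < N.+1) (c' n * zchar z n * RtoC (INR (count (fun m => (m * n)%nat \in divisors R0) (divisors R0))))).
Proof.
move=> R00; set D := divisors R0.
have D0 m : m \in D -> (0 < m)%nat by rewrite -dvdn_divisors // => /(dvdn_gt0 R00).
pose s := [seq (n, mm) | n <- index_iota 1 N.+1, mm <- [seq (m, m') | m <- D, m' <- D]].
(* [mean_positive] asks for positive frequencies at every index, so the default value at 0 is 1; on
   the indices that occur [g] is the identity. *)
pose g (i : nat) := if i is 0 then 1%nat else i.
pose u (i : nat * (nat * nat)) := (c' i.1 * (Cconj (zchar z i.2.1) * zchar z i.2.2))%C.
pose a (i : nat * (nat * nat)) := (g i.2.1 * g i.1)%nat.
pose b (i : nat * (nat * nat)) := g i.2.2.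
have g0 i : (0 < g i)%nat by case: i.
have gE i : (0 < i)%nat -> g i = i by case: i.
have := mean_positive _ s u a b.
have -> : \csum_(i <- s | a i == b i) u i = \csum_(1 <= n < N.+1) (c' n * zchar z n * RtoC (INR (count (fun m => (m * n)%nat \in D) D))).
  rewrite big_mkcond /= big_allpairs big_nat [RHS]big_nat; apply: eq_bigr => n /andP [n0 _].
  rewrite big_allpairs /=.
  transitivity (\csum_(m <- D) (if (m * n)%nat \in D then c' n * zchar z n else RtoC 0)%C); last first.
    exact: csum_count.
  rewrite big_seq [RHS]big_seq; apply: eq_bigr => m mD; have m0 := D0 m mD.
  rewrite -big_mkcond /= /a /b /u /= (gE m m0) (gE n n0).
  case: ifP => hmn.
    rewrite (big_rem _ hmn) /= gE ?muln_gt0 ?m0 // eqxx big1_seq ?Cplus_0_r.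
      by rewrite zchar_mul //; have := zu m m0 => h; transitivity (c' n * zchar z n * (Cconj (zchar z m) * zchar z m))%C; [ring | rewrite h; ring].
    move=> m' /andP [/eqP e]; rewrite mem_rem_uniq ?divisors_uniq // inE => /andP [ne m'D].
    by case/negP: ne; rewrite e gE // D0.
  rewrite big1_seq // => m' /andP [/eqP e m'D]; move: hmn; rewrite e gE ?D0 //.
  by rewrite m'D.
apply; first by move=> i; rewrite /a /b muln_gt0 !g0.
move=> t; set chi := fun n => npow n (Ci * RtoC t).
set S := \csum_(m <- D) (Cconj (zchar z m) * chi m).
have -> : \csum_(i <- s) (u i * (chi (a i) * Cconj (chi (b i)))) = ((Phi N c chi - RtoC (1 / 2)) * RtoC (Cmod S ^ 2))%C.
  rewrite -Phi'; last exact: npow1.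
  rewrite Cmod2_conj csum_scalr big_allpairs big_nat [RHS]big_nat; apply: eq_bigr => n /andP [n0 _].
  rewrite big_allpairs /= /S Cconj_csum csum_scalr csum_scal.
  rewrite big_seq [RHS]big_seq; apply: eq_bigr => m mD; have m0 := D0 m mD.
  rewrite !csum_scal; rewrite big_seq [RHS]big_seq; apply: eq_bigr => m' m'D; have m'0 := D0 m' m'D.
  rewrite /u /a /b /= !gE // /chi npow_mul // !Cmult_conj Cconj_conj; ring.
have h := line t; rewrite -/chi in h.
have -> : Re ((Phi N c chi - RtoC (1 / 2)) * RtoC (Cmod S ^ 2)) = (Re (Phi N c chi) - 1 / 2) * Cmod S ^ 2.
  have rr (x : C) (r : R) : Re ((x - RtoC (1 / 2)) * RtoC r) = (Re x - 1 / 2) * r by case: x => x y /=; ring.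
  exact: rr.
by apply: Rmult_le_pos; [lra | exact: pow2_ge_0].
Qed.

(** Divided by d(R0), the Fejer coefficients tend to 1 as [L] grows, uniformly for the finitely many
    n. If the value [Y] were negative, an [L] above N (W+1) / |Y| would contradict
    [fejer_positive]. *)
Lemma transfer_torus : 1 / 2 <= Re (Phi N c (zchar z)).
Proof.
set W := \rsum_(1 <= n < N.+1) Cmod (c' n).
have W0 : 0 <= W by apply: rsum_ge0 => n _; apply: Cmod_ge_0.
suff : 0 <= Re (\csum_(1 <= n < N.+1) (c' n * zchar z n)).
  rewrite Phi'; last exact: zchar1.
  by rewrite (_ : Re (_ - _) = Re (Phi N c (zchar z)) - 1 / 2) //; lra.
set Y := Re _; case: (Rle_lt_dec 0 Y) => // Yn; exfalso.
have [L hL] := INR_unbounded (INR N * (W + 1) / - Y).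
have L0 : (0 < L)%nat.
  case: L hL => // h; have : 0 <= INR N * (W + 1) / - Y by apply: Rmult_le_pos; [apply: Rmult_le_pos; [exact: pos_INR | lra] | apply: Rlt_le; apply: Rinv_0_lt_compat; lra].
  by rewrite /= in h; lra.
set R0 := ((\prod_(p <- P) p) ^ (L + N))%nat.
have P0 : (0 < \prod_(p <- P) p)%nat.
  by rewrite big_seq; elim/big_ind: _ => // [x y x0 y0|p /Pp /prime_gt0 //]; rewrite muln_gt0 x0.
have R00 : (0 < R0)%nat by rewrite expn_gt0 P0.
have hlog p : p \in P -> (L + N <= logn p R0)%nat.
  move=> pP; rewrite -pfactor_dvdn // ?Pp //; apply: dvdn_exp2r.
  by rewrite (big_rem p pP) dvdn_mulr.
have T0 : 0 < INR (ndiv R0) by apply: INR_pos; apply: ndiv_gt0.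
have := fejer_positive R0 R00; set D := divisors R0.
pose tau n := count (fun m => (m * n)%nat \in D) D; rewrite -/(ndiv R0) => h.
have ratio n : (0 < n)%nat -> (n <= N)%nat -> c' n <> 0 ->
   (1 - INR N / INR L) * INR (ndiv R0) <= INR (tau n) <= INR (ndiv R0).
  move=> n0 nN cn; split; last by apply: INR_leq; apply: count_size.
  have hpn : forall p, prime p -> (p %| n)%nat -> p \in P.
    move=> p pp pn; case: (eqVneq n 1%nat) => [e|n1]; first by move: pn pp; rewrite e dvdn1 => /eqP ->.
    apply: (cP n) => //; move: cn; rewrite /c' (negbTE n1).
    by rewrite (_ : c n - 0 = c n)%C //; ring.
  have [dn hr] := ndiv_ratio_iter R0 L N P R00 L0 hlog n n0 hpn (leq_trans (bigOmega_le n n0) nN).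
  apply: Rle_trans (_ : INR (ndiv (R0 %/ n)) <= _).
    apply: Rle_trans hr; apply: Rmult_le_compat_r; first lra.
    have L1 := INR_pos L L0.
    have e : 0 <= / INR L.+1 <= 1.
      split; first by apply: Rlt_le; apply: Rinv_0_lt_compat; exact: INRS_pos.
      by rewrite -Rinv_1; apply: Rinv_le_contravar; [lra | exact: INR_ge1].
    have -> : INR L / INR L.+1 = 1 - / INR L.+1 by rewrite S_INR; field; lra.
    have [hp _] := pow_contract _ (bigOmega n) e; apply: Rle_trans hp.
    have : INR (bigOmega n) * / INR L.+1 <= INR N * / INR L; last by rewrite /Rdiv; lra.
    apply: Rmult_le_compat; [exact: pos_INR | lra | |].
      by apply: INR_leq; apply: leq_trans nN; apply: bigOmega_le.
    by apply: Rinv_le_contravar => //; rewrite S_INR; lra.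
  apply: INR_leq; rewrite /tau -size_filter; apply: uniq_leq_size; first exact: divisors_uniq.
  have q0 : (0 < R0 %/ n)%nat by rewrite divn_gt0 // dvdn_leq.
  move=> m; rewrite mem_filter -!dvdn_divisors // => dm.
  have mn : (m * n %| R0)%nat by rewrite -(divnK dn) dvdn_mul.
  by rewrite mn /=; apply: dvdn_trans mn; apply: dvdn_mulr.
have L1 := INR_pos L L0; have NL : 0 <= INR N / INR L.
  by apply: Rmult_le_pos; [exact: pos_INR | apply: Rlt_le; apply: Rinv_0_lt_compat].
set V := Re _ in h.
have e : V - INR (ndiv R0) * Y = Re (\csum_(1 <= n < N.+1) (c' n * zchar z n * RtoC (INR (tau n) - INR (ndiv R0)))).
  rewrite /V /Y.
  have rr x (r : R) : r * Re x = Re (RtoC r * x)%C by case: x => x y /=; ring.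
  rewrite rr; set v := (_ * _)%C; set w := \csum_(1 <= n < N.+1) _.
  suff -> : w = (v + \csum_(1 <= n < N.+1) (c' n * zchar z n * RtoC (INR (tau n) - INR (ndiv R0))))%C.
    have ra (x y : C) : Re (x + y) - Re x = Re y by case: x y => ? ? [? ?] /=; ring.
    exact: ra.
  by rewrite /v /w csum_scal -big_split /=; apply: eq_bigr => n _; rewrite RtoC_minus -/(tau n); ring.
have hd : V - INR (ndiv R0) * Y <= W * (INR N / INR L * INR (ndiv R0)).
  rewrite e; apply: Rle_trans (Rle_abs _) _; apply: Rle_trans (re_le_Cmod _) _.
  apply: Rle_trans (Cmod_csum _ _ _ _) _; rewrite /W rsum_scalr; apply: rsum_le_nat => n /andP [n0 nN].
  rewrite !Cmod_mult Rmult_assoc; have [->|cn] := Ceq_dec (c' n) 0; first by rewrite Cmod_0 !Rmult_0_l; lra.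
  apply: Rmult_le_compat_l; first exact: Cmod_ge_0.
  have zn : Cmod (zchar z n) <= 1 by apply: zchar_mod_le => // p pp; rewrite z1 //; lra.
  have [t1 t2] := ratio n n0 nN cn.
  rewrite Cmod_R -Rabs_Ropp Rabs_pos_eq; last lra.
  have := Cmod_ge_0 (zchar z n); nra.
have h2 : - Y <= W * (INR N / INR L).
  apply: (Rmult_le_reg_r (INR (ndiv R0))) => //; nra.
have h3 : INR N * (W + 1) < INR L * - Y by apply/Rlt_div_l; lra.
have h4 : INR L * - Y <= W * INR N.
  have := Rmult_le_compat_l _ _ _ (Rlt_le _ _ L1) h2.
  by rewrite (_ : INR L * (W * (INR N / INR L)) = W * INR N) //; field; lra.
have := pos_INR N; lra.
Qed.
End Transfer.

(** * Quadratic polynomials on the polydisc *)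

Lemma Re_RtoC_mult (a : R) (v : C) : Re (RtoC a * v) = a * Re v.
Proof. by case: v => v1 v2 /=; ring. Qed.

Lemma Re_plus (x y : C) : Re (x + y) = Re x + Re y.
Proof. by []. Qed.

Lemma Re_Cmult (x y : C) : Re (x * y) = Re x * Re y - Im x * Im y.
Proof. by []. Qed.

Lemma Cexp_RtoC (x : R) : Cexp (RtoC x) = RtoC (exp x).
Proof. by rewrite /Cexp /= cos_0 sin_0 Rmult_1_r Rmult_0_r. Qed.

(** The hypothesis concerns the open half-plane; uniform continuity of the polynomial up to Re s = 0
    carries it to the boundary, with non-strict inequality. *)
Lemma inG_line (N : nat) (c : nat -> C) : inG N c ->
  forall t : R, 1 / 2 <= Re (Phi N c (fun n => npow n (Ci * RtoC t))).
Proof.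
move=> hG t; set S := \rsum_(1 <= n < N.+1) (Cmod (c n) * ln (INR n)).
have S0 : 0 <= S by apply: rsum_ge0 => n _; apply: Rmult_le_pos; [exact: Cmod_ge_0 | exact: ln_INR_ge0].
apply: le_epsilon => e e0; set d := e / (S + 1).
have d0 : 0 < d by apply: Rdiv_lt_0_compat; lra.
pose s := (RtoC d + Ci * RtoC t)%C.
have s0 : 0 < Re s by rewrite /s /=; lra.
have := hG s s0; rewrite dpoly_Phi => h.
suff hd : Cmod (Phi N c (fun n => npow n (Ci * RtoC t)) - Phi N c (fun n => npow n s)) <= e.
  have := re_le_Cmod (Phi N c (fun n => npow n (Ci * RtoC t)) - Phi N c (fun n => npow n s)).
  set y := Phi _ _ _ in h hd *; set x := Phi _ _ _ in h hd *.
  have := Rle_abs (- Re (x - y)); rewrite Rabs_Ropp (_ : Re (x - y) = Re x - Re y) //; lra.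
have -> : (Phi N c (fun n => npow n (Ci * RtoC t)) - Phi N c (fun n => npow n s))%C =
   \csum_(1 <= n < N.+1) (c n * (npow n (Ci * RtoC t) - npow n s)).
  set w := (RHS); suff -> : Phi N c (fun n => npow n (Ci * RtoC t)) = (Phi N c (fun n => npow n s) + w)%C by ring.
  by rewrite /Phi /w -big_split /=; apply: eq_bigr => n _; ring.
apply: Rle_trans (Cmod_csum _ _ _ _) _; apply: Rle_trans (_ : S * d <= _); last first.
  by rewrite /d (_ : S * (e / (S + 1)) = e * (S / (S + 1))); [rewrite -[X in _ <= X]Rmult_1_r; apply: Rmult_le_compat_l; [lra | apply/Rle_div_l; lra] | field; lra].
rewrite /S rsum_scalr; apply: rsum_le_nat => n /andP [n0 _].
rewrite Cmod_mult Rmult_assoc; apply: Rmult_le_compat_l; first exact: Cmod_ge_0.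
have -> : (npow n (Ci * RtoC t) - npow n s = npow n (Ci * RtoC t) * RtoC (1 - exp (- (ln (INR n) * d))))%C.
  have -> : npow n s = (npow n (Ci * RtoC t) * RtoC (exp (- (ln (INR n) * d))))%C.
    rewrite !npow_Cexp (_ : RtoC (exp _) = Cexp (- (RtoC (ln (INR n)) * RtoC d))%C).
      by rewrite -Cexp_plus; congr Cexp; rewrite /s; ring.
    by rewrite -RtoC_mult -RtoC_opp Cexp_RtoC.
  by rewrite RtoC_minus; ring.
rewrite Cmod_mult Cmod_npow Cmod_R.
have -> : - Re (Ci * RtoC t) = 0 by rewrite /=; ring.
rewrite Rpower_O ?Rmult_1_l; last exact: INR_pos.
have l0 := ln_INR_ge0 n; have h1 := exp_ineq1_le (- (ln (INR n) * d)).
have h2 : exp (- (ln (INR n) * d)) <= 1 by rewrite -exp_0; apply: exp_le; nra.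
rewrite Rabs_pos_eq; lra.
Qed.

Definition upd (z : nat -> C) (p : nat) (zeta : C) (q : nat) : C := if q == p then zeta else z q.

Lemma zchar_ext (z w : nat -> C) (n : nat) : (0 < n)%nat ->
  (forall q, prime q -> (q %| n)%nat -> z q = w q) -> zchar z n = zchar w n.
Proof.
move=> n0 h; rewrite /zchar big_seq [RHS]big_seq; apply: eq_bigr => q.
by rewrite mem_primes => /and3P [pq _ d]; rewrite h.
Qed.

Lemma zchar_upd (z : nat -> C) (p : nat) (zeta : C) (n : nat) : prime p -> (0 < n)%nat ->
  zchar (upd z p zeta) n = (zeta ^ logn p n * zchar (upd z p 1) n)%C.
Proof.
move=> pp; move: n; apply: (cmult_eq (zchar _) (fun n => (zeta ^ logn p n * zchar (upd z p 1) n)%C)).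
- exact: zchar_cmult.
- split; first by rewrite logn1 zchar1 Cmult_1_l.
  by move=> m n m0 n0; rewrite lognM // Cpow_D zchar_mul //; ring.
- move=> q pq; rewrite !zchar_prime // logn_prime // /upd.
  case: (eqVneq q p) => _; first by rewrite Cpow_1_r Cmult_1_r.
  by rewrite Cmult_1_l.
Qed.

Definition inDisc (z : nat -> C) : Prop := forall p, prime p -> Cmod (z p) <= 1.

Lemma inDisc_upd (z : nat -> C) (p : nat) (zeta : C) : inDisc z -> Cmod zeta <= 1 -> inDisc (upd z p zeta).
Proof. by move=> h hz q pq; rewrite /upd; case: ifP => // _; apply: h. Qed.

(* Harnack's inequality for quadratic polynomials: the Poisson kernel is replaced by a kernel on the
   sixth roots of unity that is still bounded below by [(1 - r) / 2]. *)
Lemma harnack_quadratic (a b q : C) :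
  (forall zeta, Cmod zeta = 1 -> 0 <= Re (a + zeta * b + zeta * zeta * q)) ->
  forall zeta, Cmod zeta <= 1 -> (1 - Cmod zeta) / 2 * Re a <= Re (a + zeta * b + zeta * zeta * q).
Proof.
move=> h zeta z1; set r := Cmod zeta in z1 *; have r0 : 0 <= r by apply: Cmod_ge_0.
have [u [u1 eu]] : exists u, Cmod u = 1 /\ zeta = (RtoC r * u)%C.
  case: (Req_dec r 0) => hr.
    by exists 1; rewrite Cmod_1 hr; split => //; rewrite (Cmod_eq_0 _ hr); ring.
  exists (RtoC (/ r) * zeta)%C; split.
    rewrite Cmod_mult Cmod_R -/r Rabs_pos_eq; first by field.
    by apply: Rlt_le; apply: Rinv_0_lt_compat; lra.
  by rewrite Cmult_assoc -RtoC_mult Rinv_r // Cmult_1_l.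
set s3 := sqrt 3; have s3s : s3 * s3 = 3 by apply: sqrt_sqrt; lra.
have hw x y : x * x + y * y = 1 -> 0 <= Re (a + (x, y) * (u * b) + (x, y) * (x, y) * (u * u * q)).
  move=> hxy; have := h ((x, y) * u)%C; rewrite Cmod_mult u1.
  have -> : Cmod (x, y) = 1 by rewrite /Cmod /= !Rmult_1_r hxy sqrt_1.
  move=> hh; apply: Rle_trans (hh ltac:(lra)) _; right; congr Re; ring.
set B := (u * b)%C in hw; set Q := (u * u * q)%C in hw.
have -> : Re (a + zeta * b + zeta * zeta * q) = Re a + r * Re B + r ^ 2 * Re Q.
  rewrite eu (_ : a + _ + _ = a + RtoC r * B + RtoC (r ^ 2) * Q)%C; last by rewrite /B /Q RtoC_pow /=; ring.
  by rewrite !Re_plus !Re_RtoC_mult.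
have hw' x y : x * x + y * y = 1 ->
  0 <= Re a + (x * Re B - y * Im B) + ((x * x - y * y) * Re Q - (2 * x * y) * Im Q).
  move=> hxy; apply: Rle_trans (hw x y hxy) _; right.
  by rewrite !Re_plus !Re_Cmult /=; ring.
have w0 := hw' 1 0 ltac:(lra); have w3 := hw' (-1) 0 ltac:(lra).
have w1 := hw' (1 / 2) (s3 / 2) ltac:(nra); have w5 := hw' (1 / 2) (- (s3 / 2)) ltac:(nra).
have w2 := hw' (- (1 / 2)) (s3 / 2) ltac:(nra); have w4 := hw' (- (1 / 2)) (- (s3 / 2)) ltac:(nra).
have e15 : 0 <= 2 * Re a + Re B - Re Q by nra.
have e24 : 0 <= 2 * Re a - Re B - Re Q by nra.
have e0 : 0 <= Re a + Re B + Re Q by lra.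
have e3 : 0 <= Re a - Re B + Re Q by lra.
(* [k0], ..., [k3] state that 1 + 2 r cos x + 2 r^2 cos 2x + s cos 3x - m is nonnegative at 0, pi/3,
   2 pi/3 and pi. On the sixth roots of unity cos 3x is orthogonal to polynomials of degree two, so
   [s] is free and is chosen for this nonnegativity. *)
set s := (3 * r ^ 2 - r) / 2; set m := (1 - r) / 2.
have k0 : 0 <= 1 + 2 * r + 2 * r ^ 2 + s - m by rewrite /s /m; nra.
have k1 : 0 <= 1 + r - r ^ 2 - s - m by rewrite /s /m; nra.
have k2 : 0 <= 1 - r - r ^ 2 + s - m by rewrite /s /m; nra.
have k3 : 0 <= 1 - 2 * r + 2 * r ^ 2 - s - m by rewrite /s /m; nra.
have := Rmult_le_pos _ _ k0 e0; have := Rmult_le_pos _ _ k1 e15.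
have := Rmult_le_pos _ _ k2 e24; have := Rmult_le_pos _ _ k3 e3.
nra.
Qed.

Lemma Cmod_le_Re_axis (a b : C) : (forall zeta, Cmod zeta = 1 -> 0 <= Re (a + zeta * b)) -> Cmod b / 2 <= Re a.
Proof.
move=> h; have h1 := h 1 Cmod_1; have h2 := h (- (1))%C ltac:(by rewrite Cmod_opp Cmod_1).
have h3 := h Ci Cmod_Ci; have h4 := h (- Ci)%C ltac:(by rewrite Cmod_opp Cmod_Ci).
have t := Cmod_Re_Im b; case: a b h1 h2 h3 h4 t {h} => a1 a2 [b1 b2] /=.
by rewrite /Rabs; case: Rcase_abs => _; case: Rcase_abs => _; lra.
Qed.

(** Adding the inequalities at zeta and - zeta removes [b]; zeta^2 then runs through the fourth
    roots of unity. *)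
Lemma Cmod_le_Re_diag (a b q : C) : (forall zeta, Cmod zeta = 1 -> 0 <= Re (a + zeta * b + zeta * zeta * q)) ->
  Cmod q / 2 <= Re a.
Proof.
move=> h; set s2 := sqrt (/ 2); have s2s : s2 * s2 = / 2 by apply: sqrt_sqrt; lra.
have hw x y : x * x + y * y = 1 -> 0 <= Re a + ((x * x - y * y) * Re q - (2 * x * y) * Im q).
  move=> hxy.
  have m1 : Cmod (x, y) = 1 by rewrite /Cmod /= !Rmult_1_r hxy sqrt_1.
  have m2 : Cmod (- x, - y) = 1 by rewrite /Cmod /= !Rmult_1_r (_ : _ + _ = 1) ?sqrt_1 //; lra.
  have := h _ m1; have := h _ m2; rewrite !Re_plus !Re_Cmult /=; lra.
have h1 := hw 1 0 ltac:(lra); have h2 := hw 0 1 ltac:(lra).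
have h3 := hw s2 s2 ltac:(lra); have h4 := hw s2 (- s2) ltac:(lra).
have t := Cmod_Re_Im q.
have h3' : 0 <= Re a - Im q by nra.
have h4' : 0 <= Re a + Im q by nra.
by move: t; rewrite /Rabs; case: Rcase_abs => _; case: Rcase_abs => _; lra.
Qed.

Lemma Re_shift (s x y : C) (r : R) : Re (s - RtoC r + x + y) = Re (s + x + y) - r.
Proof. by case: s x y => ? ? [? ?] [? ?] /=; ring. Qed.

(** The steps are - t^2 + i t and - t^2 - i t in the frame directed by zeta: tangential of size t,
    bent inward by t^2 to stay in the disc, so that their sum is only of second order. *)
Lemma tangent_points (zeta : C) (t : R) : Cmod zeta <= 1 -> 0 <= t <= 1 / 2 ->
  exists v w, [/\ Cmod (zeta + v) <= 1, Cmod (zeta + w) <= 1, t <= Cmod v <= 2 * t, t <= Cmod w <= 2 * t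
    & Cmod (v + w) = 2 * t ^ 2].
Proof.
move=> z1 ht; set r := Cmod zeta in z1 *; have r0 : 0 <= r by apply: Cmod_ge_0.
have [u [u1 eu]] : exists u, Cmod u = 1 /\ zeta = (RtoC r * u)%C.
  case: (Req_dec r 0) => hr.
    by exists 1; rewrite Cmod_1 hr; split => //; rewrite (Cmod_eq_0 _ hr); ring.
  exists (RtoC (/ r) * zeta)%C; split.
    rewrite Cmod_mult Cmod_R -/r Rabs_pos_eq; first by field.
    by apply: Rlt_le; apply: Rinv_0_lt_compat; lra.
  by rewrite Cmult_assoc -RtoC_mult Rinv_r // Cmult_1_l.
have cm x y : Cmod (x, y) = sqrt (x ^ 2 + y ^ 2) by [].
have t2 : t ^ 2 <= t / 2 by nra.
have inside y : y ^ 2 = t ^ 2 -> Cmod (zeta + ((- t ^ 2)%R, y) * u) <= 1.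
  move=> hy; rewrite eu (_ : _ + _ = ((r - t ^ 2)%R, y) * u)%C; last first.
    by rewrite -Cmult_plus_distr_r; congr Cmult; rewrite /Cplus /RtoC /=; congr pair; ring.
  rewrite Cmod_mult u1 Rmult_1_r cm -sqrt_1; apply: sqrt_le_1_alt; rewrite hy.
  have h0 : 0 <= t ^ 2 * (1 - t ^ 2) by nra.
  have h1 : 0 <= (1 - r) * (1 + r - 2 * t ^ 2) by apply: Rmult_le_pos; nra.
  have : (r - t ^ 2) ^ 2 + t ^ 2 = 1 - (1 - r) * (1 + r - 2 * t ^ 2) - t ^ 2 * (1 - t ^ 2) by ring.
  lra.
have size y : y ^ 2 = t ^ 2 -> t <= Cmod (((- t ^ 2)%R, y) * u) <= 2 * t.
  move=> hy; rewrite Cmod_mult u1 Rmult_1_r cm hy; split.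
    by rewrite -{1}(sqrt_pow2 t); [apply: sqrt_le_1_alt; nra | lra].
  by rewrite -[X in _ <= X](sqrt_pow2 (2 * t)); [apply: sqrt_le_1_alt; nra | lra].
have ht2 : (- t) ^ 2 = t ^ 2 by ring.
exists (((- t ^ 2)%R, t) * u)%C, (((- t ^ 2)%R, (- t)%R) * u)%C; split.
- exact: inside.
- exact: inside.
- exact: size.
- exact: size.
rewrite -Cmult_plus_distr_r Cmod_mult u1 Rmult_1_r.
have -> : (((- t ^ 2)%R, t) + ((- t ^ 2)%R, (- t)%R))%C = RtoC (- (2 * t ^ 2)).
  by rewrite /Cplus /RtoC /=; congr pair; ring.
by rewrite Cmod_R Rabs_Ropp Rabs_pos_eq //; nra.
Qed.

(* The points [zeta + v] for the three cube roots of unity [v] times [- zeta/|zeta|] stay in the disc,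
   and the squares of the [v] again run over cube roots of unity. *)
Lemma derivative_lower (a b q zeta : C) (d : R) : Cmod zeta <= 1 -> d <= Re a ->
  (forall x, Cmod x <= 1 -> 0 <= Re (a + x * b + x * x * q)) ->
  d / 3 <= Re (a + zeta * b + zeta * zeta * q) + Cmod (b + 2 * zeta * q).
Proof.
move=> z1 da h; set r := Cmod zeta in z1 *; have r0 : 0 <= r by apply: Cmod_ge_0.
have [u [u1 eu]] : exists u, Cmod u = 1 /\ zeta = (RtoC r * u)%C.
  case: (Req_dec r 0) => hr.
    by exists 1; rewrite Cmod_1 hr; split => //; rewrite (Cmod_eq_0 _ hr); ring.
  exists (RtoC (/ r) * zeta)%C; split.
    rewrite Cmod_mult Cmod_R -/r Rabs_pos_eq; first by field.
    by apply: Rlt_le; apply: Rinv_0_lt_compat; lra.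
  by rewrite Cmult_assoc -RtoC_mult Rinv_r // Cmult_1_l.
set s3 := sqrt 3; have s3s : s3 * s3 = 3 by apply: sqrt_sqrt; lra.
set g := Re (a + zeta * b + zeta * zeta * q); set D := (b + 2 * zeta * q)%C.
set Q := (u * u * q)%C.
have Qm : Cmod Q = Cmod q by rewrite /Q !Cmod_mult u1; ring.
have cm x y : Cmod (x, y) = sqrt (x ^ 2 + y ^ 2) by [].
have key x y : x ^ 2 + y ^ 2 = 1 -> (r + x) ^ 2 + y ^ 2 <= 1 ->
  0 <= g + Cmod D + ((x * x - y * y) * Re Q - 2 * x * y * Im Q).
  move=> h1 h2; set v := ((x, y) * u)%C.
  have vm : Cmod v = 1 by rewrite /v Cmod_mult u1 cm h1 sqrt_1; ring.
  have zv : Cmod (zeta + v) <= 1.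
    rewrite eu /v (_ : _ + _ = ((r + x)%R, y) * u)%C; last first.
      by rewrite -Cmult_plus_distr_r; congr Cmult; rewrite /Cplus /RtoC /=; congr pair; ring.
    by rewrite Cmod_mult u1 Rmult_1_r cm -sqrt_1; apply: sqrt_le_1_alt.
  have e1 : Re (a + (zeta + v) * b + (zeta + v) * (zeta + v) * q) = g + Re (v * D) + Re ((x, y) * (x, y) * Q).
    rewrite (_ : a + _ + _ = (a + zeta * b + zeta * zeta * q) + v * D + (x, y) * (x, y) * Q)%C; last by rewrite /D /v /Q; ring.
    by [].
  have rq (w : C) : Re ((x, y) * (x, y) * w) = (x * x - y * y) * Re w - 2 * x * y * Im w by case: w => w1 w2 /=; ring.
  have := h _ zv; rewrite e1 rq.
  have := re_le_Cmod (v * D); rewrite Cmod_mult vm Rmult_1_l; have := Rle_abs (Re (v * D)).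
  lra.
have k1 := key (-1) 0 ltac:(lra) ltac:(nra).
have k2 := key (- (1 / 2)) (s3 / 2) ltac:(nra) ltac:(nra).
have k3 := key (- (1 / 2)) (- (s3 / 2)) ltac:(nra) ltac:(nra).
have G0 : 0 <= g by apply: h.
have D0 := Cmod_ge_0 D.
set e := g + Cmod D in k1 k2 k3 *.
have e0 : 0 <= e by rewrite /e; lra.
have {k1} k1 : - Re Q <= e by lra.
have {k2} k2 : Re Q / 2 - s3 / 2 * Im Q <= e by nra.
have {k3} k3 : Re Q / 2 + s3 / 2 * Im Q <= e by nra.
have qm : Cmod q <= 2 * e.
  rewrite -Qm; have -> : Cmod Q = sqrt (Re Q ^ 2 + Im Q ^ 2) by [].
  rewrite -(sqrt_pow2 (2 * e)); last lra.
  apply: sqrt_le_1_alt; set x := Re Q in k1 k2 k3 *; set y := Im Q in k2 k3 *.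
  have p1 : 0 <= (e - (x / 2 - s3 / 2 * y)) * (e - (x / 2 + s3 / 2 * y)) by apply: Rmult_le_pos; lra.
  have p2 : 0 <= (e + x) * (e - x / 2) by apply: Rmult_le_pos; lra.
  have e1 : (e - (x / 2 - s3 / 2 * y)) * (e - (x / 2 + s3 / 2 * y)) = e ^ 2 - e * x + x ^ 2 / 4 - (s3 * s3) * y ^ 2 / 4 by field.
  rewrite e1 s3s in p1.
  nra.
have : Re a = g - Re (zeta * D) + Re (zeta * zeta * q).
  have -> : a = (a + zeta * b + zeta * zeta * q - zeta * D + zeta * zeta * q)%C by rewrite /D; ring.
  by [].
have := re_le_Cmod (zeta * D); have := re_le_Cmod (zeta * zeta * q); rewrite !Cmod_mult -/r.
have := Rle_abs (- Re (zeta * D)); have := Rle_abs (Re (zeta * zeta * q)); rewrite Rabs_Ropp.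
have q0 := Cmod_ge_0 q.
have : r * Cmod D <= Cmod D by nra.
have rr : r * r <= 1 by nra.
have := Rmult_le_compat_r _ _ _ q0 rr.
rewrite /e in qm *; lra.
Qed.

Section Quad.
Variables (N : nat) (c : nat -> C).
Hypothesis c2 : forall n, (0 < n)%nat -> (n <= N)%nat -> c n <> 0 -> (bigOmega n <= 2)%nat.
Hypothesis hG : inG N c.

Let W := l1norm N c.
Let P := cprimes N c.
Let F (z : nat -> C) := Phi N c (zchar z).

(** The coefficient of z_p^j in the Bohr lift, as a function of the other variables: setting z_p = 1
    leaves the cofactor of z_p^j. *)
Definition slice (p j : nat) (z : nat -> C) : C :=
  \csum_(1 <= n < N.+1 | logn p n == j) (c n * zchar (upd z p 1) n).

Let csum_nz (Q : pred nat) (f g : nat -> C) :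
  (forall n, (0 < n)%nat -> (n <= N)%nat -> c n <> 0 -> Q n -> f n = g n) ->
  \csum_(1 <= n < N.+1 | Q n) (c n * f n) = \csum_(1 <= n < N.+1 | Q n) (c n * g n).
Proof.
move=> h; rewrite big_nat_cond [RHS]big_nat_cond; apply: eq_bigr => n /andP [/andP [n0 nN] qn].
have [->|cn] := Ceq_dec (c n) 0; first by rewrite !Cmult_0_l.
by rewrite h.
Qed.

Lemma Phi_slice (p : nat) (z : nat -> C) (zeta : C) : prime p ->
  F (upd z p zeta) = (slice p 0 z + zeta * slice p 1 z + zeta * zeta * slice p 2 z)%C.
Proof.
move=> pp; rewrite /F /Phi (bigID (fun n => logn p n == 0%nat)) /=.
rewrite [X in (_ + X)%C](bigID (fun n => logn p n == 1%nat)) /= Cplus_assoc; congr (_ + _ + _)%C.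
- rewrite big_nat_cond [RHS]big_nat_cond; apply: eq_bigr => n /andP [/andP [n0 nN] /eqP ln].
  by rewrite zchar_upd // ln Cmult_1_l.
- rewrite csum_scal (eq_bigl (fun n => logn p n == 1%nat)); last by move=> n; case: (logn p n) => [|[|]].
  rewrite big_nat_cond [RHS]big_nat_cond; apply: eq_bigr => n /andP [/andP [n0 nN] /eqP ln].
  by rewrite zchar_upd // ln Cpow_1_r; ring.
- rewrite csum_scal big_mkcond [RHS]big_mkcond /= big_nat [RHS]big_nat; apply: eq_bigr => n /andP [n0 nN].
  have [->|cn] := Ceq_dec (c n) 0; first by rewrite !Cmult_0_l Cmult_0_r !if_same.
  have : (logn p n <= 2)%nat by apply: leq_trans (logn_le_bigOmega p n pp n0) (c2 n n0 nN cn).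
  rewrite zchar_upd //; case: (logn p n) => [|[|[|//]]] //= _; ring.
Qed.

Lemma slice_mod (p j : nat) (z : nat -> C) : inDisc z -> Cmod (slice p j z) <= W.
Proof.
move=> hz; apply: Rle_trans (Cmod_csum _ _ _ _) _; apply: Rle_trans (_ : \rsum_(1 <= n < N.+1 | logn p n == j) Cmod (c n) <= _).
  rewrite big_nat_cond [X in _ <= X]big_nat_cond; apply: rsum_le => n /andP [/andP [n0 _] _].
  rewrite Cmod_mult; have h1 : Cmod 1 <= 1 by rewrite Cmod_1; lra.
  have := zchar_mod_le _ n (inDisc_upd z p 1 hz h1) n0.
  by have := Cmod_ge_0 (c n); nra.
by apply: rsum_cond_le => // n _; apply: Cmod_ge_0.
Qed.

Lemma slice_ext (p j : nat) (z w : nat -> C) : (forall q, prime q -> q != p -> z q = w q) -> slice p j z = slice p j w.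
Proof.
move=> h; apply: csum_nz => n n0 _ _ _; apply: zchar_ext => // q pq _; rewrite /upd.
by case: eqVneq => // ne; apply: h.
Qed.

Lemma upd_id (z : nat -> C) (p : nat) : F (upd z p (z p)) = F z.
Proof. by apply: Phi_eq => n n0 _; apply: zchar_ext => // q _ _; rewrite /upd; case: eqP => [->|]. Qed.

Lemma Phi_slice_id (p : nat) (z : nat -> C) : prime p ->
  F z = (slice p 0 z + z p * slice p 1 z + z p * z p * slice p 2 z)%C.
Proof. by move=> pp; rewrite -Phi_slice // upd_id. Qed.

Lemma prime_cofactor (p n : nat) : prime p -> (0 < n)%nat -> (p %| n)%nat ->
  [/\ (0 < n %/ p)%nat, n = (p * (n %/ p))%nat & bigOmega n = (bigOmega (n %/ p)).+1].
Proof.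
move=> pp n0 d; have q0 : (0 < n %/ p)%nat by rewrite divn_gt0 ?(prime_gt0 pp) // dvdn_leq.
have e : n = (p * (n %/ p))%nat by rewrite mulnC divnK.
by split => //; rewrite {1}e bigOmega_mul ?(prime_gt0 pp) // bigOmega_prime.
Qed.

Lemma bigOmega0 (n : nat) : (0 < n)%nat -> bigOmega n = 0%nat -> n = 1%nat.
Proof.
move=> n0 h; case: (leqP n 1) => n1; first by apply/eqP; rewrite eqn_leq n1.
have pp := pdiv_prime n1; have := logn_le_bigOmega _ n pp n0; rewrite h leqn0 => /eqP e.
have : (0 < logn (pdiv n) n)%nat by rewrite logn_gt0 mem_primes pp n0 pdiv_dvd.
by rewrite e.
Qed.

(** In degree at most two, p^2 leaves room for no other prime. *)
Lemma slice2_const (p : nat) (z w : nat -> C) : prime p -> slice p 2 z = slice p 2 w.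
Proof.
move=> pp; apply: csum_nz => n n0 nN cn /eqP ln.
suff -> : n = (p ^ 2)%nat by rewrite !(cmult_exp _ _ _ (zchar_cmult _)) ?prime_gt0 // !zchar_prime // /upd eqxx.
have [m pm em] := pfactor_coprime pp n0; rewrite ln in em.
have m0 : (0 < m)%nat by move: n0; rewrite em muln_gt0 => /andP [].
have p20 : (0 < p ^ 2)%nat by rewrite expn_gt0 prime_gt0.
have := c2 n n0 nN cn; rewrite {1}em bigOmega_mul // bigOmega_exp // => h.
by rewrite em (bigOmega0 m m0) ?mul1n //; lia.
Qed.

(* Coefficient of [z_p z_q] in the Bohr lift. *)
Definition cross (p q : nat) : C := \csum_(1 <= n < N.+1 | (logn p n == 1%nat) && (q %| n)%nat) c n.

Lemma semiprime_eq (p q n : nat) : prime p -> prime q -> p != q -> (0 < n)%nat -> (n <= N)%nat -> c n <> 0 ->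
  logn p n = 1%nat -> (q %| n)%nat -> n = (p * q)%nat.
Proof.
move=> pp pq ne n0 nN cn lp dq.
have dp : (p %| n)%nat by rewrite -(expn1 p) pfactor_dvdn // lp.
have [m0 em eo] := prime_cofactor p n pp n0 dp.
have dqm : (q %| n %/ p)%nat.
  move: dq; rewrite {1}em Euclid_dvdM // => /orP [|//]; rewrite dvdn_prime2 // => /eqP e.
  by rewrite e eqxx in ne.
have [k0 ek ek2] := prime_cofactor q _ pq m0 dqm.
have := c2 n n0 nN cn; rewrite eo ek2 => h.
have := bigOmega0 _ k0 ltac:(lia) => e1; by rewrite {1}em ek e1 muln1.
Qed.

Lemma slice1_upd (p q : nat) (z : nat -> C) (zeta : C) : prime p -> prime q -> p != q ->
  slice p 1 (upd z q zeta) = (slice p 1 (upd z q 0) + zeta * cross p q)%C.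
Proof.
move=> pp pq ne.
have cE : cross p q = \csum_(1 <= n < N.+1 | logn p n == 1%nat) (c n * (if (q %| n)%nat then RtoC 1 else RtoC 0)).
  rewrite /cross big_mkcondr; apply: eq_bigr => n _; by case: ifP => _; ring.
rewrite cE csum_scal /slice -big_split /=.
rewrite big_nat_cond [RHS]big_nat_cond; apply: eq_bigr => n /andP [/andP [n0 nN] /eqP ln].
have [->|cn] := Ceq_dec (c n) 0; first by ring.
case: ifP => dq; last first.
  rewrite Cmult_0_r Cmult_0_r Cplus_0_r; congr Cmult; apply: zchar_ext => // r pr dr; rewrite /upd.
  by case: (r == p) => //; case: (eqVneq r q) => // e; rewrite -e dr in dq.
rewrite (semiprime_eq p q n pp pq ne n0 nN cn ln dq).
rewrite !zchar_mul ?prime_gt0 // !zchar_prime // /upd !eqxx eq_sym (negbTE ne); ring.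
Qed.

Lemma csum_only (f : nat -> C) (Q : pred nat) (n : nat) : (0 < n)%nat -> (n <= N)%nat -> Q n ->
  (forall k, (0 < k)%nat -> (k <= N)%nat -> f k <> 0 -> Q k -> k = n) ->
  \csum_(1 <= k < N.+1 | Q k) f k = f n.
Proof.
move=> n0 nN qn h; have mem : n \in index_iota 1 N.+1 by rewrite mem_index_iota n0 ltnS.
rewrite (big_rem n mem) /= qn big1_seq ?Cplus_0_r //.
move=> k /andP [qk]; rewrite mem_rem_uniq ?iota_uniq // inE mem_index_iota ltnS => /andP [kn /andP [k0 kN]].
have [//|fk] := Ceq_dec (f k) 0.
by rewrite (h k k0 kN fk qk) eqxx in kn.
Qed.

(** In degree at most two a prime of the symbol occurs in a square, in a mixed product, or in a
    linear term with no mixed product beside it; [center_gap] has a different argument for each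
    case. *)
Lemma slice1_cases (p : nat) : p \in P ->
  [\/ slice p 2 (fun _ => 0) <> 0, exists q, [/\ prime q, p != q & cross p q <> 0] |
    exists b : C, b <> 0 /\ forall z, slice p 1 z = b].
Proof.
move=> /cprimesP [pp [n [n0 nN cn d]]]; have p0 := prime_gt0 pp.
have lg : (0 < logn p n)%nat by rewrite logn_gt0 mem_primes pp n0 d.
have l2 : (logn p n <= 2)%nat by apply: leq_trans (logn_le_bigOmega p n pp n0) (c2 n n0 nN cn).
case: (eqVneq (logn p n) 2%nat) => [e|ne2].
  constructor 1.
  have sq k : (0 < k)%nat -> (k <= N)%nat -> c k <> 0 -> logn p k = 2%nat -> k = (p ^ 2)%nat.
    move=> k0 kN ck lk; have [m pm ek] := pfactor_coprime pp k0; rewrite lk in ek.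
    have mm0 : (0 < m)%nat by move: k0; rewrite ek muln_gt0 => /andP [].
    have p20 : (0 < p ^ 2)%nat by rewrite expn_gt0 p0.
    have := c2 k k0 kN ck; rewrite {1}ek bigOmega_mul // bigOmega_exp // => h.
    by rewrite ek (bigOmega0 m mm0) ?mul1n //; lia.
  rewrite /slice (csum_only _ _ n n0 nN); last 2 first.
  - by rewrite e.
  - move=> k k0 kN fk /eqP lk; rewrite (sq n n0 nN cn e); apply: sq => // ck.
    by apply: fk; rewrite ck Cmult_0_l.
  rewrite {2}(sq n n0 nN cn e) (cmult_exp _ _ _ (zchar_cmult _)) // zchar_prime // /upd eqxx Cpow_1_l.
  by rewrite Cmult_1_r.
have l1 : logn p n = 1%nat by move: lg l2 ne2; case: (logn p n) => [|[|[|]]].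
case: (boolP (has (fun k => [&& Cnz (c k), logn p k == 1%nat & k != p]) (iota 1%nat N))) => [/hasP [k]|/hasPn h].
  rewrite mem_iota add1n ltnS => /andP [k0 kN] /and3P [/Cnz_neq0 ck /eqP lk kp]; constructor 2.
  have dk : (p %| k)%nat by rewrite -(expn1 p) pfactor_dvdn // lk.
  have [m0 em _] := prime_cofactor p k pp k0 dk.
  have m1 : (1 < k %/ p)%nat.
    rewrite ltn_neqAle m0 andbT eq_sym; apply/eqP => h; move: kp; rewrite em h muln1 eqxx.
    by [].
  have [q pq dq] : exists2 q, prime q & (q %| k %/ p)%nat by exists (pdiv (k %/ p)); [exact: (pdiv_prime m1) | exact: pdiv_dvd].
  have dqk : (q %| k)%nat by rewrite em dvdn_mull.
  have pnq : p != q.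
    apply/eqP => e; have : (p ^ 2 %| k)%nat by rewrite em expnS expn1; apply: dvdn_mul => //; rewrite {1}e.
    by rewrite pfactor_dvdn // lk.
  exists q; split => //; rewrite /cross (csum_only _ _ k k0 kN) //; first by rewrite lk.
  move=> j j0 jN cj /andP [/eqP lj dj].
  by rewrite (semiprime_eq p q j) // (semiprime_eq p q k).
have h' k : (0 < k)%nat -> (k <= N)%nat -> c k <> 0 -> logn p k = 1%nat -> k = p.
  move=> k0 kN ck lk; have := h k; rewrite mem_iota add1n ltnS k0 kN => /(_ isT).
  by rewrite Cnz_true // lk /= negbK => /eqP.
constructor 3; exists (c n); split => // z.
have en := h' n n0 nN cn l1.
rewrite /slice (csum_only _ _ n n0 nN); last 2 first.
- by rewrite l1.
- move=> k k0 kN fk /eqP lk; rewrite en; apply: h' => // ck.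
  by apply: fk; rewrite ck Cmult_0_l.
by rewrite {2}en zchar_prime // /upd eqxx Cmult_1_r.
Qed.

Let N1 : (1 <= N)%nat.
Proof.
case: (posnP N) => // e; have := hG 1 ltac:(rewrite /=; lra).
by rewrite dpoly_Phi /Phi e big_geq //=; lra.
Qed.

Let Pp p : p \in P -> prime p.
Proof. by move=> /cprimesP []. Qed.

Lemma Phi_torus (z : nat -> C) : (forall p, prime p -> Cmod (z p) = 1) -> 1 / 2 <= Re (F z).
Proof.
apply: (transfer_torus N c P) => //; last exact: inG_line.
by move=> n n0 nN cn p pp d; apply: (mem_cprimes N c p n).
Qed.

(** The variables of [s] leave the circle one at a time; in each of them the Harnack inequality acts
    as a minimum principle. *)
Lemma Phi_partial_disc (s : seq nat) (z : nat -> C) : inDisc z ->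
  (forall p, prime p -> p \notin s -> Cmod (z p) = 1) -> 1 / 2 <= Re (F z).
Proof.
elim: s z => [|p s IH] z hz h1; first by apply: Phi_torus => p pp; apply: h1.
case: (boolP (prime p)) => pp; last first.
  apply: IH => // q pq qs; apply: h1 => //; rewrite inE negb_or qs andbT.
  by apply/eqP => e; rewrite -e pq in pp.
set a := (slice p 0 z - RtoC (1 / 2))%C.
have e zeta : Re (a + zeta * slice p 1 z + zeta * zeta * slice p 2 z) = Re (F (upd z p zeta)) - 1 / 2.
  by rewrite Phi_slice // /a Re_shift.
have [pos har] : (forall zeta, Cmod zeta = 1 -> 0 <= Re (a + zeta * slice p 1 z + zeta * zeta * slice p 2 z)) /\ True.
  split => // zeta z1; rewrite e; suff : 1 / 2 <= Re (F (upd z p zeta)) by lra.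
  apply: IH; first by apply: inDisc_upd => //; lra.
  move=> q pq qs; rewrite /upd; case: (eqVneq q p) => // ne; apply: h1 => //.
  by rewrite inE negb_or ne.
have h0 := harnack_quadratic _ _ _ pos 0 ltac:(rewrite Cmod_0; lra).
have hz' := harnack_quadratic _ _ _ pos (z p) (hz p pp).
have ea : Re (a + 0 * slice p 1 z + 0 * 0 * slice p 2 z) = Re a by congr Re; ring.
rewrite ea Cmod_0 in h0; rewrite e upd_id in hz'.
have := hz p pp; have : 0 <= Re a by lra.
nra.
Qed.

Lemma Phi_disc (z : nat -> C) : inDisc z -> 1 / 2 <= Re (F z).
Proof.
move=> hz; pose w q := if q \in P then z q else RtoC 1.
have -> : F z = F w.
  rewrite /F /Phi; apply: csum_nz => n n0 nN cn _; apply: zchar_ext => // q pq dq.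
  by rewrite /w (mem_cprimes N c q n).
apply: (Phi_partial_disc P) => [q pq|q pq qP]; rewrite /w.
  by case: ifP => _; [exact: hz | rewrite Cmod_1; lra].
by rewrite (negbTE qP) Cmod_1.
Qed.

Let slice_pos (p : nat) (z : nat -> C) (zeta : C) : prime p -> inDisc z -> Cmod zeta <= 1 ->
  0 <= Re (slice p 0 z - RtoC (1 / 2) + zeta * slice p 1 z + zeta * zeta * slice p 2 z).
Proof.
move=> pp hz z1; have := Phi_disc _ (inDisc_upd z p zeta hz z1); rewrite Phi_slice //.
rewrite Re_shift; lra.
Qed.

Let slice0_Phi (p : nat) (z : nat -> C) : prime p -> slice p 0 z = F (upd z p 0).
Proof. by move=> pp; rewrite Phi_slice //; ring. Qed.

Let W0 : 0 <= W.
Proof. exact: l1norm_ge0. Qed.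

(* If some mixed coefficient is nonzero, [Re Phi - 1/2 >= |B| / 2] on the slice with [B] affine and
   nonconstant; at a near-zero of [Re Phi - 1/2], moving by [+- t] tangentially changes the left side by
   [O(t^2)] but the right side by order [t]. *)
Lemma center_gap (p : nat) : p \in P -> exists2 d, 0 < d & forall z, inDisc z -> d <= Re (slice p 0 z) - 1 / 2.
Proof.
move=> pP; have pp := Pp p pP.
have lin z : inDisc z -> slice p 2 z = 0 -> Cmod (slice p 1 z) / 2 <= Re (slice p 0 z) - 1 / 2.
  move=> hz e; have := Cmod_le_Re_axis (slice p 0 z - RtoC (1 / 2))%C (slice p 1 z).
  rewrite (_ : Re (_ - _) = Re (slice p 0 z) - 1 / 2) //; apply => zeta z1.
  have := slice_pos p z zeta pp hz ltac:(lra); rewrite e.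
  by rewrite (_ : _ + _ + _ = slice p 0 z - RtoC (1 / 2) + zeta * slice p 1 z)%C //; ring.
have [s2|s2] := Ceq_dec (slice p 2 (fun _ => 0)) 0; last first.
  exists (Cmod (slice p 2 (fun _ => 0)) / 2); first by have := proj1 (Cmod_gt_0 _) s2; lra.
  move=> z hz; rewrite (slice2_const p _ z) //.
  rewrite (_ : Re (slice p 0 z) - 1 / 2 = Re (slice p 0 z - RtoC (1 / 2))%C) //.
  apply: (Cmod_le_Re_diag _ (slice p 1 z)) => zeta z1; apply: slice_pos => //; lra.
have s2z z : slice p 2 z = 0 by rewrite (slice2_const p z (fun _ => 0)).
case: (slice1_cases p pP) => [//|[q [pq pnq cn]]|[b [bn hb]]]; last first.
  exists (Cmod b / 2); first by have := proj1 (Cmod_gt_0 _) bn; lra.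
  by move=> z hz; have := lin z hz (s2z z); rewrite hb.
set be := Cmod (cross p q); have be0 : 0 < be by apply/Cmod_gt_0.
(* Ensures 20 W t <= [be], so that the second-order terms 14 W t^2 stay below 7/10 of the gain [be]
   t; 1/2 is the range allowed by [tangent_points]. *)
set t := Rmin (1 / 2) (be / (20 * W + 1)).
have t0 : 0 < t by apply: Rmin_glb_lt; [lra | apply: Rdiv_lt_0_compat; lra].
have t1 : t <= 1 / 2 by apply: Rmin_l.
have t2 : t * (20 * W + 1) <= be by apply/Rle_div_r; [lra | exact: Rmin_r].
exists (be * t / 16); first by nra.
move=> z hz; have [v [w [hv hw [v1 v2] [w1 w2] hvw]]] := tangent_points (z q) t (hz q pq) ltac:(lra).
set eta := Re (slice p 0 z) - 1 / 2.
pose g x := Re (slice p 0 (upd z q x)) - 1 / 2.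
have gB x : Cmod (z q + x) <= 1 -> (be * Cmod x - 2 * eta) / 2 <= g (z q + x)%C.
  move=> hx; have := lin _ (inDisc_upd z q _ hz hx) (s2z _); rewrite -/(g _) => h.
  have e1 : slice p 1 (upd z q (z q + x)) = (slice p 1 z + x * cross p q)%C.
    have ez : slice p 1 z = slice p 1 (upd z q (z q)).
      by apply: slice_ext => r _ _; rewrite /upd; case: eqP => [->|].
    by rewrite ez slice1_upd // [in RHS]slice1_upd //; ring.
  have h2 := lin z hz (s2z z); rewrite -/eta in h2.
  have := Cmod_triangle (slice p 1 z + x * cross p q) (- slice p 1 z).
  rewrite (_ : _ + _ = x * cross p q)%C; last by ring.
  rewrite Cmod_mult Cmod_opp -/be -e1; lra.
have up0 : inDisc (upd z p 0) by apply: inDisc_upd => //; rewrite Cmod_0; lra.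
pose y := upd z p 0.
have gE x : g x = Re (slice q 0 y + x * slice q 1 y + x * x * slice q 2 y) - 1 / 2.
  rewrite /g slice0_Phi // -Phi_slice //; congr (Re _ - _); apply: Phi_eq => n n0 _.
  apply: zchar_ext => // l _ _; rewrite /y /upd; case: (eqVneq l p) => [e|//]; case: (eqVneq l q) => // e'.
  by rewrite -e -e' eqxx in pnq.
have gz : eta = g (z q).
  rewrite /eta /g (slice_ext p 0 z (upd z q (z q))) // => r _ _.
  by rewrite /upd; case: eqP => [->|].
have b1 := slice_mod q 1 y up0; have b2 := slice_mod q 2 y up0.
(* Of the 14, six come from the linear term, where |v + w| = 2 t^2 meets a derivative of size 3 W,
   and eight from v^2 + w^2. *)
have sum : g (z q + v)%C + g (z q + w)%C <= 2 * eta + 14 * W * t ^ 2.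
  have -> : g (z q + v)%C + g (z q + w)%C = 2 * eta + Re ((v + w) * (slice q 1 y + 2 * z q * slice q 2 y)) +
     Re ((v * v + w * w) * slice q 2 y).
    rewrite gz !gE.
    have ex x : (slice q 0 y + (z q + x) * slice q 1 y + (z q + x) * (z q + x) * slice q 2 y =
      (slice q 0 y + z q * slice q 1 y + z q * z q * slice q 2 y) + x * (slice q 1 y + 2 * z q * slice q 2 y) + x * x * slice q 2 y)%C by ring.
    rewrite !ex.
    rewrite (_ : (v + w) * _ = v * (slice q 1 y + 2 * z q * slice q 2 y) + w * (slice q 1 y + 2 * z q * slice q 2 y))%C; last by ring.
    rewrite (_ : (v * v + w * w) * _ = v * v * slice q 2 y + w * w * slice q 2 y)%C; last by ring.
    have rs (A0 x1 x2 y1 y2 : C) : Re (A0 + x1 + y1) - 1 / 2 + (Re (A0 + x2 + y2) - 1 / 2) =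
      2 * (Re A0 - 1 / 2) + Re (x1 + x2) + Re (y1 + y2) by case: A0 x1 x2 y1 y2 => ? ? [? ?] [? ?] [? ?] [? ?] /=; ring.
    exact: rs.
  have zq := hz q pq.
  have d1 : Cmod (slice q 1 y + 2 * z q * slice q 2 y) <= 3 * W.
    apply: Rle_trans (Cmod_triangle _ _) _; rewrite !Cmod_mult Cmod_R Rabs_pos_eq; last lra.
    have := Cmod_ge_0 (z q); have := Cmod_ge_0 (slice q 2 y); nra.
  have r1 : Re ((v + w) * (slice q 1 y + 2 * z q * slice q 2 y)) <= 2 * t ^ 2 * (3 * W).
    apply: Rle_trans (Rle_abs _) _; apply: Rle_trans (re_le_Cmod _) _; rewrite Cmod_mult hvw.
    by apply: Rmult_le_compat_l => //; nra.
  have r2 : Re ((v * v + w * w) * slice q 2 y) <= 8 * t ^ 2 * W.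
    apply: Rle_trans (Rle_abs _) _; apply: Rle_trans (re_le_Cmod _) _; rewrite Cmod_mult.
    apply: Rmult_le_compat => //; try exact: Cmod_ge_0.
    apply: Rle_trans (Cmod_triangle _ _) _; rewrite !Cmod_mult; nra.
  lra.
have := gB v hv; have := gB w hw => hB1 hB2.
have l1 : be * t <= be * Cmod v by apply: Rmult_le_compat_l; lra.
have l2 : be * t <= be * Cmod w by apply: Rmult_le_compat_l; lra.
have l3 : be * t <= 4 * eta + 14 * W * t ^ 2 by lra.
have l4 : 14 * W * t ^ 2 <= 7 / 10 * (be * t).
  have : t * (t * (20 * W + 1)) <= t * be by apply: Rmult_le_compat_l; lra.
  nra.
have bt : 0 < be * t by apply: Rmult_lt_0_compat.
rewrite -/eta; lra.
Qed.

(** The uniform gap [d0] at the centre of all slices feeds both conclusions: it is the factor in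
    Harnack's inequality for each variable, and it bounds the derivative below where Re Phi - 1/2 is
    small. Any prime of the symbol can serve as [p0]. *)
Lemma geometry : (0 < size P)%nat -> exists d p0, [/\ 0 < d, p0 \in P,
  forall z p, inDisc z -> p \in P -> d * (1 - Cmod (z p)) <= Re (F z) - 1 / 2 &
  forall z x, inDisc z -> Cmod x <= 1 -> Re (F z) - 1 / 2 <= d -> Cmod (x - z p0) <= d ->
    d * Cmod (x - z p0) <= Cmod (F (upd z p0 x) - F z)].
Proof.
move=> sP.
have [d0 d00 hd0] : exists2 d, 0 < d & forall p, p \in P -> forall z, inDisc z -> d <= Re (slice p 0 z) - 1 / 2.
  suff : forall s : seq nat, {subset s <= P} -> exists2 d, 0 < d &
      forall p, p \in s -> forall z, inDisc z -> d <= Re (slice p 0 z) - 1 / 2 by apply.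
  elim=> [|p s IH] hs; first by exists 1; [lra | move=> p].
  have [d1 d10 h1] := IH (fun q qs => hs q ltac:(by rewrite inE qs orbT)).
  have [d2 d20 h2] := center_gap p (hs p ltac:(by rewrite inE eqxx)).
  exists (Rmin d1 d2); first exact: Rmin_glb_lt.
  move=> q; rewrite inE => /orP [/eqP ->|qs] z hz; first by apply: Rle_trans (Rmin_r _ _) (h2 z hz).
  by apply: Rle_trans (Rmin_l _ _) (h1 q qs z hz).
have [p0 pP] : exists p0, p0 \in P by case: (P) sP => [//|p s _]; exists p; rewrite inE eqxx.
have pp := Pp p0 pP.
(* With d <= d0 / 12 the derivative is at least d0 / 3 - d >= d0 / 4, and d W <= d0 / 12 absorbs the
   quadratic term when |x - z_p0| <= d. *)
set d := Rmin (d0 / 12) (d0 / (12 * W + 1)).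
have dp : 0 < d by apply: Rmin_glb_lt; [lra | apply: Rdiv_lt_0_compat; lra].
have da : d <= d0 / 12 by apply: Rmin_l.
have db : d * (12 * W + 1) <= d0 by apply/Rle_div_r; [lra | exact: Rmin_r].
exists d, p0; split => //.
- move=> z p hz hp; have p' := Pp p hp.
  have har := harnack_quadratic (slice p 0 z - RtoC (1 / 2)) (slice p 1 z) (slice p 2 z)
    (fun zeta z1 => slice_pos p z zeta p' hz (Req_le _ _ z1)) (z p) (hz p p').
  have e1 : Re (slice p 0 z - RtoC (1 / 2)) = Re (slice p 0 z) - 1 / 2 by [].
  have e2 : Re (slice p 0 z - RtoC (1 / 2) + z p * slice p 1 z + z p * z p * slice p 2 z) = Re (F z) - 1 / 2.
    by rewrite (Phi_slice_id p) // Re_shift.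
  rewrite e1 e2 in har; apply: Rle_trans har.
  have := hd0 p hp z hz; have := hz p p'; nra.
- move=> z x hz x1 hs hx.
  have := derivative_lower (slice p0 0 z - RtoC (1 / 2)) (slice p0 1 z) (slice p0 2 z) (z p0) d0 (hz p0 pp)
    (hd0 p0 pP z hz) (fun zeta z1 => slice_pos p0 z zeta pp hz z1).
  have e1 : Re (slice p0 0 z - RtoC (1 / 2)) = Re (slice p0 0 z) - 1 / 2 by [].
  have e2 : Re (slice p0 0 z - RtoC (1 / 2) + z p0 * slice p0 1 z + z p0 * z p0 * slice p0 2 z) = Re (F z) - 1 / 2.
    by rewrite (Phi_slice_id p0) // Re_shift.
  rewrite e2; set D := (slice p0 1 z + 2 * z p0 * slice p0 2 z)%C => hD.
  set y := (x - z p0)%C in hx *.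
  have -> : (F (upd z p0 x) - F z)%C = (y * D + y * y * slice p0 2 z)%C.
    by rewrite Phi_slice // (Phi_slice_id p0) // /y /D; ring.
  have Y0 := Cmod_ge_0 y; have b2 := slice_mod p0 2 z hz.
  have tr := Cmod_triangle (y * D + y * y * slice p0 2 z) (- (y * y * slice p0 2 z)).
  rewrite (_ : _ + _ = y * D)%C in tr; last by ring.
  rewrite Cmod_opp !Cmod_mult in tr.
  have l1 : Cmod y * Cmod y * Cmod (slice p0 2 z) <= Cmod y * (d * W).
    rewrite Rmult_assoc; apply: Rmult_le_compat_l => //; apply: Rmult_le_compat => //; exact: Cmod_ge_0.
  have l2 : Cmod y * (d0 / 4) <= Cmod y * Cmod D by apply: Rmult_le_compat_l => //; lra.
  have l3 : Cmod y * (d + d * W) <= Cmod y * (d0 / 4) by apply: Rmult_le_compat_l => //; lra.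
  lra.
Qed.
End Quad.

(** * Parseval on a grid *)

Definition omega (M : nat) : C := Cexp (Ci * RtoC (2 * PI / INR M)).

Lemma Cmod_Cexp_i (x : R) : Cmod (Cexp (Ci * RtoC x)) = 1.
Proof. by rewrite Cmod_Cexp /= !Rmult_0_l Rmult_1_l Rminus_0_l Ropp_0 exp_0. Qed.

Lemma omega_mod (M : nat) : Cmod (omega M) = 1.
Proof. exact: Cmod_Cexp_i. Qed.

Lemma Cexp_i_eq1 (x : R) : Cexp (Ci * RtoC x) = 1 -> sin (x / 2) = 0.
Proof.
move=> h; have hc : cos x = 1.
  have := f_equal Re h; rewrite /Cexp /= !Rmult_0_l !Rmult_1_l Rminus_0_l Rplus_0_l Ropp_0 exp_0 Rmult_1_l => ->.
  by [].
have := cos_2a_sin (x / 2); rewrite (_ : 2 * (x / 2) = x); last by field.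
rewrite hc => h2; nra.
Qed.

(** The ratio of the geometric sum is an M-th root of unity; it differs from 1 when k and l do,
    since pi (k - l) / M then lies strictly between - pi and pi without vanishing. *)
Lemma omega_orth (M k l : nat) : (k < M)%nat -> (l < M)%nat ->
  \csum_(0 <= n < M) ((omega M ^ n) ^ k * Cconj ((omega M ^ n) ^ l)) = if k == l then RtoC (INR M) else RtoC 0.
Proof.
move=> kM lM; have M0 : 0 < INR M by apply: INR_pos; apply: leq_ltn_trans kM.
set q := Cexp (Ci * RtoC (2 * PI / INR M * (INR k - INR l))).
have -> : \csum_(0 <= n < M) ((omega M ^ n) ^ k * Cconj ((omega M ^ n) ^ l)) = \csum_(0 <= n < M) (q ^ n).
  apply: eq_bigr => n _; rewrite /omega !Cexp_pow Cexp_conj -Cexp_plus; congr Cexp.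
  by rewrite /Ci /Cconj /Cmult /Cplus /RtoC /=; congr pair; ring.
case: eqP => [e|ne].
  rewrite /q e Rminus_diag Rmult_0_r Cmult_0_r Cexp_0.
  elim: (M) => [|m IH]; first by rewrite big_geq.
  by rewrite big_nat_recr // IH Cpow_1_l S_INR RtoC_plus.
have qM : (q ^ M = 1)%C.
  rewrite /q Cexp_pow (_ : RtoC (INR M) * _ = Ci * RtoC (INR k * (2 * PI)) - Ci * RtoC (INR l * (2 * PI)))%C; last first.
    rewrite (_ : 2 * PI / INR M * (INR k - INR l) = / INR M * ((INR k - INR l) * (2 * PI))); last by field; lra.
    rewrite (RtoC_mult (/ INR M)) (_ : RtoC (INR M) * _ = (RtoC (INR M) * RtoC (/ INR M)) * (Ci * RtoC ((INR k - INR l) * (2 * PI))))%C; last by ring.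
    by rewrite -RtoC_mult Rinv_r; [rewrite !RtoC_mult RtoC_minus; ring | lra].
  have e n : Cexp (Ci * RtoC (INR n * (2 * PI))) = 1.
    have -> : (Ci * RtoC (INR n * (2 * PI)) = RtoC (INR n) * (Ci * RtoC (2 * PI)))%C by rewrite RtoC_mult; ring.
    rewrite -Cexp_pow (_ : Cexp (Ci * RtoC (2 * PI)) = 1) ?Cpow_1_l //.
    rewrite /Cexp /= !Rmult_0_l !Rmult_1_l Rminus_0_l Rplus_0_l Ropp_0 exp_0 !Rmult_1_l cos_2PI sin_2PI.
    by [].
  have := Cexp_plus (Ci * RtoC (INR k * (2 * PI)) - Ci * RtoC (INR l * (2 * PI))) (Ci * RtoC (INR l * (2 * PI))).
  rewrite (_ : _ - _ + _ = Ci * RtoC (INR k * (2 * PI)))%C; last by ring.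
  by rewrite !e Cmult_1_r => <-.
have q1 : q <> 1.
  move=> /Cexp_i_eq1; rewrite (_ : _ / 2 = PI / INR M * (INR k - INR l)); last by field; lra.
  have pi := PI_RGT_0.
  have key a b : (a < b)%nat -> (b < M)%nat -> 0 < sin (PI / INR M * (INR b - INR a)).
    move=> ab bM; have d1 : INR a < INR b by apply: lt_INR; apply/ltP.
    have d2 : INR b < INR M by apply: lt_INR; apply/ltP.
    have a0 := pos_INR a.
    apply: sin_gt_0.
      by apply: Rmult_lt_0_compat; [apply: Rdiv_lt_0_compat | lra].
    rewrite (_ : PI / INR M * (INR b - INR a) = PI * ((INR b - INR a) / INR M)); last by field; lra.
    rewrite -[X in _ < X]Rmult_1_r; apply: Rmult_lt_compat_l => //.
    by apply/Rlt_div_l => //; lra.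
  case: (ltngtP k l) => [kl|lk|//] hs.
    have := key k l kl lM; rewrite (_ : INR l - INR k = - (INR k - INR l)); last by ring.
    by rewrite Ropp_mult_distr_r_reverse sin_neg hs; lra.
  by have := key l k lk kM; rewrite hs; lra.
have := Cgeom_sum q M; rewrite qM (_ : 1 - 1 = 0)%C; last by ring.
move=> h; have n1 : (1 - q)%C <> 0.
  by move=> h1; apply: q1; transitivity (1 - (1 - q))%C; [ring | rewrite h1; ring].
by rewrite -[LHS]Cmult_1_l -(Cinv_l _ n1) -Cmult_assoc h Cmult_0_r.
Qed.

Section Grid.
Variable P : seq nat.
Hypothesis Pu : uniq P.
Hypothesis Pp : forall p, p \in P -> prime p.
Let d := size P.

Definition pr (i : 'I_d) : nat := nth 0%nat P i.

Definition ptz (g : 'I_d -> C) (q : nat) : C := if insub (index q P) is Some i then g i else RtoC 0.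

Lemma pr_mem (i : 'I_d) : pr i \in P.
Proof. by apply: mem_nth; apply: ltn_ord. Qed.

Lemma ptz_pr (g : 'I_d -> C) (i : 'I_d) : ptz g (pr i) = g i.
Proof. by rewrite /ptz /pr index_uniq ?ltn_ord // valK. Qed.

Lemma prP (q : nat) : q \in P -> exists i : 'I_d, pr i = q.
Proof.
move=> qP; have h : (index q P < d)%nat by rewrite index_mem.
by exists (Ordinal h); rewrite /pr /= nth_index.
Qed.

Lemma ptz_mod (g : 'I_d -> C) : (forall i, Cmod (g i) <= 1) -> inDisc (ptz g).
Proof. by move=> h q _; rewrite /ptz; case: insub => [i|]; [exact: h | rewrite Cmod_0; lra]. Qed.

Definition Psmooth (m : nat) : Prop := (0 < m)%nat /\ forall q, prime q -> (q %| m)%nat -> q \in P.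

Lemma big_pr (R0 : Type) (idx : R0) (op : Monoid.com_law idx) (F : nat -> R0) :
  \big[op/idx]_(p <- P) F p = \big[op/idx]_(i : 'I_d) F (pr i).
Proof. by rewrite (big_nth 0%nat) big_mkord. Qed.

Lemma zchar_pr (z : nat -> C) (m : nat) : Psmooth m ->
  zchar z m = \big[Cmult/RtoC 1]_(i : 'I_d) (z (pr i) ^ logn (pr i) m)%C.
Proof.
move=> [m0 hm]; rewrite -(big_pr _ _ _ (fun p => z p ^ logn p m)%C) /zchar.
rewrite [RHS](bigID (fun p => p \in primes m)) /= [X in (_ * X)%C]big1_seq ?Cmult_1_r; last first.
  by move=> p /andP [np _]; rewrite -logn_gt0 lt0n negbK in np; rewrite (eqP np).
rewrite -[in RHS]big_filter; apply: perm_big; apply: uniq_perm; [exact: primes_uniq | exact: filter_uniq |].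
move=> p; rewrite mem_filter mem_primes m0 /=; case: (boolP (prime p)) => pp //=.
by case: (boolP (p %| m)%nat) => //= dm; rewrite hm.
Qed.

Lemma smooth_inj (m n : nat) : Psmooth m -> Psmooth n -> (forall i, logn (pr i) m = logn (pr i) n) -> m = n.
Proof.
move=> [m0 hm] [n0 hn] h; apply: eqn_from_log => // p.
case: (boolP (prime p)) => pp; last by have z k : logn p k = 0%nat; [rewrite lognE (negbTE pp) | rewrite !z].
case: (boolP (p \in P)) => [/prP [i <-]|np].
  exact: h.
have z k : (0 < k)%nat -> (forall q, prime q -> (q %| k)%nat -> q \in P) -> logn p k = 0%nat.
  move=> k0 hk; apply/eqP; rewrite -leqn0 leqNgt logn_gt0 mem_primes pp k0 /=.
  by apply/negP => dk; move: np; rewrite hk.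
by rewrite !z.
Qed.

Lemma logn_prod_primes (s : seq nat) (e : nat -> nat) (q : nat) : uniq s -> (forall p, p \in s -> prime p) -> prime q ->
  logn q (\prod_(p <- s) p ^ e p)%nat = (if q \in s then e q else 0)%nat /\ (0 < \prod_(p <- s) p ^ e p)%nat.
Proof.
move=> us hs pq; elim: s us hs => [|p s IH] /=; first by rewrite big_nil logn1.
case/andP=> ps us hs; have pp : prime p by apply: hs; rewrite inE eqxx.
have [IH1 IH2] := IH us (fun r rs => hs r ltac:(by rewrite inE rs orbT)).
have pe0 : (0 < p ^ e p)%nat by rewrite expn_gt0 prime_gt0.
rewrite big_cons muln_gt0 pe0 IH2 lognM // IH1 lognX logn_prime // inE; split => //.
case: (eqVneq q p) => [->|ne] /=; first by rewrite (negbTE ps) muln1 addn0.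
by rewrite muln0.
Qed.

Lemma dpow_prod_primes (b : R) (s : seq nat) (e : nat -> nat) : uniq s -> (forall p, p \in s -> prime p) ->
  dpow b (\prod_(p <- s) p ^ e p)%nat = \rprod_(p <- s) Rpower (INR (e p).+1) b.
Proof.
elim: s => [|p s IH] /=; first by rewrite !big_nil dpow1.
case/andP=> ps us hs; have pp : prime p by apply: hs; rewrite inE eqxx.
have hs' r : r \in s -> prime r by move=> rs; apply: hs; rewrite inE rs orbT.
have [l0 q0] := logn_prod_primes s e p us hs' pp; rewrite (negbTE ps) in l0.
rewrite !big_cons dpow_coprime ?expn_gt0 ?(prime_gt0 pp) // ?dpow_pexp // ?IH //.
apply: coprimeXl; rewrite prime_coprime //; apply/negP => dp.
by have : (0 < logn p (\prod_(p0 <- s) p0 ^ e p0))%nat; [rewrite logn_gt0 mem_primes pp q0 dp | rewrite l0].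
Qed.

Lemma dpow_pr (b : R) (m : nat) : Psmooth m ->
  dpow b m = \big[Rmult/1]_(i : 'I_d) Rpower (INR (logn (pr i) m).+1) b.
Proof.
move=> hm; rewrite -(big_pr _ _ _ (fun p => Rpower (INR (logn p m).+1) b)).
rewrite -(dpow_prod_primes b P (fun p => logn p m) Pu Pp); congr dpow; apply: smooth_inj => //.
  split; first by case: (logn_prod_primes P (fun p => logn p m) 2 Pu Pp isT).
  move=> q pq dq; have [l0 p0] := logn_prod_primes P (fun p => logn p m) q Pu Pp pq.
  have : (0 < logn q (\prod_(p <- P) p ^ logn p m))%nat by rewrite logn_gt0 mem_primes pq p0 dq.
  by rewrite l0; case: ifP.
move=> i; have [-> _] := logn_prod_primes P (fun p => logn p m) (pr i) Pu Pp (Pp _ (pr_mem i)).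
by rewrite pr_mem.
Qed.

Definition rho (j : nat) : R := exp (- (/ 2) ^ j).

Lemma rho_bounds (j : nat) : [/\ exp (- 1) <= rho j, rho j <= 1, 0 < rho j & (/ 2) ^ j / 2 <= 1 - rho j].
Proof.
have h0 : 0 < (/ 2) ^ j by apply: pow_lt; lra.
have h1 : (/ 2) ^ j <= 1 by rewrite -(pow1 j); apply: pow_incr; lra.
split; [apply: exp_le; lra | rewrite -exp_0; apply: exp_le; lra | exact: exp_pos |].
by apply: one_minus_exp; lra.
Qed.

(* Layer-cake: the weight [(k+1)^-b] is a superposition of the dilation weights [rho_j^(2k)]. *)
Lemma weight_dyadic (b : R) (k J : nat) : 0 < b -> (k.+1 < 2 ^ J)%nat ->
  / Rpower (INR k.+1) b <= exp 4 * \rsum_(0 <= j < J) (Rpower 2 (- (b * INR j)) * rho j ^ (2 * k)).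
Proof.
(* A single radius suffices: for 2^l <= k+1 < 2^(l+1), 2^(-b l) is at least (k+1)^(-b) and
   rho_l^(2k) is at least exp(-4). *)
move=> b0 kJ; set l := trunc_log 2 k.+1.
have h1 : (2 ^ l <= k.+1)%nat by apply: trunc_logP.
have h2 : (k.+1 < 2 ^ l.+1)%nat by apply: trunc_log_ltn.
have lJ : (l < J)%nat by rewrite -(ltn_exp2l (m := 2)) //; apply: leq_ltn_trans h1 kJ.
have p2 n : INR (2 ^ n)%nat = 2 ^ n by rewrite INR_expn (_ : INR 2 = 2) // /=; lra.
have t0 j : 0 <= Rpower 2 (- (b * INR j)) * rho j ^ (2 * k).
  by apply: Rmult_le_pos; [apply: Rlt_le; apply: Rpower_pos | apply: pow_le; apply: Rlt_le; apply: exp_pos].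
have e4 := exp_pos 4.
apply: Rle_trans (_ : exp 4 * (Rpower 2 (- (b * INR l)) * rho l ^ (2 * k)) <= _); last first.
  apply: Rmult_le_compat_l; first lra.
  by apply: (rsum_ge_term _ (index_iota 0 J) (fun j => Rpower 2 (- (b * INR j)) * rho j ^ (2 * k))); [rewrite mem_index_iota | move=> j _].
have a1 : / Rpower (INR k.+1) b <= Rpower 2 (- (b * INR l)).
  rewrite -Ropp_mult_distr_l_reverse Rmult_comm -Rpower_mult Rpower_pow; last lra.
  rewrite Rpower_Ropp; apply: Rinv_le_contravar; first exact: Rpower_pos.
  apply: Rle_Rpower_l; first lra.
  split; first by apply: pow_lt; lra.
  by rewrite -p2; apply: INR_leq.
have a2 : exp (- 4) <= rho l ^ (2 * k).
  rewrite exp_pow; apply: exp_le.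
  have h3 := INR_leq _ _ (ltnW h2); rewrite p2 /= -/(INR k.+1) in h3.
  have hp : 0 < (/ 2) ^ l by apply: pow_lt; lra.
  have hq : (/ 2) ^ l * 2 ^ l = 1 by rewrite -Rpow_mult_distr Rinv_l ?pow1; lra.
  have := Rmult_le_compat_l _ _ _ (Rlt_le _ _ hp) h3.
  rewrite mult_INR [INR 2]/=; have := S_INR k; set y := INR k.+1 => ey.
  have : INR k = y - 1 by lra.
  move=> ->; nra.
have p := Rpower_pos 2 (- (b * INR l)).
have : exp 4 * exp (- 4) = 1 by rewrite -exp_plus (_ : 4 + -4 = 0) ?exp_0; lra.
move=> ee; apply: Rle_trans a1 _.
have := Rmult_le_compat_l (exp 4 * Rpower 2 (- (b * INR l))) _ _ ltac:(nra) a2; nra.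
Qed.

Section Parseval.
Variables (J M : nat).
Hypothesis M0 : (0 < M)%nat.

Definition gpt (j : {ffun 'I_d -> 'I_J}) (f : {ffun 'I_d -> 'I_M}) : nat -> C :=
  ptz (fun i => RtoC (rho (j i)) * omega M ^ f i)%C.

Definition jweight (b : R) (j : {ffun 'I_d -> 'I_J}) : R := \big[Rmult/1]_(i : 'I_d) Rpower 2 (- (b * INR (j i))).

Definition jrad (j : {ffun 'I_d -> 'I_J}) (m : nat) : R :=
  \big[Rmult/1]_(i : 'I_d) (rho (j i) ^ logn (pr i) m).

Lemma gpt_inDisc (j : {ffun 'I_d -> 'I_J}) (f : {ffun 'I_d -> 'I_M}) : inDisc (gpt j f).
Proof.
apply: ptz_mod => i; have [_ r1 r0 _] := rho_bounds (j i).
by rewrite Cmod_mult Cmod_pow omega_mod pow1 Cmod_R Rabs_pos_eq; lra.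
Qed.

Lemma zchar_gpt (j : {ffun 'I_d -> 'I_J}) (f : {ffun 'I_d -> 'I_M}) (m : nat) : Psmooth m ->
  zchar (gpt j f) m = (RtoC (jrad j m) *
    \big[Cmult/RtoC 1]_(i : 'I_d) ((omega M ^ f i) ^ logn (pr i) m)%C)%C.
Proof.
move=> hm; rewrite zchar_pr //.
have -> : RtoC (jrad j m) =
    \big[Cmult/RtoC 1]_(i : 'I_d) RtoC (rho (j i) ^ logn (pr i) m).
  by rewrite /jrad; elim/big_ind2: _ => // x1 x2 y1 y2 <- <-; rewrite RtoC_mult.
by rewrite -[RHS]big_split /=; apply: eq_bigr => i _; rewrite /gpt ptz_pr Cpow_mult_l RtoC_pow.
Qed.

(** The exponents of an integer below M are themselves below M, so distinct monomials remain
    orthogonal on the grid: there is no aliasing. *)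
Lemma parseval (b : nat -> C) (B : nat) (j : {ffun 'I_d -> 'I_J}) : (B <= M)%nat ->
  (forall m, (0 < m)%nat -> b m <> 0 -> Psmooth m) ->
  \rsum_(f : {ffun 'I_d -> 'I_M}) Cmod (\csum_(1 <= m < B) (b m * zchar (gpt j f) m)) ^ 2 =
  INR M ^ d * \rsum_(1 <= m < B) (Cmod (b m) ^ 2 * jrad j m ^ 2).
Proof.
move=> BM hb; apply: RtoC_inj; rewrite RtoC_rsum.
pose r m := jrad j m.
pose w (f : {ffun 'I_d -> 'I_M}) m := \big[Cmult/RtoC 1]_(i : 'I_d) ((omega M ^ f i) ^ logn (pr i) m)%C.
have conjp (F : 'I_d -> C) : Cconj (\big[Cmult/RtoC 1]_(i : 'I_d) F i) = \big[Cmult/RtoC 1]_(i : 'I_d) Cconj (F i).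
  elim/big_ind2: _ => //; first by rewrite /Cconj /RtoC /= Ropp_0.
  by move=> x1 x2 y1 y2 <- <-; rewrite Cmult_conj.
have ortho m n : (m < M)%nat -> (n < M)%nat -> Psmooth m -> Psmooth n ->
   \csum_(f : {ffun 'I_d -> 'I_M}) (w f m * Cconj (w f n)) = if m == n then RtoC (INR M ^ d) else RtoC 0.
  move=> mM nM hm hn.
  have lM k p : Psmooth k -> (k < M)%nat -> (logn p k < M)%nat.
    by move=> [k0 _] kM; apply: leq_ltn_trans kM; apply: ltnW; apply: ltn_logl.
  transitivity (\big[Cmult/RtoC 1]_(i : 'I_d) \csum_(k : 'I_M)
     ((omega M ^ k) ^ logn (pr i) m * Cconj ((omega M ^ k) ^ logn (pr i) n))).
    rewrite bigA_distr_bigA; apply: eq_bigr => f _.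
    by rewrite /w conjp -big_split.
  have -> : \big[Cmult/RtoC 1]_(i : 'I_d) \csum_(k : 'I_M)
     ((omega M ^ k) ^ logn (pr i) m * Cconj ((omega M ^ k) ^ logn (pr i) n)) =
     \big[Cmult/RtoC 1]_(i : 'I_d) (if logn (pr i) m == logn (pr i) n then RtoC (INR M) else RtoC 0).
    apply: eq_bigr => i _; rewrite -omega_orth; [|exact: lM|exact: lM].
    by rewrite big_mkord.
  case: eqP => [->|ne].
    under eq_bigr do rewrite eqxx.
    rewrite big_const card_ord; elim: (d) => [|k IH] //.
    by rewrite iterS IH /= RtoC_mult.
  case: (pickP (fun i => logn (pr i) m != logn (pr i) n)) => [i hi|h].
    by rewrite (bigD1 i) //= (negbTE hi) Cmult_0_l.
  by case: ne; apply: smooth_inj => // i; have /negbFE /eqP := h i.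
transitivity (\csum_(f : {ffun 'I_d -> 'I_M}) \csum_(1 <= m < B) \csum_(1 <= n < B)
   (b m * Cconj (b n) * RtoC (r m * r n) * (w f m * Cconj (w f n)))).
  apply: eq_bigr => f _; rewrite Cmod2_conj Cconj_csum csum_scalr; rewrite big_nat [RHS]big_nat; apply: eq_bigr => m /andP [m0 _].
  rewrite csum_scal; rewrite big_nat [RHS]big_nat; apply: eq_bigr => n /andP [n0 _].
  have [->|bm] := Ceq_dec (b m) 0; first by ring.
  have [->|bn] := Ceq_dec (b n) 0.
    by rewrite Cmult_0_l (_ : Cconj 0 = 0); [ring | rewrite /Cconj /RtoC /= Ropp_0].
  rewrite !zchar_gpt; [|exact: hb|exact: hb]; rewrite -/(r m) -/(r n) -/(w f m) -/(w f n).
  rewrite !Cmult_conj RtoC_mult (_ : Cconj (RtoC (r n)) = RtoC (r n)); last by rewrite /Cconj /RtoC /= Ropp_0.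
  ring.
rewrite exchange_big /= RtoC_mult RtoC_rsum csum_scal; rewrite big_nat [RHS]big_nat; apply: eq_bigr => m /andP [m0 mB].
have mM : (m < M)%nat by apply: leq_trans BM.
rewrite exchange_big /=.
have mI : m \in index_iota 1 B by rewrite mem_index_iota m0.
have [bz|bm] := Ceq_dec (b m) 0.
  rewrite bz Cmod_0 big1; first by rewrite /= !Rmult_0_l Cmult_0_r.
  by move=> n _; rewrite big1 // => f _; ring.
rewrite (big_rem m mI) [X in Cplus _ X = _]big1_seq ?Cplus_0_r; last first.
  move=> n /andP [_]; rewrite mem_rem_uniq ?iota_uniq // inE mem_index_iota => /andP [nm /andP [n0 nB]].
  rewrite -csum_scal; have [->|bn] := Ceq_dec (b n) 0.
    by rewrite (_ : Cconj 0 = 0); [ring | rewrite /Cconj /RtoC /= Ropp_0].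
  rewrite ortho //; [|exact: leq_trans nB BM|exact: hb|exact: hb].
  by rewrite eq_sym (negbTE nm) Cmult_0_r.
rewrite -csum_scal ortho //; [|exact: hb|exact: hb].
rewrite eqxx -/(r m) -Cmod2_conj (_ : Cmod (b m) ^ 2 * r m ^ 2 = Cmod (b m) ^ 2 * (r m * r m)); last by ring.
rewrite !RtoC_mult; ring.
Qed.

(** d(m)^(-beta) is a product over the variables; [weight_dyadic] in each factor and expansion of
    the product of sums yield one term per choice of radii. *)
Lemma weighted_parseval (beta : R) (b : nat -> C) (B : nat) : 0 < beta -> (B <= M)%nat -> (B <= 2 ^ J)%nat ->
  (forall m, (0 < m)%nat -> b m <> 0 -> Psmooth m) ->
  \rsum_(1 <= m < B) (Cmod (b m) ^ 2 / dpow beta m) <=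
  exp 4 ^ d * \rsum_(j : {ffun 'I_d -> 'I_J}) (jweight beta j * (/ INR M ^ d *
    \rsum_(f : {ffun 'I_d -> 'I_M}) Cmod (\csum_(1 <= m < B) (b m * zchar (gpt j f) m)) ^ 2)).
Proof.
move=> b0 BM BJ hb; have Md : 0 < INR M ^ d by apply: pow_lt; apply: INR_pos.
pose r j m := jrad j m.
have -> : \rsum_(j : {ffun 'I_d -> 'I_J}) (jweight beta j * (/ INR M ^ d *
    \rsum_(f : {ffun 'I_d -> 'I_M}) Cmod (\csum_(1 <= m < B) (b m * zchar (gpt j f) m)) ^ 2)) =
   \rsum_(1 <= m < B) (Cmod (b m) ^ 2 * \rsum_(j : {ffun 'I_d -> 'I_J}) (jweight beta j * r j m ^ 2)).
  transitivity (\rsum_(j : {ffun 'I_d -> 'I_J}) \rsum_(1 <= m < B) (Cmod (b m) ^ 2 * (jweight beta j * r j m ^ 2))).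
    apply: eq_bigr => j _; rewrite parseval // -Rmult_assoc -Rmult_assoc.
    rewrite Rmult_assoc Rmult_assoc -(Rmult_assoc (/ _)) Rinv_l ?Rmult_1_l; last lra.
    rewrite rsum_scal; apply: eq_bigr => m _; rewrite -/(r j m); ring.
  by rewrite exchange_big /=; apply: eq_bigr => m _; rewrite -rsum_scal.
rewrite rsum_scal; apply: rsum_le_nat => m /andP [m0 mB].
have [->|bm] := Ceq_dec (b m) 0.
  by rewrite Cmod_0 (_ : 0 ^ 2 = 0) /Rdiv ?Rmult_0_l ?Rmult_0_r; [lra | rewrite /=; ring].
have hm := hb m m0 bm.
rewrite /Rdiv -Rmult_assoc (Rmult_comm (exp 4 ^ d)) Rmult_assoc; apply: Rmult_le_compat_l; first exact: pow2_ge_0.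
have -> : \rsum_(j : {ffun 'I_d -> 'I_J}) (jweight beta j * r j m ^ 2) =
  \big[Rmult/1]_(i : 'I_d) \rsum_(0 <= j < J) (Rpower 2 (- (beta * INR j)) * rho j ^ (2 * logn (pr i) m)).
  transitivity (\big[Rmult/1]_(i : 'I_d) \rsum_(j : 'I_J) (Rpower 2 (- (beta * INR j)) * rho j ^ (2 * logn (pr i) m))).
    rewrite bigA_distr_bigA; apply: eq_bigr => j _; rewrite big_split /=; congr Rmult.
    rewrite /r /jrad Rmult_1_r -big_split /=; apply: eq_bigr => i _.
    by rewrite -pow_add; congr pow; lia.
  by apply: eq_bigr => i _; rewrite big_mkord.
have -> : exp 4 ^ d = \big[Rmult/1]_(i : 'I_d) exp 4.
  by rewrite big_const card_ord; elim: (d) => [//|k IH]; rewrite iterS -IH.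
rewrite -big_split /= (dpow_pr beta m hm).
have -> : / (\big[Rmult/1]_(i : 'I_d) Rpower (INR (logn (pr i) m).+1) beta) = \big[Rmult/1]_(i : 'I_d) / Rpower (INR (logn (pr i) m).+1) beta.
  elim/big_ind2: _ => //; first exact: Rinv_1.
  by move=> x1 x2 y1 y2 <- <-; rewrite Rinv_mult.
apply: rprod_le => i _; split; first by apply: Rlt_le; apply: Rinv_0_lt_compat; apply: Rpower_pos.
apply: weight_dyadic => //; apply: leq_trans BJ; apply: leq_ltn_trans mB.
by apply: ltn_logl.
Qed.
End Parseval.
End Grid.

(** * A large sieve for the divisor weight *)

Lemma inv_sq_sum (n T : nat) : \rsum_(0 <= i < T) / (1 + (INR n - INR i) ^ 2) <= 6.
Proof.
have hA k : (k <= n)%nat -> \rsum_(0 <= i < k) / (1 + (INR n - INR i) ^ 2) <= 3 / (INR n - INR k + 1).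
  elim: k => [|k IH] kn.
    by rewrite big_geq //; apply: Rdiv_le_0_compat; [lra | have := pos_INR n; rewrite [INR 0]/=; lra].
  rewrite big_nat_recr //.
  have kn' : INR k.+1 <= INR n by apply: INR_leq.
  apply: Rle_trans (Rplus_le_compat_r _ _ _ (IH (ltnW kn))) _.
  rewrite S_INR in kn' *; set u := INR n - INR k; have u1 : 1 <= u by rewrite /u; lra.
  rewrite (_ : INR n - (INR k + 1) + 1 = u); last by rewrite /u; ring.
  apply: Rle_trans (_ : 3 / (u + 1) + 3 / (u * (u + 1)) <= _); last by right; field; lra.
  apply: Rplus_le_compat_l; apply/Rle_div_r; first nra.
  rewrite Rmult_comm; apply/Rle_div_l; nra.
have hB k : \rsum_(n <= i < n + k) / (1 + (INR n - INR i) ^ 2) <= 3 - 3 / INR k.+1.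
  elim: k => [|k IH].
    by rewrite addn0 big_geq // [INR 1]/=; lra.
  rewrite addnS big_nat_recr ?leq_addr //.
  apply: Rle_trans (Rplus_le_compat_r _ _ _ IH) _.
  rewrite plus_INR !S_INR; set u := INR k; have u0 : 0 <= u by apply: pos_INR.
  rewrite (_ : 3 - 3 / (u + 1 + 1) = 3 - 3 / (u + 1) + 3 / ((u + 1) * (u + 2))); last by field; lra.
  apply: Rplus_le_compat_l; apply/Rle_div_r; first nra.
  rewrite Rmult_comm; apply/Rle_div_l; first nra.
  (* Nonnegative at integers, although negative between 1/2 and 1. *)
  suff : 0 <= (2 * u - 1) * (u - 1) by nra.
  rewrite /u; case: k {IH u u0} => [|k]; first by rewrite [INR 0]/=; lra.
  by have := pos_INR k; rewrite S_INR; nra.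
have q0 k : 0 < 3 / INR k.+1 by apply: Rdiv_lt_0_compat; [lra | exact: INRS_pos].
case: (leqP T n) => h.
  apply: Rle_trans (hA T h) _; apply/Rle_div_l; have := INR_leq _ _ h; lra.
rewrite (big_cat_nat (n := n)) //=; last exact: ltnW.
have := hA n (leqnn n); rewrite (_ : INR n - INR n + 1 = 1); last by ring.
have := hB (T - n)%nat; rewrite subnKC; last exact: ltnW.
have := q0 (T - n)%nat; move=> a1 a2 a3.
by apply: Rle_trans (Rplus_le_compat _ _ _ _ a3 a2) _; lra.
Qed.

Lemma dyadic_split (G : nat -> R) (T : nat) :
  \rsum_(1 <= m < (2 ^ T)%nat) G m = \rsum_(0 <= i < T) \rsum_((2 ^ i)%nat <= m < (2 ^ i.+1)%nat) G m.
Proof.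
elim: T => [|T IH]; first by rewrite !big_geq.
rewrite [RHS]big_nat_recr // -IH -big_cat_nat //; first by rewrite expn_gt0.
by rewrite leq_exp2l.
Qed.

Lemma trunc_log_window (i m : nat) : (2 ^ i <= m < 2 ^ i.+1)%nat -> trunc_log 2 m = i.
Proof. by move=> h; apply: trunc_log_eq. Qed.

Lemma ln2_ge_half : 1 / 2 <= ln 2.
Proof.
have := exp_ineq1_le (- ln 2); rewrite exp_Ropp exp_ln; lra.
Qed.

Lemma ln_INR_window (n : nat) : (0 < n)%nat ->
  INR (trunc_log 2 n) * ln 2 <= ln (INR n) <= INR (trunc_log 2 n).+1 * ln 2.
Proof.
move=> n0; have e k : INR k * ln 2 = ln (INR (2 ^ k)%nat).
  by rewrite INR_expn (_ : INR 2 = 2) ?ln_pow; [lra | lra | rewrite /=; lra].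
rewrite !e; split; apply: ln_le; try (apply: INR_pos; by rewrite ?expn_gt0).
  exact: INR_leq (trunc_logP _ n0).
by apply: INR_leq; apply: ltnW; apply: trunc_log_ltn.
Qed.

(** Replaces logarithms by indices of dyadic blocks. Blocks at distance at most one are covered by
    the constant; beyond that |ln n - ln m| is at least (|t| - 1) / 2, as ln 2 >= 1/2. *)
Lemma ln_kernel_le (n m : nat) : (0 < n)%nat -> (0 < m)%nat ->
  / (1 + (ln (INR n) - ln (INR m)) ^ 2) <= 12 * / (1 + (INR (trunc_log 2 n) - INR (trunc_log 2 m)) ^ 2).
Proof.
move=> n0 m0; have [a1 a2] := ln_INR_window n n0; have [b1 b2] := ln_INR_window m m0.
move: a1 a2 b1 b2; set i := trunc_log 2 n; set k := trunc_log 2 m; set x := ln (INR n); set y := ln (INR m).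
rewrite !S_INR => a1 a2 b1 b2; have l2 := ln2_ge_half.
have key u v : INR u * ln 2 <= v -> 0 <= v.
  by move=> h; apply: Rle_trans h; apply: Rmult_le_pos; [exact: pos_INR | lra].
set t := INR i - INR k.
have h : t <= 1 /\ - 1 <= t \/ 1 / 4 * (Rabs t - 1) ^ 2 <= (x - y) ^ 2.
  case: (Rle_dec (Rabs t) 1) => ht; first by left; move: ht; rewrite /Rabs; case: Rcase_abs; lra.
  right; move: ht; rewrite /Rabs /t; case: Rcase_abs => hs ht.
    have : 1 / 2 * (INR k - INR i - 1) <= y - x by nra.
    nra.
  have : 1 / 2 * (INR i - INR k - 1) <= x - y by nra.
  nra.
apply: Rle_trans (_ : / ((1 + t ^ 2) / 12) <= _); last by right; field; nra.
apply: Rinv_le_contravar; first nra.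
have q := pow2_ge_0 (x - y).
case: h => [[h1 h2]|]; first nra.
have e : t ^ 2 = Rabs t ^ 2 by rewrite pow2_abs.
rewrite e; set r := Rabs t => hr; nra.
Qed.

(** The dyadic logarithm plus one stands for ln n: it is positive at n = 1 and constant on dyadic
    blocks. *)
Definition pweight (alpha : R) (n : nat) : R :=
  dpow alpha n / INR n * Rpower (INR (trunc_log 2 n).+1) (1 - Rpower 2 alpha).

Lemma pweight_pos (alpha : R) (n : nat) : (0 < n)%nat -> 0 < pweight alpha n.
Proof.
move=> n0; apply: Rmult_lt_0_compat; last exact: Rpower_pos.
by apply: Rdiv_lt_0_compat; [exact: dpow_pos | exact: INR_pos].
Qed.

(** By [div_window] every dyadic block has total weight O(1): the factor (i+1)^(1-A) cancels the
    growth (i+1)^(A-1). There remains the sum of 1 / (1 + k^2) over the distances k between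
    blocks. *)
Lemma pweight_kernel (alpha : R) : 0 < alpha -> exists2 C0, 0 < C0 & forall n X, (0 < n)%nat ->
  \rsum_(1 <= m < X) (pweight alpha m * / (1 + (ln (INR n) - ln (INR m)) ^ 2)) <= C0.
Proof.
move=> a0; have [C0 C00 hC] := div_window alpha a0; exists (12 * C0 * 6); first lra.
move=> n X n0; set k0 := fun m => / (1 + (ln (INR n) - ln (INR m)) ^ 2).
have k0p m : 0 <= k0 m by apply: Rlt_le; apply: Rinv_0_lt_compat; have := pow2_ge_0 (ln (INR n) - ln (INR m)); lra.
have XT : (X <= 2 ^ X)%nat by apply: ltnW; apply: ltn_expl.
apply: Rle_trans (_ : \rsum_(1 <= m < (2 ^ X)%nat) (pweight alpha m * k0 m) <= _).
  apply: rsum_sub; first exact: iota_uniq.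
    by move=> m; rewrite !mem_index_iota => /andP [-> h]; apply: leq_trans h XT.
  move=> m; rewrite mem_index_iota => /andP [m0 _]; apply: Rmult_le_pos; last exact: (k0p m).
  by apply: Rlt_le; apply: pweight_pos.
rewrite (dyadic_split (fun m => pweight alpha m * k0 m)).
apply: Rle_trans (_ : \rsum_(0 <= i < X) (12 * C0 * / (1 + (INR (trunc_log 2 n) - INR i) ^ 2)) <= _); last first.
  by rewrite -rsum_scal; apply: Rmult_le_compat_l; [lra | exact: inv_sq_sum].
apply: rsum_le_nat => i _; set q := / _; have q0 : 0 < q.
  by apply: Rinv_0_lt_compat; have := pow2_ge_0 (INR (trunc_log 2 n) - INR i); lra.
set e := Rpower 2 alpha - 1; set r := Rpower (INR i.+1) (- e).
apply: Rle_trans (_ : \rsum_((2 ^ i)%nat <= m < (2 ^ i.+1)%nat) (12 * q * r * (dpow alpha m / INR m)) <= _).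
  apply: rsum_le_nat => m hm; have m0 : (0 < m)%nat by apply: leq_trans (proj1 (andP hm)); rewrite expn_gt0.
  have := ln_kernel_le n m n0 m0; rewrite /pweight (trunc_log_window _ _ hm) -/q -/(k0 m).
  rewrite (_ : 1 - Rpower 2 alpha = - e); last by rewrite /e; ring.
  rewrite -/r => h; rewrite (_ : 12 * q * r * _ = dpow alpha m / INR m * r * (12 * q)); last by ring.
  apply: Rmult_le_compat_l => //; apply: Rmult_le_pos; last by apply: Rlt_le; apply: Rpower_pos.
  by apply: Rlt_le; apply: Rdiv_lt_0_compat; [exact: dpow_pos | exact: INR_pos].
rewrite -rsum_scal; have r0 : 0 < r by apply: Rpower_pos.
have := Rmult_le_compat_l (12 * q * r) _ _ ltac:(apply: Rmult_le_pos; nra) (hC i).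
have er : r * Rpower (INR i.+1) e = 1 by rewrite /r -Rpower_plus Rplus_opp_l Rpower_O //; exact: INRS_pos.
rewrite -/e; rewrite (_ : 12 * q * r * (C0 * _) = 12 * C0 * q * (r * Rpower (INR i.+1) e)); last by ring.
by rewrite er Rmult_1_r.
Qed.

(** x_i x_j is split by the arithmetic-geometric inequality in the proportion p_j : p_i, and the
    symmetry of the kernel makes the two halves equal. *)
Lemma schur_test (I : eqType) (s : seq I) (x p : I -> R) (k : I -> I -> R) (C0 : R) :
  (forall i, i \in s -> 0 < p i) -> (forall i, 0 <= x i) -> (forall i j, 0 <= k i j) -> (forall i j, k i j = k j i) ->
  (forall i, i \in s -> \rsum_(j <- s) (p j * k i j) <= C0) ->
  \rsum_(i <- s) \rsum_(j <- s) (x i * x j * k i j) <= C0 * \rsum_(i <- s) (x i ^ 2 / p i).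
Proof.
move=> p0 x0 k0 ks hk.
apply: Rle_trans (_ : \rsum_(i <- s) \rsum_(j <- s)
  (/ 2 * (x i ^ 2 / p i * (p j * k i j)) + / 2 * (x j ^ 2 / p j * (p i * k i j))) <= _).
  apply: rsum_le_in => i si _; apply: rsum_le_in => j sj _.
  have h : x i * x j <= / 2 * (x i ^ 2 / p i * p j) + / 2 * (x j ^ 2 / p j * p i).
    have pi := p0 i si; have pj := p0 j sj.
    have : 0 <= (x i * p j - x j * p i) ^ 2 / (p i * p j) by apply: Rdiv_le_0_compat; [exact: pow2_ge_0 | nra].
    rewrite (_ : (x i * p j - x j * p i) ^ 2 / (p i * p j) = x i ^ 2 / p i * p j + x j ^ 2 / p j * p i - 2 * (x i * x j)); last by field; lra.
    lra.
  have := Rmult_le_compat_r _ _ _ (k0 i j) h; lra.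
have e F : \rsum_(i <- s) \rsum_(j <- s) (/ 2 * (x i ^ 2 / p i * (p j * F i j))) = / 2 * \rsum_(i <- s) (x i ^ 2 / p i * \rsum_(j <- s) (p j * F i j)).
  rewrite rsum_scal; apply: eq_bigr => i _; rewrite rsum_scal rsum_scal; apply: eq_bigr => j _; ring.
under eq_bigr do rewrite big_split /=.
rewrite big_split /= e [X in _ + X]exchange_big /=.
have -> : \rsum_(j <- s) \rsum_(i <- s) (/ 2 * (x j ^ 2 / p j * (p i * k i j))) = \rsum_(j <- s) \rsum_(i <- s) (/ 2 * (x j ^ 2 / p j * (p i * k j i))).
  by apply: eq_bigr => j _; apply: eq_bigr => i _; rewrite (ks i j).
rewrite (e k).
have : \rsum_(i <- s) (x i ^ 2 / p i * \rsum_(j <- s) (p j * k i j)) <= C0 * \rsum_(i <- s) (x i ^ 2 / p i).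
  rewrite Rmult_comm rsum_scalr; apply: rsum_le_in => i si _; apply: Rmult_le_compat_l; last exact: hk.
  by apply: Rdiv_le_0_compat; [exact: pow2_ge_0 | exact: p0].
set u := (X in X <= _ -> _); set v := (X in u <= X -> _) => h.
by change (/ 2 * u + / 2 * u <= v); lra.
Qed.

Lemma sin_ge_half (x : R) : 0 <= x <= 1 -> x / 2 <= sin x.
Proof.
move=> [x0 x1]; have [h _] := pre_sin_bound x 0 x0 ltac:(lra).
apply: Rle_trans h; rewrite /sin_approx /sin_term /= /sin_term /=; nra.
Qed.

Lemma chord_ge (x : R) : Rabs x <= 1 -> Rabs x / 2 <= Cmod (1 - Cexp (Ci * RtoC x)).
Proof.
move=> x1; have e : Im (1 - Cexp (Ci * RtoC x)) = - sin x.
  by rewrite /Cexp /= !Rmult_0_l !Rmult_1_l Rminus_0_l Rplus_0_l Rplus_0_l Ropp_0 exp_0 Rmult_1_l.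
apply: Rle_trans (im_le_Cmod _); rewrite e Rabs_Ropp.
case: (Rle_dec 0 x) => x0.
  by rewrite (Rabs_pos_eq x) // in x1 *; apply: Rle_trans (Rle_abs _); apply: sin_ge_half.
rewrite Rabs_left in x1 *; last lra.
have := sin_ge_half (- x) ltac:(lra); rewrite sin_neg => h; have := Rabs_maj2 (sin x); lra.
Qed.

(** Combines the trivial bound 4 L with the chord estimate 4 / (tau |th|) <= 4 L / |th|. The
    condition tau |th| <= 1 keeps the ratio from wrapping around the circle. *)
Lemma geom_kernel_le (L : nat) (tau th : R) : (0 < L)%nat -> 1 <= tau * INR L -> tau * Rabs th <= 1 -> 0 < tau ->
  Cmod (\csum_(0 <= a < (4 * L)%nat) (Cexp (Ci * RtoC (- (tau * th))) ^ a)) ^ 2 <= 32 * INR L ^ 2 * / (1 + th ^ 2).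
Proof.
move=> L0 tL tth t0; set q := Cexp _; set S := Cmod _; have S0 : 0 <= S by apply: Cmod_ge_0.
have q1 : Cmod q = 1 by apply: Cmod_Cexp_i.
have l0 : 0 < INR L by apply: INR_pos.
have h1 : S <= 4 * INR L.
  apply: Rle_trans (Cmod_csum _ _ _ _) _.
  under eq_bigr do rewrite Cmod_pow q1 pow1.
  by rewrite rsum_const_nat subn0 mult_INR Rmult_1_r [INR 4]/=; lra.
have p0 : 0 < 1 + th ^ 2 by have := pow2_ge_0 th; lra.
apply/(Rle_div_r (S ^ 2) _ (1 + th ^ 2)) => //.
have h2 : S * Rabs th <= 4 * INR L.
  case: (Req_dec th 0) => [->|thn]; first by rewrite Rabs_R0; lra.
  have a0 := Rabs_pos_lt _ thn.
  have ra : Rabs (- (tau * th)) = tau * Rabs th by rewrite Rabs_Ropp Rabs_mult Rabs_pos_eq; lra.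
  have qn : q <> 1 by apply: Cexp_i_neq1; rewrite ra //; nra.
  have := Cgeom_sum_le q (4 * L) q1 qn; rewrite -/S => h.
  have c := chord_ge (- (tau * th)) ltac:(rewrite ra //); rewrite ra -/q in c.
  have c0 : 0 < tau * Rabs th / 2 by nra.
  have : S * Cmod (1 - q) <= 2 by apply/Rle_div_r => //; lra.
  move=> h3; have h4 : S * (tau * Rabs th / 2) <= 2 by nra.
  have : (S * Rabs th) * 1 <= S * Rabs th * (tau * INR L) by apply: Rmult_le_compat_l => //; nra.
  nra.
have e : th ^ 2 = Rabs th ^ 2 by rewrite pow2_abs.
change (S ^ 2 * (1 + th ^ 2) <= 32 * INR L ^ 2).
rewrite e; have r0 := Rabs_pos th; have := pow_incr _ _ 2 (conj S0 h1).
have := pow_incr _ _ 2 (conj (Rmult_le_pos _ _ S0 r0) h2); set r := Rabs th; lra.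
Qed.

(* A dual large sieve: the Fejer kernel coming from the differences [a - b] decays like [1/(1 + ln^2(n/m))]. *)
Lemma large_sieve (alpha W : R) : 0 < alpha -> 1 <= W -> exists2 C0, 0 < C0 & forall L X (x : nat -> C), (0 < L)%nat ->
  W / INR L * ln (INR X) <= 1 ->
  / INR L ^ 2 * \rsum_(0 <= a < (4 * L)%nat) \rsum_(0 <= b < (4 * L)%nat)
     Cmod (\csum_(1 <= n < X.+1) (x n * npow n (Ci * RtoC ((INR a - INR b) * (W / INR L))))) ^ 2 <=
  C0 * \rsum_(1 <= n < X.+1) (Cmod (x n) ^ 2 / pweight alpha n).
Proof.
move=> a0 W1; have [C1 C10 hC] := pweight_kernel alpha a0; exists (32 * C1); first lra.
move=> L X x L0 hX; set tau := W / INR L in hX *; have l0 : 0 < INR L by apply: INR_pos.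
have t0 : 0 < tau by apply: Rdiv_lt_0_compat; lra.
have tL : tau * INR L = W by rewrite /tau; field; lra.
(* Summing the phases exp(- i (a - b) tau (ln n - ln m)) over a and b gives the squared modulus of
   one geometric sum. *)
pose ker n m := Cmod (\csum_(0 <= a < (4 * L)%nat) (Cexp (Ci * RtoC (- (tau * (ln (INR n) - ln (INR m))))) ^ a)) ^ 2.
set S := \rsum_(0 <= a < (4 * L)%nat) _.
have eS : RtoC S = \csum_(1 <= n < X.+1) \csum_(1 <= m < X.+1) (x n * Cconj (x m) * RtoC (ker n m)).
  transitivity (\csum_(0 <= a < (4 * L)%nat) \csum_(0 <= b < (4 * L)%nat) \csum_(1 <= n < X.+1) \csum_(1 <= m < X.+1)
    (x n * Cconj (x m) * (Cexp (Ci * RtoC (- (tau * (ln (INR n) - ln (INR m))))) ^ a * Cconj (Cexp (Ci * RtoC (- (tau * (ln (INR n) - ln (INR m))))) ^ b)))).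
    rewrite /S RtoC_rsum; apply: eq_bigr => a _; rewrite RtoC_rsum; apply: eq_bigr => b _.
    rewrite Cmod2_conj Cconj_csum csum_scalr; apply: eq_bigr => n _.
    rewrite csum_scal; apply: eq_bigr => m _; rewrite Cmult_conj.
    set u := npow n _; set v := npow m _.
    transitivity (x n * Cconj (x m) * (u * Cconj v))%C; first by ring.
    congr Cmult; rewrite /u /v npow_ratio !Cexp_pow Cexp_conj -Cexp_plus; congr Cexp.
    by rewrite /Ci /Cconj /Cmult /Cplus /RtoC /=; congr pair; ring.
  under eq_bigr => a _ do rewrite exchange_big /=.
  rewrite exchange_big /=; apply: eq_bigr => n _.
  under eq_bigr => a _ do rewrite exchange_big /=.
  rewrite exchange_big /=; apply: eq_bigr => m _.
  rewrite /ker Cmod2_conj Cconj_csum csum_scalr csum_scal; apply: eq_bigr => a _.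
  by rewrite csum_scal csum_scal.
have S0 : 0 <= S by apply: rsum_ge0 => a _; apply: rsum_ge0 => b _; apply: pow2_ge_0.
have h1 : S <= \rsum_(1 <= n < X.+1) \rsum_(1 <= m < X.+1) (Cmod (x n) * Cmod (x m) * (32 * INR L ^ 2 * / (1 + (ln (INR n) - ln (INR m)) ^ 2))).
  rewrite -(Rabs_pos_eq S) // -Cmod_R eS; apply: Rle_trans (Cmod_csum _ _ _ _) _.
  apply: rsum_le_nat => n /andP [n0 nX]; apply: Rle_trans (Cmod_csum _ _ _ _) _.
  apply: rsum_le_nat => m /andP [m0 mX]; rewrite !Cmod_mult Cmod_conj Cmod_R.
  apply: Rmult_le_compat_l; first by apply: Rmult_le_pos; apply: Cmod_ge_0.
  rewrite Rabs_pos_eq; last exact: pow2_ge_0.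
  apply: geom_kernel_le => //; first lra.
  have ln0 k : 0 <= ln (INR k) by apply: ln_INR_ge0.
  have lnX k : (0 < k)%nat -> (k < X.+1)%nat -> ln (INR k) <= ln (INR X).
    by move=> k0 kX; apply: ln_le; [exact: INR_pos | exact: INR_leq].
  apply: Rle_trans hX; apply: Rmult_le_compat_l; first lra.
  have := lnX n n0 nX; have := lnX m m0 mX; have := ln0 n; have := ln0 m.
  by move=> *; apply: Rabs_le; lra.
have := schur_test _ (index_iota 1 X.+1) (fun n => Cmod (x n)) (pweight alpha)
  (fun n m => / (1 + (ln (INR n) - ln (INR m)) ^ 2)) C1.
move=> /(_ _ _ _ _ _) h.
have {h} : \rsum_(1 <= n < X.+1) \rsum_(1 <= m < X.+1) (Cmod (x n) * Cmod (x m) * / (1 + (ln (INR n) - ln (INR m)) ^ 2)) <=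
   C1 * \rsum_(1 <= n < X.+1) (Cmod (x n) ^ 2 / pweight alpha n).
  apply: h.
  - by move=> i; rewrite mem_index_iota => /andP [i0 _]; apply: pweight_pos.
  - by move=> i; apply: Cmod_ge_0.
  - by move=> i j; apply: Rlt_le; apply: Rinv_0_lt_compat; have := pow2_ge_0 (ln (INR i) - ln (INR j)); lra.
  - by move=> i j; congr Rinv; ring.
  - by move=> i; rewrite mem_index_iota => /andP [i0 _]; apply: hC.
set u := (X in X <= _ -> _) => h2.
have L2 : 0 < INR L ^ 2 by apply: pow_lt.
apply: Rle_trans (_ : 32 * u <= _); last lra.
rewrite Rmult_comm; apply/Rle_div_l => //; apply: Rle_trans h1 _; right.
rewrite /u rsum_scal rsum_scalr; apply: eq_bigr => n _; rewrite rsum_scal rsum_scalr; apply: eq_bigr => m _; ring.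
Qed.

(** * Sums over a level of the real part *)

Definition Rleb (x y : R) : bool := if Rle_dec x y then true else false.

Lemma RlebP (x y : R) : reflect (x <= y) (Rleb x y).
Proof. by rewrite /Rleb; case: Rle_dec => h; constructor. Qed.

Lemma INR_floor (x : R) : 0 <= x -> exists n : nat, INR n <= x < INR n + 1.
Proof. by move=> /nfloor_ex [n [h1 h2]]; exists n. Qed.

Lemma INR_ceil (x : R) : 0 <= x -> exists n : nat, x <= INR n < x + 1.
Proof.
move=> x0; have [n [h1 h2]] := INR_floor x x0; case: (Req_dec x (INR n)) => h.
  by exists n; lra.
by exists n.+1; rewrite S_INR; lra.
Qed.

Lemma count_window (Q : nat) (x k : R) : 1 <= k -> 0 <= x - k -> x + k < INR Q ->
  k <= \rsum_(0 <= a < Q | Rleb (Rabs (INR a - x)) k) 1.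
Proof.
move=> k1 xk xQ; have [a0 [h1 h2]] := INR_ceil _ xk; have [m [m1 m2]] := INR_floor (2 * k) ltac:(lra).
apply: Rle_trans (_ : \rsum_(0 <= i < m) 1 <= _).
  by rewrite rsum_const_nat subn0; lra.
rewrite [X in _ <= X]big_mkcond /=.
apply: (rsum_inj_le _ _ _ _ (fun i => a0 + i)%nat); first exact: iota_uniq.
- by move=> i j _ _ /addnI.
- move=> i; rewrite mem_index_iota => /andP [_ im]; have hi : INR i.+1 <= INR m by apply: INR_leq.
  rewrite S_INR in hi; rewrite mem_index_iota /= ; split.
    by apply/ltP; apply: INR_lt; rewrite plus_INR; lra.
  case: RlebP => [_|h]; first lra.
  by case: h; rewrite plus_INR; apply: Rabs_le; have := pos_INR i; lra.
- by move=> j _; case: ifP; lra.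
Qed.

Lemma rsum_sq_le (I : Type) (s : seq I) (c : I -> R) : (forall i, 0 <= c i) ->
  \rsum_(i <- s) c i ^ 2 <= (\rsum_(i <- s) c i) ^ 2.
Proof.
move=> c0; elim: s => [|i s IH]; first by rewrite !big_nil /=; lra.
rewrite !big_cons; have := c0 i; have : 0 <= \rsum_(j <- s) c j by apply: rsum_ge0.
by move=> h1 h2; nra.
Qed.

Lemma exp_partial_le (u : R) (K : nat) : 0 <= u -> \rsum_(0 <= k < K) (u ^ k / INR (fact k)) <= exp u.
Proof.
move=> u0; have t0 n : 0 <= / INR (fact n) * u ^ n.
  by apply: Rmult_le_pos; [apply: Rlt_le; apply: Rinv_0_lt_compat; exact: INR_fact_lt_0 | exact: pow_le].
case: K => [|K]; first by rewrite big_geq //; apply: Rlt_le; apply: exp_pos.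
have h := exist_exp u; case: h => l hl; have -> : exp u = l.
  by rewrite /exp; case: exist_exp => l' hl'; apply: uniqueness_sum hl' hl.
apply: Rle_trans (sum_incr _ K _ hl t0).
rewrite -sum_n_Reals sum_n_rsum; right; apply: eq_bigr => k _; rewrite /Rdiv; ring.
Qed.

(** As 2 <= (3/2)^2, the sum is at most the square of the exponential series at 3 u / 2. *)
Lemma exp_sq_partial_le (u : R) (K : nat) : 0 <= u ->
  \rsum_(0 <= k < K) (2 ^ k * (u ^ k / INR (fact k)) ^ 2) <= exp (3 * u).
Proof.
move=> u0; have f0 n := INR_fact_lt_0 n.
apply: Rle_trans (_ : \rsum_(0 <= k < K) ((3 / 2 * u) ^ k / INR (fact k)) ^ 2 <= _).
  apply: rsum_le => k _; rewrite (Rpow_mult_distr (3 / 2)).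
  have h : 2 ^ k <= ((3 / 2) ^ k) ^ 2 by rewrite -pow_mult PeanoNat.Nat.mul_comm pow_mult; apply: pow_incr; lra.
  rewrite (_ : (3 / 2) ^ k * u ^ k / INR (fact k) = (3 / 2) ^ k * (u ^ k / INR (fact k))); last by rewrite /Rdiv; ring.
  by rewrite Rpow_mult_distr; apply: Rmult_le_compat_r => //; apply: pow2_ge_0.
apply: Rle_trans (rsum_sq_le _ _ _ _) _.
  move=> k; apply: Rdiv_le_0_compat; [by apply: pow_le; lra | exact: f0].
rewrite (_ : exp (3 * u) = exp (3 / 2 * u) ^ 2); last by rewrite /= Rmult_1_r -exp_plus; congr exp; lra.
apply: pow_incr; split; last by apply: exp_partial_le; lra.
apply: rsum_ge0 => k _; apply: Rdiv_le_0_compat; [by apply: pow_le; lra | exact: f0].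
Qed.

(** The size of the k-th Taylor term of n^(-s) around 1/2 + 3e/2 + it, at radius 3e/4. This radius
    adds the half-width e/2 of the range of Re s and the tolerance e/4 in Im s. *)
Definition tcoef (e : R) (k n : nat) : R :=
  (ln (INR n) * (3 / 4 * e)) ^ k / INR (fact k) * Rpower (INR n) (- (1 / 2 + 3 / 2 * e)).

(* Taylor expansion at [1/2 + 3e/2 + it] of the Dirichlet polynomial: the Cauchy-Schwarz weights [2^k] replace an area mean. *)
Lemma taylor_mean (a : nat -> C) (X K : nat) (e err t : R) (s : C) : 0 < e ->
  e <= Re s - 1 / 2 <= 2 * e -> Rabs (Im s - t) <= e / 4 ->
  (forall w, Cmod w <= ln (INR X) * (3 / 4 * e) -> Cmod (Cexp w - Texp K w) <= err) ->
  Cmod (\csum_(1 <= n < X.+1) (a n * Cexp (- (ln (INR n) * s)))) ^ 2 <=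
  4 * \rsum_(0 <= k < K) (2 ^ k * Cmod (\csum_(1 <= n < X.+1) (a n * RtoC (tcoef e k n) * npow n (Ci * RtoC t))) ^ 2)
   + 2 * (err * \rsum_(1 <= n < X.+1) Cmod (a n)) ^ 2.
Proof.
move=> e0 hs ht hK; set w := (s - (RtoC (1 / 2 + 3 / 2 * e) + Ci * RtoC t))%C.
have r0 : 0 < 3 / 4 * e by lra.
have wm : Cmod w <= 3 / 4 * e.
  apply: Rle_trans (Cmod_Re_Im w) _.
  have -> : Re w = Re s - 1 / 2 - 3 / 2 * e by rewrite /w /= /Re; field.
  have -> : Im w = Im s - t by rewrite /w /= /Im; ring.
  have : Rabs (Re s - 1 / 2 - 3 / 2 * e) <= e / 2 by apply: Rabs_le; lra.
  by move=> h; lra.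
pose lam n := ln (INR n); pose g n := Rpower (INR n) (- (1 / 2 + 3 / 2 * e)).
pose v n := npow n (Ci * RtoC t).
have lam0 n : 0 <= lam n by apply: ln_INR_ge0.
have split_exp n : Cexp (- (lam n * s)) = (RtoC (g n) * v n * Cexp (- (lam n * w)))%C.
  rewrite /v npow_Cexp /g /Rpower -/(lam n) -Cexp_RtoC -!Cexp_plus; congr Cexp.
  rewrite /w RtoC_mult RtoC_opp; ring.
set F := fun k => \csum_(1 <= n < X.+1) (a n * RtoC (tcoef e k n) * v n).
pose u := (- w * RtoC (/ (3 / 4 * e)))%C.
have um : Cmod u <= 1.
  rewrite /u Cmod_mult Cmod_opp Cmod_R Rabs_pos_eq; last by apply: Rlt_le; apply: Rinv_0_lt_compat.
  by apply/Rle_div_l => //; lra.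
have eF : \csum_(1 <= n < X.+1) (a n * (RtoC (g n) * v n * Texp K (- (lam n * w)))) = \csum_(0 <= k < K) (u ^ k * F k).
  under [RHS]eq_bigr do rewrite /F csum_scal.
  rewrite exchange_big /=; apply: eq_bigr => n _; rewrite /Texp csum_scal csum_scal; apply: eq_bigr => k _.
  pose y := lam n * (3 / 4 * e).
  rewrite /tcoef -/(lam n) -/(g n) -/y (_ : (- (lam n * w) = RtoC y * u)%C); last first.
    rewrite /u /y RtoC_mult (_ : (RtoC (lam n) * RtoC (3 / 4 * e) * (- w * RtoC (/ (3 / 4 * e))) = - (RtoC (lam n) * w) * (RtoC (3 / 4 * e) * RtoC (/ (3 / 4 * e))))%C); last by ring.
    by rewrite -RtoC_mult Rinv_r; [ring | lra].
  by clearbody y; rewrite Cpow_mult_l /Rdiv !RtoC_mult RtoC_pow; ring.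
set D := \csum_(1 <= n < X.+1) _.
have h1 : Cmod (D - \csum_(0 <= k < K) (u ^ k * F k)) <= err * \rsum_(1 <= n < X.+1) Cmod (a n).
  rewrite -eF /D /Cminus (big_morph Copp (id1 := RtoC 0) (op1 := Cplus)); last by rewrite /Copp /RtoC /= Ropp_0.
    rewrite -big_split /=; apply: Rle_trans (Cmod_csum _ _ _ _) _; rewrite rsum_scal; apply: rsum_le_nat => n /andP [n0 nX].
    rewrite (split_exp n) (_ : (_ + _ = a n * (RtoC (g n) * v n) * (Cexp (- (lam n * w)) - Texp K (- (lam n * w))))%C); last by ring.
    rewrite !Cmod_mult Cmod_R Rabs_pos_eq; last by apply: Rlt_le; apply: Rpower_pos.
    have -> : Cmod (v n) = 1 by rewrite /v Cmod_npow /= !Rmult_0_l Rmult_0_r Rminus_0_r Ropp_0 Rpower_O //; apply: INR_pos.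
    have g1 : g n <= 1.
      rewrite /g -[X in _ <= X](Rpower_O (INR n)); last exact: INR_pos.
      by apply: Rle_Rpower; [exact: INR_ge1 | lra].
    have hK1 : Cmod (Cexp (- (lam n * w)) - Texp K (- (lam n * w))) <= err.
      apply: hK; rewrite Cmod_opp Cmod_mult Cmod_R Rabs_pos_eq //.
      apply: Rmult_le_compat => //; first exact: Cmod_ge_0.
      by apply: ln_le; [exact: INR_pos | exact: INR_leq].
    have := Cmod_ge_0 (a n); have := Cmod_ge_0 (Cexp (- (lam n * w)) - Texp K (- (lam n * w))).
    have g0 : 0 < g n by apply: Rpower_pos.
    move=> q1 q2; have : g n * Cmod (Cexp (- (lam n * w)) - Texp K (- (lam n * w))) <= err by nra.
    by move=> q3; nra.
  by move=> x y; rewrite Copp_plus_distr.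
have h2 : Cmod (\csum_(0 <= k < K) (u ^ k * F k)) ^ 2 <= 2 * \rsum_(0 <= k < K) (2 ^ k * Cmod (F k) ^ 2).
  set G := \rsum_(0 <= k < K) (2 ^ k * Cmod (F k) ^ 2).
  have G0 : 0 <= G by apply: rsum_ge0 => k _; apply: Rmult_le_pos; [apply: pow_le; lra | exact: pow2_ge_0].
  apply: Rle_trans (_ : (\rsum_(0 <= k < K) (sqrt ((/ 2) ^ k) * sqrt (2 ^ k * Cmod (F k) ^ 2))) ^ 2 <= _).
    apply: pow_incr; split; first exact: Cmod_ge_0.
    apply: Rle_trans (Cmod_csum _ _ _ _) _; apply: rsum_le => k _.
    have p2 : 0 < 2 ^ k by apply: pow_lt; lra.
    rewrite -sqrt_mult_alt; last by apply: pow_le; lra.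
    rewrite -Rmult_assoc -Rpow_mult_distr Rinv_l ?pow1 ?Rmult_1_l; last lra.
    rewrite sqrt_pow2; last exact: Cmod_ge_0.
    rewrite Cmod_mult Cmod_pow -[X in _ <= X]Rmult_1_l; apply: Rmult_le_compat_r; first exact: Cmod_ge_0.
    by rewrite -(pow1 k); apply: pow_incr; split => //; apply: Cmod_ge_0.
  apply: Rle_trans (rsum_cauchy _ _ _ _ _) _.
  have -> : \rsum_(0 <= k < K) sqrt (2 ^ k * Cmod (F k) ^ 2) ^ 2 = G.
    apply: eq_bigr => k _; rewrite pow2_sqrt //; apply: Rmult_le_pos; [apply: pow_le; lra | exact: pow2_ge_0].
  apply: Rmult_le_compat_r => //.
  apply: Rle_trans (_ : \rsum_(0 <= k < K) (/ 2) ^ k <= _); last first.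
    by have := geom_sum_le (/ 2) K ltac:(lra); lra.
  apply: rsum_le => k _; rewrite pow2_sqrt; [lra | apply: pow_le; lra].
have tri : Cmod D <= Cmod (\csum_(0 <= k < K) (u ^ k * F k)) + Cmod (D - \csum_(0 <= k < K) (u ^ k * F k)).
  by apply: Rle_trans (Cmod_triangle _ _); right; congr Cmod; ring.
set p := Cmod (\csum_(0 <= k < K) _) in h2 tri; set q := Cmod (D - _) in h1 tri.
have p0 : 0 <= p by apply: Cmod_ge_0.
have q0 : 0 <= q by apply: Cmod_ge_0.
have D0 := Cmod_ge_0 D.
have := pow_incr _ _ 2 (conj q0 h1); set r := (_ * _) ^ 2 => h3.
have h4 := pow_incr _ _ 2 (conj D0 tri).
have := pow2_ge_0 (p - q); rewrite -/(F _); set G := \rsum_(0 <= k < K) _ in h2 *.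
move=> h5; change (Cmod D ^ 2 <= 4 * G + 2 * r); nra.
Qed.

(** Bookkeeping of exponents: the Taylor terms contribute at most n^(9e/4), the centre n^(-1-3e),
    and the Schur weight compensates 1/n. The decay n^(-3e/4) that is left makes the sum over levels
    converge. *)
Lemma tcoef_sq_sum (alpha e : R) (n K : nat) : 0 < e -> (0 < n)%nat ->
  \rsum_(0 <= k < K) (2 ^ k * tcoef e k n ^ 2) / pweight alpha n <=
  Rpower (INR (trunc_log 2 n).+1) (Rpower 2 alpha - 1) * exp (- (3 / 4 * e * ln (INR n))) / dpow alpha n.
Proof.
move=> e0 n0; set l := ln (INR n); have l0 : 0 <= l by apply: ln_INR_ge0.
set g := Rpower (INR n) (- (1 / 2 + 3 / 2 * e)).
have h : \rsum_(0 <= k < K) (2 ^ k * tcoef e k n ^ 2) <= exp (3 * (l * (3 / 4 * e))) * g ^ 2.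
  apply: Rle_trans (_ : (\rsum_(0 <= k < K) (2 ^ k * ((l * (3 / 4 * e)) ^ k / INR (fact k)) ^ 2)) * g ^ 2 <= _).
    by right; rewrite rsum_scalr; apply: eq_bigr => k _; rewrite /tcoef -/l -/g; ring.
  apply: Rmult_le_compat_r; first exact: pow2_ge_0.
  by apply: exp_sq_partial_le; apply: Rmult_le_pos; lra.
have n0' := INR_pos _ n0; have d0 := dpow_pos alpha n; have y0 := INRS_pos (trunc_log 2 n).
have p0 := pweight_pos alpha n n0.
have eg : exp (3 * (l * (3 / 4 * e))) * g ^ 2 = exp (- (3 / 4 * e * l)) / INR n.
  have en : INR n = exp l by rewrite exp_ln.
  rewrite [X in _ = _ / X]en /Rdiv -exp_Ropp -exp_plus /g /Rpower -/l [_ ^ 2]/= Rmult_1_r -!exp_plus.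
  congr exp; field.
rewrite eg in h.
apply: Rle_trans (Rmult_le_compat_r _ _ _ (Rlt_le _ _ (Rinv_0_lt_compat _ p0)) h) _.
right; rewrite /pweight (_ : 1 - Rpower 2 alpha = - (Rpower 2 alpha - 1)); last by ring.
rewrite Rpower_Ropp; have := Rpower_pos (INR (trunc_log 2 n).+1) (Rpower 2 alpha - 1).
set r := Rpower _ (_ - 1) => r0; field; repeat split; lra.
Qed.

(** A discrete Carleson embedding. Each point is compared with the Taylor data at the heights (x -
    y) tau within e/4 of its imaginary part: it sees at least L^2 e / (4 W) pairs (x, y), whereas a
    pair is seen by at most [Cn] points. Double counting produces the factor [Cn / e]. *)
Lemma carleson_level (alpha W : R) : 0 < alpha -> 1 <= W -> exists2 C0, 0 < C0 &
  forall (F : finType) (S : pred F) (s : F -> C) (e Cn : R) (a : nat -> C) (X : nat), 0 < e -> e <= W -> 0 <= Cn ->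
  (forall f, S f -> e <= Re (s f) - 1 / 2 <= 2 * e /\ Rabs (Im (s f)) <= W) ->
  (forall t, \rsum_(f | S f && Rleb (Rabs (Im (s f) - t)) (e / 4)) 1 <= Cn) ->
  \rsum_(f | S f) Cmod (\csum_(1 <= n < X.+1) (a n * Cexp (- (ln (INR n) * s f)))) ^ 2 <=
  C0 * (Cn / e) * \rsum_(1 <= n < X.+1) (Cmod (a n) ^ 2 *
    (Rpower (INR (trunc_log 2 n).+1) (Rpower 2 alpha - 1) * exp (- (3 / 4 * e * ln (INR n))) / dpow alpha n)).
Proof.
move=> a0 W1; have [C1 C10 hC] := large_sieve alpha (2 * W) a0 ltac:(lra); exists (16 * W * C1); first nra.
move=> F S s e Cn a X e0 eW Cn0 hS hcount; set B := \rsum_(1 <= n < X.+1) _; set A := \rsum_(f | S f) _.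
(* [L] is large enough for the large sieve of width 2 W, and for the step 2 W / L to be at most e/4,
   so that every window is at least as wide as the step. *)
have [L [L0 L1 L2]] : exists L : nat, [/\ (0 < L)%nat, 2 * W / INR L * ln (INR X) <= 1 & 2 * W / INR L <= e / 4].
  have lX := ln_INR_ge0 X.
  have q1 : 0 < 8 * W / e by apply: Rdiv_lt_0_compat; lra.
  have q2 : 0 <= W * ln (INR X) by apply: Rmult_le_pos; lra.
  have [L [h1 h2]] := INR_ceil (2 * W * ln (INR X) + 8 * W / e + 1) ltac:(lra).
  have L0 : 0 < INR L by lra.
  exists L; split; first by apply/ltP; apply: INR_lt.
    have -> : 2 * W / INR L * ln (INR X) = 2 * W * ln (INR X) / INR L by field; lra.
    by apply/Rle_div_l => //; lra.
  apply/Rle_div_l => //; have : 8 * W / e * e <= INR L * e by apply: Rmult_le_compat_r; lra.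
  by rewrite /Rdiv Rmult_assoc Rinv_l; lra.
set tau := 2 * W / INR L in L1 L2; have l0 : 0 < INR L by apply: INR_pos.
have t0 : 0 < tau by apply: Rdiv_lt_0_compat; lra.
have tL : tau * INR L = 2 * W by rewrite /tau; field; lra.
pose G K x y := \rsum_(0 <= k < K) (2 ^ k * Cmod (\csum_(1 <= n < X.+1) (a n * RtoC (tcoef e k n) * npow n (Ci * RtoC ((INR x - INR y) * tau)))) ^ 2).
have hG K : / INR L ^ 2 * \rsum_(0 <= x < (4 * L)%nat) \rsum_(0 <= y < (4 * L)%nat) G K x y <= C1 * B.
  have -> : \rsum_(0 <= x < (4 * L)%nat) \rsum_(0 <= y < (4 * L)%nat) G K x y =
     \rsum_(0 <= k < K) (2 ^ k * \rsum_(0 <= x < (4 * L)%nat) \rsum_(0 <= y < (4 * L)%nat) Cmod (\csum_(1 <= n < X.+1) (a n * RtoC (tcoef e k n) * npow n (Ci * RtoC ((INR x - INR y) * tau)))) ^ 2).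
    rewrite /G; under eq_bigr do rewrite exchange_big /=.
    rewrite exchange_big /=; apply: eq_bigr => k _; rewrite rsum_scal; apply: eq_bigr => x _; by rewrite rsum_scal.
  rewrite rsum_scal.
  apply: Rle_trans (_ : \rsum_(0 <= k < K) (2 ^ k * (C1 * \rsum_(1 <= n < X.+1) (Cmod (a n * RtoC (tcoef e k n)) ^ 2 / pweight alpha n))) <= _).
    apply: rsum_le => k _; rewrite -Rmult_assoc (Rmult_comm (/ _)) Rmult_assoc.
    by apply: Rmult_le_compat_l; [apply: pow_le; lra | apply: (hC L X)].
  have -> : \rsum_(0 <= k < K) (2 ^ k * (C1 * \rsum_(1 <= n < X.+1) (Cmod (a n * RtoC (tcoef e k n)) ^ 2 / pweight alpha n))) =
     C1 * \rsum_(1 <= n < X.+1) (Cmod (a n) ^ 2 * (\rsum_(0 <= k < K) (2 ^ k * tcoef e k n ^ 2) / pweight alpha n)).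
    transitivity (C1 * \rsum_(0 <= k < K) \rsum_(1 <= n < X.+1) (Cmod (a n) ^ 2 * (2 ^ k * tcoef e k n ^ 2) / pweight alpha n)).
      rewrite rsum_scal; apply: eq_bigr => k _; rewrite !rsum_scal; apply: eq_bigr => n _.
      rewrite Cmod_mult Cmod_R Rpow_mult_distr pow2_abs /Rdiv; ring.
    congr Rmult; rewrite exchange_big; apply: eq_bigr => n _; rewrite /Rdiv rsum_scalr rsum_scal; apply: eq_bigr => k _; ring.
  apply: Rmult_le_compat_l; first lra.
  apply: rsum_le_nat => n /andP [n0 _]; apply: Rmult_le_compat_l; first exact: pow2_ge_0.
  exact: tcoef_sq_sum.
pose adm f x y := Rleb (Rabs (Im (s f) - (INR x - INR y) * tau)) (e / 4).
have pairs f : S f -> INR L ^ 2 * (e / (4 * W)) <= \rsum_(0 <= x < (4 * L)%nat) \rsum_(0 <= y < (4 * L)%nat | adm f x y) 1.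
  move=> Sf; have [_ hW] := hS f Sf.
  have [w1 w2] : - W <= Im (s f) <= W by move: hW; rewrite /Rabs; case: Rcase_abs; lra.
  set k := e / (4 * tau).
  have k1 : 1 <= k by apply/Rle_div_r; lra.
  have kt : k * tau = e / 4 by rewrite /k; field; lra.
  (* For y in the middle half of [0, 4L), the centre y + Im s / tau stays L/2 away from the ends,
     because |Im s| <= W = tau L / 2. *)
  have inner y : (L <= y < 3 * L)%nat -> k <= \rsum_(0 <= x < (4 * L)%nat | adm f x y) 1.
    move=> /andP [y1 y2]; set c := INR y + Im (s f) / tau.
    have ct : (c - INR y) * tau = Im (s f) by rewrite /c; field; lra.
    have y1' : INR L <= INR y by apply: INR_leq.
    have y2' : INR y <= 3 * INR L - 1.
      have := INR_leq _ _ y2; rewrite S_INR mult_INR [INR 3]/=; lra.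
    have -> : \rsum_(0 <= x < (4 * L)%nat | adm f x y) 1 = \rsum_(0 <= x < (4 * L)%nat | Rleb (Rabs (INR x - c)) k) 1.
      apply: eq_bigl => x; rewrite /adm.
      have e1 : Im (s f) - (INR x - INR y) * tau = (c - INR x) * tau by rewrite -ct; ring.
      have e2 : Rabs (Im (s f) - (INR x - INR y) * tau) = Rabs (INR x - c) * tau by rewrite e1 Rabs_mult Rabs_minus_sym (Rabs_pos_eq tau) //; lra.
      rewrite e2; apply/RlebP/RlebP => h; nra.
    apply: count_window => //.
      suff : 0 <= (c - k) * tau by move=> h; nra.
      have : (c - k) * tau = INR y * tau + Im (s f) - e / 4 by rewrite Rmult_minus_distr_r kt -ct; ring.
      have : INR L * tau <= INR y * tau by apply: Rmult_le_compat_r; lra.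
      lra.
    rewrite mult_INR [INR 4]/=.
    suff : (c + k) * tau < (4 * INR L) * tau by move=> h; nra.
    have : (c + k) * tau = INR y * tau + Im (s f) + e / 4 by rewrite Rmult_plus_distr_r kt -ct; ring.
    have : INR y * tau <= (3 * INR L - 1) * tau by apply: Rmult_le_compat_r; lra.
    lra.
  apply: Rle_trans (_ : \rsum_(L <= y < (3 * L)%nat) k <= _).
    rewrite rsum_const_nat (_ : (3 * L - L = 2 * L)%nat); last lia.
    rewrite mult_INR [INR 2]/=; right; rewrite /k /tau; field; lra.
  rewrite (exchange_big_dep predT) //=.
  apply: Rle_trans (_ : \rsum_(L <= y < (3 * L)%nat) \rsum_(0 <= x < (4 * L)%nat | adm f x y) 1 <= _); first exact: rsum_le_nat.
  apply: rsum_sub; first exact: iota_uniq.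
    by move=> y; rewrite !mem_index_iota => /andP [y1 y2]; apply: leq_trans y2 _; rewrite leq_mul2r orbT.
  by move=> y _; apply: rsum_ge0 => x _; lra.
have B0 : 0 <= B.
  apply: rsum_ge0 => n _; apply: Rmult_le_pos; first exact: pow2_ge_0.
  apply: Rdiv_le_0_compat; last exact: dpow_pos.
  by apply: Rlt_le; apply: Rmult_lt_0_compat; [exact: Rpower_pos | exact: exp_pos].
have A0 : 0 <= A by apply: rsum_ge0 => f _; apply: pow2_ge_0.
(* The order [K] of the expansion depends on [eta], but the main term of the bound does not depend
   on [K]; hence [eta] can tend to 0. *)
have bound eta : 0 < eta -> A * (INR L ^ 2 * (e / (4 * W))) <= Cn * (INR L ^ 2 * (4 * (C1 * B)) + 16 * INR L ^ 2 * eta).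
  move=> eta0; set S1 := \rsum_(1 <= n < X.+1) Cmod (a n).
  have S10 : 0 <= S1 by apply: rsum_ge0 => n _; apply: Cmod_ge_0.
  have [K hK] : exists K, forall w, Cmod w <= ln (INR X) * (3 / 4 * e) -> Cmod (Cexp w - Texp K w) <= sqrt (eta / 2) / (S1 + 1).
    have q0 : 0 < sqrt (eta / 2) / (S1 + 1) by apply: Rdiv_lt_0_compat; [apply: sqrt_lt_R0; lra | lra].
    by have [K0 hK0] := Texp_uniform (ln (INR X) * (3 / 4 * e)) _ q0; exists K0 => w hw; apply: hK0.
  have herr : 2 * (sqrt (eta / 2) / (S1 + 1) * S1) ^ 2 <= eta.
    have q0 : 0 <= sqrt (eta / 2) by apply: sqrt_pos.
    have q2 : sqrt (eta / 2) ^ 2 = eta / 2 by apply: pow2_sqrt; lra.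
    have : (sqrt (eta / 2) / (S1 + 1) * S1) ^ 2 <= sqrt (eta / 2) ^ 2.
      apply: pow_incr; split; first by apply: Rmult_le_pos => //; apply: Rdiv_le_0_compat; lra.
      rewrite /Rdiv Rmult_assoc -[X in _ <= X]Rmult_1_r; apply: Rmult_le_compat_l => //.
      by rewrite Rmult_comm; apply/Rle_div_l; lra.
    lra.
  have pt f x y : S f -> adm f x y -> Cmod (\csum_(1 <= n < X.+1) (a n * Cexp (- (ln (INR n) * s f)))) ^ 2 <= 4 * G K x y + eta.
    move=> Sf /RlebP h; have [hs _] := hS f Sf.
    have := taylor_mean a X K e _ ((INR x - INR y) * tau) (s f) e0 hs h hK.
    rewrite -/(G K x y) -/S1; lra.
  have G0 x y : 0 <= G K x y.
    by apply: rsum_ge0 => k _; apply: Rmult_le_pos; [apply: pow_le; lra | exact: pow2_ge_0].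
  apply: Rle_trans (_ : \rsum_(f | S f) \rsum_(0 <= x < (4 * L)%nat) \rsum_(0 <= y < (4 * L)%nat | adm f x y) (4 * G K x y + eta) <= _).
    rewrite /A rsum_scalr; apply: rsum_le => f Sf.
    apply: Rle_trans (Rmult_le_compat_l _ _ _ (pow2_ge_0 _) (pairs f Sf)) _.
    rewrite rsum_scal; apply: rsum_le => x _; rewrite rsum_scal; apply: rsum_le => y hy.
    by rewrite Rmult_1_r; apply: pt.
  rewrite exchange_big /=.
  apply: Rle_trans (_ : \rsum_(0 <= x < (4 * L)%nat) \rsum_(0 <= y < (4 * L)%nat) (Cn * (4 * G K x y + eta)) <= _).
    apply: rsum_le => x _; rewrite (exchange_big_dep predT) //=; apply: rsum_le => y _.
    have := hcount ((INR x - INR y) * tau); rewrite -/(adm _ x y) => h.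
    apply: Rle_trans (_ : (\rsum_(f | S f && adm f x y) 1) * (4 * G K x y + eta) <= _).
      by right; rewrite rsum_scalr; apply: eq_bigr => f _; ring.
    by apply: Rmult_le_compat_r => //; have := G0 x y; lra.
  have hGK := hG K; have Lp : 0 < INR L ^ 2 by apply: pow_lt.
  have -> : \rsum_(0 <= x < (4 * L)%nat) \rsum_(0 <= y < (4 * L)%nat) (Cn * (4 * G K x y + eta)) =
     Cn * (4 * (\rsum_(0 <= x < (4 * L)%nat) \rsum_(0 <= y < (4 * L)%nat) G K x y) + 16 * INR L ^ 2 * eta).
    have -> : 16 * INR L ^ 2 * eta = \rsum_(0 <= x < (4 * L)%nat) \rsum_(0 <= y < (4 * L)%nat) eta.
      by rewrite !rsum_const_nat !subn0 mult_INR [INR 4]/=; ring.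
    rewrite rsum_scal -big_split /= rsum_scal; apply: eq_bigr => x _.
    rewrite rsum_scal -big_split /= rsum_scal; apply: eq_bigr => y _; ring.
  apply: Rmult_le_compat_l => //.
  have : \rsum_(0 <= x < (4 * L)%nat) \rsum_(0 <= y < (4 * L)%nat) G K x y <= INR L ^ 2 * (C1 * B).
    by rewrite (Rmult_comm (INR L ^ 2)); apply/Rle_div_l => //; rewrite /Rdiv Rmult_comm.
  lra.
have Lp : 0 < INR L ^ 2 by apply: pow_lt.
apply: le_epsilon => eta eta0.
set z := Cn / e; have z0 : 0 <= z by apply: Rdiv_le_0_compat.
have := bound (eta / (64 * W * z + 1)) ltac:(apply: Rdiv_lt_0_compat => //; nra).
set th := eta / _ => h.
have hth : 64 * W * z * th <= eta.
  rewrite /th /Rdiv -Rmult_assoc; apply/Rle_div_l; nra.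
have h' : A * (e / (4 * W)) <= Cn * (4 * (C1 * B) + 16 * th).
  apply: (Rmult_le_reg_l (INR L ^ 2)) => //; lra.
have : A <= Cn * (4 * (C1 * B) + 16 * th) * (4 * W / e).
  apply: Rle_trans (_ : A * (e / (4 * W)) * (4 * W / e) <= _); first by right; field; lra.
  by apply: Rmult_le_compat_r => //; apply: Rdiv_le_0_compat; lra.
rewrite (_ : Cn * (4 * (C1 * B) + 16 * th) * (4 * W / e) = 16 * W * C1 * z * B + 64 * W * z * th); last by rewrite /z; field; lra.
lra.
Qed.

(** * Counting grid points in a level *)

Lemma count_close (T : pred nat) (s n : nat) (D : R) : 0 <= D ->
  (forall k l, (s <= k)%nat -> (k <= l)%nat -> (l < s + n)%nat -> T k -> T l -> INR (l - k) <= D) ->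
  \rsum_(s <= k < (s + n)%nat | T k) 1 <= D + 1.
Proof.
move=> D0; elim: n s => [|n IH] s h; first by rewrite addn0 big_geq //; lra.
case: (boolP (T s)) => Ts; last first.
  rewrite big_ltn_cond; last by rewrite addnS ltnS leq_addr.
  rewrite (negbTE Ts) addnS -addSn; apply: IH => k l sk kl ln; apply: h => //; first exact: ltnW.
  by rewrite addnS -addSn.
apply: Rle_trans (_ : \rsum_(s <= k < (s + n.+1)%nat | Rleb (INR (k - s)) D) 1 <= _).
  rewrite big_mkcond [X in _ <= X]big_mkcond; apply: rsum_le_nat => k /andP [sk kn] /=.
  case: (boolP (T k)) => Tk; last by case: ifP; lra.
  by case: RlebP => [_|[]]; [lra | apply: h].
rewrite -{1}(add0n s) (addnC s n.+1) big_addn addnK.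
under eq_bigl do rewrite addnK.
elim: (n.+1) => [|m IHm]; first by rewrite big_geq //; lra.
rewrite big_mkcond big_nat_recr // -big_mkcond.
case: RlebP => h1; last by apply: Rle_trans IHm; right; exact: Rplus_0_r.
apply: Rle_trans (_ : INR m + 1 <= _); last lra.
apply: Rplus_le_compat_r; rewrite big_mkcond.
apply: Rle_trans (_ : \rsum_(0 <= i < m) 1 <= _); first by apply: rsum_le => i _; case: ifP; lra.
by rewrite rsum_const_nat subn0; lra.
Qed.

(** Marked points are known to lie within [D] only when they are less than [B] apart, so the range
    is cut into blocks of length [B], each containing at most D + 1 of them. *)
Lemma count_blocks (T : pred nat) (M B : nat) (D : R) : 0 <= D -> (0 < B)%nat ->
  (forall k l, (k <= l)%nat -> (l < M)%nat -> (l - k < B)%nat -> T k -> T l -> INR (l - k) <= D) ->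
  \rsum_(0 <= k < M | T k) 1 <= INR (M %/ B).+1 * (D + 1).
Proof.
move=> D0 B0 h; pose T' k := T k && (k < M)%nat.
have blocks q : \rsum_(0 <= k < (q * B)%nat | T' k) 1 <= INR q * (D + 1).
  elim: q => [|q IH]; first by rewrite mul0n big_geq // Rmult_0_l; lra.
  rewrite mulSn addnC (big_cat_nat (n := (q * B)%nat)) //=; last exact: leq_addr.
  rewrite -/(INR q.+1) S_INR Rmult_plus_distr_r Rmult_1_l; apply: (Rplus_le_compat _ _ _ _ IH).
  apply: count_close => // k l sk kl lq /andP [Tk kM] /andP [Tl lM]; apply: h => //.
  by rewrite ltn_subLR //; apply: leq_trans lq _; rewrite leq_add2r.
apply: Rle_trans (blocks (M %/ B).+1).
have MB : (M <= (M %/ B).+1 * B)%nat by apply: ltnW; rewrite {1}(divn_eq M B) mulSn addnC ltn_add2r ltn_mod.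
set q := (M %/ B).+1 in MB *; clearbody q; rewrite [X in _ <= X](big_cat_nat (n := M)) //=.
have r0 : 0 <= \rsum_(M <= k < (q * B)%nat | T' k) 1 by apply: rsum_ge0 => k _; lra.
apply: Rle_trans (Rplus_le_compat _ _ _ _ (Rle_refl _) r0); rewrite Rplus_0_r.
right; rewrite big_nat_cond [RHS]big_nat_cond; apply: eq_bigl => k; rewrite /T' /=.
by case: (k < M)%nat; rewrite ?andbF ?andbT.
Qed.

Lemma rsum_const_fin (T : finType) (a : R) : \rsum_(i : T) a = INR #|T| * a.
Proof.
rewrite big_const; elim: #|T| => [|k IH]; first by rewrite Rmult_0_l.
by rewrite iterS IH S_INR; ring.
Qed.

Section Fibres.
Variables (d M : nat).

Definition fupd (f : {ffun 'I_d -> 'I_M}) (i : 'I_d) (k : 'I_M) : {ffun 'I_d -> 'I_M} :=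
  [ffun l => if l == i then k else f l].

(** Exchanging the new value k with the old value of f at [i] is an involution on pairs (f, k), so
    each function is reached exactly M times. *)
Lemma fupd_sum (i : 'I_d) (g : {ffun 'I_d -> 'I_M} -> R) :
  \rsum_(f : {ffun 'I_d -> 'I_M}) \rsum_(k : 'I_M) g (fupd f i k) = INR M * \rsum_(f : {ffun 'I_d -> 'I_M}) g f.
Proof.
pose h (x : {ffun 'I_d -> 'I_M} * 'I_M) := (fupd x.1 i x.2, x.1 i).
have hK : involutive h.
  move=> [f k]; rewrite /h /=; congr pair; last by rewrite ffunE eqxx.
  by apply/ffunP => l; rewrite !ffunE; case: eqP => [->|].
rewrite pair_big /= (eq_bigr (fun x => g (h x).1)) //.
rewrite -(reindex_inj (inv_inj hK) (P := predT) (F := fun x => g x.1)) /=.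
rewrite -(pair_big predT predT (fun f _ => g f)) /= rsum_scal; apply: eq_bigr => f _.
by rewrite rsum_const_fin card_ord.
Qed.

Lemma fibre_count (i : 'I_d) (T : pred {ffun 'I_d -> 'I_M}) (B : R) :
  (forall f, \rsum_(k : 'I_M) (if T (fupd f i k) then 1 else 0) <= B) ->
  INR M * \rsum_(f | T f) 1 <= INR M ^ d * B.
Proof.
move=> h; rewrite big_mkcond -(fupd_sum i).
apply: Rle_trans (_ : \rsum_(f : {ffun 'I_d -> 'I_M}) B <= _); first exact: rsum_le.
rewrite rsum_const_fin card_ffun !card_ord INR_expn; lra.
Qed.
End Fibres.

Lemma chord_le (x : R) : 0 <= x <= 1 -> Cmod (1 - Cexp (Ci * RtoC x)) <= 2 * x.
Proof.
move=> [x0 x1]; apply: Rle_trans (Cmod_Re_Im _) _.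
have [-> ->] : Re (1 - Cexp (Ci * RtoC x)) = 1 - cos x /\ Im (1 - Cexp (Ci * RtoC x)) = - sin x.
  by rewrite /Cexp /= !Rmult_0_l !Rmult_1_l Rminus_0_l !Rplus_0_l Ropp_0 exp_0 !Rmult_1_l.
have le y : 0 <= y -> sin y <= y.
  by case=> [/sin_lt_x|<-]; [lra | rewrite sin_0; lra].
have s0 : 0 <= sin x by have := sin_ge_half x; lra.
have s1 : 0 <= sin (x / 2) by have := sin_ge_half (x / 2); lra.
have s2 := le (x / 2) ltac:(lra).
have := cos_2a_sin (x / 2); rewrite (_ : 2 * (x / 2) = x); last by field.
move=> ->; rewrite Rabs_Ropp (Rabs_pos_eq (sin x)) //; have := le x x0 => s3.
by rewrite Rabs_pos_eq; nra.
Qed.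

Lemma omega_pow (M m : nat) : (omega M ^ m)%C = Cexp (Ci * RtoC (2 * PI * INR m / INR M)).
Proof.
rewrite /omega Cexp_pow; congr Cexp.
rewrite (_ : 2 * PI * INR m / INR M = INR m * (2 * PI / INR M)); last by rewrite /Rdiv; ring.
by rewrite RtoC_mult; ring.
Qed.

(** The last condition keeps the angle at most 1, where chord and arc are comparable; exp(-1) is the
    smallest radius in use. *)
Lemma omega_gap (M k l : nat) (r : R) : exp (- 1) <= r <= 1 -> (k <= l)%nat -> (0 < M)%nat -> 8 * INR (l - k) <= INR M ->
  INR (l - k) / INR M <= Cmod (RtoC r * omega M ^ l - RtoC r * omega M ^ k) <= 16 * INR (l - k) / INR M.
Proof.
move=> [r0 r1] kl M0 hm; set m := (l - k)%nat in hm *.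
have e : (RtoC r * omega M ^ l - RtoC r * omega M ^ k = - (RtoC r * omega M ^ k * (1 - omega M ^ m)))%C.
  by rewrite -{1}(subnKC kl) -/m Cpow_add_r; ring.
have M0' := INR_pos _ M0; have m0 := pos_INR m.
have e1 : 1 / 3 <= exp (- 1).
  have h3 := exp_le_3; have h0 := exp_pos 1.
  have h1 : exp 1 * exp (- 1) = 1 by rewrite -exp_plus (_ : 1 + -1 = 0) ?exp_0; lra.
  have := exp_pos (- 1); nra.
have p3 : 3 <= PI by have := PI2_3_2; lra.
have p4 := PI_4.
rewrite e Cmod_opp !Cmod_mult Cmod_pow omega_mod pow1 Rmult_1_r Cmod_R Rabs_pos_eq; last lra.
rewrite omega_pow; set x := 2 * PI * INR m / INR M.
have x6 : 6 * (INR m / INR M) <= x.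
  rewrite /x /Rdiv Rmult_assoc; apply: Rmult_le_compat_r; last lra.
  by apply: Rdiv_le_0_compat.
have x8 : x <= 8 * (INR m / INR M).
  rewrite /x /Rdiv Rmult_assoc; apply: Rmult_le_compat_r; last lra.
  by apply: Rdiv_le_0_compat.
have q0 : 0 <= INR m / INR M by apply: Rdiv_le_0_compat.
have q1 : 8 * (INR m / INR M) <= 1 by rewrite /Rdiv -Rmult_assoc; apply/Rle_div_l; lra.
have c1 := chord_le x ltac:(lra); have c2 := chord_ge x ltac:(rewrite Rabs_pos_eq; lra).
rewrite Rabs_pos_eq in c2; last lra.
rewrite (_ : 16 * INR m / INR M = 16 * (INR m / INR M)); last by rewrite /Rdiv; ring.
split; nra.
Qed.

Section Count.
Variables (N : nat) (c : nat -> C) (dl : R) (p0 : nat).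
Hypothesis dl0 : 0 < dl.
Hypothesis dl1 : dl <= 1.
Let P := cprimes N c.
Let d := size P.
Let F (z : nat -> C) : C := Phi N c (zchar z).
Hypothesis p0P : p0 \in P.
Hypothesis expand : forall z x, inDisc z -> Cmod x <= 1 -> Re (F z) - 1 / 2 <= dl -> Cmod (x - z p0) <= dl ->
    dl * Cmod (x - z p0) <= Cmod (F (upd z p0 x) - F z).

Definition box (e t : R) (s : C) : bool :=
  Rleb e (Re s - 1 / 2) && Rleb (Re s - 1 / 2) (2 * e) && Rleb (Rabs (Im s - t)) (e / 4).

(** All coordinates but that of [p0] are frozen. On such a fibre two points of the box differ in
    value by at most 2 e, so their indices are O(e M) apart as soon as they are close enough for
    [expand]; blocks of length about dl M / 16 ensure this. When 2 e > dl the trivial count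
    suffices. *)
Lemma grid_count : exists2 C0, 0 < C0 & forall e, 0 < e -> exists M0, forall (M J : nat) (j : {ffun 'I_d -> 'I_J}) (t : R),
  (M0 <= M)%nat ->
  \rsum_(f | box e t (F (gpt P J M j f))) 1 <= C0 * e * INR M ^ d.
Proof.
have Pu : uniq P by rewrite filter_uniq // iota_uniq.
exists ((32 / dl + 1) * (3 / dl)).
  by have := Rinv_0_lt_compat _ dl0; rewrite /Rdiv => h; nra.
move=> e e0; set C0 := (32 / dl + 1) * (3 / dl).
have i0 : 0 < / dl by apply: Rinv_0_lt_compat.
have C1 : 3 / dl <= C0 by rewrite /C0 /Rdiv; nra.
(* 32 / dl makes the blocks nonempty; dl / e makes e M / dl at least 1, which absorbs the 1 in D +
   1. *)
have [M0 [hM0 _]] := INR_ceil (32 / dl + dl / e + 1) ltac:(have : 0 < dl / e by [apply: Rdiv_lt_0_compat]; rewrite /Rdiv; lra).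
exists M0 => M J j t MM.
have hM : 32 / dl + dl / e + 1 <= INR M by have := INR_leq _ _ MM; lra.
have q0 : 0 < dl / e by apply: Rdiv_lt_0_compat.
have q1 : 0 < 32 / dl by apply: Rdiv_lt_0_compat; lra.
have M1 : 0 < INR M by lra.
have Mp : (0 < M)%nat by apply/ltP; apply: INR_lt.
have Md : 0 < INR M ^ d by apply: pow_lt.
case: (Rle_dec (2 * e) dl) => he; last first.
  apply: Rle_trans (_ : \rsum_(f : {ffun 'I_d -> 'I_M}) 1 <= _).
    by rewrite big_mkcond; apply: rsum_le => f _; case: ifP; lra.
  rewrite rsum_const_fin card_ffun !card_ord INR_expn Rmult_1_r -[X in X <= _]Rmult_1_l.
  apply: Rmult_le_compat_r; first lra.
  have : 3 / dl * (dl / 2) <= C0 * e by apply: Rmult_le_compat; lra || (rewrite /Rdiv; lra).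
  rewrite (_ : 3 / dl * (dl / 2) = 3 / 2); [lra | field; lra].
have [i1 ei] := prP P p0 p0P.
apply: (Rmult_le_reg_l (INR M)) => //.
rewrite (_ : INR M * (C0 * e * INR M ^ d) = INR M ^ d * (C0 * e * INR M)); last by ring.
apply: (fibre_count _ _ i1) => f.
have [B [b1 b2]] := INR_floor (dl * INR M / 16) ltac:(apply: Rdiv_le_0_compat; nra).
have dM : 32 <= dl * INR M.
  have : 32 / dl * dl <= INR M * dl by apply: Rmult_le_compat_r; lra.
  rewrite /Rdiv Rmult_assoc Rinv_l; lra.
have B2 : dl * INR M / 32 <= INR B by lra.
have B0 : (0 < B)%nat by apply/ltP; apply: INR_lt; rewrite [INR 0]/=; lra.
pose D := 2 * e * INR M / dl.
have D0 : 0 <= D by apply: Rdiv_le_0_compat; nra.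
pose T k := if insub k is Some k' then box e t (F (gpt P J M j (fupd d M f i1 k'))) else false.
have -> : \rsum_(k : 'I_M) (if box e t (F (gpt P J M j (fupd d M f i1 k))) then 1 else 0) = \rsum_(0 <= k < M | T k) 1.
  rewrite [RHS]big_mkcond big_mkord; apply: eq_bigr => k _; by rewrite /T valK.
apply: Rle_trans (count_blocks T M B D D0 B0 _) _; last first.
  have h1 : INR (M %/ B).+1 <= 32 / dl + 1.
    rewrite S_INR; apply: Rplus_le_compat_r.
    have h2 : INR (M %/ B) * INR B <= INR M by rewrite -mult_INR; apply: INR_leq; exact: leq_trunc_div.
    have h3 : 0 <= INR (M %/ B) by apply: pos_INR.
    apply/Rle_div_r => //; nra.
  have h2 : D + 1 <= 3 / dl * e * INR M.
    have : 1 <= e * INR M / dl.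
      apply/Rle_div_r => //; have : dl / e * e <= INR M * e by apply: Rmult_le_compat_r; lra.
      rewrite /Rdiv Rmult_assoc Rinv_l; lra.
    rewrite /D (_ : 3 / dl * e * INR M = 3 * (e * INR M / dl)); last by rewrite /Rdiv; ring.
    rewrite (_ : 2 * e * INR M / dl = 2 * (e * INR M / dl)); last by rewrite /Rdiv; ring.
    lra.
  rewrite (_ : C0 * e * INR M = (32 / dl + 1) * (3 / dl * e * INR M)); last by rewrite /C0; ring.
  by apply: Rmult_le_compat; [exact: pos_INR | lra | |].
move=> k l kl lM lkB; have kM : (k < M)%nat by apply: leq_ltn_trans lM.
rewrite /T (insubT (fun x => (x < M)%nat) kM) (insubT (fun x => (x < M)%nat) lM) /=.
set z := gpt P J M j _; set z' := gpt P J M j _.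
have zd : inDisc z by apply: gpt_inDisc.
set x := (RtoC (rho (j i1)) * omega M ^ l)%C.
have [r1 r2 r3 _] := rho_bounds (j i1).
have x1 : Cmod x <= 1 by rewrite /x Cmod_mult Cmod_pow omega_mod pow1 Cmod_R Rabs_pos_eq; lra.
have ezp : z p0 = (RtoC (rho (j i1)) * omega M ^ k)%C.
  by rewrite -ei /z /gpt ptz_pr // ffunE eqxx.
have ez' : F z' = F (upd z p0 x).
  apply: Phi_eq => n n0 nN; apply: zchar_ext => // q pq _.
  rewrite /upd; case: eqP => [->|ne]; first by rewrite -ei /z' /gpt ptz_pr // ffunE eqxx.
  rewrite /z /z' /gpt /ptz; case: insubP => // i _ eiq; rewrite !ffunE.
  case: eqP => // ei1; case: ne; rewrite -ei /pr -ei1 eiq nth_index //.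
  by rewrite -index_mem -eiq ltn_ord.
rewrite ez'; move=> /andP [/andP [/RlebP a1 /RlebP a2] /RlebP a3] /andP [/andP [/RlebP b1' /RlebP b2'] /RlebP b3].
have lk : INR (l - k) <= dl * INR M / 16 by have := INR_leq _ _ (ltnW lkB); lra.
have gap := omega_gap M k l (rho (j i1)) ltac:(lra) kl Mp ltac:(nra).
rewrite -/x -ezp in gap; case: gap => g1 g2.
have g3 : Cmod (x - z p0) <= dl.
  apply: Rle_trans g2 _; apply/Rle_div_l => //; lra.
have := expand z x zd x1 ltac:(lra) g3.
have h : Cmod (F (upd z p0 x) - F z) <= 2 * e.
  apply: Rle_trans (Cmod_Re_Im _) _; rewrite /= -/(Re (F (upd z p0 x))) -/(Re (F z)) -/(Im (F (upd z p0 x))) -/(Im (F z)).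
  have : Rabs (Re (F (upd z p0 x)) + - Re (F z)) <= e by apply: Rabs_le; lra.
  have : Rabs (Im (F (upd z p0 x)) + - Im (F z)) <= e / 2.
    move: a3 b3; rewrite /Rabs; do 3! case: Rcase_abs; lra.
  lra.
move=> h4; have h5 : dl * (INR (l - k) / INR M) <= 2 * e.
  by apply: Rle_trans h; apply: Rle_trans h4; apply: Rmult_le_compat_l; lra.
rewrite /D; apply/Rle_div_r => //.
have : dl * (INR (l - k) / INR M) * INR M <= 2 * e * INR M by apply: Rmult_le_compat_r; lra.
by rewrite (_ : dl * (INR (l - k) / INR M) * INR M = INR (l - k) * dl) //; field; lra.
Qed.
End Count.

(** * The norm inequality *)

Lemma pow2_sum_le (n : nat) : \rsum_(0 <= l < n) 2 ^ l <= 2 ^ n.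
Proof.
elim: n => [|n IH]; first by rewrite big_geq //=; lra.
by rewrite big_nat_recr //; apply: Rle_trans (Rplus_le_compat_r _ _ _ IH) _; rewrite /=; lra.
Qed.

(** The summand depends on x = y 2^(-l). As long as x >= 1 the exponential gives K / x, whose sum is
    dominated by its last term; afterwards x^g is geometric, as g > 0. The change occurs at the
    dyadic logarithm [l1] of [y]. *)
Lemma level_sum (g c : R) : 0 < g -> 0 < c -> exists2 C0, 0 < C0 & forall y T, (0 < y)%nat ->
  \rsum_(0 <= l < T) (Rpower (INR y * (/ 2) ^ l) g * exp (- (c * (INR y * (/ 2) ^ l)))) <= C0.
Proof.
move=> g0 c0; set r := Rpower 2 (- g).
have ln_Rpower x y : ln (Rpower x y) = y * ln x by rewrite /Rpower ln_exp.
have r0 : 0 < r by apply: Rpower_pos.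
have r1 : r < 1 by rewrite /r -(Rpower_O 2); [apply: Rpower_lt; lra | lra].
set K := exp ((g + 1) * ln (g + 1) - (g + 1)) / Rpower c (g + 1).
have cg := Rpower_pos c (g + 1).
have K0 : 0 < K by apply: Rdiv_lt_0_compat => //; apply: exp_pos.
have q0 : 0 < / (1 - r) by apply: Rinv_0_lt_compat; lra.
exists (K * 2 + / (1 - r)); first lra.
move=> y T y0; have Y0 := INR_pos _ y0.
pose x l := INR y * (/ 2) ^ l.
have x0 l : 0 < x l by apply: Rmult_lt_0_compat => //; apply: pow_lt; lra.
pose u l := Rpower (x l) g * exp (- (c * x l)).
have u0 l : 0 <= u l by apply: Rlt_le; apply: Rmult_lt_0_compat; [exact: Rpower_pos | exact: exp_pos].
have uA l : u l <= K / x l.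
  have := Rpower_le_exp (g + 1) (c * x l) ltac:(lra) ltac:(apply: Rmult_lt_0_compat => //).
  rewrite -Rpower_mult_distr // (Rpower_plus g 1 (x l)) (Rpower_1 (x l)) // => h.
  apply: (proj1 (Rle_div_r _ _ _ (x0 l))); rewrite /u /K.
  apply: (proj1 (Rle_div_r _ _ _ cg)); rewrite exp_Ropp.
  have e0 := exp_pos (c * x l).
  set p := Rpower (x l) g in h *; set E := exp (c * x l) in h e0 *.
  rewrite (_ : p * / E * x l * Rpower c (g + 1) = (Rpower c (g + 1) * (p * x l)) / E); last by rewrite /Rdiv; ring.
  by apply: (proj2 (Rle_div_l _ _ _ e0)).
have uB l : u l <= Rpower (x l) g.
  rewrite -[X in _ <= X]Rmult_1_r; apply: Rmult_le_compat_l; first by apply: Rlt_le; apply: Rpower_pos.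
  rewrite -exp_0; apply: exp_le; have := x0 l; nra.
set l1 := trunc_log 2 y.
have h1 : 2 ^ l1 <= INR y by have := INR_leq _ _ (trunc_logP (p := 2) isT y0); rewrite INR_expn (_ : INR 2 = 2) //; rewrite /=; lra.
have h2 : INR y <= 2 ^ l1.+1 by have := INR_leq _ _ (ltnW (trunc_log_ltn (p := 2) y isT)); rewrite INR_expn (_ : INR 2 = 2) //; rewrite /=; lra.
apply: Rle_trans (_ : \rsum_(0 <= l < (l1.+1 + T)%nat) u l <= _).
  apply: rsum_sub; [exact: iota_uniq | | move=> l _; exact: (u0 l)].
  by move=> l; rewrite !mem_index_iota /= => h; apply: leq_trans h (leq_addl _ _).
rewrite (big_cat_nat (n := l1.+1)) //; last exact: leq_addr.
apply: Rplus_le_compat.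
  apply: Rle_trans (_ : \rsum_(0 <= l < l1.+1) (K / INR y * 2 ^ l) <= _).
    apply: rsum_le => l _; apply: Rle_trans (uA l) _; right; rewrite /x pow_inv; field.
    by split; [lra | apply: pow_nonzero; lra].
  rewrite -rsum_scal; have := pow2_sum_le l1.+1 => h3.
  apply: Rle_trans (Rmult_le_compat_l _ _ _ _ h3) _; first by apply: Rdiv_le_0_compat; lra.
  rewrite /Rdiv Rmult_assoc; apply: Rmult_le_compat_l; first lra.
  rewrite Rmult_comm; apply/Rle_div_l => //; rewrite /=; lra.
rewrite -{1}(add0n l1.+1) (addnC l1.+1 T) big_addn addnK.
apply: Rle_trans (geom_sum_le r T ltac:(lra)); apply: rsum_le => k _.
apply: Rle_trans (uB _) _.
have -> : r ^ k = Rpower ((/ 2) ^ k) g.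
  rewrite -Rpower_pow // /r {1 3}/Rpower ln_Rpower ln_pow ?ln_Rinv; [congr exp; ring | lra | lra].
apply: Rle_Rpower_l; first lra; split; first exact: x0.
rewrite /x pow_add -Rmult_assoc.
have p0 : 0 < (/ 2) ^ k by apply: pow_lt; lra.
have : INR y * (/ 2) ^ l1.+1 <= 1.
  by rewrite pow_inv; apply/Rle_div_l; [apply: pow_lt; lra | lra].
have : 0 < (/ 2) ^ l1.+1 by apply: pow_lt; lra.
set v := (/ 2) ^ l1.+1; nra.
Qed.

Lemma geom_tail_le (q : R) (J l l0 : nat) : 0 < q -> q < 1 ->
  \rsum_(0 <= k < J | (l <= k + l0)%nat) q ^ k <= / (1 - q) * (/ q) ^ l0 * q ^ l.
Proof.
move=> q0 q1; set s := (l - l0)%nat.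
have qk k : 0 < q ^ k by apply: pow_lt.
apply: Rle_trans (_ : \rsum_(s <= k < (J + s)%nat) q ^ k <= _).
  rewrite -big_filter; apply: rsum_sub; [exact: filter_uniq (iota_uniq _ _) | | by move=> k _; apply: Rlt_le].
  move=> k; rewrite mem_filter !mem_index_iota => /andP [h1 /andP [_ h2]].
  by rewrite (leq_trans h2 (leq_addr _ _)) andbT /s leq_subLR addnC.
rewrite -{1}(add0n s) big_addn addnK.
apply: Rle_trans (_ : / (1 - q) * q ^ s <= _).
  have := geom_sum_le q J ltac:(lra) => h.
  apply: Rle_trans (Rmult_le_compat_r _ _ _ (Rlt_le _ _ (qk s)) h); right.
  by rewrite rsum_scalr; apply: eq_bigr => k _; rewrite pow_add.
rewrite Rmult_assoc; apply: Rmult_le_compat_l; first by apply: Rlt_le; apply: Rinv_0_lt_compat; lra.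
have e : (/ q) ^ l0 * q ^ l0 = 1 by rewrite -Rpow_mult_distr Rinv_l ?pow1; lra.
have h : q ^ (s + l0) <= q ^ l.
  have -> : (s + l0 = l + (s + l0 - l))%nat by rewrite subnKC // /s; lia.
  rewrite pow_add -[X in _ <= X]Rmult_1_r; apply: Rmult_le_compat_l; first exact: Rlt_le.
  by rewrite -(pow1 (s + l0 - l)); apply: pow_incr; lra.
have i0 : 0 < (/ q) ^ l0 by apply: pow_lt; apply: Rinv_0_lt_compat.
have := Rmult_le_compat_l _ _ _ (Rlt_le _ _ i0) h; rewrite pow_add.
by rewrite (_ : (/ q) ^ l0 * (q ^ s * q ^ l0) = q ^ s * ((/ q) ^ l0 * q ^ l0)); [rewrite e Rmult_1_r | ring].
Qed.

Section Norm.
Variables (N : nat) (c : nat -> C).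
Hypothesis c2 : forall n, (0 < n)%nat -> (n <= N)%nat -> c n <> 0 -> (bigOmega n <= 2)%nat.
Hypothesis hG : inG N c.
Let P := cprimes N c.
Let d := size P.
Hypothesis dpos : (0 < d)%nat.
Let F (z : nat -> C) : C := Phi N c (zchar z).

Lemma geometry1 : exists dl p0, [/\ 0 < dl, dl <= 1, p0 \in P,
  forall z p, inDisc z -> p \in P -> dl * (1 - Cmod (z p)) <= Re (F z) - 1 / 2 &
  forall z x, inDisc z -> Cmod x <= 1 -> Re (F z) - 1 / 2 <= dl -> Cmod (x - z p0) <= dl ->
    dl * Cmod (x - z p0) <= Cmod (F (upd z p0 x) - F z)].
Proof.
have [dl [p0 [dl0 p0P h1 h2]]] := geometry N c c2 hG dpos.
have m1 := Rmin_l dl 1; have m2 := Rmin_r dl 1; have m0 : 0 < Rmin dl 1 by apply: Rmin_pos; lra.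
exists (Rmin dl 1), p0; split => //.
- move=> z p hz pP; apply: Rle_trans (h1 z p hz pP); apply: Rmult_le_compat_r => //.
  have pp : prime p by case/cprimesP: pP.
  by have := hz p pp; lra.
- move=> z x hz hx h3 h4; apply: Rle_trans (h2 z x hz hx _ _); [|exact: Rle_trans h3 m1|exact: Rle_trans h4 m1].
  by apply: Rmult_le_compat_r => //; apply: Cmod_ge_0.
Qed.

Lemma gpt_H_bounds (dl : R) (J M : nat) (j : {ffun 'I_d -> 'I_J}) (f : {ffun 'I_d -> 'I_M}) : 0 < dl ->
  (forall z p, inDisc z -> p \in P -> dl * (1 - Cmod (z p)) <= Re (F z) - 1 / 2) ->
  (forall i, dl / 2 * (/ 2) ^ j i <= Re (F (gpt P J M j f)) - 1 / 2) /\
  (Re (F (gpt P J M j f)) - 1 / 2 <= l1norm N c + 1 /\ Rabs (Im (F (gpt P J M j f))) <= l1norm N c + 1).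
Proof.
move=> dl0 h; have Pu : uniq P by rewrite filter_uniq // iota_uniq.
have zd := gpt_inDisc P J M j f; split.
  move=> i; apply: Rle_trans (h _ _ zd (pr_mem P i)).
  have [_ r1 r0 r2] := rho_bounds (j i).
  rewrite /gpt ptz_pr // Cmod_mult Cmod_pow omega_mod pow1 Rmult_1_r Cmod_R Rabs_pos_eq; last exact: Rlt_le.
  rewrite (_ : dl / 2 * _ = dl * ((/ 2) ^ j i / 2)); last by rewrite /Rdiv; ring.
  by apply: Rmult_le_compat_l; [exact: Rlt_le | exact: r2].
have hm : Cmod (F (gpt P J M j f)) <= l1norm N c by apply: Phi_mod_le => n n0; apply: zchar_mod_le.
have h1 := Rle_trans _ _ _ (Rle_abs _) (re_le_Cmod (F (gpt P J M j f))).
have h2 := im_le_Cmod (F (gpt P J M j f)).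
split; lra.
Qed.

Lemma level_exists (W H : R) (n : nat) : 0 < H -> H <= W -> W * (/ 2) ^ n <= H ->
  exists2 l, (l <= n)%nat & W * (/ 2) ^ l.+1 <= H <= 2 * (W * (/ 2) ^ l.+1).
Proof.
move=> H0 HW; elim: n => [|n IH] hn.
  by exists 0%nat => //; rewrite pow_1; rewrite pow_O in hn; split; lra.
case: (Rle_dec (W * (/ 2) ^ n) H) => h; first by have [l ln hl] := IH h; exists l => //; apply: leqW.
have e k : (/ 2) ^ k.+1 = / 2 * (/ 2) ^ k by [].
by exists n => //; split => //; rewrite e; lra.
Qed.

Variable alpha : R.
Hypothesis a0 : 0 < alpha.
Let g := Rpower 2 alpha - 1.
Let beta := g / INR d.

Lemma g_pos : 0 < g.
Proof. by rewrite /g; have := Rpower_lt 2 0 alpha ltac:(lra) a0; rewrite Rpower_O; lra. Qed.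

(** For given radii, [carleson_level] with the count of [grid_count] bounds each level by a multiple
    of [Q l] that does not involve the radii; these enter only through the total weight of those for
    which the level occurs. [M0] is common to the finitely many levels. *)
Lemma norm_ineq : exists2 C0, 0 < C0 & forall (a : nat -> C) (X J : nat), exists M0, forall M, (M0 <= M)%nat ->
  \rsum_(j : {ffun 'I_d -> 'I_J}) (jweight P J beta j * (/ INR M ^ d *
    \rsum_(f : {ffun 'I_d -> 'I_M}) Cmod (expPhi N c a X (zchar (gpt P J M j f))) ^ 2)) <=
  C0 * \rsum_(1 <= n < X.+1) (Cmod (a n) ^ 2 / dpow alpha n).
Proof.
have [dl [p0 [dl0 dl1 p0P hdl expand]]] := geometry1.
have [Cc Cc0 hCc] := grid_count N c dl p0 dl0 dl1 p0P expand.
set W := l1norm N c + 1; have W1 : 1 <= W by have := l1norm_ge0 N c; rewrite /W; lra.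
have [C1 C10 hC1] := carleson_level alpha W a0 W1.
have g0 := g_pos; have d0 : 0 < INR d by apply: INR_pos.
have b0 : 0 < beta by apply: Rdiv_lt_0_compat.
have [C2 C20 hC2] := level_sum g (3 / 16 * W) g0 ltac:(lra).
set q := Rpower 2 (- beta); have q0 : 0 < q by apply: Rpower_pos.
have q1 : q < 1 by rewrite /q -(Rpower_O 2); [apply: Rpower_lt; lra | lra].
(* Absorbs the constants of Harnack's bound: level l occurs only if l <= j_i + [l0] for every i. *)
have [l0 hl0] : exists l0 : nat, 2 * W / dl <= 2 ^ l0.
  have [n [hn _]] := INR_ceil (2 * W / dl) ltac:(apply: Rdiv_le_0_compat; lra).
  have e2 : INR (2 ^ n)%nat = 2 ^ n by rewrite INR_expn (_ : INR 2 = 2) //; rewrite /=; lra.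
  by exists n; apply: Rle_trans hn _; rewrite -e2; apply: INR_leq; apply: ltnW; apply: ltn_expl.
set G := / (1 - q) * (/ q) ^ l0.
have G0 : 0 < G by apply: Rmult_lt_0_compat; [apply: Rinv_0_lt_compat; lra | apply: pow_lt; apply: Rinv_0_lt_compat].
exists (G ^ d * (C1 * Cc) * (exp (3 / 16 * W) * C2)).
  have := pow_lt G d G0; have := exp_pos (3 / 16 * W); move=> h1 h2.
  by repeat apply: Rmult_lt_0_compat.
move=> a X J; pose e l := W * (/ 2) ^ l.+1.
have e0 l : 0 < e l by apply: Rmult_lt_0_compat; [lra | apply: pow_lt; lra].
(* Since j_i < J, Re Phi - 1/2 is at least W 2^(-(J + l0)) on the grid, and these levels cover
   it. *)
set T := (J + l0).+1.
have [M0 hM0] : exists M0, forall l, (l < T)%nat -> forall M (j : {ffun 'I_d -> 'I_J}) t, (M0 <= M)%nat ->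
    \rsum_(f | box (e l) t (F (gpt P J M j f))) 1 <= Cc * e l * INR M ^ d.
  elim: (T) => [|n [M0 IH]]; first by exists 0%nat.
  have [M1 h1] := hCc (e n) (e0 n); exists (maxn M0 M1) => l; rewrite ltnS leq_eqVlt => /orP [/eqP ->|ln] M j t.
    by rewrite geq_max => /andP [_ h]; apply: h1.
  by rewrite geq_max => /andP [h _]; apply: IH.
exists M0.+1 => M MM; have Mp : (0 < M)%nat by apply: leq_ltn_trans MM.
have Md : 0 < INR M ^ d by apply: pow_lt; apply: INR_pos.
pose y n := (trunc_log 2 n).+1.
pose Q l := \rsum_(1 <= n < X.+1) (Cmod (a n) ^ 2 * (Rpower (INR (y n)) g * exp (- (3 / 4 * e l * ln (INR n))) / dpow alpha n)).
have Q0 l : 0 <= Q l.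
  apply: rsum_ge0 => n _; apply: Rmult_le_pos; first exact: pow2_ge_0.
  apply: Rdiv_le_0_compat; last exact: dpow_pos.
  by apply: Rlt_le; apply: Rmult_lt_0_compat; [exact: Rpower_pos | exact: exp_pos].
pose s (j : {ffun 'I_d -> 'I_J}) (f : {ffun 'I_d -> 'I_M}) := F (gpt P J M j f).
pose D j f := Cmod (expPhi N c a X (zchar (gpt P J M j f))) ^ 2.
have D0 j f : 0 <= D j f by apply: pow2_ge_0.
pose lev l j f := Rleb (e l) (Re (s j f) - 1 / 2) && Rleb (Re (s j f) - 1 / 2) (2 * e l).
have iI : 'I_d by apply: Ordinal dpos.
have pow2J k : (/ 2) ^ k * 2 ^ k = 1 by rewrite -Rpow_mult_distr Rinv_l ?pow1; lra.
have p2 k : 0 < 2 ^ k by apply: pow_lt; lra.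
have i2 k : 0 < (/ 2) ^ k by apply: pow_lt; lra.
have imono k m : (k <= m)%nat -> (/ 2) ^ m <= (/ 2) ^ k.
  move=> km; rewrite -(subnKC km) pow_add -[X in _ <= X]Rmult_1_r; apply: Rmult_le_compat_l; first exact: Rlt_le.
  by rewrite -(pow1 (m - k)); apply: pow_incr; lra.
have cover j f : D j f <= \rsum_(0 <= l < T) (if lev l j f then D j f else 0).
  have [hj [hW _]] := gpt_H_bounds dl J M j f dl0 hdl.
  have hp : 0 < Re (s j f) - 1 / 2.
    by apply: Rlt_le_trans (hj iI); apply: Rmult_lt_0_compat; [lra | exact: i2].
  have hT : W * (/ 2) ^ (J + l0) <= Re (s j f) - 1 / 2.
    apply: Rle_trans (hj iI).
    have jJ : (/ 2) ^ J <= (/ 2) ^ j iI by apply: imono; apply: ltnW; apply: ltn_ord.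
    apply: Rle_trans (_ : dl / 2 * (/ 2) ^ J <= _); last by apply: Rmult_le_compat_l => //; lra.
    rewrite pow_add; have h := pow2J l0; have h1 := i2 l0; have h2 := i2 J; have h3 := p2 l0.
    have h4 : W * (/ 2) ^ l0 <= dl / 2.
      have : 2 * W <= 2 ^ l0 * dl by apply: (proj1 (Rle_div_l _ _ _ dl0)).
      move=> h5; have := Rmult_le_compat_r _ _ _ (Rlt_le _ _ h1) h5.
      rewrite (_ : 2 ^ l0 * dl * (/ 2) ^ l0 = dl * ((/ 2) ^ l0 * 2 ^ l0)); last by ring.
      by rewrite h; lra.
    by rewrite (Rmult_comm ((/ 2) ^ J)) -Rmult_assoc; apply: Rmult_le_compat_r => //; apply: Rlt_le.
  have [l lT [hl1 hl2]] := level_exists W _ (J + l0) hp hW hT.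
  have hl : lev l j f by apply/andP; split; apply/RlebP.
  have := rsum_ge_term _ (index_iota 0 T) (fun l => if lev l j f then D j f else 0) l.
  rewrite hl; apply; first by rewrite mem_index_iota.
  by move=> k _; case: ifP => _; [exact: D0 | lra].
(* The weight of j, or 0 when level l is excluded for it; the product form lets the sum over j
   factorise. *)
pose ind (j : {ffun 'I_d -> 'I_J}) l := \big[Rmult/1]_(i : 'I_d) (if (l <= j i + l0)%nat then q ^ j i else 0).
have jwE j : jweight P J beta j = \big[Rmult/1]_(i : 'I_d) q ^ j i.
  apply: eq_bigr => i _; rewrite -Rpower_pow // /q Rpower_mult; congr Rpower; ring.
have jw0 j : 0 <= jweight P J beta j.
  by rewrite jwE; apply: rprod_ge0 => i _; apply: pow_le; apply: Rlt_le.
have lev_bound j l : (l < T)%nat ->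
   jweight P J beta j * (/ INR M ^ d * \rsum_(f | lev l j f) D j f) <= ind j l * (C1 * Cc * Q l).
  move=> lT; have ind0 : 0 <= ind j l.
    by apply: rprod_ge0 => i _; case: ifP => _; [apply: pow_le; apply: Rlt_le | lra].
  case: (pickP (fun i : 'I_d => ~~ (l <= j i + l0)%nat)) => [i hi|hall].
    rewrite big_pred0; last first.
      move=> f; apply/negP => /andP [_ /RlebP h2]; move/negP: hi; apply.
      have [hj _] := gpt_H_bounds dl J M j f dl0 hdl.
      have h3 : dl / 2 * (/ 2) ^ j i <= W * (/ 2) ^ l.
        apply: Rle_trans (hj i) _; apply: Rle_trans h2 _; right; rewrite /e /=; field.
      rewrite leqNgt; apply/negP => hlt.
      have h4 : 2 * W <= 2 ^ l0 * dl by apply: (proj1 (Rle_div_l _ _ _ dl0)).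
      have h5 : (/ 2) ^ l <= (/ 2) * ((/ 2) ^ j i * (/ 2) ^ l0).
        by rewrite -pow_add; apply: (imono (j i + l0).+1).
      have h6 := i2 (j i); have h7 := i2 l0; have h8 := pow2J l0; have h9 := p2 l0.
      have : dl / 2 * (/ 2) ^ j i <= W * (/ 2 * ((/ 2) ^ j i * (/ 2) ^ l0)).
        by apply: Rle_trans h3 _; apply: Rmult_le_compat_l; lra.
      have h10 : W * (/ 2) ^ l0 <= dl / 2.
        have := Rmult_le_compat_r _ _ _ (Rlt_le _ _ h7) h4.
        rewrite (_ : 2 ^ l0 * dl * (/ 2) ^ l0 = dl * ((/ 2) ^ l0 * 2 ^ l0)); last by ring.
        by rewrite h8; lra.
      have := Rmult_le_compat_r _ _ _ (Rlt_le _ _ h6) h10.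
      have := Rmult_lt_0_compat _ _ dl0 h6.
      lra.
    rewrite !Rmult_0_r; apply: Rmult_le_pos => //; apply: Rmult_le_pos => //; apply: Rlt_le; exact: Rmult_lt_0_compat.
  have -> : ind j l = jweight P J beta j.
    by rewrite jwE; apply: eq_bigr => i _; have /negbFE -> := hall i.
  apply: Rmult_le_compat_l => //.
  have h := hC1 _ (lev l j) (s j) (e l) (Cc * e l * INR M ^ d) a X (e0 l).
  have {}h : \rsum_(f | lev l j f) D j f <= C1 * (Cc * e l * INR M ^ d / e l) * Q l.
    apply: Rle_trans (h _ _ _ _).
    - right; apply: eq_bigr => f _; rewrite /D /expPhi; congr (Cmod _ ^ 2); apply: eq_bigr => n _.
      congr Cmult; congr Cexp; rewrite /s /F; ring.
    - rewrite /e -[X in _ <= X]Rmult_1_r; apply: Rmult_le_compat_l; first lra.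
      by rewrite -(pow1 l.+1); apply: pow_incr; lra.
    - by apply: Rlt_le; apply: Rmult_lt_0_compat => //; apply: Rmult_lt_0_compat.
    - move=> f /andP [/RlebP h1 /RlebP h2]; split; first by split.
      by have [_ [_ hI]] := gpt_H_bounds dl J M j f dl0 hdl.
    - by move=> t; apply: hM0 => //; apply: ltnW.
  rewrite Rmult_comm; apply: (proj2 (Rle_div_l _ _ _ Md)); apply: Rle_trans h _; right; field.
  by apply: Rgt_not_eq; apply: e0.
have ind_sum l : \rsum_(j : {ffun 'I_d -> 'I_J}) ind j l <= G ^ d * q ^ (l * d).
  rewrite /ind -(bigA_distr_bigA (fun (_ : 'I_d) (k : 'I_J) => if (l <= k + l0)%nat then q ^ k else 0)) /=.
  apply: Rle_trans (_ : \big[Rmult/1]_(i : 'I_d) (G * q ^ l) <= _).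
    apply: rprod_le => i _; split.
      by apply: rsum_ge0 => k _; case: ifP => _; [apply: pow_le; apply: Rlt_le | lra].
    have := geom_tail_le q J l l0 q0 q1; rewrite big_mkcond big_mkord; exact.
  right; rewrite big_const card_ord pow_mult -Rpow_mult_distr.
  by elim: (d) => [//|k IH]; rewrite iterS IH.
apply: Rle_trans (_ : \rsum_(j : {ffun 'I_d -> 'I_J}) \rsum_(0 <= l < T) (ind j l * (C1 * Cc * Q l)) <= _).
  apply: rsum_le => j _.
  apply: Rle_trans (_ : jweight P J beta j * (/ INR M ^ d * \rsum_(0 <= l < T) \rsum_(f | lev l j f) D j f) <= _).
    apply: Rmult_le_compat_l => //; apply: Rmult_le_compat_l; first by apply: Rlt_le; apply: Rinv_0_lt_compat.
    under [X in _ <= X]eq_bigr do rewrite big_mkcond.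
    by rewrite exchange_big /=; apply: rsum_le => f _; apply: cover.
  by rewrite !rsum_scal; apply: rsum_le_nat => l /andP [_ lT]; apply: lev_bound.
rewrite exchange_big /=.
apply: Rle_trans (_ : \rsum_(0 <= l < T) (G ^ d * (C1 * Cc) * (q ^ (l * d) * Q l)) <= _).
  apply: rsum_le => l _; rewrite -rsum_scalr.
  rewrite (_ : G ^ d * _ * _ = G ^ d * q ^ (l * d) * (C1 * Cc * Q l)); last by ring.
  apply: Rmult_le_compat_r; last exact: ind_sum.
  by apply: Rmult_le_pos => //; apply: Rlt_le; apply: Rmult_lt_0_compat.
rewrite -rsum_scal [X in _ <= X]Rmult_assoc; apply: Rmult_le_compat_l.
  by apply: Rmult_le_pos; [apply: pow_le; apply: Rlt_le | apply: Rlt_le; apply: Rmult_lt_0_compat].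
have -> : \rsum_(0 <= l < T) (q ^ (l * d) * Q l) =
   \rsum_(1 <= n < X.+1) (Cmod (a n) ^ 2 / dpow alpha n * \rsum_(0 <= l < T) (q ^ (l * d) * (Rpower (INR (y n)) g * exp (- (3 / 4 * e l * ln (INR n)))))).
  rewrite /Q; under eq_bigr do rewrite rsum_scal.
  rewrite exchange_big /=; apply: eq_bigr => n _; rewrite rsum_scal; apply: eq_bigr => l _; rewrite /Rdiv; ring.
rewrite [X in _ <= X]rsum_scal; apply: rsum_le_nat => n /andP [n0 _].
rewrite (Rmult_comm (_ * C2)); apply: Rmult_le_compat_l.
  by apply: Rdiv_le_0_compat; [exact: pow2_ge_0 | exact: dpow_pos].
apply: Rle_trans (Rmult_le_compat_l _ _ _ (Rlt_le _ _ (exp_pos _)) (hC2 (y n) T isT)).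
rewrite rsum_scal; apply: rsum_le => l _.
(* Here beta d = g is used: q^(l d) is 2^(- l g). *)
have eq1 : q ^ (l * d) * Rpower (INR (y n)) g = Rpower (INR (y n) * (/ 2) ^ l) g.
  rewrite -Rpower_mult_distr //; last exact: INRS_pos.
  rewrite Rmult_comm; congr Rmult.
  rewrite -Rpower_pow // /q Rpower_mult mult_INR /Rpower ln_pow ?ln_Rinv; [|lra|lra].
  congr exp; rewrite /beta; field; lra.
rewrite -Rmult_assoc eq1 (Rmult_comm (exp (3 / 16 * W))) [X in _ <= X]Rmult_assoc; apply: Rmult_le_compat_l; first by apply: Rlt_le; apply: Rpower_pos.
(* As e_l = W 2^(-l) / 2 and ln n >= (y - 1) / 2, the decay exponent is at least 3/16 W 2^(-l) (y -
   1); replacing y - 1 by y costs the factor exp(3/16 W). *)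
rewrite -exp_plus; apply: exp_le.
have [hl _] := ln_INR_window n n0; have l2 := ln2_ge_half.
have h0 := i2 l; have h1 : (/ 2) ^ l <= 1 by rewrite -(pow1 l); apply: pow_incr; lra.
rewrite /y S_INR /e -/(pow (/ 2) l.+1) (_ : (/ 2) ^ l.+1 = / 2 * (/ 2) ^ l) //.
set u := INR (trunc_log 2 n) in hl *; set L := ln (INR n) in hl *; set v := (/ 2) ^ l in h0 h1 *.
have u0 : 0 <= u by apply: pos_INR.
have uL : u / 2 <= L by nra.
have Wv : 0 < W * v by apply: Rmult_lt_0_compat; lra.
have := Rmult_le_compat_l _ _ _ (Rlt_le _ _ Wv) uL.
have : W * v <= W by rewrite -[X in _ <= X]Rmult_1_r; apply: Rmult_le_compat_l; lra.
nra.
Qed.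
End Norm.

(** * Boundedness of the composition operator *)

Definition dsum (beta : R) (b : nat -> C) (m n : nat) : R := \rsum_(m <= k < n) (Cmod (b k) ^ 2 / dpow beta k).

Lemma dterm_ge0 (beta : R) (b : nat -> C) (k : nat) : 0 <= Cmod (b k) ^ 2 / dpow beta k.
Proof. by apply: Rdiv_le_0_compat; [exact: pow2_ge_0 | exact: dpow_pos]. Qed.

Lemma dsum_ge0 (beta : R) (b : nat -> C) (m n : nat) : 0 <= dsum beta b m n.
Proof. by apply: rsum_ge0 => k _; apply: dterm_ge0. Qed.

(** The weights d(m)^beta are at least 1 and a sum of squares is at most the square of the sum, so
    closeness in l^1 controls the norm of D_beta. Norm bounds pass in this way from [bT] to [bX] and
    to limits. *)
Lemma dsum_perturb (beta : R) (b b' : nat -> C) (B : nat) (e : R) : 0 < beta -> 0 <= e ->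
  \rsum_(1 <= m < B) Cmod (b m - b' m) <= e -> dsum beta b 1 B <= 2 * dsum beta b' 1 B + 2 * e ^ 2.
Proof.
move=> b0 e0 h.
apply: Rle_trans (_ : \rsum_(1 <= m < B) (2 * (Cmod (b' m) ^ 2 / dpow beta m) + 2 * Cmod (b m - b' m) ^ 2) <= _).
  apply: rsum_le_nat => m /andP [m0 _]; have d1 := dpow_ge1 beta m (Rlt_le _ _ b0) m0.
  have t : Cmod (b m) <= Cmod (b' m) + Cmod (b m - b' m).
    by apply: Rle_trans (Cmod_triangle _ _); right; congr Cmod; ring.
  have p0 := Cmod_ge_0 (b m); have p1 := Cmod_ge_0 (b' m); have p2 := Cmod_ge_0 (b m - b' m).
  set x := Cmod (b m) in t p0 *; set y := Cmod (b' m) in t p1 *; set z := Cmod (_ - _) in t p2 *.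
  have h1 : x ^ 2 <= 2 * y ^ 2 + 2 * z ^ 2.
    by have := pow_incr _ _ 2 (conj p0 t); have := pow2_ge_0 (y - z); lra.
  have i0 : 0 < / dpow beta m by apply: Rinv_0_lt_compat; lra.
  have i1 : / dpow beta m <= 1 by rewrite -Rinv_1; apply: Rinv_le_contravar; lra.
  have := Rmult_le_compat_r _ _ _ (Rlt_le _ _ i0) h1.
  have : z ^ 2 * / dpow beta m <= z ^ 2 * 1 by apply: Rmult_le_compat_l => //; apply: pow2_ge_0.
  rewrite /Rdiv; lra.
rewrite big_split /= -!rsum_scal; apply: Rplus_le_compat_l; apply: Rmult_le_compat_l; first lra.
apply: Rle_trans (rsum_sq_le _ _ _ _) _; first by move=> m; apply: Cmod_ge_0.
by apply: pow_incr; split => //; apply: rsum_ge0 => m _; apply: Cmod_ge_0.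
Qed.

Lemma bX_conv (N : nat) (c a : nat -> C) (X m : nat) : (0 < m)%nat -> Cconv (fun K => bT N c a X K m) (bX N c a X m).
Proof.
move=> m0 e e0; have [K0 hK] := bX_tail N c a X e e0; exists K0 => K hk.
apply: Rle_trans (hK K m.+1 hk); rewrite -Cmod_opp Copp_minus_distr.
apply: (rsum_ge_term _ (index_iota 1 m.+1) (fun m => Cmod (bX N c a X m - bT N c a X K m))).
  by rewrite mem_index_iota m0 /=.
by move=> k _; apply: Cmod_ge_0.
Qed.

(** Linearity in [a]: the difference is the image of the block X < n <= Y. *)
Lemma bX_sub (N : nat) (c a : nat -> C) (X Y m : nat) : (0 < m)%nat -> (X <= Y)%nat ->
  (bX N c a Y m - bX N c a X m)%C = bX N c (fun n => if (n <= X)%nat then RtoC 0 else a n) Y m.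
Proof.
move=> m0 XY; apply: (Cconv_unique _ _ _ (Cconv_sub _ _ _ _ (bX_conv N c a Y m m0) (bX_conv N c a X m m0))).
move=> e e0; have [K0 hK] := bX_conv N c (fun n => if (n <= X)%nat then RtoC 0 else a n) Y m m0 e e0.
exists K0 => K hk; apply: Rle_trans (hK K hk); right; congr Cmod; congr (_ - _)%C.
rewrite /bT (big_cat_nat (n := X.+1) (p := Y.+1)) //= [in RHS](big_cat_nat (n := X.+1) (p := Y.+1)) //=.
rewrite [X in _ = (X + _)%C]big_nat [X in _ = (X + _)%C]big1; last first.
  by move=> n /andP [_]; rewrite ltnS => ->; ring.
set u := \csum_(1 <= n < X.+1) _; set v := \csum_(X.+1 <= n < Y.+1) _.
have -> : (u + v - u = v)%C by ring.
rewrite /v Cplus_0_l big_nat [RHS]big_nat; apply: eq_bigr => n /andP [Xn _].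
by rewrite leqNgt Xn.
Qed.

Lemma Cpw_smooth (N : nat) (c : nat -> C) (k m : nat) : (0 < m)%nat -> Cpw N c k m <> 0 -> Psmooth (cprimes N c) m.
Proof.
elim: k m => [|k IH] m m0 /= h.
  have m1 : m = 1%nat by case: eqP h.
  by rewrite m1; split=> // q pq; rewrite dvdn1 => /eqP q1; rewrite q1 in pq.
split=> // q pq dq; case: (boolP (q \in cprimes N c)) => // nq; case: h.
rewrite big_nat_cond big1 // => n /andP [/andP [n0 nN] d].
have [->|cn] := Ceq_dec (c n) 0; first by rewrite Cmult_0_l.
have [->|cm] := Ceq_dec (Cpw N c k (m %/ n)) 0; first by rewrite Cmult_0_r.
have q0 : (0 < m %/ n)%nat by rewrite divn_gt0 // dvdn_leq.
have [_ hs] := IH _ q0 cm.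
have : (q %| n * (m %/ n))%nat by rewrite mulnC divnK.
rewrite Euclid_dvdM // => /orP [dn|dm]; last by rewrite hs in nq.
by move: nq; rewrite (mem_cprimes N c q n pq n0 _ cn dn) // -ltnS.
Qed.

Lemma bT_neq0 (N : nat) (c a : nat -> C) (X K m : nat) : bT N c a X K m <> 0 ->
  exists2 k, (k < K)%nat & Cpw N c k m <> 0.
Proof.
move=> h; case: (pickP (fun k : 'I_K => Cnz (Cpw N c k m))) => [k /Cnz_neq0 hk|hall]; first by exists k => //; apply: ltn_ord.
by case: h; rewrite /bT big1 // => n _; rewrite big_mkord big1 ?Cmult_0_r // => k _; rewrite (Cnz_false _ (hall k)) Cmult_0_r.
Qed.

Section Bounded.
Variables (N : nat) (c : nat -> C).
Hypothesis c2 : forall n, (0 < n)%nat -> (n <= N)%nat -> c n <> 0 -> (bigOmega n <= 2)%nat.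
Hypothesis hG : inG N c.
Let P := cprimes N c.
Let d := size P.
Hypothesis dpos : (0 < d)%nat.
Variable alpha : R.
Hypothesis a0 : 0 < alpha.
Let beta := (Rpower 2 alpha - 1) / INR d.

Lemma beta_pos : 0 < beta.
Proof. by apply: Rdiv_lt_0_compat; [exact: g_pos | exact: INR_pos]. Qed.

(** The total mass of the radii, by which the truncation error is multiplied in [bX_norm]. *)
Lemma jweight_sum (J : nat) : \rsum_(j : {ffun 'I_d -> 'I_J}) jweight P J beta j <= (/ (1 - Rpower 2 (- beta))) ^ d.
Proof.
have b0 := beta_pos; set q := Rpower 2 (- beta); have q0 : 0 < q by apply: Rpower_pos.
have q1 : q < 1 by rewrite /q -(Rpower_O 2); [apply: Rpower_lt; lra | lra].
rewrite -(bigA_distr_bigA (fun (_ : 'I_d) (k : 'I_J) => Rpower 2 (- (beta * INR k)))) /=.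
apply: Rle_trans (_ : \big[Rmult/1]_(i : 'I_d) / (1 - q) <= _).
  apply: rprod_le => i _; split.
    by apply: rsum_ge0 => k _; apply: Rlt_le; apply: Rpower_pos.
  apply: Rle_trans (geom_sum_le q J ltac:(lra)); right; rewrite big_mkord; apply: eq_bigr => k _.
  by rewrite -Rpower_pow // /q Rpower_mult; congr Rpower; ring.
right; rewrite big_const card_ord.
by elim: (d) => [//|k IH]; rewrite iterS IH.
Qed.

(** Parseval needs finitely many coefficients, so it is applied to [bT], whose grid values are close
    to those of [expPhi]. For a given error e the order K, the cut-off B' and the grid size M are
    chosen in this order; then e tends to 0. The factor 4 comes from two uses of |u + v|^2 <= 2
    |u|^2 + 2 |v|^2. *)
Lemma bX_norm : exists2 C0, 0 < C0 & forall (a : nat -> C) (X B : nat),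
  dsum beta (bX N c a X) 1 B <= C0 * dsum alpha a 1 X.+1.
Proof.
have b0 := beta_pos; have [C1 C10 hC1] := norm_ineq N c c2 hG dpos alpha a0.
have Pu : uniq P by rewrite filter_uniq // iota_uniq.
have Pp p : p \in P -> prime p by case/cprimesP.
set G := (/ (1 - Rpower 2 (- beta))) ^ d.
have E0 : 0 < exp 4 ^ d by apply: pow_lt; apply: exp_pos.
exists (4 * exp 4 ^ d * C1); first by nra.
move=> a X B; set A := dsum alpha a 1 X.+1.
have G0 : 0 <= G.
  by apply: Rle_trans (jweight_sum 1); apply: rsum_ge0 => j _; apply: rprod_ge0 => i _; apply: Rlt_le; apply: Rpower_pos.
have key e : 0 < e -> dsum beta (bX N c a X) 1 B <= 4 * exp 4 ^ d * C1 * A + (4 * exp 4 ^ d * G + 2) * e ^ 2.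
  move=> e0; have [K1 h1] := bX_tail N c a X e e0; have [K2 h2] := bT_near_expPhi N c a X e e0.
  set K := maxn K1 K2; have [B0 hB0] := expn_bound N K.
  set B' := maxn B B0; have hB' k : (k < K)%nat -> (N ^ k < B')%nat.
    by move=> /hB0 h; apply: leq_trans h (leq_maxr _ _).
  have [M0 hM0] := hC1 a X B'.
  set M := maxn B'.+1 M0; have BM : (B' <= M)%nat by apply: leq_trans (leqnSn _) (leq_maxl _ _).
  have Mp : (0 < M)%nat by apply: leq_trans (leq_maxl _ _).
  have Md : 0 < INR M ^ d by apply: pow_lt; apply: INR_pos.
  have hsm m : (0 < m)%nat -> bT N c a X K m <> 0 -> Psmooth P m.
    by move=> m0 /bT_neq0 [k _]; apply: Cpw_smooth.
  (* [B'] also serves as the number of radii, since B' <= 2^B'. *)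
  have hw := weighted_parseval P Pu Pp B' M Mp beta (bT N c a X K) B' b0 BM (ltnW (ltn_expl B' (isT : (1 < 2)%nat))) hsm.
  have hn := hM0 M (leq_maxr _ _).
  have hT : dsum beta (bT N c a X K) 1 B' <= exp 4 ^ d * (2 * (C1 * A) + 2 * e ^ 2 * G).
    apply: Rle_trans hw _; apply: Rmult_le_compat_l; first exact: Rlt_le.
    apply: Rle_trans (Rplus_le_compat _ _ _ _ (Rmult_le_compat_l 2 _ _ ltac:(lra) hn)
      (Rmult_le_compat_l (2 * e ^ 2) _ _ ltac:(have := pow2_ge_0 e; lra) (jweight_sum B'))).
    rewrite !rsum_scal -big_split /=; apply: rsum_le => j _.
    set w := jweight P B' beta j; have w0 : 0 <= w by apply: rprod_ge0 => i _; apply: Rlt_le; apply: Rpower_pos.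
    set S := \rsum_(f : {ffun 'I_d -> 'I_M}) Cmod (expPhi _ _ _ _ _) ^ 2.
    have hS : \rsum_(f : {ffun 'I_d -> 'I_M}) Cmod (\csum_(1 <= m < B') (bT N c a X K m * zchar (gpt P B' M j f) m)) ^ 2 <= 2 * S + 2 * e ^ 2 * INR M ^ d.
      have -> : 2 * e ^ 2 * INR M ^ d = \rsum_(f : {ffun 'I_d -> 'I_M}) (2 * e ^ 2).
        by rewrite rsum_const_fin card_ffun !card_ord INR_expn Rmult_comm.
      rewrite rsum_scal -big_split /=; apply: rsum_le => f _.
      rewrite (bT_eval _ _ _ _ _ _ _ (zchar_cmult _) hB').
      have zd := gpt_inDisc P B' M j f.
      have := h2 K (zchar (gpt P B' M j f)) (leq_maxr _ _) (fun n n0 => zchar_mod_le _ n zd n0).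
      set u := expPhi _ _ _ _ _; set v := \csum_(1 <= n < X.+1) _ => h3.
      have t : Cmod v <= Cmod u + Cmod (u - v).
        by apply: Rle_trans (_ : Cmod (u + (- (u - v))) <= _); [right; congr Cmod; ring | rewrite -(Cmod_opp (u - v)); apply: Cmod_triangle].
      have := pow_incr _ _ 2 (conj (Cmod_ge_0 v) t); have := pow2_ge_0 (Cmod u - Cmod (u - v)).
      have := pow_incr _ _ 2 (conj (Cmod_ge_0 (u - v)) h3).
      move=> q1 q2 q3; change (Cmod v ^ 2 <= 2 * Cmod u ^ 2 + 2 * e ^ 2); lra.
    apply: Rle_trans (_ : w * (/ INR M ^ d * (2 * S + 2 * e ^ 2 * INR M ^ d)) <= _).
      by apply: Rmult_le_compat_l => //; apply: Rmult_le_compat_l => //; apply: Rlt_le; apply: Rinv_0_lt_compat.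
    right; change (w * (/ INR M ^ d * (2 * S + 2 * e ^ 2 * INR M ^ d)) = 2 * (w * (/ INR M ^ d * S)) + 2 * e ^ 2 * w); field; lra.
  have h3 : \rsum_(1 <= m < B) Cmod (bX N c a X m - bT N c a X K m) <= e by apply: h1; apply: leq_maxl.
  apply: Rle_trans (dsum_perturb _ _ _ _ _ b0 (Rlt_le _ _ e0) h3) _.
  have h4 : dsum beta (bT N c a X K) 1 B <= dsum beta (bT N c a X K) 1 B'.
    apply: rsum_sub; [exact: iota_uniq | | by move=> m _; apply: dterm_ge0].
    by move=> m; rewrite !mem_index_iota => /andP [-> h]; apply: leq_trans h (leq_maxl _ _).
  lra.
apply: le_epsilon => eta eta0.
set Q := 4 * exp 4 ^ d * G + 2; have Q0 : 0 < Q.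
  by rewrite /Q; have := Rmult_le_pos _ _ (Rlt_le _ _ E0) G0; lra.
have r0 : 0 < eta / Q by apply: Rdiv_lt_0_compat.
have := key (sqrt (eta / Q)) (sqrt_lt_R0 _ r0); rewrite -/Q pow2_sqrt; last lra.
by rewrite (_ : Q * (eta / Q) = eta) //; field; lra.
Qed.
End Bounded.

(** * From Dirichlet polynomials to the whole space *)

Lemma npow_weight_sum (g : R) (s : C) : 0 <= g -> 1 / 2 < Re s -> exists2 S, 0 < S & forall m B,
  (0 < m)%nat -> \rsum_(m <= k < B) (dpow g k * Cmod (npow k s) ^ 2) <= S.
Proof.
move=> g0 hs; have [C1 C10 hC] := div_series_upper g g0.
exists (C1 * Rpower (1 + 1 / (2 * Re s - 1)) (Rpower 2 g)).
  by apply: Rmult_lt_0_compat => //; apply: Rpower_pos.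
move=> m B m0; apply: Rle_trans (hC (2 * Re s - 1) B ltac:(lra)).
have e k : dpow g k * Cmod (npow k s) ^ 2 = dpow g k * Rpower (INR k) (- (1 + (2 * Re s - 1))).
  by congr Rmult; rewrite Cmod_npow /= Rmult_1_r -Rpower_plus; congr Rpower; ring.
under eq_bigr do rewrite e.
apply: rsum_sub; first exact: iota_uniq.
  by move=> k; rewrite !mem_index_iota => /andP [h1 h2]; rewrite (leq_trans m0 h1) ltnW.
by move=> k _; apply: Rmult_le_pos; apply: Rlt_le; [exact: dpow_pos | exact: Rpower_pos].
Qed.

Lemma csum_npow_le (g : R) (a : nat -> C) (s : C) (S : R) (m B : nat) : (0 < m)%nat ->
  (forall m B, (0 < m)%nat -> \rsum_(m <= k < B) (dpow g k * Cmod (npow k s) ^ 2) <= S) ->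
  Cmod (\csum_(m <= k < B) (a k * npow k s)) ^ 2 <= dsum g a m B * S.
Proof.
move=> m0 hS; apply: Rle_trans (_ : (\rsum_(m <= k < B) (Cmod (a k) * Cmod (npow k s))) ^ 2 <= _).
  apply: pow_incr; split; first exact: Cmod_ge_0.
  by apply: Rle_trans (Cmod_csum _ _ _ _) _; right; apply: eq_bigr => k _; rewrite Cmod_mult.
apply: Rle_trans (rsum_cauchy_weight (dpow g) _ _ _ (dpow_pos g)) _.
by apply: Rmult_le_compat_l; [apply: dsum_ge0 | apply: hS].
Qed.

Lemma inD_tail (g : R) (a : nat -> C) (e : R) : inD g a -> 0 < e ->
  exists X0, forall X Y, (X0 <= X)%nat -> dsum g a X.+1 Y.+1 <= e.
Proof.
move=> ha e0; have [l hl] := ha.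
have hlim : is_lim_seq (sum_n (Dterm g a)) l by [].
have [n0 h0] := proj2 (is_lim_seq_spec _ (Finite l)) hlim (mkposreal (e / 2) ltac:(lra)).
exists n0.+1 => X Y hX; case: (leqP X Y) => XY; last first.
  by rewrite /dsum big_geq //; [lra | exact: leqW].
have hp n : dsum g a 1 n.+2 = sum_n (Dterm g a) n.
  by rewrite sum_n_rsum /dsum big_add1.
case: X hX XY => [//|X]; rewrite ltnS => hX; case: Y => [//|Y] XY.
have e1 : dsum g a 1 Y.+2 = dsum g a 1 X.+2 + dsum g a X.+2 Y.+2 by rewrite /dsum (big_cat_nat (n := X.+2)).
have := h0 X (elimT leP hX); have := h0 Y (elimT leP (leq_trans hX XY)).
rewrite -!hp e1 /=; move=> /Rabs_def2 h1 /Rabs_def2 h2; lra.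
Qed.

Lemma sq_small (u e S : R) : 0 <= u -> 0 < e -> 0 < S -> u ^ 2 <= (e ^ 2 / S) * S -> u <= e.
Proof.
move=> u0 e0 S0; rewrite /Rdiv Rmult_assoc Rinv_l; last lra.
by rewrite Rmult_1_r => h; case: (Rle_dec u e) => // n; nra.
Qed.

Section Composition.
Variables (N : nat) (c : nat -> C) (alpha beta C0 : R).
Hypothesis a0 : 0 < alpha.
Hypothesis b0 : 0 < beta.
Hypothesis C00 : 0 < C0.
Hypothesis hG : inG N c.
Hypothesis bound : forall (a : nat -> C) (X B : nat), dsum beta (bX N c a X) 1 B <= C0 * dsum alpha a 1 X.+1.

Lemma bX_diff (a : nat -> C) (X Y B : nat) : (X <= Y)%nat ->
  dsum beta (fun m => bX N c a Y m - bX N c a X m)%C 1 B <= C0 * dsum alpha a X.+1 Y.+1.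
Proof.
move=> XY; set a' := fun n => if (n <= X)%nat then RtoC 0 else a n.
apply: Rle_trans (_ : dsum beta (bX N c a' Y) 1 B <= _).
  by apply: rsum_le_nat => m /andP [m0 _]; rewrite bX_sub //; apply: Rle_refl.
apply: Rle_trans (bound a' Y B) _; apply: Rmult_le_compat_l; first lra.
right; rewrite /dsum (big_cat_nat (n := X.+1)) //= big_nat big1; last first.
  by move=> n /andP [_ nX]; rewrite /a' -ltnS nX Cmod_0 /= /Rdiv !Rmult_0_l.
have -> u : 0 + u = u by ring.
rewrite big_nat [RHS]big_nat; apply: eq_bigr => n /andP [Xn _].
by rewrite /a' leqNgt Xn.
Qed.

(** By [bX_diff] the images of the truncations of [a] are Cauchy in D_beta; [b] is their
    coefficientwise limit and is also close to them in D_beta. Both series converge pointwise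
    because point evaluations are bounded for real part above 1/2, at s and at its image. The 2 in
    the constant is that of [dsum_perturb]. *)
Lemma comp_bounded : CompBounded N c alpha beta.
Proof.
exists (sqrt (2 * C0)) => a ha.
have small e : 0 < e -> exists X0, forall X Y B, (X0 <= X)%nat -> (X <= Y)%nat ->
    dsum beta (fun m => bX N c a Y m - bX N c a X m)%C 1 B <= e.
  move=> e0; have [X0 h] := inD_tail alpha a (e / C0) ha ltac:(apply: Rdiv_lt_0_compat; lra).
  exists X0 => X Y B hX XY; apply: Rle_trans (bX_diff a X Y B XY) _.
  have := Rmult_le_compat_l C0 _ _ ltac:(lra) (h X Y hX).
  by rewrite (_ : C0 * (e / C0) = e) //; field; lra.
pose b m := Climit (fun X => bX N c a X m).
have hb m : (0 < m)%nat -> Cconv (fun X => bX N c a X m) (b m).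
  move=> m0; apply: Climit_cauchy => e e0.
  have D0 : 0 < / dpow beta m by apply: Rinv_0_lt_compat; exact: dpow_pos.
  have [X0 h] := small _ (Rmult_lt_0_compat _ _ (pow_lt e 2 e0) D0).
  exists X0 => X Y hX XY.
  have := rsum_ge_term _ (index_iota 1 m.+1) (fun m => Cmod (bX N c a Y m - bX N c a X m) ^ 2 / dpow beta m) m.
  move=> /(_ _ _) t; have {}t := Rle_trans _ _ _ (t ltac:(by rewrite mem_index_iota m0 /=) (fun k _ => dterm_ge0 beta (fun m => bX N c a Y m - bX N c a X m)%C k)) (h X Y m.+1 hX XY).
  apply: (sq_small _ _ (dpow beta m)) => //; [exact: Cmod_ge_0 | exact: dpow_pos |].
  have := Rmult_le_compat_r _ _ _ (Rlt_le _ _ (dpow_pos beta m)) t.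
  rewrite {1}/Rdiv Rmult_assoc Rinv_l ?Rmult_1_r //; have := dpow_pos beta m; lra.
have near B e : 0 < e -> exists Y0, forall Y, (Y0 <= Y)%nat -> \rsum_(1 <= m < B) Cmod (b m - bX N c a Y m) <= e.
  by move=> e0; apply: (rsum_Cconv_small (fun m Y => bX N c a Y m)) => // m m0; apply: hb.
have eps_sq (x y : R) : (forall e, 0 < e -> x <= y + 2 * e ^ 2) -> x <= y.
  move=> h; apply: le_epsilon => e e0; have := h (sqrt (e / 2)) ltac:(apply: sqrt_lt_R0; lra).
  by rewrite pow2_sqrt; lra.
have bnorm B : dsum beta b 1 B <= 2 * (C0 * normD alpha a ^ 2).
  apply: eps_sq => e e0; have [Y hY] := near B e e0.
  apply: Rle_trans (dsum_perturb _ _ _ _ _ b0 (Rlt_le _ _ e0) (hY Y (leqnn Y))) _.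
  apply: Rplus_le_compat_r; apply: Rmult_le_compat_l; first lra.
  apply: Rle_trans (bound a Y B) _; apply: Rmult_le_compat_l; first lra.
  exact: normD_partial.
have [hb1 hb2] := inD_bound beta b _ bnorm.
(* Coefficientwise convergence is uniform only on finite ranges, so for each [B] a later truncation
   Y near [b] is inserted; the resulting bound does not depend on [B]. *)
have bclose e : 0 < e -> exists X0, forall X B, (X0 <= X)%nat -> dsum beta (fun m => b m - bX N c a X m)%C 1 B <= e.
  move=> e0; have [X0 h] := small (e / 2) ltac:(lra); exists X0 => X B hX.
  apply: eps_sq => r r0; have [Y0 hY] := near B r r0; set Y := maxn X Y0.
  have h1 : \rsum_(1 <= m < B) Cmod ((b m - bX N c a X m) - (bX N c a Y m - bX N c a X m)) <= r.
    apply: Rle_trans (hY Y (leq_maxr _ _)); right; apply: eq_bigr => m _; congr Cmod; ring.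
  have := dsum_perturb beta (fun m => b m - bX N c a X m)%C (fun m => bX N c a Y m - bX N c a X m)%C B r b0 (Rlt_le _ _ r0) h1.
  have := h X Y B hX (leq_maxl _ _); lra.
exists b; split => //; split.
  apply: Rle_trans hb2 _; rewrite -Rmult_assoc sqrt_mult_alt; last lra.
  by rewrite sqrt_pow2; [lra | exact: normD_ge0].
move=> s hs; set s' := dpoly N c s.
have hs' : 1 / 2 < Re s' by apply: hG; lra.
pose v := Climit (fun X => \csum_(1 <= n < X.+1) (a n * npow n s')).
have hv : Cconv (fun X => \csum_(1 <= n < X.+1) (a n * npow n s')) v.
  apply: Climit_cauchy => e e0; have [S S0 hS] := npow_weight_sum alpha s' (Rlt_le _ _ a0) hs'.
  have [X0 h] := inD_tail alpha a (e ^ 2 / S) ha (Rdiv_lt_0_compat _ _ (pow_lt e 2 e0) S0).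
  exists X0 => X Y hX XY; rewrite (big_cat_nat (n := X.+1) (p := Y.+1)) //=.
  set u := \csum_(1 <= n < X.+1) _; set w := \csum_(X.+1 <= n < Y.+1) _.
  have -> : (u + w - u = w)%C by ring.
  apply: (sq_small _ _ S) => //; first exact: Cmod_ge_0.
  apply: Rle_trans (csum_npow_le alpha a s' S X.+1 Y.+1 isT hS) _.
  by apply: Rmult_le_compat_r; [lra | apply: h].
exists v; split; apply/DS_at_Csum.
  move=> e e0; have [S S0 hS] := npow_weight_sum beta s (Rlt_le _ _ b0) hs.
  have e3 : 0 < e / 3 by lra.
  have [X1 h1] := bclose ((e / 3) ^ 2 / S) (Rdiv_lt_0_compat _ _ (pow_lt _ 2 e3) S0).
  have [X2 h2] := hv (e / 3) e3; set X := maxn X1 X2.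
  have hchi n : (0 < n)%nat -> Cmod (npow n s) <= 1 by apply: Cmod_npow_le1; lra.
  have [B0 h3] := bX_eval N c a _ X (npow_cmult s) hchi (e / 3) e3.
  exists B0 => B hB; have := h3 B hB; have := h2 X (leq_maxr _ _).
  rewrite expPhi_npow -/s'; set V := \csum_(1 <= n < X.+1) _; set U := \csum_(1 <= m < B) (bX _ _ _ _ _ * _).
  move=> q1 q2.
  have q3 : Cmod (\csum_(1 <= m < B) ((b m - bX N c a X m) * npow m s)) <= e / 3.
    apply: (sq_small _ _ S) => //; first exact: Cmod_ge_0.
    apply: Rle_trans (csum_npow_le beta (fun m => b m - bX N c a X m)%C s S 1 B isT hS) _.
    by apply: Rmult_le_compat_r; [lra | apply: h1; apply: leq_maxl].
  have -> : (\csum_(1 <= m < B) (b m * npow m s) - v = \csum_(1 <= m < B) ((b m - bX N c a X m) * npow m s) + ((U - V) + (V - v)))%C.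
    have -> : \csum_(1 <= m < B) (b m * npow m s) = (\csum_(1 <= m < B) ((b m - bX N c a X m) * npow m s) + U)%C.
      by rewrite /U -big_split /=; apply: eq_bigr => m _; ring.
    ring.
  apply: Rle_trans (Cmod_triangle _ _) _; have := Cmod_triangle (U - V) (V - v); lra.
move=> e e0; have [K0 h] := hv e e0; exists K0.+1 => -[//|B]; rewrite ltnS => hB; exact: h.
Qed.
End Composition.

Theorem theorem4p1 (alpha : R) (Halpha : 0 < alpha) :
  (* (i) *)
  (forall (N : nat) (c : nat -> C),
     inG N c -> unrestricted N c ->
     (2 <= dimD N c)%nat -> (degD N c = 1 \/ degD N c = 2)%nat ->
     CompBounded N c alpha ((Rpower 2 alpha - 1) / INR (dimD N c)) /\
     (exists beta : R, beta < Rpower 2 alpha - 1 /\ CompBounded N c alpha beta)) /\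
  (* (ii) *)
  (forall (N : nat) (c : nat -> C),
     inG N c -> unrestricted N c -> dimD N c = 1%nat ->
     forall beta : R, beta < Rpower 2 alpha - 1 -> ~ CompBounded N c alpha beta) /\
  (* (iii) *)
  (forall d K : nat, (1 <= d)%nat -> (3 <= K)%nat ->
     exists (N : nat) (c : nat -> C),
       inG N c /\ unrestricted N c /\ dimD N c = d /\ degD N c = K /\
       forall beta : R, beta < Rpower 2 alpha - 1 -> ~ CompBounded N c alpha beta).
Proof.
split; last split.
- move=> N c hG hu hd hdeg.
  have c2 n : (0 < n)%nat -> (n <= N)%nat -> c n <> 0 -> (bigOmega n <= 2)%nat.
    move=> n0 nN /Cnz_true cn; apply: (@leq_trans (degD N c)); last by case: hdeg => ->.
    by rewrite /degD; apply: (leq_bigmax_seq n) => //; rewrite mem_index_iota n0 ltnS.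
  have dpos : (0 < size (cprimes N c))%nat by rewrite -dimD_size; apply: leq_trans hd.
  have g0 := g_pos alpha Halpha.
  have h : CompBounded N c alpha ((Rpower 2 alpha - 1) / INR (dimD N c)).
    have [C0 C00 hC] := bX_norm N c c2 hG dpos alpha Halpha.
    rewrite dimD_size; apply: comp_bounded C00 hG hC => //.
    exact: beta_pos.
  split=> //; eexists; split; last exact: h.
  have d2 : 2 <= INR (dimD N c) by have := INR_leq _ _ hd; rewrite [INR 2]/=; lra.
  by apply/Rlt_div_l; nra.
- by move=> N c _ hu hd beta hb; apply: dim_one_unbounded.
- move=> d K d1 K3; have [N [c [h1 h2 h3 h4 h5]]] := exists_unbounded d K d1 K3.
  by exists N, c; do 4! split => //; move=> beta hb; apply: h5.
Qed.
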